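(* Let $V\in C^\infty(\mathbb R;\mathbb R)$ satisfy the exponential expansion hypothesis. The resolvent of $P_V=D_x^2+V(x)$, $D_x=\partial_x/i$, $$R_V(\lambda)=(P_V-\lambda^2)^{-1}:L^2(\mathbb R)\to L^2(\mathbb R),\qquad\operatorname{Im}\lambda\gg1,$$ continues meromorphically to $$R_V(\lambda):L^2_{\rm c}(\mathbb R)\to L^2_{\rm loc}(\mathbb R),\qquad\lambda\in\mathbb C.$$ In other words, for any $f,g\in L^2_{\rm c}(\mathbb R)$, $\lambda\mapsto\langle R_V(\lambda)f,g\rangle$ is a meromorphic function on $\mathbb C$ with poles independent of $f$ and $g$.
   Context: Exponential expansion hypothesis: there are constants $A_\pm>0$, $R>0$ and functions $F_\pm$ holomorphic in a neighborhood of $0\in\mathbb C$ with $F_\pm(0)=0$, $F_\pm'(0)\neq0$, such that $V(x)=F_+(e^{-A_+x})$ for $x>R$ and $V(x)=F_-(e^{A_-x})$ for $x<-R$. $L^2_{\rm c}(\mathbb R)$ denotes compactly supported $L^2$ functions and $L^2_{\rm loc}(\mathbb R)$ locally $L^2$ functions. ''Poles independent of $f$ and $g$'' means that there is one discrete set of poles containing the poles of all these functions. *)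

(* Defs.v *)
From HB Require Import structures.
From mathcomp Require Import all_boot all_order all_algebra.
From mathcomp Require Import complex.
From mathcomp Require Import all_classical all_reals all_analysis.
Set Implicit Arguments.
Unset Strict Implicit.
Unset Printing Implicit Defensive.
Import Order.TTheory GRing.Theory Num.Theory.
Import numFieldNormedType.Exports.
Local Open Scope classical_set_scope.
Local Open Scope ring_scope.
Local Open Scope complex_scope.

Section ComplexAnalysis.
Variable R : realType.

(* The regular module R[i]^o carries the norm topology of the complex plane;
   derivability in the direction 1 is complex differentiability. *)
Definition holomorphic_on (U : set R[i]^o) (F : R[i]^o -> R[i]^o) :=
  open U /\ forall z : R[i]^o, U z -> derivable F z 1.

(* The values of F on S are irrelevant. *)
Definition meromorphic_with_poles_in (S : set R[i]^o) (F : R[i]^o -> R[i]^o) :=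
  holomorphic_on (~` S) F /\
  forall z : R[i]^o, S z ->
    exists (n : nat) (U : set R[i]^o) (h : R[i]^o -> R[i]^o),
      [/\ U z, holomorphic_on U h &
        forall w : R[i]^o, U w -> w != z -> F w = h w / (w - z) ^+ n].

End ComplexAnalysis.

Section Potential.
Variable R : realType.

Definition smooth (V : R -> R) := forall (n : nat) (x : R), derivable (derive1n n V) x 1.

Definition exponential_expansion (V : R -> R) :=
  exists (Ap Am r : R) (Up Um : set R[i]^o) (Fp Fm : R[i]^o -> R[i]^o),
    [/\ 0 < Ap, 0 < Am & 0 < r] /\
    [/\ Up 0, holomorphic_on Up Fp, Fp 0 = 0, derive1 Fp 0 != 0 &
      forall x : R, r < x ->
        Up (expR (- Ap * x))%:C /\ (V x)%:C = Fp (expR (- Ap * x))%:C] /\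
    [/\ Um 0, holomorphic_on Um Fm, Fm 0 = 0, derive1 Fm 0 != 0 &
      forall x : R, x < - r ->
        Um (expR (Am * x))%:C /\ (V x)%:C = Fm (expR (Am * x))%:C].

End Potential.

Section L2Spaces.
Variable R : realType.
Local Notation mu := (@lebesgue_measure R).
Implicit Types u v w f g : R -> R[i].

Definition L2 f :=
  (fun x => complex.Re (f x)) \in Lfun mu 2%:E /\
  (fun x => complex.Im (f x)) \in Lfun mu 2%:E.

Definition L2norm f : \bar R :=
  Lnorm mu 2%:E (fun x => (ComplexField.Normc.normc (f x))%:E).

Definition ae_equal u v := {ae mu, forall x, u x = v x}.

Definition supported_in (M : R) f := {ae mu, forall x, M < `|x| -> f x = 0}.

Definition L2c f := L2 f /\ exists M : R, supported_in M f.

Definition cutoff (M : R) u : R -> R[i] := fun x => (\1_(`[- M, M]%classic) x)%:C * u x.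

Definition L2loc u := forall M : R, L2 (cutoff M u).

Definition cintegral u : R[i] :=
  (\int[mu]_x complex.Re (u x))%R +i* (\int[mu]_x complex.Im (u x))%R.

Definition pairing u g : R[i] := cintegral (fun x => u x * conjc (g x)).

Definition test_function (phi : R -> R) :=
  smooth phi /\ exists M : R, forall x, M < `|x| -> phi x = 0.

(* Real test functions suffice: complex ones are their complex-linear span. *)
Definition weak_derivative u v :=
  forall phi : R -> R, test_function phi ->
    cintegral (fun x => u x * (derive1 phi x)%:C) =
    - cintegral (fun x => v x * (phi x)%:C).

(* The graph of P_V = D_x^2 + V = - d^2/dx^2 + V, with domain the Sobolev
   space H^2 (R), as an unbounded operator on L^2 (R). *)
Definition schrodinger_graph (V : R -> R) u w :=
  L2 w /\ exists u1 u2,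
    [/\ L2 u, L2 u1 & L2 u2] /\
    [/\ weak_derivative u u1, weak_derivative u1 u2 &
      ae_equal w (fun x => - u2 x + (V x)%:C * u x)].

(* T is a bounded two-sided inverse of P_V - l^2 : H^2 (R) -> L^2 (R); linearity
   of T up to null sets is a consequence. *)
Definition is_resolvent (V : R -> R) (l : R[i]) (T : (R -> R[i]) -> (R -> R[i])) :=
  [/\ forall f, L2 f -> schrodinger_graph V (T f) (fun x => f x + l ^+ 2 * T f x),
      forall u w, schrodinger_graph V u w ->
        ae_equal (T (fun x => w x - l ^+ 2 * u x)) u &
      exists c : R, forall f, L2 f -> (L2norm (T f) <= c%:E * L2norm f)%E].

(* A continuous linear map L^2_c -> L^2_loc; the last clause also makes T
   compatible with equality almost everywhere. *)
Definition bounded_L2c_L2loc (T : (R -> R[i]) -> (R -> R[i])) :=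
  [/\ forall f, L2c f -> L2loc (T f),
      forall (a : R[i]) f g, L2c f -> L2c g ->
        ae_equal (T (fun x => a * f x + g x)) (fun x => a * T f x + T g x) &
      forall M N : R, exists c : R, forall f, L2 f -> supported_in M f ->
        (L2norm (cutoff N (T f)) <= c%:E * L2norm f)%E].

End L2Spaces.

(* Main.v *)
Require Import Defs.
From mathcomp Require Import all_boot all_order all_algebra.
From mathcomp Require Import complex.
From mathcomp Require Import all_classical all_reals all_analysis.
From mathcomp Require Import measurable_realfun.
From mathcomp Require Import ring lra.
Import Order.TTheory GRing.Theory Num.Theory.
Import numFieldNormedType.Exports.
Local Open Scope classical_set_scope.
Local Open Scope ring_scope.
Local Open Scope complex_scope.
Set Implicit Arguments.
Unset Strict Implicit.
Unset Printing Implicit Defensive.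

(** The resolvent is continued by writing it as a Green operator.  For every
    [l] the equation [u'' = (V - l^2) u] has solutions [f_+] and [f_-], the
    Jost solutions, of size [exp (- Im l |x|)] at the right and the left end,
    and when their Wronskian [W l] does not vanish,

      [T f (x) = W^-1 (f_+ (x) \int_(-oo, x) f_- f + f_- (x) \int_(x, +oo) f_+ f)]

    solves [(P_V - l^2) T f = f].  The formula defines the resolvent for large
    [Im l].  For compactly supported [f] it involves finitely many functions of
    [l], so it makes sense and is meromorphic wherever the coefficients of the
    Jost solutions are.

    Only the behaviour at infinity could obstruct this.  With [w = exp (- A x)]
    the potential is a convergent power series in [w] without constant term
    near [+oo] ([taylor]), hence [f_+] is [exp (i l x)] times a power
    series in [w] with coefficients given by a Frobenius recursion.  The
    denominators are [A k (A k - 2 i l)] with [k >= 1]; they vanish on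
    a discrete set in the lower half plane and the zeros are simple
    ([jpole_isolated], [jpole_Im]).  So the coordinates of [f_+] and [f_-] in
    the basis of solutions normalized at the origin, which is entire in [l]
    ([sol_hol]), are meromorphic on the whole plane ([jost_mero]), and so is [W].

    For [Im l] large compared with the bound of [V], the imaginary part of
    [conj l u' conj u] has a derivative that controls [|u'|^2 + |u|^2]
    ([energy_pt]).  Integrating it shows at once that the Jost solutions are
    independent ([no_eigenfunction]), so that [W] is not identically zero, and
    that [T] is bounded on square integrable functions
    ([resolvent_bound]).  To identify [T] with the inverse of the operator, whose
    domain is defined by weak derivatives, weakly differentiable functions are
    replaced by absolutely continuous representatives ([weak_AC], a form of the
    lemma of du Bois-Reymond); a square integrable solution of the homogeneous
    equation has vanishing Wronskians with [f_+] and [f_-]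
    ([L2_solution_eq0]).

    The poles lie in the set [resonances] where a Jost coefficient has a pole or
    [W] vanishes.  It is discrete by the identity theorem for
    meromorphic functions ([mero_identity]), and it does not involve [f] or [g].

    The function theory rests on Cauchy's formula for a circle, proved by
    subdividing the rectangle that parametrizes the contraction of the circle
    onto a point ([goursat], [cauchy_formula]).  All series converge
    geometrically, which lets one explicit remainder bound ([cseries]) replace
    the theory of uniform convergence. *)

(** * Complex modulus and complex differentiability *)

Notation nc := ComplexField.Normc.normc.

Section ComplexNorm.
Variable R : realType.
Local Notation C := R[i].
Implicit Types z w : C.

Lemma ncE z : nc z = Num.sqrt (complex.Re z ^+ 2 + complex.Im z ^+ 2).
Proof. by case: z. Qed.

Lemma nc_ge0 z : 0 <= nc z. Proof. by rewrite ncE sqrtr_ge0. Qed.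

Lemma ncM z w : nc (z * w) = nc z * nc w. Proof. exact: ComplexField.Normc.normcM. Qed.
Lemma ncN z : nc (- z) = nc z. Proof. exact: normcN. Qed.
Lemma ncD z w : nc (z + w) <= nc z + nc w. Proof. exact: le_normcD. Qed.
Lemma nc0 : nc (0 : C) = 0. Proof. exact: ComplexField.Normc.normc0. Qed.
Lemma nc1 : nc (1 : C) = 1. Proof. exact: ComplexField.Normc.normc1. Qed.
Lemma ncV z : nc z^-1 = (nc z)^-1. Proof. exact: ComplexField.Normc.normcV. Qed.
Lemma nc_eq0 z : nc z = 0 -> z = 0. Proof. exact: ComplexField.Normc.eq0_normc. Qed.
Lemma ncR (x : R) : nc (x%:C : C) = `|x|.
Proof. by rewrite ncE /= expr0n addr0 sqrtr_sqr. Qed.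
Lemma nci : nc ('i : C) = 1.
Proof. by rewrite ncE /= expr0n expr1n add0r sqrtr1. Qed.
Lemma ncB z w : nc (z - w) = nc (w - z).
Proof. by rewrite -ncN opprB. Qed.
Lemma ncDB z w : nc (z - w) <= nc z + nc w.
Proof. by rewrite -[nc w]ncN ncD. Qed.
Lemma nc_gt0 z : z != 0 -> 0 < nc z.
Proof.
move=> z0; rewrite lt_neqAle nc_ge0 andbT eq_sym; apply: contra z0.
by move=> /eqP/nc_eq0 ->.
Qed.
Lemma nc_neq0 z : 0 < nc z -> z != 0.
Proof. by apply: contraTneq => ->; rewrite nc0 ltxx. Qed.
Lemma ncX z n : nc (z ^+ n) = nc z ^+ n.
Proof. by elim: n => [|n IH]; rewrite ?expr0 ?nc1// !exprS ncM IH. Qed.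
Lemma ncJ z : nc (conjc z) = nc z.
Proof. by rewrite !ncE; case: z => a b /=; rewrite sqrrN. Qed.
Lemma nc_Re z : `|complex.Re z| <= nc z.
Proof. by rewrite ncE -sqrtr_sqr ler_sqrt ?addr_ge0 ?sqr_ge0// lerDl sqr_ge0. Qed.
Lemma nc_Im z : `|complex.Im z| <= nc z.
Proof. by rewrite ncE -sqrtr_sqr ler_sqrt ?addr_ge0 ?sqr_ge0// lerDr sqr_ge0. Qed.
Lemma complexRI z : z = (complex.Re z)%:C + 'i * (complex.Im z)%:C.
Proof. by case: z => a b /=; simpc. Qed.
Lemma nc_le z : nc z <= `|complex.Re z| + `|complex.Im z|.
Proof. by rewrite {1}[z]complexRI (le_trans (ncD _ _))// ncM nci mul1r !ncR. Qed.
Lemma nc_sum I (s : seq I) (P : pred I) (F : I -> C) :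
  nc (\sum_(i <- s | P i) F i) <= \sum_(i <- s | P i) nc (F i).
Proof.
elim/big_ind2: _ => [|x1 x2 y1 y2 h1 h2|//]; first by rewrite nc0.
by rewrite (le_trans (ncD _ _))// lerD.
Qed.
Lemma nc_dist z w : nc z - nc w <= nc (z - w).
Proof. by rewrite lerBlDr -{1}(subrK w z) ncD. Qed.
Lemma ncn (n : nat) : nc (n%:R : C) = n%:R.
Proof.
have -> : (n%:R : C) = (n%:R : R)%:C by rewrite rmorph_nat.
by rewrite ncR ger0_norm.
Qed.

Lemma nc_le0 z : nc z <= 0 -> z = 0.
Proof. by move=> h; apply: nc_eq0; apply/le_anti; rewrite h nc_ge0. Qed.

Lemma nc_eqP z w : (forall e : R, 0 < e -> nc (z - w) <= e) -> z = w.
Proof.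
move=> h; apply/eqP; rewrite -subr_eq0; apply/eqP; apply: nc_le0.
by apply/ler_addgt0Pl => e e0; rewrite addr0 h.
Qed.

End ComplexNorm.

Section ComplexDiff.
Variable R : realType.
Local Notation C := R[i].
Implicit Types (F G : C -> C) (z w L : C).

(** Complex differentiability with explicit moduli; [derivableCP] identifies it
    with derivability in the direction [1] for the norm topology of the plane. *)
Definition cdiff F z L := forall e : R, 0 < e ->
  exists2 d : R, 0 < d & forall h, nc h < d -> nc (F (z + h) - F z - h * L) <= e * nc h.

Definition cdiffable F z := exists L, cdiff F z L.

Lemma nbhsCP (z : C^o) (P : set C^o) :
  nbhs z P <-> exists2 d : R, 0 < d & forall w : C, nc (w - z) < d -> P w.
Proof.
rewrite -nbhs_ballE; split.
  case=> e /= e0 h.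
  have eR : e = (complex.Re e)%:C by move: e0; case: (e) => a b; rewrite ltcE /= => /andP[/eqP -> _].
  exists (complex.Re e); first by move: e0; rewrite {1}eR ltcR.
  move=> w hw; apply: h; rewrite -ball_normE /= eR.
  by rewrite normc_def ltcR -ncE ncB.
case=> d d0 h; exists d%:C => /=; first by rewrite ltcR.
by move=> w; rewrite -ball_normE /= normc_def ltcR -ncE ncB; apply: h.
Qed.

Lemma derivableCP (F : C^o -> C^o) z : derivable F z 1 <-> cdiffable F z.
Proof.
split.
  move=> /cvg_ex[/= L hL]; exists L => e e0.
  move/cvgrPdist_le : hL => /(_ e%:C); rewrite ltcR => /(_ e0).
  move=> /nbhsCP[d d0 hd]; exists d => // h hh.
  have [->|h0] := eqVneq h 0; first by rewrite addr0 subrr mul0r subrr nc0 mulr0.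
  have := hd h; rewrite subr0 => /(_ hh h0).
  rewrite normc_def -ncE lecR => hle.
  have hle' : nc (L - h^-1 *: (F (h *: 1 + z) - F z)) * nc h <= e * nc h.
    by rewrite ler_pM2r ?nc_gt0.
  apply: le_trans hle'; rewrite -ncM ncB.
  rewrite le_eqVlt; apply/orP; left; apply/eqP; congr nc.
  rewrite /GRing.scale /= mulr1 (addrC h).
  by field.
case=> L hL; apply/cvg_ex; exists L.
apply/cvgrPdist_le => e e0.
have eR : e = (complex.Re e)%:C by move: e0; case: (e) => a b; rewrite ltcE /= => /andP[/eqP -> _].
rewrite eR ltcR in e0 *.
have [d d0 hd] := hL _ e0.
apply/nbhsCP; exists d => // h; rewrite subr0 => hh h0 /=.
rewrite normc_def -ncE lecR.
have := hd _ hh; rewrite -ler_pdivrMr ?nc_gt0//; apply: le_trans.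
rewrite -ncV -ncM ncB.
rewrite le_eqVlt; apply/orP; left; apply/eqP; congr nc.
rewrite /GRing.scale /= mulr1 (addrC h).
by field.
Qed.

End ComplexDiff.

(** * Rules of differentiation, and bisection *)

Section ComplexDiffAlgebra.
Variable R : realType.
Local Notation C := R[i].
Implicit Types (F G : C -> C) (z w L : C).

Lemma cdiffable_cst a z : cdiffable (fun _ : C => a) z.
Proof. by apply/derivableCP; exact: derivable_cst. Qed.
Lemma cdiffable_id z : cdiffable (fun w : C => w) z.
Proof. by apply/derivableCP; exact: derivable_id. Qed.
Lemma cdiffableD F G z : cdiffable F z -> cdiffable G z -> cdiffable (fun w => F w + G w) z.
Proof.
by move=> /derivableCP f /derivableCP g; apply/(@derivableCP R (fun w => F w + G w)); exact: derivableD.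
Qed.
Lemma cdiffableM F G z : cdiffable F z -> cdiffable G z -> cdiffable (fun w => F w * G w) z.
Proof.
move=> /derivableCP f /derivableCP g; apply/(@derivableCP R (fun w => F w * G w)).
exact: (@derivableM _ _ (F : C^o -> C^o) (G : C^o -> C^o) z 1 f g).
Qed.
Lemma cdiffableV F z : F z != 0 -> cdiffable F z -> cdiffable (fun w => (F w)^-1) z.
Proof.
move=> Fz /derivableCP f; apply/(@derivableCP R (fun w => (F w)^-1)).
exact: (@derivableV _ _ (F : C^o -> C^o) z 1 Fz f).
Qed.
Lemma cdiffableN F z : cdiffable F z -> cdiffable (fun w => - F w) z.
Proof.
by move=> /derivableCP f; apply/(@derivableCP R (fun w => - F w)); exact: derivableN.
Qed.
Lemma cdiffableB F G z : cdiffable F z -> cdiffable G z -> cdiffable (fun w => F w - G w) z.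
Proof. by move=> f g; apply: cdiffableD => //; exact: cdiffableN. Qed.
Lemma cdiffableX F n z : cdiffable F z -> cdiffable (fun w => F w ^+ n) z.
Proof.
move=> f; elim: n => [|n IH].
  have -> : (fun w => F w ^+ 0) = fun=> 1 by apply/funext => w; rewrite expr0.
  exact: cdiffable_cst.
have -> : (fun w => F w ^+ n.+1) = fun w => F w * F w ^+ n.
  by apply/funext => w; rewrite exprS.
exact: cdiffableM.
Qed.

Lemma cdiffable_near F G z (d : R) : 0 < d ->
  (forall w, nc (w - z) < d -> F w = G w) -> cdiffable F z -> cdiffable G z.
Proof.
move=> d0 FG [L hL]; exists L => e e0; have [d1 d10 hd1] := hL _ e0.
exists (Num.min d d1); first by rewrite lt_min d0.
move=> h; rewrite lt_min => /andP[hd hd'].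
by rewrite -!FG ?subrr ?nc0 ?hd1// addrAC subrr add0r.
Qed.

Lemma cdiff_lip F z L : cdiff F z L ->
  exists2 d : R, 0 < d & forall h, nc h < d -> nc (F (z + h) - F z) <= (1 + nc L) * nc h.
Proof.
move=> /(_ 1 ltr01)[d d0 hd]; exists d => // h /hd; rewrite mul1r => hh.
have -> : F (z + h) - F z = (F (z + h) - F z - h * L) + h * L by ring.
by rewrite (le_trans (ncD _ _))// mulrDl mul1r lerD// ncM mulrC.
Qed.

Lemma cdiffable_cont F z : cdiffable F z -> forall e : R, 0 < e ->
  exists2 d : R, 0 < d & forall w, nc (w - z) < d -> nc (F w - F z) <= e.
Proof.
move=> [L /cdiff_lip[d d0 hd]] e e0.
have L0 : 0 < 1 + nc L by rewrite ltr_wpDr ?nc_ge0.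
exists (Num.min d (e / (1 + nc L))); first by rewrite lt_min d0 divr_gt0.
move=> w; rewrite lt_min => /andP[h1 h2].
rewrite -{1}(subrKC z w); apply: le_trans (hd _ h1) _.
by rewrite mulrC -ler_pdivlMr// ltW.
Qed.

(** The form in which derivatives of sums and integrals are found: a second
    order bound with a constant uniform in the summand survives summation. *)
Lemma cdiff_quad F z L (K d : R) : 0 < d -> 0 <= K ->
  (forall h, nc h < d -> nc (F (z + h) - F z - h * L) <= K * nc h ^+ 2) -> cdiff F z L.
Proof.
move=> d0 K0 H e e0; have K1 : 0 < K + 1 by rewrite ltr_wpDl.
exists (Num.min d (e / (K + 1))); first by rewrite lt_min d0 divr_gt0.
move=> h; rewrite lt_min => /andP[h1 h2].
apply: le_trans (H _ h1) _; rewrite expr2 mulrA ler_wpM2r ?nc_ge0//.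
rewrite ltr_pdivlMr// in h2; apply: le_trans (ltW h2).
by rewrite mulrC ler_wpM2l ?nc_ge0// lerDl.
Qed.

Lemma cdiffable_shift F z a : cdiffable F (a + z) -> cdiffable (fun w => F (a + w)) z.
Proof.
move=> [L hL]; exists L => e e0; have [d d0 hd] := hL _ e0; exists d => // h hh.
by rewrite addrA hd.
Qed.

End ComplexDiffAlgebra.

Section Bisection.
Variable R : realType.
Implicit Types (a b c d x y : R).

Let quarter (P : R -> R -> R -> R -> Prop) (q : R * R * R * R) : R * R * R * R :=
  let: (a, b, c, d) := q in
  let m := (a + b) / 2 in let n := (c + d) / 2 in
  if pselect (P a m c n) then
    if pselect (P m b c n) then
      if pselect (P a m n d) then (m, b, n, d) else (a, m, n, d)
    else (m, b, c, n)
  else (a, m, c, n).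

Lemma nested_pt (u v : nat -> R) : (forall n, u n <= u n.+1) -> (forall n, v n.+1 <= v n) ->
  (forall n, u n <= v n) -> exists x, forall n, u n <= x <= v n.
Proof.
have mono (f : nat -> R) : (forall n, f n <= f n.+1) -> forall m n, (m <= n)%N -> f m <= f n.
  move=> hf m n mn; rewrite -(subnK mn); elim: (n - m)%N => // k; rewrite addSn => h.
  exact: le_trans h (hf _).
move=> hu hv huv.
have uv m n : u m <= v n.
  apply: (le_trans (mono _ hu _ _ (leq_maxl m n))); apply: (le_trans (huv _)).
  rewrite -lerN2; apply: (mono (fun k => - v k)) (leq_maxr m n) => k.
  by rewrite lerN2.
exists (sup (range u)) => n; apply/andP; split.
  by apply: ub_le_sup; [exists (v 0) => _ [k _ <-]|exists n].
by apply: ge_sup; [exists (u 0); exists 0|move=> _ [k _ <-]].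
Qed.

Lemma pow2_small (t e : R) : 0 < e -> exists n : nat, t / 2 ^+ n <= e.
Proof.
move=> e0.
have [n hn] : exists n : nat, `|t| / e <= n%:R.
  by exists (Num.bound (`|t| / e)); rewrite ltW// Num.Theory.archi_boundP// divr_ge0// ltW.
exists n; rewrite ler_pdivrMr ?exprn_gt0//.
rewrite ler_pdivrMr// mulrC in hn; apply: (le_trans (ler_norm _)); apply: (le_trans hn).
rewrite ler_wpM2l// ?(ltW e0)//.
by rewrite -natrX ler_nat ltnW// ltn_expl.
Qed.

Lemma pow2_le (t : R) k n : 0 <= t -> (k <= n)%N -> t / 2 ^+ n <= t / 2 ^+ k.
Proof. by move=> t0 kn; rewrite ler_wpM2l// lef_pV2 ?posrE ?exprn_gt0// ler_weXn2l//; lra. Qed.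

(** Compactness of a rectangle in the form used by Goursat: a bad rectangle has
    a bad quarter, and the nested bad quarters shrink to a point. *)
Lemma bisection2 (P : R -> R -> R -> R -> Prop) a b c d : a <= b -> c <= d ->
  (forall a b c d, a <= b -> c <= d ->
     P a ((a + b) / 2) c ((c + d) / 2) -> P ((a + b) / 2) b c ((c + d) / 2) ->
     P a ((a + b) / 2) ((c + d) / 2) d -> P ((a + b) / 2) b ((c + d) / 2) d ->
     P a b c d) ->
  (forall x y, a <= x <= b -> c <= y <= d -> exists2 e : R, 0 < e &
     forall a' b' c' d', a <= a' <= x -> x <= b' <= b -> c <= c' <= y -> y <= d' <= d ->
       b' - a' <= e -> d' - c' <= e -> P a' b' c' d') ->
  P a b c d.
Proof.
move=> ab cd Psub Ploc; apply: contrapT => nP.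
pose q n := iter n (quarter P) (a, b, c, d).
pose A n := (q n).1.1.1; pose B n := (q n).1.1.2.
pose E n := (q n).1.2; pose D n := (q n).2.
have inv n : ~ P (A n) (B n) (E n) (D n) /\
    [/\ a <= A n, A n <= B n, B n <= b & B n - A n = (b - a) / 2 ^+ n] /\
    [/\ c <= E n, E n <= D n, D n <= d & D n - E n = (d - c) / 2 ^+ n].
  elim: n => [|n [IH [[h1 h2 h3 h4] [h5 h6 h7 h8]]]].
    by rewrite /A /B /E /D /= !expr0 !divr1.
  have ha : (b - a) / 2 ^+ n.+1 = (B n - A n) / 2 by rewrite h4 exprS invfM; ring.
  have hc : (d - c) / 2 ^+ n.+1 = (D n - E n) / 2 by rewrite h8 exprS invfM; ring.
  rewrite ha hc; move: IH h1 h2 h3 h5 h6 h7 {h4 h8 ha hc}.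
  rewrite /A /B /E /D /q /= -/(q n).
  case: (q n) => [[[a1 b1] c1] d1] /= IH h1 h2 h3 h5 h6 h7.
  case: pselect => p1 /=; last by split => //; split; split; lra.
  case: pselect => p2 /=; last by split => //; split; split; lra.
  case: pselect => p3 /=; last by split => //; split; split; lra.
  split; last by split; split; lra.
  by move=> p4; apply: IH; exact: Psub.
have step n : [/\ A n <= A n.+1, B n.+1 <= B n, E n <= E n.+1 & D n.+1 <= D n].
  have [_ [[_ h2 _ _] [_ h6 _ _]]] := inv n; move: h2 h6.
  rewrite /A /B /E /D /q /= -/(q n).
  case: (q n) => [[[a1 b1] c1] d1] /= h2 h6.
  by case: pselect => ? /=; [case: pselect => ? /=; [case: pselect => ? /=|]|]; split; lra.
have [x hx] : exists x, forall n, A n <= x <= B n.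
  by apply: nested_pt => n; have [? ? ? ?] := step n; have [_ [[? ? ? ?] [? ? ? ?]]] := inv n.
have [y hy] : exists y, forall n, E n <= y <= D n.
  by apply: nested_pt => n; have [? ? ? ?] := step n; have [_ [[? ? ? ?] [? ? ? ?]]] := inv n.
have hx0 := hx 0%N; have hy0 := hy 0%N.
have [e e0 he] := Ploc x y hx0 hy0.
have [n1 hn1] := pow2_small (b - a) e0; have [n2 hn2] := pow2_small (d - c) e0.
pose n := maxn n1 n2.
have [nPn [[h1 h2 h3 h4] [h5 h6 h7 h8]]] := inv n.
apply: nPn; apply: he.
- by rewrite h1; case/andP: (hx n).
- by rewrite h3 andbT; case/andP: (hx n).
- by rewrite h5; case/andP: (hy n).
- by rewrite h7 andbT; case/andP: (hy n).
- by rewrite h4 (le_trans _ hn1)// pow2_le ?leq_maxl// subr_ge0.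
- by rewrite h8 (le_trans _ hn2)// pow2_le ?leq_maxr// subr_ge0.
Qed.

Lemma bisection1 (P : R -> R -> Prop) a b : a <= b ->
  (forall a b, a <= b -> P a ((a + b) / 2) -> P ((a + b) / 2) b -> P a b) ->
  (forall x, a <= x <= b -> exists2 e : R, 0 < e &
     forall a' b', a <= a' <= x -> x <= b' <= b -> b' - a' <= e -> P a' b') ->
  P a b.
Proof.
move=> ab Psub Ploc; apply: (@bisection2 (fun a b _ _ => P a b) a b 0 0) => //.
  by move=> a1 b1 ? ? h _ p1 p2 _ _; exact: Psub.
move=> x y hx _; have [e e0 he] := Ploc x hx; exists e => // *; exact: he.
Qed.

End Bisection.

(** * Integrals of complex-valued functions *)

Notation cRe := complex.Re.
Notation cIm := complex.Im.

Section ReIm.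
Variable R : realType.
Implicit Types z w : R[i].
Lemma ReD z w : cRe (z + w) = cRe z + cRe w. Proof. by case: z; case: w. Qed.
Lemma ImD z w : cIm (z + w) = cIm z + cIm w. Proof. by case: z; case: w. Qed.
Lemma ReN z : cRe (- z) = - cRe z. Proof. by case: z. Qed.
Lemma ImN z : cIm (- z) = - cIm z. Proof. by case: z. Qed.
Lemma ReB z w : cRe (z - w) = cRe z - cRe w. Proof. by rewrite ReD ReN. Qed.
Lemma ImB z w : cIm (z - w) = cIm z - cIm w. Proof. by rewrite ImD ImN. Qed.
Lemma ReM z w : cRe (z * w) = cRe z * cRe w - cIm z * cIm w. Proof. by case: z; case: w. Qed.
Lemma ImM z w : cIm (z * w) = cRe z * cIm w + cIm z * cRe w. Proof. by case: z; case: w. Qed.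
Lemma eqC z w : cRe z = cRe w -> cIm z = cIm w -> z = w.
Proof. by case: z => a b; case: w => c d /= -> ->. Qed.
End ReIm.

Section ComplexIntegral.
Variable R : realType.
Local Notation C := R[i].
Local Notation mu := (@lebesgue_measure R).
Implicit Types (D : set (measurableTypeR R)) (f g : R -> C) (a b x y : R).

Definition cmeas D f := measurable_fun D (fun x => cRe (f x)) /\ measurable_fun D (fun x => cIm (f x)).
(** Working with real and imaginary parts keeps the real-valued integration
    theory applicable. *)
Definition cintegrable D f :=
  mu.-integrable D (EFin \o (fun x => cRe (f x))) /\ mu.-integrable D (EFin \o (fun x => cIm (f x))).
Definition cint D f : C := (\int[mu]_(x in D) cRe (f x))%R +i* (\int[mu]_(x in D) cIm (f x))%R.

Lemma Re_cint D f : cRe (cint D f) = (\int[mu]_(x in D) cRe (f x))%R. Proof. by []. Qed.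
Lemma Im_cint D f : cIm (cint D f) = (\int[mu]_(x in D) cIm (f x))%R. Proof. by []. Qed.

Lemma cintegrable_meas D f : cintegrable D f -> cmeas D f.
Proof. by case=> /measurable_int/measurable_EFinP h1 /measurable_int/measurable_EFinP h2. Qed.

Lemma eq_cint D f g : (forall x, D x -> f x = g x) -> cint D f = cint D g.
Proof.
by move=> h; congr (_ +i* _); apply: eq_Rintegral => x; rewrite inE => /h ->.
Qed.

Lemma eq_cintegrable D f g : measurable D -> (forall x, D x -> f x = g x) -> cintegrable D f -> cintegrable D g.
Proof.
move=> mD h [h1 h2]; split.
  by apply: eq_integrable h1 => // x; rewrite inE /= => /h ->.
by apply: eq_integrable h2 => // x; rewrite inE /= => /h ->.
Qed.

Lemma cintegrableS D1 D2 f : measurable D1 -> measurable D2 -> D2 `<=` D1 ->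
  cintegrable D1 f -> cintegrable D2 f.
Proof. by move=> m1 m2 h [i1 i2]; split; [apply: integrableS i1|apply: integrableS i2]. Qed.

Lemma cintegrableD D f g : measurable D -> cintegrable D f -> cintegrable D g -> cintegrable D (fun x => f x + g x).
Proof.
move=> mD [f1 f2] [g1 g2]; split.
  apply: eq_integrable (integrableD mD f1 g1) => // x _ /=; by rewrite ReD EFinD.
apply: eq_integrable (integrableD mD f2 g2) => // x _ /=; by rewrite ImD EFinD.
Qed.

Lemma integrableZR D (h : R -> R) (k : R) : measurable D -> mu.-integrable D (EFin \o h) ->
  mu.-integrable D (EFin \o (fun x => k * h x)).
Proof. by move=> mD i; apply: eq_integrable (integrableZl mD k i). Qed.

Lemma integrableBR D (h k : R -> R) : measurable D -> mu.-integrable D (EFin \o h) ->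
  mu.-integrable D (EFin \o k) -> mu.-integrable D (EFin \o (fun x => h x - k x)).
Proof. by move=> mD i j; apply: eq_integrable (integrableB mD i j) => // x _ /=; rewrite EFinB. Qed.

Lemma integrableDR D (h k : R -> R) : measurable D -> mu.-integrable D (EFin \o h) ->
  mu.-integrable D (EFin \o k) -> mu.-integrable D (EFin \o (fun x => h x + k x)).
Proof. by move=> mD i j; apply: eq_integrable (integrableD mD i j) => // x _ /=; rewrite EFinD. Qed.

Lemma cintegrableZ D c f : measurable D -> cintegrable D f -> cintegrable D (fun x => c * f x).
Proof.
move=> mD [f1 f2]; split.
  have -> : (fun x => cRe (c * f x)) = (fun x => cRe c * cRe (f x) - cIm c * cIm (f x)).
    by apply/funext => x; rewrite ReM.
  by apply: integrableBR => //; exact: integrableZR.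
have -> : (fun x => cIm (c * f x)) = (fun x => cRe c * cIm (f x) + cIm c * cRe (f x)).
  by apply/funext => x; rewrite ImM.
by apply: integrableDR => //; exact: integrableZR.
Qed.

Lemma cintegrableN D f : measurable D -> cintegrable D f -> cintegrable D (fun x => - f x).
Proof.
move=> mD i; apply: eq_cintegrable (cintegrableZ (-1) mD i) => // x _.
by rewrite mulN1r.
Qed.

Lemma cintegrableB D f g : measurable D -> cintegrable D f -> cintegrable D g -> cintegrable D (fun x => f x - g x).
Proof. by move=> mD i j; apply: cintegrableD => //; exact: cintegrableN. Qed.

Lemma cintD D f g : measurable D -> cintegrable D f -> cintegrable D g ->
  cint D (fun x => f x + g x) = cint D f + cint D g.
Proof.
move=> mD [f1 f2] [g1 g2]; apply: eqC => /=; rewrite -?RintegralD//.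
  by apply: eq_Rintegral => x _; rewrite ReD.
by apply: eq_Rintegral => x _; rewrite ImD.
Qed.

Lemma cintZ D c f : measurable D -> cintegrable D f -> cint D (fun x => c * f x) = c * cint D f.
Proof.
move=> mD [f1 f2]; apply: eqC; rewrite ?ReM ?ImM /=.
  rewrite -!RintegralZl// -RintegralB//; [|exact: integrableZR..].
  by apply: eq_Rintegral => x _; rewrite ReM.
rewrite -!RintegralZl// -RintegralD//; [|exact: integrableZR..].
by apply: eq_Rintegral => x _; rewrite ImM.
Qed.

Lemma cintN D f : measurable D -> cintegrable D f -> cint D (fun x => - f x) = - cint D f.
Proof.
move=> mD i; rewrite -[RHS]mulN1r -cintZ//.
by apply: eq_cint => x _; rewrite mulN1r.
Qed.

Lemma cintB D f g : measurable D -> cintegrable D f -> cintegrable D g ->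
  cint D (fun x => f x - g x) = cint D f - cint D g.
Proof. by move=> mD i j; rewrite cintD ?cintN//; exact: cintegrableN. Qed.

Lemma cmeasS D1 D2 f : measurable D1 -> D2 `<=` D1 -> cmeas D1 f -> cmeas D2 f.
Proof. by move=> m h [h1 h2]; split; [apply: measurable_funS h1|apply: measurable_funS h2]. Qed.

Lemma cmeasD D f g : measurable D -> cmeas D f -> cmeas D g -> cmeas D (fun x => f x + g x).
Proof.
move=> mD [f1 f2] [g1 g2]; split.
  have -> : (fun x => cRe (f x + g x)) = (fun x => cRe (f x) + cRe (g x)) by apply/funext => x; rewrite ReD.
  exact: measurable_funD.
have -> : (fun x => cIm (f x + g x)) = (fun x => cIm (f x) + cIm (g x)) by apply/funext => x; rewrite ImD.
exact: measurable_funD.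
Qed.

Lemma cmeasM D f g : measurable D -> cmeas D f -> cmeas D g -> cmeas D (fun x => f x * g x).
Proof.
move=> mD [f1 f2] [g1 g2]; split.
  have -> : (fun x => cRe (f x * g x)) = (fun x => cRe (f x) * cRe (g x) - cIm (f x) * cIm (g x)).
    by apply/funext => x; rewrite ReM.
  by apply: measurable_funB; exact: measurable_funM.
have -> : (fun x => cIm (f x * g x)) = (fun x => cRe (f x) * cIm (g x) + cIm (f x) * cRe (g x)).
  by apply/funext => x; rewrite ImM.
by apply: measurable_funD; exact: measurable_funM.
Qed.

Lemma cmeas_cst D c : cmeas D (fun=> c).
Proof. by split; exact: measurable_cst. Qed.

Lemma cmeasN D f : measurable D -> cmeas D f -> cmeas D (fun x => - f x).
Proof.
move=> mD mf; have := cmeasM mD (cmeas_cst D (-1)) mf.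
by congr cmeas; apply/funext => x; rewrite mulN1r.
Qed.

Lemma cmeasB D f g : measurable D -> cmeas D f -> cmeas D g -> cmeas D (fun x => f x - g x).
Proof. by move=> mD mf mg; apply: cmeasD => //; exact: cmeasN. Qed.

Lemma cmeas_R D (h : R -> R) : measurable_fun D h -> cmeas D (fun x => (h x)%:C).
Proof. by move=> mh; split => //=; exact: measurable_cst. Qed.

Lemma cmeas_conj D f : cmeas D f -> cmeas D (fun x => conjc (f x)).
Proof.
move=> [f1 f2]; split.
  by have -> : (fun x => cRe (conjc (f x))) = (fun x => cRe (f x)) by apply/funext => x; case: (f x).
have -> : (fun x => cIm (conjc (f x))) = \- (fun x => cIm (f x)) by apply/funext => x /=; case: (f x).
exact: measurableT_comp.
Qed.

Lemma cmeas_nc D f : measurable D -> cmeas D f -> measurable_fun D (fun x => nc (f x)).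
Proof.
move=> mD [f1 f2].
have -> : (fun x => nc (f x)) = (@Num.sqrt R) \o (fun x => (cRe (f x)) ^+ 2 + (cIm (f x)) ^+ 2).
  by apply/funext => x /=; rewrite ncE.
apply: (@measurableT_comp _ _ _ _ _ _ (@Num.sqrt R)); first by apply: continuous_measurable_fun; exact: sqrt_continuous.
by apply: measurable_funD; exact: measurable_funX.
Qed.

Lemma le_cintegrable D f (h : R -> R) : measurable D -> cmeas D f -> mu.-integrable D (EFin \o h) ->
  (forall x, D x -> nc (f x) <= h x) -> cintegrable D f.
Proof.
move=> mD [m1 m2] ih fh; split.
  apply: le_integrable ih => //; first exact/measurable_EFinP.
  move=> x Dx /=; rewrite lee_fin (le_trans (nc_Re _))// (le_trans (fh _ Dx))//.
  exact: ler_norm.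
apply: le_integrable ih => //; first exact/measurable_EFinP.
move=> x Dx /=; rewrite lee_fin (le_trans (nc_Im _))// (le_trans (fh _ Dx))//.
exact: ler_norm.
Qed.

Lemma cintegrable_nc D f : measurable D -> cintegrable D f -> mu.-integrable D (EFin \o (fun x => nc (f x))).
Proof.
move=> mD /[dup] /cintegrable_meas mf [f1 f2].
apply: (@le_integrable _ _ _ mu D mD _ (EFin \o (fun x => `|cRe (f x)| + `|cIm (f x)|))) => //.
- by apply/measurable_EFinP; exact: cmeas_nc.
- move=> x Dx /=; rewrite lee_fin (ger0_norm (nc_ge0 _)) (ger0_norm (addr_ge0 _ _))//.
  exact: nc_le.
- by apply: integrableDR => //; exact: integrable_norm.
Qed.

(** Rotating the integral onto the positive real axis reduces the bound to the
    monotonicity of the real integral. *)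
Lemma cint_norm D f : measurable D -> cintegrable D f ->
  nc (cint D f) <= (\int[mu]_(x in D) nc (f x))%R.
Proof.
move=> mD i; have [->|w0] := eqVneq (cint D f) 0.
  by rewrite nc0; apply: Rintegral_ge0 => x _; exact: nc_ge0.
pose u := conjc (cint D f) / (nc (cint D f))%:C.
have nu : nc u = 1 by rewrite /u ncM ncJ ncV ncR ger0_norm ?nc_ge0// divff// gt_eqF ?nc_gt0.
have uE : u * cint D f = (nc (cint D f))%:C.
  have h : (nc (cint D f))%:C != 0 :> C.
    by apply: nc_neq0; rewrite ncR ger0_norm ?nc_gt0 ?nc_ge0.
  rewrite /u mulrAC; apply: (canLR (mulfK h)).
  by rewrite mulrC -sqr_normc normc_def -ncE expr2.
have -> : nc (cint D f) = cRe (cint D (fun x => u * f x)).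
  by rewrite cintZ// uE.
rewrite /cint /=; apply: le_Rintegral => //.
- by have [] := cintegrableZ u mD i.
- exact: cintegrable_nc.
move=> x Dx; rewrite (le_trans (ler_norm _))// (le_trans (nc_Re _))//.
by rewrite ncM nu mul1r.
Qed.

Lemma cint_norm_le D f (h : R -> R) : measurable D -> cintegrable D f -> mu.-integrable D (EFin \o h) ->
  (forall x, D x -> nc (f x) <= h x) -> nc (cint D f) <= (\int[mu]_(x in D) h x)%R.
Proof.
move=> mD i ih fh; apply: (le_trans (cint_norm mD i)); apply: le_Rintegral => //.
exact: cintegrable_nc.
Qed.

Lemma Rint_split a b c (h : R -> R) : a <= b -> b <= c -> mu.-integrable `[a, c] (EFin \o h) ->
  (\int[mu]_(x in `[a, c]) h x = \int[mu]_(x in `[a, b]) h x + \int[mu]_(x in `[b, c]) h x)%R.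
Proof.
move=> ab bc i; have := @Rintegral_itvB _ h (BLeft a) (BRight c) b i.
rewrite !bnd_simp => /(_ ab bc) e; apply/eqP; rewrite addrC -subr_eq e; apply/eqP.
apply: Rintegral_itv_obnd_cbnd; apply: integrableS i => //.
by apply: subset_itvr; rewrite bnd_simp.
Qed.

Lemma cint_split a b c f : a <= b -> b <= c -> cintegrable `[a, c] f ->
  cint `[a, c] f = cint `[a, b] f + cint `[b, c] f.
Proof.
by move=> ab bc [i1 i2]; apply: eqC; rewrite ?ReD ?ImD /=; exact: Rint_split.
Qed.

Lemma cint0 D : cint D (fun=> 0) = 0.
Proof.
have h : (\int[mu]_(x in D) (0 : R) = 0)%R by rewrite /Rintegral integral0.
by rewrite /cint /= h.
Qed.

Lemma cint_pt a f : cint `[a, a] f = 0.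
Proof. by rewrite set_itv1; apply: eqC => /=; rewrite Rintegral_set1. Qed.

Lemma integrable_cst_itv a b (k : R) : mu.-integrable `[a, b] (EFin \o (fun=> k)).
Proof.
apply: continuous_compact_integrable; first exact: segment_compact.
by apply: continuous_subspaceT; exact: cst_continuous.
Qed.

Lemma Rintegral_cst_itv a b (k : R) : a <= b -> (\int[mu]_(x in `[a, b]) k = k * (b - a))%R.
Proof.
move=> ab; rewrite Rintegral_cst//= lebesgue_measure_itv /= lte_fin.
case: ifP => /= [//|]; move: ab; rewrite le_eqVlt => /orP[/eqP ->|-> //].
by rewrite subrr.
Qed.

Lemma cint_bound a b f K : a <= b -> cintegrable `[a, b] f -> (forall x, a <= x <= b -> nc (f x) <= K) ->
  nc (cint `[a, b] f) <= K * (b - a).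
Proof.
move=> ab i h; rewrite -Rintegral_cst_itv//; apply: cint_norm_le => //; exact: integrable_cst_itv.
Qed.

End ComplexIntegral.

(* Unification would otherwise split the integral into its two components. *)
#[global] Opaque cint.

(** * Continuity and absolute continuity *)

Section Continuity.
Variable R : realType.
Local Notation C := R[i].
Local Notation mu := (@lebesgue_measure R).
Implicit Types (f g : R -> C) (a b x y : R).

Lemma within_epsP a b (h : R -> R) : {within `[a, b], continuous h} <->
  forall x, a <= x <= b -> forall e, 0 < e ->
    exists2 d, 0 < d & forall y, a <= y <= b -> `|y - x| < d -> `|h y - h x| <= e.
Proof.
split=> [hc x xab e e0|hc].
  have xA : `[a, b]%classic x by rewrite /= in_itv.
  move: (hc x); rewrite /continuous_at => /cvgrPdist_le/(_ e e0).
  rewrite /prop_near1 /nbhs /= -nbhs_subspace_in// => /nbhs_ballP[d /= d0 hd]; exists d => // y yab yx.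
  rewrite distrC; apply: hd; last by rewrite /= in_itv.
  by rewrite -ball_normE /= distrC.
rewrite continuous_subspace_in => x; rewrite inE /= in_itv /= => xab.
apply/cvgrPdist_le => e e0; have [d d0 hd] := hc x xab e e0.
rewrite /prop_near1 /nbhs /= -nbhs_subspace_in; last by rewrite /= in_itv.
apply/nbhs_ballP; exists d => // y; rewrite -ball_normE /= distrC => yx yA.
by rewrite distrC; apply: hd => //; move: yA; rewrite /= in_itv.
Qed.

(** Continuity relative to the interval, so that one-sided behaviour at the end
    points is enough. *)
Definition ccont_on a b f := forall x, a <= x <= b -> forall e, 0 < e ->
  exists2 d, 0 < d & forall y, a <= y <= b -> `|y - x| < d -> nc (f y - f x) <= e.

Definition ccont f := forall a b, ccont_on a b f.

Lemma ccont_on_ReIm a b f : ccont_on a b f <->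
  {within `[a, b], continuous (fun x => cRe (f x))} /\ {within `[a, b], continuous (fun x => cIm (f x))}.
Proof.
split=> [hf|[/within_epsP h1 /within_epsP h2] x xab e e0].
  split; apply/within_epsP => x xab e e0; have [d d0 hd] := hf x xab e e0; exists d => // y yab yx.
    by rewrite -ReB (le_trans (nc_Re _))// hd.
  by rewrite -ImB (le_trans (nc_Im _))// hd.
have e2 : 0 < e / 2 by rewrite divr_gt0.
have [d1 d10 hd1] := h1 x xab _ e2; have [d2 d20 hd2] := h2 x xab _ e2.
exists (Num.min d1 d2) => [|y yab]; first by rewrite lt_min d10.
rewrite lt_min => /andP[y1 y2]; rewrite (le_trans (nc_le _))// ReB ImB.
by rewrite (splitr e) lerD ?hd1 ?hd2.
Qed.

Lemma ccont_on_integrable a b f : ccont_on a b f -> cintegrable `[a, b] f.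
Proof.
move=> /ccont_on_ReIm[h1 h2]; split.
  by apply: continuous_compact_integrable => //; exact: segment_compact.
by apply: continuous_compact_integrable => //; exact: segment_compact.
Qed.

Lemma ccont_on_meas a b f : ccont_on a b f -> cmeas `[a, b] f.
Proof. by move=> h; apply: cintegrable_meas; exact: ccont_on_integrable. Qed.

Lemma ccont_cst c : ccont (fun=> c).
Proof. by move=> a b x _ e e0; exists 1 => // y _ _; rewrite subrr nc0 ltW. Qed.

Lemma ccont_on_R a b (h : R -> R) : {within `[a, b], continuous h} -> ccont_on a b (fun x => (h x)%:C).
Proof. by move=> hc; apply/ccont_on_ReIm; split => //=; apply: continuous_subspaceT; exact: cst_continuous. Qed.

Lemma ccont_R (h : R -> R) : continuous h -> ccont (fun x => (h x)%:C).
Proof. by move=> hc a b; apply: ccont_on_R; exact: continuous_subspaceT. Qed.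

Lemma ccont_onD a b f g : ccont_on a b f -> ccont_on a b g -> ccont_on a b (fun x => f x + g x).
Proof.
move=> hf hg x xab e e0; have e2 : 0 < e / 2 by rewrite divr_gt0.
have [d1 d10 hd1] := hf x xab _ e2; have [d2 d20 hd2] := hg x xab _ e2.
exists (Num.min d1 d2) => [|y yab]; first by rewrite lt_min d10.
rewrite lt_min => /andP[y1 y2].
have -> : f y + g y - (f x + g x) = (f y - f x) + (g y - g x) by ring.
by rewrite (le_trans (ncD _ _))// (splitr e) lerD ?hd1 ?hd2.
Qed.

Lemma ccont_onM a b f g : ccont_on a b f -> ccont_on a b g -> ccont_on a b (fun x => f x * g x).
Proof.
move=> hf hg x xab e e0; pose M := 1 + nc (g x) + nc (f x).
have M0 : 0 < M by rewrite /M -addrA ltr_wpDr// addr_ge0 ?nc_ge0.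
have e2 : 0 < e / (2 * M) by rewrite divr_gt0// mulr_gt0.
have [d1 d10 hd1] := hf x xab _ e2; have [d2 d20 hd2] := hg x xab _ e2.
have [d3 d30 hd3] := hg x xab _ ltr01.
exists (Num.min d1 (Num.min d2 d3)) => [|y yab]; first by rewrite !lt_min d10 d20.
rewrite !lt_min => /and3P[y1 y2 y3].
have -> : f y * g y - f x * g x = (f y - f x) * g y + f x * (g y - g x) by ring.
rewrite (le_trans (ncD _ _))// (splitr e) !ncM.
have gy : nc (g y) <= M.
  have -> : g y = (g y - g x) + g x by ring.
  by rewrite (le_trans (ncD _ _))// /M (le_trans (lerD (hd3 _ yab y3) (lexx _)))// lerDl nc_ge0.
have fx : nc (f x) <= M by rewrite /M lerDr addr_ge0 ?nc_ge0.
have -> : e / 2 = e / (2 * M) * M by field; rewrite gt_eqF.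
by apply: lerD; [|rewrite mulrC]; apply: ler_pM; rewrite ?nc_ge0 ?hd1 ?hd2.
Qed.

Lemma ccont_onN a b f : ccont_on a b f -> ccont_on a b (fun x => - f x).
Proof.
move=> hf; have := ccont_onM (@ccont_cst (-1) a b) hf.
by congr ccont_on; apply/funext => x; rewrite mulN1r.
Qed.

Lemma ccont_onB a b f g : ccont_on a b f -> ccont_on a b g -> ccont_on a b (fun x => f x - g x).
Proof. by move=> hf hg; apply: ccont_onD => //; exact: ccont_onN. Qed.

Lemma ccontD f g : ccont f -> ccont g -> ccont (fun x => f x + g x).
Proof. by move=> hf hg a b; exact: ccont_onD. Qed.
Lemma ccontB f g : ccont f -> ccont g -> ccont (fun x => f x - g x).
Proof. by move=> hf hg a b; exact: ccont_onB. Qed.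
Lemma ccontM f g : ccont f -> ccont g -> ccont (fun x => f x * g x).
Proof. by move=> hf hg a b; exact: ccont_onM. Qed.
Lemma ccontZ c f : ccont f -> ccont (fun x => c * f x).
Proof. by move=> hf; apply: ccontM => //; exact: ccont_cst. Qed.

Lemma ccont_on_comp a b (F : C -> C) f : (forall x, a <= x <= b -> cdiffable F (f x)) ->
  ccont_on a b f -> ccont_on a b (fun x => F (f x)).
Proof.
move=> hF hf x xab e e0; have [d d0 hd] := cdiffable_cont (hF x xab) e0.
have d2 : 0 < d / 2 by rewrite divr_gt0.
have [d' d'0 hd'] := hf x xab _ d2; exists d' => // y yab yx; apply: hd.
by rewrite (le_lt_trans (hd' y yab yx))// ltr_pdivrMr// mulr_natr mulr2n ltrDl.
Qed.

(** Boundedness holds near each point and passes from two halves to the whole. *)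
Lemma ccont_on_bounded a b f : a <= b -> ccont_on a b f ->
  exists2 M, 0 <= M & forall x, a <= x <= b -> nc (f x) <= M.
Proof.
move=> ab hf; pose P x y := exists2 M, 0 <= M & forall z, a <= x -> y <= b -> x <= z <= y -> nc (f z) <= M.
have [M M0 hM] : P a b.
  apply: bisection1 => // {ab}.
    move=> x y xy [M1 M10 h1] [M2 M20 h2]; exists (M1 + M2); first by rewrite addr_ge0.
    move=> z ax yb /andP[xz zy]; have [zm|mz] := leP z ((x + y) / 2).
      by rewrite (le_trans (h1 z _ _ _)) ?xz ?zm ?lerDl//; lra.
    by rewrite (le_trans (h2 z _ _ _)) ?zy ?(ltW mz) ?lerDr//; lra.
  move=> x xab; have [d d0 hd] := hf x xab _ ltr01.
  exists (d / 2); first by rewrite divr_gt0.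
  move=> a' b' h1 h2 h3; exists (1 + nc (f x)); first by rewrite addr_ge0 ?nc_ge0.
  move=> z h4 h5 h6; have -> : f z = (f z - f x) + f x by ring.
  rewrite (le_trans (ncD _ _))// lerD2r hd//; first lra.
  by rewrite ltr_norml; lra.
by exists M => // x xab; apply: hM.
Qed.

Lemma ccont_cmeas f : ccont f -> cmeas setT f.
Proof.
move=> hf; have H (h : R -> R) : (forall a b, {within `[a, b], continuous h}) -> measurable_fun setT h.
  move=> hh; apply: continuous_measurable_fun => x.
  have x1 : x \in (`]x - 1, x + 1[ : interval R) by rewrite in_itv /=; lra.
  have xx : x - 1 < x + 1 by lra.
  by have /(continuous_within_itvP _ xx)[/(_ x x1)] := hh (x - 1) (x + 1).
by split; apply: H => a b; have /ccont_on_ReIm[] := hf a b.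
Qed.

Lemma cintegrable_Mbd (D : set (measurableTypeR R)) f g K : measurable D -> cmeas D f -> cintegrable D g ->
  (forall x, D x -> nc (f x) <= K) -> cintegrable D (fun x => f x * g x).
Proof.
move=> mD mf ig hK; apply: (@le_cintegrable _ _ _ (fun x => K * nc (g x))) => //.
- by apply: cmeasM => //; exact: cintegrable_meas.
- by apply: integrableZR => //; exact: cintegrable_nc.
- by move=> x Dx; rewrite ncM ler_wpM2r ?nc_ge0 ?hK.
Qed.

Lemma cintegrable_Mcont a b f g : a <= b -> ccont_on a b f -> cintegrable `[a, b] g ->
  cintegrable `[a, b] (fun x => f x * g x).
Proof.
move=> ab hf ig; have [K K0 hK] := ccont_on_bounded ab hf.
by apply: (@cintegrable_Mbd _ _ _ K) => //; exact: ccont_on_meas.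
Qed.

End Continuity.

Section AbsContinuity.
Variable R : realType.
Local Notation C := R[i].
Local Notation mu := (@lebesgue_measure R).
Implicit Types (f g h F G H : R -> C) (a b x y : R).

(** [G] is an indefinite integral of [g]. Differential equations are read in this
    integrated sense, which tolerates a merely integrable source and passes to
    limits without any discussion of derivatives. *)
Definition AC a b g G := cintegrable `[a, b] g /\
  forall x y, a <= x -> x <= y -> y <= b -> G y - G x = cint `[x, y] g.

Lemma AC_S a b c d g G : a <= c -> d <= b -> AC a b g G -> AC c d g G.
Proof.
move=> ac db [ig hG]; split.
  apply: cintegrableS ig => // x /=; rewrite !in_itv /= => /andP[cx xd].
  by rewrite (le_trans ac cx) (le_trans xd db).
by move=> x y cx xy yd; apply: hG => //; [exact: le_trans cx|exact: le_trans db].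
Qed.

Lemma AC_cont a b g G : a <= b -> AC a b g G -> ccont_on a b G.
Proof.
move=> ab [[i1 i2] hG].
suff H (k : R -> R) (K : R -> R) : mu.-integrable `[a, b] (EFin \o k) ->
   (forall y, a <= y -> y <= b -> K y - K a = \int[mu]_(t in `[a, y]) k t)%R ->
   {within `[a, b], continuous K}.
  apply/ccont_on_ReIm; split.
    by apply: H i1 _ => y ay yb; rewrite -ReB hG.
  by apply: H i2 _ => y ay yb; rewrite -ImB hG.
move=> ik hK; have := parameterized_integral_continuous ab ik.
move=> /within_epsP h; apply/within_epsP => x xab e e0; have [d d0 hd] := h x xab e e0.
exists d => // y yab yx; have := hd y yab yx.
rewrite /parameterized_integral; move: xab yab => /andP[ax xb] /andP[ay yb].
by rewrite -!hK// opprB addrA subrK.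
Qed.

Lemma AC_D a b g G h H : AC a b g G -> AC a b h H -> AC a b (fun x => g x + h x) (fun x => G x + H x).
Proof.
move=> [ig hG] [ih hH]; split; first exact: cintegrableD.
move=> x y ax xy yb.
have sub : `[x, y] `<=` `[a, b] by apply: subset_itvScc; rewrite bnd_simp.
rewrite cintD//; [|exact: cintegrableS ig|exact: cintegrableS ih].
by rewrite -hG// -hH//; ring.
Qed.

Lemma AC_Z a b c g G : AC a b g G -> AC a b (fun x => c * g x) (fun x => c * G x).
Proof.
move=> [ig hG]; split; first exact: cintegrableZ.
move=> x y ax xy yb.
have sub : `[x, y] `<=` `[a, b] by apply: subset_itvScc; rewrite bnd_simp.
by rewrite cintZ//; [rewrite -hG// mulrBr|exact: cintegrableS ig].
Qed.

Lemma AC_N a b g G : AC a b g G -> AC a b (fun x => - g x) (fun x => - G x).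
Proof.
move=> /(AC_Z (-1)); congr AC; apply/funext => x; exact: mulN1r.
Qed.

Lemma AC_B a b g G h H : AC a b g G -> AC a b h H -> AC a b (fun x => g x - h x) (fun x => G x - H x).
Proof. by move=> gG hH; apply: AC_D => //; exact: AC_N. Qed.

Lemma AC_cst a b c : AC a b (fun=> 0) (fun=> c).
Proof.
split; first exact/ccont_on_integrable/ccont_cst.
by move=> x y _ _ _; rewrite subrr cint0.
Qed.

Lemma eq_AC a b g g' G G' : (forall x, a <= x <= b -> g x = g' x) -> (forall x, a <= x <= b -> G x = G' x) ->
  AC a b g G -> AC a b g' G'.
Proof.
move=> gg GG [ig hG]; split.
  by apply: eq_cintegrable ig => // x /=; rewrite in_itv /= => /gg.
move=> x y ax xy yb; rewrite -!GG ?ax ?(le_trans ax xy) ?yb ?(le_trans xy yb)// hG//.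
apply: eq_cint => t /=; rewrite in_itv /= => /andP[xt ty]; apply: gg.
by rewrite (le_trans ax xt) (le_trans ty yb).
Qed.

Lemma AC_ccont g G : (forall a b, AC a b g G) -> ccont G.
Proof.
move=> h a b; have [ab|ba] := leP a b; first exact: AC_cont (h a b).
by move=> x /andP[ax xb]; move: (le_trans ax xb); rewrite leNgt ba.
Qed.

Lemma cint_eq0_small a b (J : C) (m : R) : 0 <= m -> (forall e, 0 < e -> nc J <= e * m) -> J = 0.
Proof.
move=> m0 h; apply: nc_le0; apply/ler_addgt0Pl => e e0; rewrite addr0.
have m1 : 0 < m + 1 by rewrite ltr_wpDl.
apply: (le_trans (h (e / (m + 1)) _)); first by rewrite divr_gt0.
by rewrite mulrAC ler_pdivrMr// ler_wpM2l ?ltW// ltrDl.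
Qed.

(** Over a short interval the defect of the product rule is at most the
    oscillation of the two functions times the mass of the two densities, so
    bisection makes it vanish. *)
Lemma AC_M a b g G h H : a <= b -> AC a b g G -> AC a b h H ->
  AC a b (fun x => g x * H x + G x * h x) (fun x => G x * H x).
Proof.
move=> ab AG AH; have cG := AC_cont ab AG; have cH := AC_cont ab AH.
have [ig hG] := AG; have [ih hH] := AH.
have igH : cintegrable `[a, b] (fun x => g x * H x).
  apply: (@eq_cintegrable _ _ (fun x => H x * g x)) => //; first by move=> x _; rewrite mulrC.
  exact: cintegrable_Mcont.
have iGh : cintegrable `[a, b] (fun x => G x * h x) by exact: cintegrable_Mcont.
pose k x := g x * H x + G x * h x.
have ik : cintegrable `[a, b] k by exact: cintegrableD.
split => // x y ax xy yb.
have sub u v : a <= u -> v <= b -> `[u, v] `<=` `[a, b] by move=> au vb; apply: subset_itvScc; rewrite bnd_simp.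
pose n (t : R) := nc (g t) + nc (h t).
have inn : mu.-integrable `[a, b] (EFin \o n) by apply: integrableDR => //; exact: cintegrable_nc.
pose m (u v : R) : R := (\int[mu]_(t in `[u, v]) n t)%R.
apply/eqP; rewrite -subr_eq0; apply/eqP; apply: (@cint_eq0_small a b _ (m x y)).
  by apply: Rintegral_ge0 => t _; rewrite addr_ge0 ?nc_ge0.
move=> e e0.
pose P u v := x <= u -> u <= v -> v <= y ->
  nc (G v * H v - G u * H u - cint `[u, v] k) <= e * m u v.
suff : P x y by move=> /(_ (lexx _) xy (lexx _)).
apply: bisection1 => //.
  move=> u v uv P1 P2 xu _ vy; set w := (u + v) / 2 in P1 P2.
  have uw : u <= w by rewrite /w; lra.
  have wv : w <= v by rewrite /w; lra.
  rewrite /m (Rint_split uw wv); last by apply: integrableS inn => //; apply: sub; lra.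
  rewrite (cint_split uw wv); last by apply: cintegrableS ik => //; apply: sub; lra.
  have -> : G v * H v - G u * H u - (cint `[u, w] k + cint `[w, v] k) =
    (G w * H w - G u * H u - cint `[u, w] k) + (G v * H v - G w * H w - cint `[w, v] k) by ring.
  by rewrite mulrDr (le_trans (ncD _ _))// lerD// ?P1 ?P2//; lra.
move=> p /andP[xp py]; have pab : a <= p <= b by apply/andP; lra.
have e2 : 0 < e / 2 by rewrite divr_gt0.
have [d1 d10 hd1] := cG p pab _ e2; have [d2 d20 hd2] := cH p pab _ e2.
exists (Num.min d1 d2 / 2); first by rewrite divr_gt0// lt_min d10.
move=> u v /andP[xu up] /andP[pv vy] uvd _ uv _.
have uvd1 : v - u < d1.
  have : Num.min d1 d2 <= d1 by rewrite ge_min lexx.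
  by move: uvd => /[swap] ?; lra.
have uvd2 : v - u < d2.
  have : Num.min d1 d2 <= d2 by rewrite ge_min lexx orbT.
  by move: uvd => /[swap] ?; lra.
have au : a <= u by lra.
have vb : v <= b by lra.
have S := sub u v au vb.
have iu : cintegrable `[u, v] g by exact: cintegrableS ig.
have jh : cintegrable `[u, v] h by exact: cintegrableS ih.
have -> : G v * H v - G u * H u = H v * cint `[u, v] g + G u * cint `[u, v] h.
  by rewrite -hG// -hH//; ring.
rewrite -!cintZ// -cintD//; [|exact: cintegrableZ..].
rewrite -cintB//; [|by apply: cintegrableD => //; exact: cintegrableZ|exact: cintegrableS ik].
have ie : mu.-integrable `[u, v] (EFin \o (fun t => e * n t)).
  by apply: integrableZR => //; apply: integrableS inn.
have -> : e * m u v = (\int[mu]_(t in `[u, v]) (e * n t))%R.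
  by rewrite RintegralZl//; apply: integrableS inn.
apply: cint_norm_le => //.
  by apply: cintegrableB => //; [apply: cintegrableD => //; exact: cintegrableZ|exact: cintegrableS ik].
move=> t /=; rewrite in_itv /= => /andP[ut tv].
have -> : H v * g t + G u * h t - k t = (H v - H t) * g t + (G u - G t) * h t by rewrite /k; ring.
have osc (F : R -> C) d : (forall y, a <= y <= b -> `|y - p| < d -> nc (F y - F p) <= e / 2) ->
   v - u < d -> forall s t, u <= s <= v -> u <= t <= v -> nc (F s - F t) <= e.
  move=> hF uvd' s t' hs ht; have -> : F s - F t' = (F s - F p) - (F t' - F p) by ring.
  rewrite (le_trans (ncDB _ _))// (splitr e) lerD// hF//; try (by apply/andP; lra); by rewrite ltr_norml; lra.
rewrite (le_trans (ncD _ _))// !ncM mulrDr lerD// ler_wpM2r ?nc_ge0//.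
  by apply: (osc H d2); rewrite ?ut ?tv ?uv ?lexx.
by apply: (osc G d1); rewrite ?ut ?tv ?uv ?lexx.
Qed.

Lemma AC_R a b (h k : R -> R) : {within `[a, b], continuous k} ->
  (forall x, is_derive x 1 h (k x)) -> AC a b (fun x => (k x)%:C) (fun x => (h x)%:C).
Proof.
move=> ck dh; split; first exact/ccont_on_integrable/ccont_on_R.
move=> x y ax; rewrite le_eqVlt => /predU1P[->|xy] yb; first by rewrite subrr cint_pt.
have dh' z : derivable h z 1 by case: (dh z).
have e := @continuous_FTC2 _ k h x y xy.
have ch : continuous h by move=> z; apply: differentiable_continuous; apply/derivable1_diffP.
apply: eqC.
  rewrite ReB Re_cint /= /Rintegral e //.
  - apply/within_epsP => z zxy eps eps0.
    have zab : a <= z <= b by apply/andP; move: zxy => /andP[]; lra.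
    move/within_epsP: ck => /(_ z zab _ eps0)[d d0 hd].
    by exists d => // w wxy wz; apply: hd => //; apply/andP; move: wxy => /andP[]; lra.
  - split => //; first exact/cvg_at_right_filter/ch.
    exact/cvg_at_left_filter/ch.
  - by move=> z _; rewrite derive1E; apply: derive_val.
by rewrite ImB Im_cint /= subrr /Rintegral integral0.
Qed.

End AbsContinuity.

(** * Geometrically convergent series and the complex exponential *)

Section GeometricSeries.
Variable R : realType.
Local Notation C := R[i].
Local Notation mu := (@lebesgue_measure R).
Implicit Types (f g : nat -> C) (s : C) (K L : R).

(** [s] is the sum of [f], with a remainder that halves at each step. One constant
    bounds the sum and all the remainders. *)
Definition cseries f s K := forall n, nc (s - \sum_(i < n) f i) <= K / 2 ^+ n.
Definition csum f : C := xget 0 [set s | exists K, cseries f s K].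

Lemma cseries_uniq f s (t : C) K L : cseries f s K -> cseries f t L -> s = t.
Proof.
move=> hs ht; apply: nc_eqP => e e0.
have e2 : 0 < e / 2 by rewrite divr_gt0.
have K0 : 0 <= K by have := hs 0%N; rewrite expr0 divr1; apply: le_trans; exact: nc_ge0.
have L0 : 0 <= L by have := ht 0%N; rewrite expr0 divr1; apply: le_trans; exact: nc_ge0.
have [n1 h1] := pow2_small K e2; have [n2 h2] := pow2_small L e2.
pose n := maxn n1 n2.
have -> : s - t = (s - \sum_(i < n) f i) - (t - \sum_(i < n) f i) by ring.
rewrite (le_trans (ncDB _ _))// (splitr e) lerD//.
  by rewrite (le_trans (hs n))// (le_trans _ h1)// pow2_le ?leq_maxl.
by rewrite (le_trans (ht n))// (le_trans _ h2)// pow2_le ?leq_maxr.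
Qed.

Lemma csum_eq f s K : cseries f s K -> csum f = s.
Proof.
move=> hs; rewrite /csum; case: xgetP => [t _ [L ht]|/(_ s)[]]; last by exists K.
exact: cseries_uniq ht hs.
Qed.

(** Real and imaginary parts of the partial sums are Cauchy, and the remainder
    after [n] terms is bounded by the tail of the geometric series. *)
Lemma csumP f K : (forall n, nc (f n) <= K / 2 ^+ n) -> cseries f (csum f) (4 * K).
Proof.
move=> hf.
have H (u : nat -> R) : (forall n, `|u n| <= K / 2 ^+ n) ->
    exists s : R, forall n, `|s - \sum_(i < n) u i| <= 2 * K / 2 ^+ n.
  move=> hu.
  have [s hs] : exists s : R, forall n, \sum_(i < n) u i - 2 * K / 2 ^+ n <= s <= \sum_(i < n) u i + 2 * K / 2 ^+ n.
    have h n : 2 * K / 2 ^+ n.+1 = K / 2 ^+ n by rewrite exprS invfM; field; rewrite expf_neq0.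
    apply: nested_pt => n.
    - rewrite big_ord_recr /= h; have := hu n; rewrite ler_norml => /andP[+ _]; lra.
    - rewrite big_ord_recr /= h; have := hu n; rewrite ler_norml => /andP[_]; lra.
    - have := hu n; have := normr_ge0 (u n); lra.
  by exists s => n; rewrite ler_norml; have := hs n; lra.
have [p hp] := H _ (fun n => le_trans (nc_Re (f n)) (hf n)).
have [q hq] := H _ (fun n => le_trans (nc_Im (f n)) (hf n)).
have hs : cseries f (p +i* q) (4 * K).
  move=> n; rewrite (le_trans (nc_le _))// ReB ImB /=.
  have sR : cRe (\sum_(i < n) f i) = \sum_(i < n) cRe (f i).
    by elim/big_rec2: _ => // i x y _ <-; rewrite ReD.
  have sI : cIm (\sum_(i < n) f i) = \sum_(i < n) cIm (f i).
    by elim/big_rec2: _ => // i x y _ <-; rewrite ImD.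
  rewrite sR sI; have := hp n; have := hq n; lra.
by rewrite (csum_eq hs).
Qed.

Lemma cseries_le f s K : cseries f s K -> nc s <= K.
Proof. by move=> /(_ 0%N); rewrite big_ord0 subr0 expr0 divr1. Qed.

Lemma cseries_ge0 f s K : cseries f s K -> 0 <= K.
Proof. by move=> /cseries_le; apply: le_trans; exact: nc_ge0. Qed.

Lemma cseriesW f s K L : K <= L -> cseries f s K -> cseries f s L.
Proof. by move=> KL hs n; rewrite (le_trans (hs n))// ler_wpM2r// invr_ge0 exprn_ge0. Qed.

Lemma cseriesZ c f s K : cseries f s K -> cseries (fun n => c * f n) (c * s) (nc c * K).
Proof. by move=> hs n; rewrite -mulr_sumr -mulrBr ncM -mulrA; apply: ler_wpM2l; [exact: nc_ge0|exact: hs]. Qed.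

Lemma cseriesD f g s (t : C) K L : cseries f s K -> cseries g t L -> cseries (fun n => f n + g n) (s + t) (K + L).
Proof.
move=> hs ht n; rewrite big_split /= opprD addrACA mulrDl.
by rewrite (le_trans (ncD _ _))//; apply: lerD; [exact: hs|exact: ht].
Qed.

Lemma eq_cseries f g s K : f =1 g -> cseries f s K -> cseries g s K.
Proof. by move=> /funext <-. Qed.

Lemma cseriesS f s K : cseries f s K -> cseries (fun n => f n.+1) (s - f 0%N) (K / 2).
Proof.
move=> hs n; have := hs n.+1; rewrite big_ord_recl /= exprS invfM opprD addrA mulrA.
by [].
Qed.

Lemma geo_sum_le n : \sum_(i < n) (1 / 2 ^+ i : R) <= 2.
Proof.
suff -> : \sum_(i < n) (1 / 2 ^+ i : R) = 2 - 2 / 2 ^+ n by rewrite gerBl divr_ge0// exprn_ge0.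
elim: n => [|n IH]; first by rewrite big_ord0 expr0 divr1 subrr.
by rewrite big_ord_recr /= IH exprS; field; rewrite expf_neq0.
Qed.

Lemma pow4 n : (4 : R) ^+ n = 2 ^+ n * 2 ^+ n.
Proof. by rewrite -exprMn; congr (_ ^+ _); ring. Qed.

(** The error of the truncated product is a sum of tails of [g] weighted by the
    terms of [f]; ratio one quarter leaves room for the geometric weights. *)
Lemma cauchy_product f g K L : 0 <= K -> 0 <= L ->
  (forall n, nc (f n) <= K / 4 ^+ n) -> (forall n, nc (g n) <= L / 4 ^+ n) ->
  exists M, cseries (fun n => \sum_(j < n.+1) f j * g (n - j)%N) (csum f * csum g) M.
Proof.
move=> K0 L0 hf hg.
have h42 (T : R) n : 0 <= T -> T / 4 ^+ n <= T / 2 ^+ n.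
  move=> T0; rewrite ler_wpM2l// lef_pV2 ?posrE ?exprn_gt0//.
  rewrite pow4 ler_peMl ?exprn_ge0// exprn_ege1//; lra.
have hf2 n : nc (f n) <= K / 2 ^+ n by rewrite (le_trans (hf n))// h42.
have hg2 n : nc (g n) <= L / 2 ^+ n by rewrite (le_trans (hg n))// h42.
have sf := csumP hf2; have sg := csumP hg2.
exists (4 * K * (4 * L) + 8 * K * L) => n.
have -> : \sum_(i < n) \sum_(j < i.+1) f j * g (i - j)%N = \sum_(j < n) f j * \sum_(k < n - j) g k.
  elim: n => [|n IH]; first by rewrite !big_ord0.
  rewrite big_ord_recr /= IH [RHS]big_ord_recr /= subSnn big_ord_recr /= addrA.
  rewrite -big_split /=; congr (_ + _); last by rewrite subnn big_ord_recr big_ord0 /= add0r.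
  apply: eq_bigr => j _; rewrite subSn; last by rewrite ltnW.
  by rewrite big_ord_recr /= mulrDr.
have -> : csum f * csum g - \sum_(j < n) f j * \sum_(k < n - j) g k =
   (csum f - \sum_(j < n) f j) * csum g + \sum_(j < n) f j * (csum g - \sum_(k < n - j) g k).
  rewrite mulrBl mulr_suml -addrA; congr (_ + _); rewrite -sumrN -sumrN -big_split /=.
  by apply: eq_bigr => j _; ring.
rewrite (le_trans (ncD _ _))// [X in _ <= X]mulrDl lerD//.
  rewrite ncM [4 * K * (4 * L)]mulrC -mulrA [X in _ <= X]mulrC.
  by apply: ler_pM; rewrite ?nc_ge0//; exact: cseries_le sg.
rewrite (le_trans (nc_sum _ _ _))//.
apply: (@le_trans _ _ (\sum_(j < n) (4 * K * L / 2 ^+ n) * (1 / 2 ^+ j))).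
  apply: ler_sum => j _; rewrite ncM.
  have -> : 4 * K * L / 2 ^+ n * (1 / 2 ^+ j) = (K / 4 ^+ j) * (4 * L / 2 ^+ (n - j)).
    have {1}-> : n = (n - j + j)%N by rewrite subnK// ltnW.
    by rewrite exprD pow4; field; rewrite !expf_neq0.
  by apply: ler_pM; rewrite ?nc_ge0.
rewrite -mulr_sumr.
have -> : 8 * K * L / 2 ^+ n = 4 * K * L / 2 ^+ n * 2 by field; rewrite expf_neq0.
by apply: ler_wpM2l; [apply: divr_ge0; [rewrite !mulr_ge0|exact: exprn_ge0]|exact: geo_sum_le].
Qed.

Lemma ccont_on_sum a b (g : nat -> R -> C) (s : R -> C) K :
  (forall n, ccont_on a b (g n)) -> (forall x, a <= x <= b -> cseries (fun n => g n x) (s x) K) ->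
  ccont_on a b s.
Proof.
move=> cg hs x xab e e0.
have e3 : 0 < e / 3 by rewrite divr_gt0.
have [n hn] := pow2_small K e3.
have cS : ccont_on a b (fun x => \sum_(i < n) g i x).
  elim: (n) => [|k IH].
    have -> : (fun x => \sum_(i < 0) g i x) = fun=> 0 by apply/funext => y; rewrite big_ord0.
    exact: ccont_cst.
  have -> : (fun x => \sum_(i < k.+1) g i x) = fun x => \sum_(i < k) g i x + g k x.
    by apply/funext => y; rewrite big_ord_recr.
  exact: ccont_onD.
have [d d0 hd] := cS x xab _ e3; exists d => // y yab yx.
have -> : s y - s x = (s y - \sum_(i < n) g i y) + (\sum_(i < n) g i y - \sum_(i < n) g i x)
   - (s x - \sum_(i < n) g i x) by ring.
rewrite (le_trans (ncDB _ _))//; apply: (le_trans (lerD (ncD _ _) (lexx _))).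
have := hd y yab yx; have := le_trans (hs x xab n) hn; have := le_trans (hs y yab n) hn.
lra.
Qed.

Lemma AC_fsum a b (g G : nat -> R -> C) n : (forall n, AC a b (g n) (G n)) ->
  AC a b (fun x => \sum_(i < n) g i x) (fun x => \sum_(i < n) G i x).
Proof.
move=> h; elim: n => [|n IH].
  by apply: eq_AC (AC_cst a b 0) => x _; rewrite big_ord0.
by apply: eq_AC (AC_D IH (h n)) => x _; rewrite big_ord_recr.
Qed.

(** The remainders are uniform in [x], so their integrals tend to zero with them. *)
Lemma AC_sum a b (g G : nat -> R -> C) (s S : R -> C) K : a <= b ->
  (forall n, AC a b (g n) (G n)) -> (forall n, ccont_on a b (g n)) ->
  (forall x, a <= x <= b -> cseries (fun n => g n x) (s x) K) ->
  (forall x, a <= x <= b -> cseries (fun n => G n x) (S x) K) ->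
  AC a b s S.
Proof.
move=> ab hgG cg hs hS; have is_ : cintegrable `[a, b] s by apply: ccont_on_integrable; exact: ccont_on_sum hs.
split => // x y ax xy yb.
have sub : `[x, y] `<=` `[a, b] by apply: subset_itvScc; rewrite bnd_simp.
have xab : a <= x <= b by apply/andP; lra.
have yab : a <= y <= b by apply/andP; lra.
have K0 := cseries_ge0 (hS x xab).
apply: nc_eqP => e e0; pose T : R := K * (2 + (y - x)).
have [n hn] := pow2_small T e0.
have [ig hG] := AC_fsum n hgG.
have -> : S y - S x - cint `[x, y] s = (S y - \sum_(i < n) G i y) - (S x - \sum_(i < n) G i x) -
   (cint `[x, y] s - cint `[x, y] (fun t => \sum_(i < n) g i t)).
  by rewrite -(hG x y)//; ring.
rewrite (le_trans _ hn)// (le_trans (ncDB _ _))// /T.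
have -> : K * (2 + (y - x)) / 2 ^+ n = (K / 2 ^+ n + K / 2 ^+ n) + K / 2 ^+ n * (y - x) by field; rewrite expf_neq0.
apply: lerD; first by rewrite (le_trans (ncDB _ _))// lerD ?hS.
rewrite -cintB//; [|exact: cintegrableS is_|exact: cintegrableS ig].
apply: cint_bound => //; first by apply: cintegrableB => //; [exact: cintegrableS is_|exact: cintegrableS ig].
by move=> t txy; apply: hs; apply/andP; move: txy => /andP[]; lra.
Qed.

End GeometricSeries.

Section ComplexExponential.
Variable R : realType.
Local Notation C := R[i].
Implicit Types (z w c : C) (a b x : R).

Definition cexp z : C := (expR (cRe z))%:C * ((cos (cIm z))%:C + 'i * (sin (cIm z))%:C).

Lemma cexpE z : cexp z = (expR (cRe z) * cos (cIm z)) +i* (expR (cRe z) * sin (cIm z)).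
Proof. by rewrite /cexp; simpc. Qed.

Lemma cexpD z w : cexp (z + w) = cexp z * cexp w.
Proof.
by rewrite !cexpE ReD ImD expRD cosD sinD; apply: eqC => /=; ring.
Qed.

Lemma nc_cexp z : nc (cexp z) = expR (cRe z).
Proof.
rewrite ncE cexpE /= !exprMn -mulrDr cos2Dsin2 mulr1 sqrtr_sqr ger0_norm// expR_ge0.
Qed.

Lemma cexp_neq0 z : cexp z != 0.
Proof. by apply: nc_neq0; rewrite nc_cexp expR_gt0. Qed.

Lemma cexp0 : cexp 0 = 1.
Proof. by rewrite cexpE /= expR0 cos0 sin0 mulr1 mulr0. Qed.

Lemma cexpN z : cexp (- z) = (cexp z)^-1.
Proof.
apply: (mulIf (cexp_neq0 z)); rewrite mulVf ?cexp_neq0// -cexpD addNr; exact: cexp0.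
Qed.

Lemma cexp_real x : cexp x%:C = (expR x)%:C.
Proof. by rewrite cexpE /= cos0 sin0 mulr1 mulr0. Qed.

Lemma cexpMn z n : cexp (n%:R * z) = cexp z ^+ n.
Proof.
elim: n => [|n IH]; first by rewrite mul0r cexp0.
by rewrite exprS -IH -cexpD; congr cexp; rewrite -natr1; ring.
Qed.

Lemma AC_cexp c a b : AC a b (fun x => c * cexp (c * x%:C)) (fun x => cexp (c * x%:C)).
Proof.
pose p := cRe c; pose q := cIm c.
pose u x := expR (p * x) * cos (q * x); pose v x := expR (p * x) * sin (q * x).
have duv x : is_derive x 1 u (p * u x - q * v x) /\ is_derive x 1 v (p * v x + q * u x).
  have dp : is_derive x 1 (fun y : R => p * y) p.
    by apply: is_derive_eq; rewrite /GRing.scale /= mulr1.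
  have dq : is_derive x 1 (fun y : R => q * y) q.
    by apply: is_derive_eq; rewrite /GRing.scale /= mulr1.
  have de : is_derive x 1 (fun y : R => expR (p * y)) (expR (p * x) * p).
    by have := @is_derive1_comp _ expR (fun y : R => p * y) x _ _ (is_derive_expR _) dp.
  have dc : is_derive x 1 (fun y : R => cos (q * y)) (- sin (q * x) * q).
    by have := @is_derive1_comp _ cos (fun y : R => q * y) x _ _ (is_derive_cos _) dq.
  have ds : is_derive x 1 (fun y : R => sin (q * y)) (cos (q * x) * q).
    by have := @is_derive1_comp _ sin (fun y : R => q * y) x _ _ (is_derive_sin _) dq.
  split.
    apply: (is_derive_eq (is_deriveM de dc)).
    by rewrite /GRing.scale /u /v /=; ring.
  apply: (is_derive_eq (is_deriveM de ds)).
  by rewrite /GRing.scale /u /v /=; ring.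
have cu : continuous u.
  by move=> x; apply: differentiable_continuous; apply/derivable1_diffP; case: (duv x) => -[].
have cv : continuous v.
  by move=> x; apply: differentiable_continuous; apply/derivable1_diffP; case: (duv x) => _ [].
have cdu : {within `[a, b], continuous (fun x => p * u x - q * v x)}.
  apply: continuous_subspaceT => x.
  by apply: cvgB; apply: cvgM; (try exact: cvg_cst); [exact: cu|exact: cv].
have cdv : {within `[a, b], continuous (fun x => p * v x + q * u x)}.
  apply: continuous_subspaceT => x.
  by apply: cvgD; apply: cvgM; (try exact: cvg_cst); [exact: cv|exact: cu].
have A1 := AC_R cdu (fun x => (duv x).1).
have A2 := AC_R cdv (fun x => (duv x).2).
have e x : cexp (c * x%:C) = (u x)%:C + 'i * (v x)%:C.
  by apply: eqC; rewrite cexpE /= ReM ImM /= !mulr0 subr0 add0r /u /v -/p -/q ?[x * _]mulrC; simpc.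
apply: eq_AC (AC_D A1 (AC_Z 'i A2)) => x _; rewrite e//.
by rewrite (complexRI c) -/p -/q; apply: eqC; simpc => /=; ring.
Qed.

End ComplexExponential.

(* Unification would otherwise unfold these functions down to limits of series. *)
#[global] Opaque cexp expR cos sin ln pi.

(** * Cauchy's formula and Taylor expansion *)

Section CauchyTaylor.
Variable R : realType.
Local Notation C := R[i].
Implicit Types (F : C -> C) (w : C) (rho : R).

Definition circle rho (x : R) : C := rho%:C * cexp ('i * x%:C).

Lemma circle_nc rho x : 0 <= rho -> nc (circle rho x) = rho.
Proof. by move=> r0; rewrite /circle ncM nc_cexp ncR ger0_norm// ReM /= !mul0r mul1r subr0 expR0 mulr1. Qed.

Lemma circle_AC rho a b : AC a b (fun x => 'i * circle rho x) (circle rho).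
Proof.
move: (AC_Z rho%:C (AC_cexp (@Complex R 0 1) a b)); congr AC; apply/funext => x.
by rewrite /circle mulrCA.
Qed.

Lemma circle_cont rho : ccont (circle rho).
Proof. by apply: AC_ccont => a b; exact: circle_AC. Qed.

Lemma cexp_2pi : cexp ('i * (2 * pi)%:C) = 1 :> C.
Proof.
rewrite cexpE ReM ImM /= !mul0r !mul1r subr0 add0r expR0 !mul1r mulr_natl.
by rewrite cos2pi sin2pi.
Qed.

Lemma circle_per rho : circle rho (2 * pi) = circle rho 0.
Proof. by rewrite /circle cexp_2pi mulr0 cexp0. Qed.

Lemma circle_lip rho x y : 0 <= rho -> nc (circle rho y - circle rho x) <= rho * `|y - x|.
Proof.
move=> r0; wlog xy : x y / x <= y => [H|].
  by have [/H//|/ltW/H] := leP x y; rewrite ncB distrC.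
have [i e] := circle_AC rho x y; rewrite e// ger0_norm ?subr_ge0//.
by apply: cint_bound => // t _; rewrite ncM nci mul1r circle_nc.
Qed.

(** Mean value inequality on the half line where the derivative is at most 1. *)
Lemma expR_lip (x y : R) : x <= 0 -> y <= 0 -> `|expR y - expR x| <= `|y - x|.
Proof.
wlog xy : x y / x <= y => [H x0 y0|x0 y0].
  have [xy|/ltW yx] := leP x y; first exact: H.
  by rewrite distrC (distrC y); exact: H.
rewrite !ger0_norm ?subr_ge0 ?ler_expR//.
have -> : expR x = expR y * expR (x - y) by rewrite -expRD; congr expR; ring.
have h1 := expR_ge1Dx (x - y).
have h2 : expR y <= 1 by rewrite -expR0 ler_expR.
have h3 : 0 <= 1 - expR (x - y) by rewrite subr_ge0 -expR0 ler_expR; lra.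
have -> : expR y - expR y * expR (x - y) = expR y * (1 - expR (x - y)) by ring.
rewrite (le_trans (ler_wpM2r h3 h2))//; lra.
Qed.

Lemma sqr_sum_le (h l : R) : (h + l) * (h + l) <= 2 * (h ^+ 2 + l ^+ 2).
Proof. by have := sqr_ge0 (h - l); rewrite !expr2; lra. Qed.

Section Formula.
Variables (F : C -> C) (w : C) (rho rho' : R).
Hypotheses (rho0 : 0 < rho) (rr : rho < rho') (wr : nc w < rho).
Hypothesis dF : forall z, nc z < rho' -> cdiffable F z.

Let z := circle rho.
Let k (x : R) : C := 'i * (z x / (z x - w)).
Let kap := rho / (rho - nc w).
(* The cone contracting the circle onto [w], in logarithmic radius. *)
Let Phi (s x : R) : C := w + (expR s)%:C * (z x - w).

Let nz x : nc (z x) = rho. Proof. by rewrite /z circle_nc ?ltW. Qed.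

Let Phi0 x : Phi 0 x = z x.
Proof. by rewrite /Phi expR0 rmorph1 mul1r subrKC. Qed.

Let zw x : z x - w != 0.
Proof.
apply: nc_neq0; apply: lt_le_trans (nc_dist _ _).
by rewrite nz subr_gt0.
Qed.

Let kap0 : 0 < kap. Proof. by rewrite divr_gt0// subr_gt0. Qed.
Let nk x : nc (k x) <= kap.
Proof.
rewrite /k ncM nci mul1r ncM nz ncV /kap ler_wpM2l ?(ltW rho0)//.
rewrite lef_pV2 ?posrE ?subr_gt0// ?nc_gt0//.
by apply: le_trans (nc_dist _ _); rewrite nz.
Qed.

Let nPhi s x : s <= 0 -> nc (Phi s x) < rho'.
Proof.
move=> s0; apply: le_lt_trans rr.
have e1 : expR s <= 1 by rewrite -expR0 ler_expR.
have e0 := expR_ge0 s.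
have -> : Phi s x = (1 - expR s)%:C * w + (expR s)%:C * z x by rewrite /Phi rmorphB rmorph1; ring.
rewrite (le_trans (ncD _ _))// ncM [nc (_ * z x)]ncM nz !ncR !ger0_norm ?subr_ge0//.
have := ler_wpM2l (_ : 0 <= 1 - expR s) (ltW wr); rewrite subr_ge0 => /(_ e1); lra.
Qed.

Let ck : ccont k.
Proof.
apply: ccontZ; apply: ccontM; first exact: circle_cont.
move=> a b; apply: (@ccont_on_comp _ _ _ (fun u => u^-1) (fun x => z x - w)).
  by move=> x _; apply: cdiffableV => //; exact: cdiffable_id.
by apply: ccont_onB; [exact: circle_cont|exact: ccont_cst].
Qed.

Let cPhi_x s : ccont (Phi s).
Proof.
apply: ccontD; first exact: ccont_cst.
by apply: ccontZ; apply: ccontB; [exact: circle_cont|exact: ccont_cst].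
Qed.

Let cPhi_s x : ccont (fun s => Phi s x).
Proof.
apply: ccontD; first exact: ccont_cst.
by apply: ccontM; [apply: ccont_R; exact: continuous_expR|exact: ccont_cst].
Qed.

Let A (G : C -> C) (s x0 x1 : R) := cint `[x0, x1] (fun x => G (Phi s x) * k x).
Let B (G : C -> C) (x s0 s1 : R) := cint `[s0, s1] (fun s => G (Phi s x)).
Let J G s0 s1 x0 x1 := A G s1 x0 x1 - A G s0 x0 x1 - (B G x1 s0 s1 - B G x0 s0 s1).

Let good (G : C -> C) := forall u, nc u < rho' -> cdiffable G u.

Let iA G s x0 x1 : good G -> s <= 0 -> cintegrable `[x0, x1] (fun x => G (Phi s x) * k x).
Proof.
move=> gG s0; apply: ccont_on_integrable; apply: ccont_onM; last exact: ck.
by apply: ccont_on_comp; [move=> x _; apply: gG; exact: nPhi|exact: cPhi_x].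
Qed.

Let iB G x s0 s1 : good G -> s1 <= 0 -> cintegrable `[s0, s1] (fun s => G (Phi s x)).
Proof.
move=> gG s1_0; apply: ccont_on_integrable.
apply: (@ccont_on_comp _ _ _ G (fun s => Phi s x)); last exact: cPhi_s.
by move=> s /andP[_ h]; apply: gG; apply: nPhi; exact: le_trans h _.
Qed.

Let JD G H s0 s1 x0 x1 : good G -> good H -> s0 <= s1 -> s1 <= 0 ->
  J (fun u => G u + H u) s0 s1 x0 x1 = J G s0 s1 x0 x1 + J H s0 s1 x0 x1.
Proof.
move=> gG gH s01 s10; have s00 : s0 <= 0 by exact: le_trans s01 s10.
have AD s : s <= 0 -> A (fun u => G u + H u) s x0 x1 = A G s x0 x1 + A H s x0 x1.
  move=> s_0; rewrite /A -cintD//; [|exact: iA..].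
  by apply: eq_cint => x _; ring.
have BD x : B (fun u => G u + H u) x s0 s1 = B G x s0 s1 + B H x s0 s1.
  by rewrite /B -cintD//; exact: iB.
rewrite /J (AD _ s10) (AD _ s00) !BD.
move: (A G s1 x0 x1) (A H s1 x0 x1) (A G s0 x0 x1) (A H s0 x0 x1) => a1 a2 a3 a4.
by move: (B G x1 s0 s1) (B H x1 s0 s1) (B G x0 s0 s1) (B H x0 s0 s1) => b1 b2 b3 b4; ring.
Qed.

(** The form has an exact primitive on affine functions. *)
Let Jaff c0 c1 s0 s1 x0 x1 : s0 <= s1 -> s1 <= 0 -> x0 <= x1 ->
  J (fun u => c0 + c1 * (u - w)) s0 s1 x0 x1 = 0.
Proof.
move=> s01 s10 x01.
have ik := ccont_on_integrable (@ck x0 x1).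
have AE s : A (fun u => c0 + c1 * (u - w)) s x0 x1 =
    c0 * cint `[x0, x1] k + c1 * (expR s)%:C * (z x1 - z x0).
  have [iz ez] := circle_AC rho x0 x1; rewrite ez// -!cintZ// -cintD//; [|exact: cintegrableZ..].
  by apply: eq_cint => x _; rewrite /Phi /k -/z; field; exact: zw.
have BE x : B (fun u => c0 + c1 * (u - w)) x s0 s1 =
    c0 * (s1 - s0)%:C + c1 * (z x - w) * ((expR s1)%:C - (expR s0)%:C).
  have [i1 e1] := AC_cexp 1 s0 s1.
  have <- := cexp_real s1; have <- := cexp_real s0.
  rewrite -[in cexp s1%:C](mul1r s1%:C) -[in cexp s0%:C](mul1r s0%:C) e1//.
  have -> : (s1 - s0)%:C = cint `[s0, s1] (fun=> 1) :> C.
    by apply: eqC; rewrite ?Re_cint ?Im_cint Rintegral_cst_itv//= ?mul1r ?mul0r.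
  have ic := ccont_on_integrable (@ccont_cst R 1 s0 s1).
  rewrite -!cintZ// -cintD//; [|exact: cintegrableZ..].
  by apply: eq_cint => s _; rewrite /Phi !mul1r cexp_real; ring.
rewrite /J !AE !BE; move: (cint _ k) => K.
by rewrite rmorphB /=; move: (z x1) (z x0) ((expR s1)%:C) ((expR s0)%:C) => *; ring.
Qed.

(** Goursat's argument on the rectangle of parameters [(s, x)]. The circulation
    [J] is additive under quartering and annihilates affine functions, while
    near a point the rest of [F] is small compared with the distance; hence [J]
    is small compared with the squared sides of small rectangles, and then of
    all. *)
Let goursat s0 : s0 <= 0 -> J F s0 0 0 (2 * pi) = 0.
Proof.
move=> s00; have pi0 : 0 <= 2 * pi :> R by rewrite mulr_ge0// pi_ge0.
apply: (@cint_eq0_small _ 0 0 _ ((0 - s0) ^+ 2 + (2 * pi - 0) ^+ 2)).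
  by rewrite addr_ge0 ?sqr_ge0.
move=> e e0.
pose P s0 s1 x0 x1 := s1 <= 0 -> nc (J F s0 s1 x0 x1) <= e * ((s1 - s0) ^+ 2 + (x1 - x0) ^+ 2).
suff : P s0 0 0 (2 * pi) by apply.
apply: bisection2 => //.
  move=> a b c d ab cd P1 P2 P3 P4 b0; pose m := (a + b) / 2; pose n := (c + d) / 2.
  have am : a <= m by rewrite /m; lra.
  have mb : m <= b by rewrite /m; lra.
  have cn : c <= n by rewrite /n; lra.
  have nd : n <= d by rewrite /n; lra.
  have -> : J F a b c d = J F a m c n + J F m b c n + (J F a m n d + J F m b n d).
    have a0 : a <= 0 by exact: le_trans ab b0.
    have m0 : m <= 0 by exact: le_trans mb b0.
    have SA s : s <= 0 -> A F s c d = A F s c n + A F s n d.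
      by move=> s_0; apply: cint_split => //; exact: iA.
    have SB x : B F x a b = B F x a m + B F x m b.
      by apply: cint_split => //; exact: iB.
    rewrite /J (SA b)// (SA a)// !SB.
    move: (A F b c n) (A F b n d) (A F a c n) (A F a n d) (A F m c n) (A F m n d) => a1 a2 a3 a4 a5 a6.
    by move: (B F d a m) (B F d m b) (B F c a m) (B F c m b) (B F n a m) (B F n m b) => b1 b2 b3 b4 b5 b6; ring.
  have -> : e * ((b - a) ^+ 2 + (d - c) ^+ 2) = e * ((m - a) ^+ 2 + (n - c) ^+ 2) + e * ((b - m) ^+ 2 + (n - c) ^+ 2) +
     (e * ((m - a) ^+ 2 + (d - n) ^+ 2) + e * ((b - m) ^+ 2 + (d - n) ^+ 2)) by rewrite /m /n; field.
  rewrite (le_trans (ncD _ _))//; apply: lerD; rewrite (le_trans (ncD _ _))//; apply: lerD.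
  - by apply: P1; rewrite -/m; lra.
  - by apply: P2.
  - by apply: P3; rewrite -/m; lra.
  - by apply: P4.
move=> ss xs /andP[_ ss0] _.
set p := Phi ss xs; have [L hL] := dF (nPhi xs ss0).
pose D := 8 * rho * (kap + 1); have D0 : 0 < D by rewrite /D !mulr_gt0// addr_gt0.
have [d d0 hd] := hL (e / D) (divr_gt0 e0 D0).
exists (d / (8 * rho)); first by rewrite divr_gt0// mulr_gt0.
move=> a b c d' /andP[_ ass] /andP[ssb b0] /andP[_ cxs] /andP[xsd _] h1 h2 b0'.
have ab : a <= b by exact: le_trans ass ssb.
have cd : c <= d' by exact: le_trans cxs xsd.
pose r u := F u + (- (F p - (p - w) * L) + (- L) * (u - w)).
have gr : good r.
  move=> u ur; apply: cdiffableD; first exact: dF.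
  apply: cdiffableD; first exact: cdiffable_cst.
  apply: cdiffableM; first exact: cdiffable_cst.
  by apply: cdiffableB; [exact: cdiffable_id|exact: cdiffable_cst].
have rE u : r u = F u - F p - (u - p) * L by rewrite /r; ring.
have -> : J F a b c d' = J r a b c d'.
  rewrite /r JD//; first by rewrite Jaff// addr0.
  move=> u _; apply: cdiffableD; first exact: cdiffable_cst.
  apply: cdiffableM; first exact: cdiffable_cst.
  by apply: cdiffableB; [exact: cdiffable_id|exact: cdiffable_cst].
pose h := b - a; pose l := d' - c.
have h0 : 0 <= h by rewrite subr_ge0.
have l0 : 0 <= l by rewrite subr_ge0.
have dist s x : a <= s <= b -> c <= x <= d' -> nc (Phi s x - p) <= 2 * rho * (h + l).
  move=> /andP[as_ sb] /andP[cx xd'].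
  have -> : Phi s x - p = (expR s)%:C * (z x - z xs) + ((expR s) - (expR ss))%:C * (z xs - w).
    by rewrite /p /Phi rmorphB /=; ring.
  have s0' : s <= 0 by exact: le_trans sb _.
  rewrite (le_trans (ncD _ _))// !ncM !ncR.
  have q1 : `|expR s| <= 1 by rewrite ger0_norm ?expR_ge0// -expR0 ler_expR.
  have q2 := @circle_lip rho xs x (ltW rho0).
  have q3 := expR_lip ss0 s0'.
  have q4 : nc (z xs - w) <= 2 * rho.
    by rewrite (le_trans (ncDB _ _))// nz; move: wr; lra.
  have q5 : `|x - xs| <= l by rewrite ler_norml /l; lra.
  have q6 : `|s - ss| <= h by rewrite ler_norml /h; lra.
  have q7 : `|expR s| * nc (z x - z xs) <= 1 * (rho * l).
    by apply: ler_pM; rewrite ?nc_ge0// (le_trans q2)// ler_wpM2l// ltW.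
  have q8 : `|expR s - expR ss| * nc (z xs - w) <= h * (2 * rho).
    by apply: ler_pM; rewrite ?nc_ge0// (le_trans q3).
  have q9 : 0 <= rho * l by rewrite mulr_ge0// ltW.
  lra.
have rb s x : a <= s <= b -> c <= x <= d' -> nc (r (Phi s x)) <= e / D * (2 * rho * (h + l)).
  move=> hs hx; have hdist := dist s x hs hx.
  rewrite rE -{1}(subrKC p (Phi s x)).
  apply: (le_trans (hd _ _)); last by rewrite ler_wpM2l// divr_ge0// ltW.
  apply: (le_lt_trans hdist).
  have t1 : 2 * rho * (h + l) <= 2 * rho * (d / (8 * rho) + d / (8 * rho)).
    by apply: ler_wpM2l; [rewrite mulr_ge0// ltW|exact: lerD].
  apply: (le_lt_trans t1).
  have -> : 2 * rho * (d / (8 * rho) + d / (8 * rho)) = d / 2 by field; rewrite gt_eqF.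
  by rewrite ltr_pdivrMr// mulr_natr mulr2n ltrDl.
pose E := e / D * (2 * rho * (h + l)).
have E0 : 0 <= E.
  apply: mulr_ge0; first by rewrite divr_ge0// ltW.
  by apply: mulr_ge0; [rewrite mulr_ge0// ltW|exact: addr_ge0].
have bA s : a <= s <= b -> nc (A r s c d') <= E * kap * l.
  move=> hs; apply: cint_bound => //; first by apply: iA => //; move: hs => /andP[]; lra.
  by move=> x hx; rewrite ncM ler_pM ?nc_ge0 ?nk// rb.
have bB x : c <= x <= d' -> nc (B r x a b) <= E * h.
  by move=> hx; apply: cint_bound => //; [exact: iB|move=> s hs; exact: rb].
have b1 := bA b; have b2 := bA a; have b3 := bB c; have b4 := bB d'.
have -> : e * ((b - a) ^+ 2 + (d' - c) ^+ 2) = e / D * (2 * rho * (2 * (kap + 1) * (2 * (h ^+ 2 + l ^+ 2)))).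
  by rewrite /D /h /l; field; rewrite !gt_eqF// addr_gt0.
apply: (@le_trans _ _ (E * (2 * (kap + 1) * (h + l)))); last first.
  have sq : (h + l) * (h + l) <= 2 * (h ^+ 2 + l ^+ 2).
    exact: sqr_sum_le.
  have -> : E * (2 * (kap + 1) * (h + l)) = e / D * (2 * rho) * (2 * (kap + 1)) * ((h + l) * (h + l)).
    by rewrite /E; ring.
  have -> : e / D * (2 * rho * (2 * (kap + 1) * (2 * (h ^+ 2 + l ^+ 2)))) =
     e / D * (2 * rho) * (2 * (kap + 1)) * (2 * (h ^+ 2 + l ^+ 2)) by ring.
  apply: ler_wpM2l => //; apply: mulr_ge0; last by rewrite mulr_ge0// addr_ge0// ltW.
  by apply: mulr_ge0; [rewrite divr_ge0// ltW|rewrite mulr_ge0// ltW].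
have -> : E * (2 * (kap + 1) * (h + l)) = E * kap * l + E * kap * l + (E * h + E * h)
   + 2 * (E * l + E * (kap * h)) by ring.
have g0 : 0 <= 2 * (E * l + E * (kap * h)).
  apply: mulr_ge0 => //; apply: addr_ge0; apply: mulr_ge0 => //.
  by apply: mulr_ge0 => //; exact: ltW.
rewrite /J; apply: (le_trans (ncDB _ _)).
apply: (@le_trans _ _ (E * kap * l + E * kap * l + (E * h + E * h))); last by rewrite lerDl.
apply: lerD; rewrite (le_trans (ncDB _ _))// lerD//.
- by apply: b1; rewrite ab lexx.
- by apply: b2; rewrite ab lexx.
- by apply: b4; rewrite cd lexx.
- by apply: b3; rewrite cd lexx.
Qed.

(** By Goursat the weighted mean of [F] over the circle is unchanged while the
    circle contracts onto [w], where [F] is close to [F w]. The weight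
    is the logarithmic derivative of [Phi - w] along the circle. *)
Lemma cauchy_formula :
  cint `[0, 2 * pi] (fun x => F (z x) * (z x / (z x - w))) =
  F w * cint `[0, 2 * pi] (fun x => z x / (z x - w)).
Proof.
have pi0 : 0 <= 2 * pi :> R by rewrite mulr_ge0// pi_ge0.
have ik := ccont_on_integrable (@ck 0 (2 * pi)).
have gF : good F by exact: dF.
have AS s : s <= 0 -> A F 0 0 (2 * pi) = A F s 0 (2 * pi).
  move=> s0; have := goursat s0; rewrite /J.
  have -> : B F (2 * pi) s 0 = B F 0 s 0.
    by apply: eq_cint => t _; rewrite /Phi /z circle_per.
  by rewrite (subrr (B F 0 s 0)) subr0; exact: subr0_eq.
have Aw : A F 0 0 (2 * pi) = F w * cint `[0, 2 * pi] k.
  apply/eqP; rewrite -subr_eq0; apply/eqP.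
  apply: (@cint_eq0_small _ 0 0 _ (kap * (2 * pi - 0))); first by rewrite subr0 mulr_ge0// ltW.
  move=> e e0; have [d d0 hd] := cdiffable_cont (dF (lt_trans wr rr)) e0.
  pose s := Num.min 0 (ln (d / (4 * rho))).
  have s0 : s <= 0 by rewrite /s ge_min lexx.
  have es : expR s * (2 * rho) < d.
    have : expR s <= d / (4 * rho).
      rewrite -[leRHS]lnK ?posrE ?divr_gt0 ?mulr_gt0// ler_expR /s ge_min lexx orbT.
      by [].
    rewrite ler_pdivlMr ?mulr_gt0// => h; have := expR_gt0 s => h1.
    have h2 : 0 < expR s * rho by rewrite mulr_gt0.
    lra.
  rewrite (AS _ s0) /A -cintZ// -cintB//; [|exact: iA|exact: cintegrableZ].
  rewrite mulrA; apply: cint_bound => //.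
    by apply: cintegrableB => //; [exact: iA|exact: cintegrableZ].
  move=> x _; rewrite -mulrBl ncM; apply: ler_pM; rewrite ?nc_ge0//.
  apply: hd; rewrite /Phi addrAC subrr add0r ncM ncR ger0_norm ?expR_ge0//.
  apply: le_lt_trans es; rewrite ler_wpM2l ?expR_ge0//.
  by rewrite (le_trans (ncDB _ _))// nz; move: wr; lra.
have i0 : 'i != 0 :> C by apply: nc_neq0; rewrite nci.
have ck' : ccont (fun x => z x / (z x - w)).
  have -> : (fun x => z x / (z x - w)) = (fun x => - 'i * k x).
    apply/funext => x; rewrite /k mulrA mulNr -expr2 sqr_i.
    by rewrite opprK mul1r.
  exact: ccontZ.
apply: (mulfI i0); rewrite mulrCA -!cintZ//.
- move: Aw; rewrite /A /k; congr (_ = _).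
  by apply: eq_cint => x _; rewrite Phi0 mulrCA.
- by rewrite (cintZ (F w) _ ik).
- exact/ccont_on_integrable/ck'.
- apply: ccont_on_integrable; apply: ccont_onM; last exact: ck'.
  apply: ccont_on_comp; last exact: circle_cont.
  by move=> x _; apply: dF; rewrite nz.
Qed.

End Formula.

(** On the half disc the kernel of Cauchy's formula is a geometric series of ratio
    at most one half; the same expansion evaluates the integral of the kernel. *)
Lemma taylor F rho rho' M : 0 < rho -> rho < rho' -> (forall z, nc z < rho' -> cdiffable F z) ->
  (forall z, nc z = rho -> nc (F z) <= M) ->
  exists a : nat -> C, (forall n, nc (a n) <= M / rho ^+ n) /\
    forall w, nc w <= rho / 2 -> cseries (fun n => a n * w ^+ n) (F w) (2 * M).
Proof.
move=> rho0 rr dF hM; pose z := circle rho.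
have zn x : nc (z x) = rho by rewrite circle_nc ?ltW.
have z0 x : z x != 0 by apply: nc_neq0; rewrite zn.
have pi0 : 0 < 2 * pi :> R by rewrite mulr_gt0// pi_gt0.
have pi00 := ltW pi0.
have piC : (2 * pi)%:C != 0 :> C by apply: nc_neq0; rewrite ncR gtr0_norm.
have cz : ccont z := circle_cont rho.
have cFz : ccont (fun x => F (z x)).
  by move=> a b; apply: ccont_on_comp => // x _; apply: dF; rewrite zn.
have czV n : ccont (fun x => (z x ^+ n)^-1).
  move=> a b; apply: (@ccont_on_comp _ _ _ (fun u => (u ^+ n)^-1) z) => // x _.
  by apply: cdiffableV; [rewrite expf_neq0|apply: cdiffableX; exact: cdiffable_id].
have czw n (w : C) : ccont (fun x => \sum_(i < n) (w / z x) ^+ i).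
  elim: n => [|n IH].
    have -> : (fun x => \sum_(i < 0) (w / z x) ^+ i) = fun=> 0 by apply/funext => x; rewrite big_ord0.
    exact: ccont_cst.
  have -> : (fun x => \sum_(i < n.+1) (w / z x) ^+ i) = fun x => \sum_(i < n) (w / z x) ^+ i + w ^+ n * (z x ^+ n)^-1.
    by apply/funext => x; rewrite big_ord_recr /= expr_div_n.
  by apply: ccontD => //; exact: ccontZ.
pose I n := cint `[0, 2 * pi] (fun x => F (z x) * (z x ^+ n)^-1).
have M0 : 0 <= M by apply: (le_trans (nc_ge0 _)); exact: hM (zn 0).
exists (fun n => I n / (2 * pi)%:C); split => [n|w wr].
  rewrite ncM ncV ncR gtr0_norm// ler_pdivrMr//.
  have := @cint_bound _ 0 (2 * pi) (fun x => F (z x) * (z x ^+ n)^-1) (M / rho ^+ n) pi00.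
  rewrite subr0; apply; first by apply: ccont_on_integrable; apply: ccontM.
  by move=> x _; rewrite ncM ncV ncX zn ler_wpM2r ?hM ?zn// invr_ge0 exprn_ge0 ?ltW.
pose k x := z x / (z x - w).
have wr' : nc w < rho by apply: le_lt_trans wr _; rewrite ltr_pdivrMr// mulr_natr mulr2n ltrDl.
have zw x : rho / 2 <= nc (z x - w).
  by apply: le_trans (nc_dist _ _); rewrite zn; lra.
have zw0 x : z x - w != 0 by apply: nc_neq0; apply: lt_le_trans (zw x); rewrite divr_gt0.
have nk x : nc (k x) <= 2.
  rewrite /k ncM ncV zn ler_pdivrMr ?nc_gt0//.
  by have := zw x; lra.
have ck : ccont k.
  apply: ccontM => // a b; apply: (@ccont_on_comp _ _ _ (fun u => u^-1) (fun x => z x - w)).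
    by move=> x _; apply: cdiffableV => //; exact: cdiffable_id.
  by apply: ccont_onB => //; exact: ccont_cst.
have kS n x : nc (k x - \sum_(i < n) (w / z x) ^+ i) <= 2 / 2 ^+ n.
  have -> : k x - \sum_(i < n) (w / z x) ^+ i = k x * (w / z x) ^+ n.
    elim: n => [|n IH]; first by rewrite big_ord0 subr0 expr0 mulr1.
    rewrite big_ord_recr /= opprD addrA IH exprS; move: ((w / z x) ^+ n) (z0 x) (zw0 x) => q.
    by rewrite /k; move: (z x) => u u0 uw; field; rewrite u0 uw.
  rewrite ncM ncX ncM ncV zn -exprVn; apply: ler_pM; rewrite ?nc_ge0 ?exprn_ge0//.
    by rewrite divr_ge0 ?nc_ge0// ltW.
  rewrite lerXn2r ?nnegrE ?invr_ge0 ?divr_ge0 ?nc_ge0 ?(ltW rho0)//.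
  by rewrite ler_pdivrMr// mulrC.
have intG (G : R -> C) (MG : R) n : ccont G -> 0 <= MG -> (forall x, nc (G x) <= MG) ->
   nc (cint `[0, 2 * pi] (fun x => G x * k x) -
       \sum_(i < n) cint `[0, 2 * pi] (fun x => G x * (z x ^+ i)^-1) * w ^+ i) <= 2 * MG / 2 ^+ n * (2 * pi).
  move=> cG MG0 hG.
  have -> : \sum_(i < n) cint `[0, 2 * pi] (fun x => G x * (z x ^+ i)^-1) * w ^+ i =
     cint `[0, 2 * pi] (fun x => G x * \sum_(i < n) (w / z x) ^+ i).
    elim: n => [|n IH].
      by rewrite big_ord0 -[LHS](@cint0 R `[0, 2 * pi]); apply: eq_cint => x _; rewrite big_ord0 mulr0.
    rewrite big_ord_recr /= IH [_ * w ^+ n]mulrC -cintZ//; last first.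
      by apply: ccont_on_integrable; exact: ccontM.
    rewrite -cintD//; [|by apply: ccont_on_integrable; exact: ccontM|].
      by apply: eq_cint => x _; rewrite big_ord_recr /= expr_div_n; ring.
    by apply: cintegrableZ => //; apply: ccont_on_integrable; exact: ccontM.
  rewrite -cintB//; [|by apply: ccont_on_integrable; exact: ccontM..].
  have := @cint_bound _ 0 (2 * pi) (fun x => G x * k x - G x * \sum_(i < n) (w / z x) ^+ i) (2 * MG / 2 ^+ n) pi00.
  rewrite subr0; apply; first by apply: ccont_on_integrable; apply: ccont_onB; apply: ccontM.
  move=> x _; rewrite -mulrBr ncM.
  have -> : 2 * MG / 2 ^+ n = MG * (2 / 2 ^+ n) by ring.
  by apply: ler_pM; rewrite ?nc_ge0.
have k2pi : cint `[0, 2 * pi] k = (2 * pi)%:C.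
  apply: (@cseries_uniq _ (fun n => cint `[0, 2 * pi] (fun x => 1 * (z x ^+ n)^-1) * w ^+ n) _ _ (2 * 1 * (2 * pi)) (2 * pi)).
    move=> n; have := @intG (fun=> 1) 1 n (@ccont_cst _ 1) ler01.
    rewrite nc1 => /(_ (fun=> lexx _)).
    have -> : cint `[0, 2 * pi] (fun x => 1 * k x) = cint `[0, 2 * pi] k by apply: eq_cint => x _; rewrite mul1r.
    by rewrite mulrAC.
  move=> n.
  have h0 m : cint `[0, 2 * pi] (fun x => 1 * (z x ^+ m.+1)^-1) = 0.
    pose c : C := - m.+1%:R * 'i.
    have c0 : c != 0 by rewrite mulf_neq0 ?oppr_eq0 ?pnatr_eq0//; apply: nc_neq0; rewrite nci.
    have [i1 e1] := AC_cexp c 0 (2 * pi).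
    have -> : cint `[0, 2 * pi] (fun x => 1 * (z x ^+ m.+1)^-1) =
       ((rho%:C ^+ m.+1)^-1 / c) * cint `[0, 2 * pi] (fun x => c * cexp (c * x%:C)).
      rewrite -cintZ//; apply: eq_cint => x _.
      have -> : cexp (c * x%:C) = (cexp ('i * x%:C) ^+ m.+1)^-1.
        by rewrite -cexpMn -cexpN; congr cexp; rewrite /c; ring.
      rewrite /z /circle exprMn mul1r invfM mulrA divfK//.
    rewrite -e1// mulr0 cexp0.
    have -> : cexp (c * (2 * pi)%:C) = 1.
      have -> : c * (2 * pi)%:C = - (m.+1%:R * ('i * (2 * pi)%:C)) by rewrite /c; ring.
      by rewrite cexpN cexpMn cexp_2pi expr1n invr1.
    by rewrite subrr mulr0.
  case: n => [|n].
    by rewrite big_ord0 subr0 expr0 divr1 ncR gtr0_norm.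
  rewrite big_ord_recl big1 => [|i _]; last by rewrite h0 mul0r.
  have -> : cint `[0, 2 * pi] (fun x => 1 * (z x ^+ 0)^-1) = (2 * pi)%:C.
    have -> : (fun x => 1 * (z x ^+ 0)^-1) = (fun=> 1%:C) by apply/funext => x; rewrite expr0 invr1 mulr1.
    by apply: eqC; rewrite ?Re_cint ?Im_cint Rintegral_cst_itv//= subr0 ?mul1r ?mul0r.
  by rewrite expr0 mulr1 addr0 subrr nc0 divr_ge0 ?exprn_ge0.
have key := cauchy_formula rho0 rr wr' dF; rewrite -/z -/k k2pi in key.
move=> n.
have -> : F w - \sum_(i < n) I i / (2 * pi)%:C * w ^+ i =
   (cint `[0, 2 * pi] (fun x => F (z x) * k x) - \sum_(i < n) I i * w ^+ i) / (2 * pi)%:C.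
  rewrite key mulrBl mulfK//; congr (_ - _); rewrite mulr_suml; apply: eq_bigr => i _.
  by rewrite mulrAC.
rewrite ncM ncV ncR gtr0_norm// ler_pdivrMr//.
by apply: intG => // x; apply: hM.
Qed.

End CauchyTaylor.

(** * Holomorphy of sums and integrals *)

Section Holomorphy.
Variable R : realType.
Local Notation C := R[i].
Local Notation mu := (@lebesgue_measure R).
Implicit Types (F : C -> C) (z w u : C) (r : R).

Lemma cseries_bound (f : nat -> C) s (K L : R) : 0 <= K ->
  (forall n, nc (f n) <= K / 2 ^+ n) -> cseries f s L -> nc s <= 2 * K.
Proof.
move=> K0 hf hs; apply/ler_addgt0Pl => e e0.
have [n hn] := pow2_small L e0.
rewrite -(subrK (\sum_(i < n) f i) s) (le_trans (ncD _ _))// lerD//.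
  exact: le_trans (hs n) hn.
rewrite (le_trans (nc_sum _ _ _))//.
apply: (@le_trans _ _ (\sum_(i < n) K * (1 / 2 ^+ i))).
  by apply: ler_sum => i _; rewrite mul1r.
by rewrite -mulr_sumr mulrC ler_wpM2r// geo_sum_le.
Qed.

Lemma cseries_pow0 (a : nat -> C) s (K : R) : cseries (fun n => a n * 0 ^+ n) s K -> s = a 0%N.
Proof.
move=> hs; apply/eqP; rewrite -subr_eq0; apply/eqP; apply: nc_le0.
have hs' := cseriesS hs; rewrite /= expr0 mulr1 in hs'.
have := cseries_bound (lexx 0) _ hs'; rewrite mulr0; apply => n.
by rewrite exprS mul0r mulr0 nc0 mul0r.
Qed.

Lemma pow_shift2 (M q t : R) n : M / q ^+ n.+2 * t ^+ n.+2 = M * (t / q) ^+ 2 * (t / q) ^+ n.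
Proof.
by rewrite -[RHS]mulrA -exprD add2n expr_div_n; move: (t ^+ _) (q ^+ _)^-1 => a b; ring.
Qed.

(** The Taylor coefficients of order at least two are bounded by Cauchy's
    estimates on the disc of radius [r / 2]. *)
Lemma quad_estimate F z r (M : R) : 0 < r -> (forall w, nc (w - z) < r -> cdiffable F w) ->
  (forall w, nc (w - z) < r -> nc (F w) <= M) ->
  exists L, nc L <= 2 * M / r /\
    forall h, nc h <= r / 4 -> nc (F (z + h) - F z - h * L) <= 8 * M / r ^+ 2 * nc h ^+ 2.
Proof.
move=> r0 dF hM; have r2 : 0 < r / 2 by rewrite divr_gt0.
have r2r : r / 2 < r by rewrite ltr_pdivrMr// mulr_natr mulr2n ltrDl.
have M0 : 0 <= M by apply: (le_trans (nc_ge0 (F z))); apply: hM; rewrite subrr nc0.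
have [a [ha hs]] : exists a : nat -> C, (forall n, nc (a n) <= M / (r / 2) ^+ n) /\
    forall w, nc w <= r / 2 / 2 -> cseries (fun n => a n * w ^+ n) (F (z + w)) (2 * M).
  apply: (@taylor _ (fun w => F (z + w)) (r / 2) r) => //.
    by move=> w wr; apply: cdiffable_shift; apply: dF; rewrite addrAC subrr add0r.
  by move=> w wr; apply: hM; rewrite addrAC subrr add0r wr.
exists (a 1%N); split.
  have := ha 1%N; rewrite expr1; have -> : M / (r / 2) = 2 * M / r by field; rewrite gt_eqF.
  by [].
move=> h hr; have hr' : nc h <= r / 2 / 2 by move: hr; have -> : r / 2 / 2 = r / 4 by field.
have h1 := hs h hr'.
have h0 : nc (0 : C) <= r / 2 / 2 by rewrite nc0 !divr_ge0// ltW.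
have a0 := hs 0 h0; rewrite addr0 in a0; rewrite (cseries_pow0 a0).
have := cseriesS (cseriesS h1); rewrite /= expr0 expr1 mulr1 => h2.
rewrite [h * _]mulrC.
have -> : 8 * M / r ^+ 2 * nc h ^+ 2 = 2 * (M * (nc h / (r / 2)) ^+ 2) by field; rewrite gt_eqF.
apply: cseries_bound h2; first by rewrite mulr_ge0// sqr_ge0.
move=> n; rewrite ncM ncX.
apply: (@le_trans _ _ (M * (nc h / (r / 2)) ^+ 2 * (nc h / (r / 2)) ^+ n)).
  apply: (le_trans (ler_wpM2r _ (ha n.+2))); first by rewrite exprn_ge0// nc_ge0.
  rewrite le_eqVlt; apply/orP; left; apply/eqP.
  exact: pow_shift2.
rewrite -exprVn; apply: ler_wpM2l; first by rewrite mulr_ge0// sqr_ge0.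
rewrite lerXn2r ?nnegrE ?invr_ge0 ?divr_ge0 ?nc_ge0 ?(ltW r0)//.
by rewrite ler_pdivrMr// (le_trans hr')// mulrC.
Qed.

(** By [quad_estimate] the linearisations have errors that are quadratic with
    geometrically decreasing constants, so they can be summed. *)
Lemma hol_sum (f : nat -> C -> C) (s : C -> C) z r (K K' : R) : 0 < r ->
  (forall n w, nc (w - z) < r -> cdiffable (f n) w) ->
  (forall n w, nc (w - z) < r -> nc (f n w) <= K / 2 ^+ n) ->
  (forall w, nc (w - z) < r -> cseries (fun n => f n w) (s w) K') -> cdiffable s z.
Proof.
move=> r0 df hf hs.
have zr : nc (z - z) < r by rewrite subrr nc0.
have K0 : 0 <= K by have := hf 0%N z zr; rewrite expr0 divr1; apply: le_trans; exact: nc_ge0.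
have /choice[L hL] := fun n => quad_estimate r0 (df n) (hf n).
have sL : cseries L (csum L) (4 * (2 * K / r)).
  by apply: csumP => n; have := (hL n).1; congr (_ <= _); ring.
exists (csum L); apply: (@cdiff_quad _ _ _ _ (2 * (8 * K / r ^+ 2)) (r / 4)).
- by rewrite divr_gt0.
- by rewrite mulr_ge0// divr_ge0 ?mulr_ge0// ltW.
move=> h hr.
have zhr : nc (z + h - z) < r.
  by rewrite addrAC subrr add0r (lt_trans hr)// ltr_pdivrMr// ltr_pMr// ltr1n.
rewrite -mulrA; have T := cseriesD (cseriesD (hs _ zhr) (cseriesZ (-1) (hs z zr))) (cseriesZ (- h) sL).
rewrite mulN1r mulNr in T.
apply: cseries_bound T.
  by apply: mulr_ge0; [rewrite divr_ge0 ?mulr_ge0// ltW|rewrite exprn_ge0 ?nc_ge0].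
move=> n; have := (hL n).2 h (ltW hr); congr (nc _ <= _); first ring.
by ring.
Qed.

(** The derivative of the integrand is measurable as a limit of difference
    quotients along a sequence of real increments, and the uniform quadratic
    error of [quad_estimate] is integrated against [f]. *)
Lemma hol_int (D : set (measurableTypeR R)) (h : R -> C -> C) (f : R -> C) z r (M : R) :
  measurable D -> 0 < r -> cintegrable D f ->
  (forall x w, D x -> nc (w - z) < r -> cdiffable (h x) w) ->
  (forall x w, D x -> nc (w - z) < r -> nc (h x w) <= M) ->
  (forall w, nc (w - z) < r -> cmeas D (fun x => h x w)) ->
  cdiffable (fun w => cint D (fun x => h x w * f x)) z.
Proof.
move=> mD r0 intf dh hM mh.
have zr : nc (z - z) < r by rewrite subrr nc0.
wlog M0 : M hM / 0 <= M => [H|].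
  apply: (H (Num.max M 0)); last by rewrite le_max lexx orbT.
  by move=> x w Dx wr; rewrite le_max hM.
have /choice[L hL] : forall x, exists L, D x -> nc L <= 2 * M / r /\
    forall e, nc e <= r / 4 -> nc (h x (z + e) - h x z - e * L) <= 8 * M / r ^+ 2 * nc e ^+ 2.
  move=> x.
  have [Dx|nDx] := pselect (D x); last by exists 0.
  have [L hL] := quad_estimate r0 (fun w => dh x w Dx) (fun w => hM x w Dx).
  by exists L.
pose B := 8 * M / r ^+ 2; have B0 : 0 <= B by rewrite divr_ge0 ?mulr_ge0// ltW.
pose d n : R := r / 4 / 2 ^+ n.
have d0 n : 0 < d n by rewrite divr_gt0 ?divr_gt0// exprn_gt0.
have dr n : d n <= r / 4 by rewrite /d -[leRHS]divr1 -(expr0 2) pow2_le// divr_ge0// ltW.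
have dn n : nc ((d n)%:C : C) = d n by rewrite ncR gtr0_norm.
have dC n : (d n)%:C != 0 :> C by apply: nc_neq0; rewrite dn.
pose q n x := ((d n)%:C)^-1 * (h x (z + (d n)%:C) - h x z).
have qL n x : D x -> nc (q n x - L x) <= B * d n.
  move=> Dx; have [_ /(_ (d n)%:C)] := hL x Dx; rewrite dn => /(_ (dr n)) H.
  have -> : q n x - L x = ((d n)%:C)^-1 * (h x (z + (d n)%:C) - h x z - (d n)%:C * L x).
    by rewrite mulrBr mulKf.
  rewrite ncM ncV dn mulrC ler_pdivrMr//; apply: le_trans H _.
  by rewrite -/B expr2 mulrA.
have zdr n : nc (z + (d n)%:C - z) < r.
  by rewrite addrAC subrr add0r dn (le_lt_trans (dr n))// ltr_pdivrMr// ltr_pMr// ltr1n.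
have mq n : cmeas D (q n).
  by apply: cmeasM => //; apply: cmeasB => //; exact: mh.
have mL : cmeas D L.
  have cv (p : C -> R) x : (forall a b, `|p a - p b| <= nc (a - b)) -> D x ->
      (fun n => p (q n x)) @ \oo --> p (L x).
    move=> hp Dx; apply/cvgrPdist_le => e e0.
    have [n hn] := pow2_small (B * (r / 4)) e0; exists n => // m /= nm.
    rewrite distrC (le_trans (hp _ _))// (le_trans (qL m x Dx))// (le_trans _ hn)//.
    rewrite /d mulrA; apply: pow2_le => //; rewrite mulr_ge0// divr_ge0// ltW//.
  split.
    apply: (@measurable_fun_cvg _ _ _ D (fun n x => cRe (q n x))) => [n|x Dx]; first by case: (mq n).
    by apply: (cv (fun a => cRe a)) => // a b; rewrite -ReB nc_Re.
  apply: (@measurable_fun_cvg _ _ _ D (fun n x => cIm (q n x))) => [n|x Dx]; first by case: (mq n).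
  by apply: (cv (fun a => cIm a)) => // a b; rewrite -ImB nc_Im.
have iL : cintegrable D (fun x => L x * f x).
  by apply: (@cintegrable_Mbd _ _ _ _ (2 * M / r)) => // x Dx; have [] := hL x Dx.
have ih w : nc (w - z) < r -> cintegrable D (fun x => h x w * f x).
  by move=> wr; apply: (@cintegrable_Mbd _ _ _ _ M) => //; [exact: mh|move=> x Dx; exact: hM].
pose N : R := (\int[mu]_(x in D) nc (f x))%R.
have N0 : 0 <= N by apply: Rintegral_ge0 => x _; exact: nc_ge0.
exists (cint D (fun x => L x * f x)); apply: (@cdiff_quad _ _ _ _ (B * N) (r / 4)).
- by rewrite divr_gt0.
- by rewrite mulr_ge0.
move=> e er.
have zer : nc (z + e - z) < r.
  by rewrite addrAC subrr add0r (lt_trans er)// ltr_pdivrMr// ltr_pMr// ltr1n.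
have i1 := ih _ zer; have i2 := ih _ zr.
rewrite -cintB// -cintZ// -cintB//; [|exact: cintegrableB|exact: cintegrableZ].
have inf := cintegrable_nc mD intf.
have -> : B * N * nc e ^+ 2 = (\int[mu]_(x in D) (B * nc e ^+ 2 * nc (f x)))%R.
  by rewrite RintegralZl// mulrAC.
apply: cint_norm_le => //.
- by apply: cintegrableB => //; [exact: cintegrableB|exact: cintegrableZ].
- exact: integrableZR.
move=> x Dx; have [_ /(_ e (ltW er)) H] := hL x Dx.
have -> : h x (z + e) * f x - h x z * f x - e * (L x * f x) = (h x (z + e) - h x z - e * L x) * f x by ring.
by rewrite ncM ler_wpM2r ?nc_ge0.
Qed.

(** Only the half disc is claimed because the terms must decrease like powers of
    one half. *)
Lemma pow_series_hol (a : nat -> C) r (K : R) z : 0 < r -> (forall n, nc (a n) <= K / r ^+ n) ->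
  nc z < r / 2 -> cdiffable (fun w => csum (fun n => a n * w ^+ n)) z.
Proof.
move=> r0 ha zr.
have K0 : 0 <= K by have := ha 0%N; rewrite expr0 divr1; apply: le_trans; exact: nc_ge0.
have hb n w : nc (w - z) < r / 2 - nc z -> nc (a n * w ^+ n) <= K / 2 ^+ n.
  move=> wz; have wr : nc w <= r / 2.
    rewrite -(subrK z w) (le_trans (ncD _ _))// ltW// -ltrBrDr//.
  rewrite ncM ncX; apply: (@le_trans _ _ (K / r ^+ n * (r / 2) ^+ n)).
    apply: ler_pM; rewrite ?nc_ge0 ?exprn_ge0 ?nc_ge0//.
    by rewrite lerXn2r ?nnegrE ?nc_ge0// divr_ge0// ltW.
  by rewrite expr_div_n mulrA divfK// expf_neq0// gt_eqF.
apply: (@hol_sum (fun n w => a n * w ^+ n) _ z (r / 2 - nc z) K (4 * K)).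
- by rewrite subr_gt0.
- move=> n w _; apply: cdiffableM; first exact: cdiffable_cst.
  by apply: cdiffableX; exact: cdiffable_id.
- by move=> n w; exact: hb.
- by move=> w wz; apply: csumP => n; exact: hb.
Qed.

Lemma local_bound F z : cdiffable F z ->
  exists2 d : R, 0 < d & exists2 M : R, 0 <= M & forall w, nc (w - z) < d -> nc (F w) <= M.
Proof.
move=> dF; have [d d0 hd] := cdiffable_cont dF ltr01; exists d => //.
exists (1 + nc (F z)); first by rewrite addr_ge0 ?nc_ge0.
move=> w wz; rewrite -(subrK (F z) (F w)) (le_trans (ncD _ _))// lerD2r.
exact: hd.
Qed.

(** Either the Taylor coefficients all vanish, or the first one that does not
    gives the order of the zero. *)
Lemma hol_factor F z r : 0 < r -> (forall w, nc (w - z) < r -> cdiffable F w) ->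
  (exists2 d : R, 0 < d & forall w, nc (w - z) < d -> F w = 0) \/
  exists (n : nat) (g : C -> C) (d : R), [/\ 0 < d,
    (forall w, nc (w - z) < d -> cdiffable g w),
    (forall w, nc (w - z) < d -> g w != 0) &
    (forall w, nc (w - z) < d -> F w = (w - z) ^+ n * g w)].
Proof.
move=> r0 dF; have zz : nc (z - z) < r by rewrite subrr nc0.
have [d1 d10 [M M0 hM]] := local_bound (dF z zz).
pose p := Num.min r d1; have p0 : 0 < p by rewrite lt_min r0.
have p2 : 0 < p / 2 by rewrite divr_gt0.
have p2p : p / 2 < p by rewrite ltr_pdivrMr// mulr_natr mulr2n ltrDl.
have [a [ha hs]] : exists a : nat -> C, (forall n, nc (a n) <= M / (p / 2) ^+ n) /\
    forall w, nc w <= p / 2 / 2 -> cseries (fun n => a n * w ^+ n) (F (z + w)) (2 * M).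
  apply: (@taylor _ (fun w => F (z + w)) (p / 2) p) => //.
    move=> w wp; apply: cdiffable_shift; apply: dF; rewrite addrAC subrr add0r.
    by move: wp; rewrite lt_min => /andP[].
  move=> w wp; apply: hM; rewrite addrAC subrr add0r wp.
  by apply: lt_le_trans p2p _; rewrite ge_min lexx orbT.
have hs' w : nc (w - z) < p / 2 / 2 -> cseries (fun n => a n * (w - z) ^+ n) (F w) (2 * M).
  by move=> /ltW/hs; rewrite subrKC.
have p4 : 0 < p / 2 / 2 by rewrite divr_gt0.
have [h0|] := pselect (forall n, a n = 0).
  left; exists (p / 2 / 2) => // w /hs' hw; apply: nc_le0.
  have := cseries_bound (lexx 0) _ hw; rewrite mulr0; apply => n.
  by rewrite h0 !mul0r nc0.
move=> /existsNP[m am]; right.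
have ex : exists n, a n != 0 by exists m; apply/eqP.
case: (ex_minnP ex) => n an0 nmin {m am ex}.
pose b k := a (n + k)%N; pose g w := csum (fun k => b k * (w - z) ^+ k).
have hb k : nc (b k) <= (M / (p / 2) ^+ n) / (p / 2) ^+ k.
  by rewrite -mulrA -invfM -exprD ha.
have dg w : nc (w - z) < p / 2 / 2 -> cdiffable g w.
  move=> wz; have H := @pow_series_hol b (p / 2) _ (w - z) p2 hb wz.
  have -> : g = (fun u => (fun v => csum (fun k => b k * v ^+ k)) (- z + u)).
    by apply/funext => u; rewrite /g; congr csum; apply/funext => k; rewrite addrC.
  by apply: (@cdiffable_shift _ (fun v => csum (fun k => b k * v ^+ k))); rewrite addrC.
have gz : g z = a n.
  have -> : g z = csum (fun k => b k * 0 ^+ k) by rewrite /g subrr.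
  rewrite -[a n]/(a n); have -> : a n = b 0%N by rewrite /b addn0.
  apply: cseries_pow0; apply: (@csumP _ _ (nc (b 0%N))) => -[|k].
    by rewrite expr0 mulr1 expr0 divr1.
  by rewrite exprS mul0r mulr0 nc0 divr_ge0 ?nc_ge0 ?exprn_ge0.
have zz4 : nc (z - z) < p / 2 / 2 by rewrite subrr nc0.
have an2 : 0 < nc (a n) / 2 by rewrite divr_gt0// nc_gt0.
have [d2 d20 hd2] := cdiffable_cont (dg z zz4) an2.
exists n, g, (Num.min d2 (p / 2 / 2)); split.
- by rewrite lt_min d20.
- by move=> w; rewrite lt_min => /andP[_]; exact: dg.
- move=> w; rewrite lt_min => /andP[wd _]; apply: nc_neq0.
  have an : 0 < nc (a n) by rewrite nc_gt0.
  have := hd2 w wd; rewrite gz => h1; have := nc_dist (a n) (g w); rewrite ncB.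
  lra.
- move=> w; rewrite lt_min => /andP[_ wp]; have hw := hs' w wp.
  have tail m : (forall k, (k < m)%N -> a k = 0) ->
      exists K : R, cseries (fun k => a (m + k)%N * (w - z) ^+ (m + k)) (F w) K.
    elim: m => [|m IH] hm; first by exists (2 * M).
    have [|K hK] := IH; first by move=> k km; apply: hm; rewrite ltnS ltnW.
    exists (K / 2); have := cseriesS hK; rewrite addn0 hm// mul0r subr0.
    by apply: eq_cseries => k; rewrite addnS addSn.
  have [|K hK] := tail n.
    by move=> k kn; apply/eqP; apply: contraTT kn => ak; rewrite -leqNgt nmin.
  have wp' : nc (w - z) <= p / 2 / 2 by exact: ltW.
  have hc : cseries (fun k => b k * (w - z) ^+ k) (g w) (4 * (M / (p / 2) ^+ n)).
    apply: csumP => k; rewrite ncM ncX.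
    apply: (@le_trans _ _ (M / (p / 2) ^+ n / (p / 2) ^+ k * (p / 2 / 2) ^+ k)).
      apply: ler_pM; rewrite ?nc_ge0 ?exprn_ge0 ?nc_ge0//.
      by rewrite lerXn2r ?nnegrE ?nc_ge0// ltW.
    by rewrite [(p / 2 / 2) ^+ k]expr_div_n mulrA divfK// expf_neq0// gt_eqF.
  apply: cseries_uniq hK _; last first.
    apply: eq_cseries (cseriesZ ((w - z) ^+ n) hc) => k.
    by rewrite exprD /b; ring.
Qed.

End Holomorphy.

(** * Meromorphic functions *)

Section Meromorphy.
Variable R : realType.
Local Notation C := R[i].
Implicit Types (f g h : C -> C) (z w u : C).

(** A pole, a removable singularity or a regular point. The value at [z] is free,
    so that identities on a punctured disc suffice. *)
Definition mero f z := exists (n : nat) (h : C -> C) (d : R), [/\ 0 < d,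
  (forall u, nc (u - z) < d -> cdiffable h u) &
  (forall u, nc (u - z) < d -> u != z -> f u = h u / (u - z) ^+ n)].

Lemma mero_hol f z (d : R) : 0 < d -> (forall u, nc (u - z) < d -> cdiffable f u) -> mero f z.
Proof. by move=> d0 df; exists 0%N, f, d; split => // u _ _; rewrite expr0 divr1. Qed.

Lemma mero_cst c z : mero (fun=> c) z.
Proof. by apply: (@mero_hol _ _ 1) => // u _; exact: cdiffable_cst. Qed.

Lemma mero_eq f g z (d : R) : 0 < d -> (forall u, nc (u - z) < d -> u != z -> f u = g u) -> mero f z -> mero g z.
Proof.
move=> d0 fg [n [h [e [e0 dh fh]]]]; exists n, h, (Num.min d e); split.
- by rewrite lt_min d0.
- by move=> u; rewrite lt_min => /andP[_]; exact: dh.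
- by move=> u; rewrite lt_min => /andP[ud ue] uz; rewrite -fg// fh.
Qed.

Lemma meroM f g z : mero f z -> mero g z -> mero (fun u => f u * g u) z.
Proof.
move=> [n [h [d [d0 dh fh]]]] [m [k [e [e0 dk gk]]]].
exists (n + m)%N, (fun u => h u * k u), (Num.min d e); split.
- by rewrite lt_min d0.
- by move=> u; rewrite lt_min => /andP[ud ue]; apply: cdiffableM; [exact: dh|exact: dk].
- move=> u; rewrite lt_min => /andP[ud ue] uz; rewrite fh// gk//.
  by rewrite mulrACA -invfM -exprD.
Qed.

Lemma meroD f g z : mero f z -> mero g z -> mero (fun u => f u + g u) z.
Proof.
move=> [n [h [d [d0 dh fh]]]] [m [k [e [e0 dk gk]]]].
have dX j u : cdiffable (fun v : C => (v - z) ^+ j) u.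
  by apply: cdiffableX; apply: cdiffableB; [exact: cdiffable_id|exact: cdiffable_cst].
exists (n + m)%N, (fun u => h u * (u - z) ^+ m + k u * (u - z) ^+ n), (Num.min d e); split.
- by rewrite lt_min d0.
- move=> u; rewrite lt_min => /andP[ud ue].
  by apply: cdiffableD; apply: cdiffableM => //; [exact: dh|exact: dk].
- move=> u; rewrite lt_min => /andP[ud ue] uz; rewrite fh// gk// exprD.
  have un i : (u - z) ^+ i != 0 by rewrite expf_neq0// subr_eq0.
  have := un n; have := un m; move: ((u - z) ^+ n) ((u - z) ^+ m) => a b b0 a0.
  by field; rewrite a0 b0.
Qed.

(** Riemann's theorem on removable singularities, for functions with an
    a priori bound on the order of the pole: two more factors make the product
    differentiable at the centre. *)
Lemma mero_bounded f z n (d M : R) : 0 < d ->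
  (forall u, nc (u - z) < d -> u != z -> cdiffable f u) ->
  (forall u, nc (u - z) < d -> u != z -> nc ((u - z) ^+ n * f u) <= M) -> mero f z.
Proof.
move=> d0 df hM; pose g u := if u == z then 0 else (u - z) ^+ 2 * ((u - z) ^+ n * f u).
wlog M0 : M hM / 0 <= M => [H|].
  by apply: (H (Num.max M 0)) => [u ud uz|]; rewrite le_max ?lexx ?orbT ?hM.
have dX j u : cdiffable (fun v : C => (v - z) ^+ j) u.
  by apply: cdiffableX; apply: cdiffableB; [exact: cdiffable_id|exact: cdiffable_cst].
exists (2 + n)%N, g, d; split => // u ud.
  have [->|uz] := eqVneq u z.
    exists 0; apply: (@cdiff_quad _ _ _ _ M d) => // h hd.
    rewrite /g eqxx mulr0 !subr0; case: ifPn => [_|hz].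
      by rewrite nc0 mulr_ge0// exprn_ge0// nc_ge0.
    have hz' : nc (z + h - z) < d by rewrite addrAC subrr add0r.
    rewrite ncM ncX mulrC; apply: ler_pM; rewrite ?nc_ge0 ?exprn_ge0 ?nc_ge0//.
      exact: hM.
    by rewrite addrAC subrr add0r.
  have uz0 : 0 < nc (u - z) by rewrite nc_gt0// subr_eq0.
  apply: (@cdiffable_near _ (fun v => (v - z) ^+ 2 * ((v - z) ^+ n * f v)) _ _ _ uz0).
    move=> v vu; rewrite /g ifN//; apply: contraTneq vu => ->.
    by rewrite ncB -leNgt.
  by do 2 apply: cdiffableM => //; exact: df.
move=> uz; rewrite /g ifN// mulrA -exprD mulrAC divff ?mul1r//.
by rewrite expf_neq0// subr_eq0.
Qed.

Definition vanish_near f z := exists2 d : R, 0 < d & forall u, nc (u - z) < d -> u != z -> f u = 0.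

(** Divide out the zero of the numerator with [hol_factor]. *)
Lemma mero_inv f z : mero f z -> vanish_near f z \/
  ((exists2 d : R, 0 < d & forall u, nc (u - z) < d -> u != z -> f u != 0) /\ mero (fun u => (f u)^-1) z).
Proof.
move=> [n [h [d [d0 dh fh]]]]; have [[e e0 he]|] := hol_factor d0 dh.
  left; exists (Num.min d e); first by rewrite lt_min d0.
  by move=> u; rewrite lt_min => /andP[ud ue] uz; rewrite fh// he// mul0r.
move=> [m [g [e [e0 dg g0 hg]]]]; right.
have fE u : nc (u - z) < Num.min d e -> u != z -> f u = (u - z) ^+ m * g u / (u - z) ^+ n.
  by rewrite lt_min => /andP[ud ue] uz; rewrite fh// hg.
have de0 : 0 < Num.min d e by rewrite lt_min d0.
have uX u i : u != z -> (u - z) ^+ i != 0 by move=> uz; rewrite expf_neq0// subr_eq0.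
split.
  exists (Num.min d e) => // u ud uz; rewrite fE// mulf_neq0 ?invr_eq0 ?uX//.
  by rewrite mulf_neq0 ?uX// g0//; move: ud; rewrite lt_min => /andP[].
exists m, (fun u => (u - z) ^+ n * (g u)^-1), (Num.min d e); split => //.
  move=> u; rewrite lt_min => /andP[_ ue]; apply: cdiffableM.
    by apply: cdiffableX; apply: cdiffableB; [exact: cdiffable_id|exact: cdiffable_cst].
  by apply: cdiffableV; [exact: g0|exact: dg].
move=> u ud uz; rewrite fE//.
have gu : g u != 0 by apply: g0; move: ud; rewrite lt_min => /andP[].
have := uX u n uz; have := uX u m uz; move: ((u - z) ^+ n) ((u - z) ^+ m) => a b b0 a0.
by field; rewrite a0 b0 gu.
Qed.

Lemma near_pick z (d : R) : 0 < d -> exists u, nc (u - z) < d /\ u != z.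
Proof.
move=> d0; exists (z + (d / 2)%:C).
have d2 : 0 < d / 2 by rewrite divr_gt0.
rewrite addrAC subrr add0r ncR gtr0_norm//; split.
  by rewrite ltr_pdivrMr// mulr_natr mulr2n ltrDl.
by rewrite -subr_eq0 addrAC subrr add0r; apply: nc_neq0; rewrite ncR gtr0_norm.
Qed.

(** The points near which a meromorphic function vanishes form an open and
    closed set; along a segment this is the bisection principle. *)
Lemma mero_identity f z w : (forall u, mero f u) -> vanish_near f z -> vanish_near f w.
Proof.
move=> mf.
have loc u : exists2 d : R, 0 < d & forall v, nc (v - u) < d -> (vanish_near f v <-> vanish_near f u).
  have punct (P : C -> Prop) (d : R) : (forall v, nc (v - u) < d -> v != u -> P v) ->
      forall v, nc (v - u) < d -> v != u -> exists2 e : R, 0 < e & forall x, nc (x - v) < e -> P x.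
    move=> hP v vd vu; exists (Num.min (nc (v - u)) (d - nc (v - u))).
      by rewrite lt_min nc_gt0 ?subr_eq0// subr_gt0.
    move=> x; rewrite lt_min => /andP[x1 x2]; apply: hP.
      have -> : x - u = (x - v) + (v - u) by ring.
      by rewrite (le_lt_trans (ncD _ _))// -ltrBrDr.
    by apply: contraTneq x1 => ->; rewrite ncB -leNgt.
  have [[d d0 hd]|[[d d0 hd] _]] := mero_inv (mf u).
    exists d => // v vd; split => _; first by exists d.
    have [->|vu] := eqVneq v u; first by exists d.
    have [e e0 he] := punct (fun x => f x = 0) d hd v vd vu.
    by exists e => // x xe _; exact: he.
  exists d => // v vd; have nu : ~ vanish_near f u.
    move=> [e e0 he]; have [|x [xe xu]] := @near_pick u (Num.min d e); first by rewrite lt_min d0.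
    move: xe; rewrite lt_min => /andP[xd xe].
    by have := hd x xd xu; rewrite he// eqxx.
  split => // -[e e0 he].
  have [vu|vu] := eqVneq v u; first by exfalso; apply: nu; rewrite -vu; exists e.
  have [e1 e10 he1] := punct (fun x => f x != 0) d hd v vd vu.
  have [|x [xe xv]] := @near_pick v (Num.min e e1); first by rewrite lt_min e0.
  move: xe; rewrite lt_min => /andP[x1 x2].
  by have := he1 x x2; rewrite he// eqxx.
pose p (t : R) : C := z + t%:C * (w - z).
have : vanish_near f (p 0) <-> vanish_near f (p 1).
  apply: (@bisection1 R (fun s t => vanish_near f (p s) <-> vanish_near f (p t))) => //.
    by move=> a b _ h1 h2; split=> [/h1/h2|/h2/h1].
  move=> t _; have [d d0 hd] := loc (p t).
  exists (d / (nc (w - z) + 1)); first by rewrite divr_gt0// ltr_wpDl// nc_ge0.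
  move=> a b /andP[_ at_] /andP[tb _] ab.
  have near s : `|s - t| <= b - a -> nc (p s - p t) < d.
    move=> st; have -> : p s - p t = (s - t)%:C * (w - z) by rewrite /p rmorphB /=; ring.
    rewrite ncM ncR; have N0 : 0 < nc (w - z) + 1 by rewrite ltr_wpDl// nc_ge0.
    apply: (@le_lt_trans _ _ (d / (nc (w - z) + 1) * nc (w - z))).
      by rewrite ler_wpM2r ?nc_ge0// (le_trans st).
    by rewrite mulrAC ltr_pdivrMr// ltr_pM2l// ltrDl.
  have ha := hd _ (near a (_ : `|a - t| <= b - a)).
  have hb := hd _ (near b (_ : `|b - t| <= b - a)).
  have la : `|a - t| <= b - a by rewrite ler_norml; lra.
  have lb : `|b - t| <= b - a by rewrite ler_norml; lra.
  by split=> h; [apply: (hb lb).2; apply: (ha la).1|apply: (ha la).2; apply: (hb lb).1].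
by rewrite /p mul0r addr0 rmorph1 mul1r subrKC => -[].
Qed.

End Meromorphy.

(** * The Cauchy problem, entire in the spectral parameter *)

Section Primitive.
Variable R : realType.
Local Notation C := R[i].
Local Notation mu := (@lebesgue_measure R).
Implicit Types (g : R -> C) (a b x : R).

(** The sign convention makes it an indefinite integral on the whole line. *)
Definition prim g x : C := if 0 <= x then cint `[0, x] g else - cint `[x, 0] g.

Lemma prim0 g : prim g 0 = 0.
Proof. by rewrite /prim lexx cint_pt. Qed.

Lemma prim_AC g : (forall a b, cintegrable `[a, b] g) -> forall a b, AC a b g (prim g).
Proof.
move=> ig a b; split => // x y _ xy _; rewrite /prim.
case: leP => y0; case: leP => x0.
- rewrite (cint_split x0 xy)//; move: (cint `[0, x] g) (cint `[x, y] g) => p q; ring.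
- rewrite (cint_split (ltW x0) y0)//; move: (cint `[0, y] g) (cint `[x, 0] g) => p q; ring.
- by move: (lt_le_trans y0 x0); rewrite ltNge xy.
- rewrite (cint_split xy (ltW y0))//; move: (cint `[y, 0] g) (cint `[x, y] g) => p q; ring.
Qed.

Lemma AC_uniq0 a b g G : a <= b -> AC a b g G -> (forall x, a <= x <= b -> g x = 0) -> G b = G a.
Proof.
move=> ab [ig hG] g0; apply/eqP; rewrite -subr_eq0; apply/eqP; rewrite hG//.
rewrite -[RHS](@cint0 R `[a, b]); apply: eq_cint => x /=; rewrite in_itv /=; exact: g0.
Qed.

Lemma exp_integral a b (D : R) : D != 0 -> a <= b ->
  (\int[mu]_(t in `[a, b]) expR (D * t) = (expR (D * b) - expR (D * a)) / D)%R.
Proof.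
move=> D0 ab; have [i e] := AC_cexp (D%:C) a b.
have := congr1 (fun z => cRe z) (e a b (lexx _) ab (lexx _)).
have cE t : cexp (D%:C * t%:C) = (expR (D * t))%:C by rewrite -rmorphM cexp_real.
rewrite ReB !cE Re_cint /= => ->.
have -> : (fun x => cRe (D%:C * cexp (D%:C * x%:C))) = (fun x => D * expR (D * x)).
  by apply/funext => x; rewrite cE -rmorphM.
rewrite RintegralZl//; first by rewrite mulrC mulKf.
have [ie _] := @ccont_on_integrable _ a b _ (AC_cont ab (AC_cexp (D%:C) a b)).
by move: ie; congr (mu.-integrable _ _); apply/funext => t /=; rewrite cE.
Qed.

Lemma exp_integrable a b (D : R) : a <= b -> mu.-integrable `[a, b] (EFin \o (fun t => expR (D * t))).
Proof.
move=> ab; have [ie _] := @ccont_on_integrable _ a b _ (AC_cont ab (AC_cexp (D%:C) a b)).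
move: ie; congr (mu.-integrable _ _); apply/funext => t /=.
by rewrite -rmorphM cexp_real.
Qed.

Lemma prim_bound g x (K D : R) : 0 < D -> (forall a b, cintegrable `[a, b] g) ->
  (forall t, `|t| <= `|x| -> nc (g t) <= K * expR (D * `|t|)) -> nc (prim g x) <= K / D * expR (D * `|x|).
Proof.
move=> D0 ig hg; have K0 : 0 <= K.
  have := hg 0; rewrite normr0 mulr0 expR0 mulr1 normr_ge0 => /(_ isT).
  by apply: le_trans; exact: nc_ge0.
have step a b E : a <= b -> E != 0 -> (forall t, a <= t <= b -> nc (g t) <= K * expR (E * t)) ->
    nc (cint `[a, b] g) <= K * ((expR (E * b) - expR (E * a)) / E).
  move=> ab E0 h; rewrite -exp_integral// -RintegralZl//; last exact: exp_integrable.
  apply: cint_norm_le => //; first by apply: integrableZR => //; exact: exp_integrable.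
rewrite /prim; case: (leP 0 x) => x0.
  have h t : 0 <= t <= x -> nc (g t) <= K * expR (D * t).
    move=> /andP[t0 tx]; have := hg t; rewrite !ger0_norm//; exact.
  rewrite ger0_norm//; apply: (le_trans (step 0 x D x0 (lt0r_neq0 D0) h)).
  rewrite -mulrA ler_wpM2l// mulr0 expR0 mulrC ler_wpM2l ?invr_ge0 ?(ltW D0)//.
  by rewrite gerBl.
have h t : x <= t <= 0 -> nc (g t) <= K * expR (- D * t).
  by move=> /andP[xt t0]; have := hg t; rewrite (ler0_norm t0) (ltr0_norm x0) lerN2 mulrN -mulNr; exact.
have D1 : - D != 0 by rewrite oppr_eq0 lt0r_neq0.
rewrite ncN ltr0_norm// mulrN -mulNr; apply: (le_trans (step x 0 (- D) (ltW x0) D1 h)).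
have -> : K * ((expR (- D * 0) - expR (- D * x)) / - D) = K / D * (expR (- D * x) - 1).
  rewrite mulr0 expR0; move: (expR (- D * x)) => E; field; exact: lt0r_neq0.
by rewrite ler_wpM2l ?divr_ge0 ?(ltW D0)// gerBl.
Qed.

End Primitive.

Section Cauchy_problem.
Variable R : realType.
Local Notation C := R[i].
Variables (V : R -> R) (B0 : R).
Hypotheses (cV : continuous V) (bV : forall x, `|V x| <= B0).
Variables (a b : C).
Implicit Types (l : C) (x : R).

Definition pot l x : C := (V x)%:C - l ^+ 2.

Lemma pot_cont l : ccont (pot l).
Proof. by apply: ccontB; [exact: ccont_R|exact: ccont_cst]. Qed.

Lemma pot_bound l N x : nc l <= N -> nc (pot l x) <= B0 + N ^+ 2.
Proof.
move=> lN; rewrite (le_trans (ncDB _ _))// lerD// ?ncR// ncX.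
by rewrite lerXn2r ?nnegrE ?nc_ge0// (le_trans (nc_ge0 l)).
Qed.

Fixpoint picard l (n : nat) : (R -> C) * (R -> C) :=
  if n is m.+1 then (prim (picard l m).2, prim (fun x => pot l x * (picard l m).1 x))
  else (fun=> a, fun=> b).

(** The solution with value [a] and slope [b] at the origin, and its derivative,
    as the sum of the Picard iterates. *)
Definition sol0 l x : C := csum (fun n => (picard l n).1 x).
Definition sol1 l x : C := csum (fun n => (picard l n).2 x).

Lemma picard_cont l n : ccont (picard l n).1 /\ ccont (picard l n).2.
Proof.
elim: n => [|n [h1 h2]] /=; first by split; exact: ccont_cst.
split; apply: AC_ccont; apply: prim_AC => x y; apply: ccont_on_integrable => //.
by apply: ccont_onM => //; exact: pot_cont.
Qed.

Let K := nc a + nc b.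
Let D (N : R) := 2 * (B0 + N ^+ 2 + 1).

Let B00 : 0 <= B0. Proof. exact: le_trans (normr_ge0 _) (bV 0). Qed.
Let D2 N : 2 <= D N.
Proof. by rewrite /D ler_pMr// lerDr addr_ge0// sqr_ge0. Qed.

(** The weight [exp (D |x|)] makes the Volterra operator a contraction of
    ratio one half on the whole line. *)
Lemma picard_bound l N n x : nc l <= N ->
  nc ((picard l n).1 x) <= K / 2 ^+ n * expR (D N * `|x|) /\
  nc ((picard l n).2 x) <= K / 2 ^+ n * expR (D N * `|x|).
Proof.
move=> lN; have D0 : 0 < D N by apply: lt_le_trans (D2 N).
elim: n x => [|n IH] x /=.
  rewrite expr0 divr1; have e1 : 1 <= expR (D N * `|x|) by rewrite -expR0 ler_expR mulr_ge0// ltW.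
  have Ke : K <= K * expR (D N * `|x|) by rewrite ler_peMr// addr_ge0 ?nc_ge0.
  by split; apply: le_trans Ke; rewrite /K ?lerDl ?lerDr nc_ge0.
have K0 : 0 <= K / 2 ^+ n by rewrite divr_ge0 ?exprn_ge0// addr_ge0 ?nc_ge0.
have half : K / 2 ^+ n.+1 = K / 2 ^+ n * 2^-1 by rewrite exprS invfM; ring.
have iD : (D N)^-1 <= 2^-1 by rewrite lef_pV2 ?posrE ?D2.
have [c1 c2] := picard_cont l n.
split.
  apply: (le_trans (@prim_bound _ _ x (K / 2 ^+ n) (D N) D0 _ _)).
  - by move=> *; exact: ccont_on_integrable.
  - by move=> t _; have [] := IH t.
  by rewrite ler_wpM2r ?expR_ge0// half; apply: ler_wpM2l.
apply: (le_trans (@prim_bound _ _ x ((B0 + N ^+ 2) * (K / 2 ^+ n)) (D N) D0 _ _)).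
- by move=> *; apply: ccont_on_integrable; apply: ccont_onM => //; exact: pot_cont.
- move=> t _; rewrite ncM -mulrA; apply: ler_pM; rewrite ?nc_ge0//; first exact: pot_bound.
  by have [] := IH t.
rewrite ler_wpM2r ?expR_ge0//.
rewrite half mulrAC mulrC ler_wpM2l// ler_pdivrMr// /D.
by rewrite mulKf// lerDl.
Qed.

Lemma sol_series l N x : nc l <= N ->
  cseries (fun n => (picard l n).1 x) (sol0 l x) (4 * (K * expR (D N * `|x|))) /\
  cseries (fun n => (picard l n).2 x) (sol1 l x) (4 * (K * expR (D N * `|x|))).
Proof.
move=> lN; split; apply: csumP => n; have [h1 h2] := picard_bound n x lN.
  by rewrite mulrAC.
by rewrite mulrAC.
Qed.

Lemma sol_bound l N X x : nc l <= N -> `|x| <= X ->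
  nc (sol0 l x) <= 4 * (K * expR (D N * X)) /\ nc (sol1 l x) <= 4 * (K * expR (D N * X)).
Proof.
move=> lN xX; have [h1 h2] := sol_series x lN.
have D0 : 0 < D N by apply: lt_le_trans (D2 N).
have h : 4 * (K * expR (D N * `|x|)) <= 4 * (K * expR (D N * X)).
  by rewrite ler_wpM2l// ler_wpM2l ?addr_ge0 ?nc_ge0// ler_expR ler_wpM2l// ltW.
by split; apply: le_trans h; apply: cseries_le; eassumption.
Qed.

Let shift (f : nat -> R -> C) n x : C := if n is m.+1 then f m x else 0.

Let series_shift (f : nat -> R -> C) s (L : R) x : cseries (fun n => f n x) s L ->
  cseries (fun n => shift f n x) s (2 * L).
Proof.
move=> h [|n].
  rewrite big_ord0 expr0 divr1 subr0 (le_trans (cseries_le h))//.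
  by rewrite ler_peMl ?(cseries_ge0 h)// ler1n.
rewrite big_ord_recl /= add0r; apply: (le_trans (h n)).
by rewrite exprS invfM mulrACA divff// mul1r.
Qed.

Lemma sol_AC l x y : AC x y (sol1 l) (sol0 l) /\ AC x y (fun t => pot l t * sol0 l t) (sol1 l).
Proof.
have [yx|xy] := ltP y x.
  have i0 g : cintegrable `[x, y] g by rewrite set_itv_ge ?bnd_simp -?ltNge//; split; exact: integrable_set0.
  by split; split => // u v xu uv vy; move: (le_lt_trans (le_trans xu (le_trans uv vy)) yx); rewrite ltxx.
pose X := `|x| + `|y|.
have tX t : x <= t <= y -> `|t| <= X.
  by move=> h; rewrite /X ler_norml; have := ler_norm y; have := ler_norm (- x); rewrite normrN;
     have := normr_ge0 x; have := normr_ge0 y; lra.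
have D0 : 0 < D (nc l) by apply: lt_le_trans (D2 _).
pose L := 4 * (K * expR (D (nc l) * X)).
have L0 : 0 <= L by rewrite /L mulr_ge0// mulr_ge0 ?expR_ge0// addr_ge0 ?nc_ge0.
have s0 t : x <= t <= y -> cseries (fun n => (picard l n).1 t) (sol0 l t) L.
  move=> /tX tt; have [h _] := sol_series t (lexx (nc l)).
  apply: cseriesW h; rewrite /L ler_wpM2l// ler_wpM2l ?addr_ge0 ?nc_ge0//.
  by rewrite ler_expR ler_wpM2l// ltW.
have s1 t : x <= t <= y -> cseries (fun n => (picard l n).2 t) (sol1 l t) L.
  move=> /tX tt; have [_ h] := sol_series t (lexx (nc l)).
  apply: cseriesW h; rewrite /L ler_wpM2l// ler_wpM2l ?addr_ge0 ?nc_ge0//.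
  by rewrite ler_expR ler_wpM2l// ltW.
pose Q := B0 + nc l ^+ 2; have Q0 : 0 <= Q by rewrite addr_ge0// sqr_ge0.
have L2 : L <= 2 * ((Q + 1) * L).
  apply: (@le_trans _ _ ((Q + 1) * L)); first by rewrite ler_peMl// lerDr.
  by rewrite ler_peMl ?ler1n// mulr_ge0// addr_ge0.
have LQ : 2 * (Q * L) <= 2 * ((Q + 1) * L) by rewrite ler_wpM2l// ler_wpM2r// lerDl.
have L1 : 2 * L <= 2 * ((Q + 1) * L) by rewrite ler_wpM2l// ler_peMl// lerDr.
split.
  apply: (@AC_sum _ x y (shift (fun n => (picard l n).2)) (fun n => (picard l n).1) _ _ (2 * ((Q + 1) * L))) => //.
  - move=> [|n] /=; first exact: AC_cst.
    by apply: prim_AC => u v; apply: ccont_on_integrable; have [_] := picard_cont l n.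
  - by move=> [|n] /=; [exact: ccont_cst|have [_] := picard_cont l n].
  - by move=> t ht; apply: cseriesW L1 _; apply: series_shift (s1 t ht).
  - by move=> t ht; apply: cseriesW L2 (s0 t ht).
apply: (@AC_sum _ x y (shift (fun n t => pot l t * (picard l n).1 t)) (fun n => (picard l n).2) _ _ (2 * ((Q + 1) * L))) => //.
- move=> [|n] /=; first exact: AC_cst.
  apply: prim_AC => u v; apply: ccont_on_integrable.
  by apply: ccont_onM; [exact: pot_cont|have [] := picard_cont l n].
- move=> [|n] /=; first exact: ccont_cst.
  by apply: ccont_onM; [exact: pot_cont|have [] := picard_cont l n].
- move=> t ht; apply: cseriesW LQ _; apply: series_shift.
  apply: cseriesW (cseriesZ (pot l t) (s0 t ht)).
  by rewrite ler_wpM2r// pot_bound.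
- by move=> t ht; apply: cseriesW L2 (s1 t ht).
Qed.

Lemma sol_cont l : ccont (sol0 l) /\ ccont (sol1 l).
Proof. by split; apply: AC_ccont => x y; have [h1 h2] := sol_AC l x y; [exact: h1|exact: h2]. Qed.

Lemma sol_init l : sol0 l 0 = a /\ sol1 l 0 = b.
Proof.
split; apply: (@csum_eq _ _ _ (nc a + nc b)) => -[|n].
- by rewrite big_ord0 subr0 expr0 divr1 lerDl nc_ge0.
- rewrite big_ord_recl big1 /= => [|i _]; last exact: prim0.
  by rewrite addr0 subrr nc0 divr_ge0 ?exprn_ge0// addr_ge0 ?nc_ge0.
- by rewrite big_ord0 subr0 expr0 divr1 lerDr nc_ge0.
- rewrite big_ord_recl big1 /= => [|i _]; last exact: prim0.
  by rewrite addr0 subrr nc0 divr_ge0 ?exprn_ge0// addr_ge0 ?nc_ge0.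
Qed.

Lemma hol_prim (h : C -> R -> C) x z (M r : R) : 0 < r ->
  (forall t w, `|t| <= `|x| -> nc (w - z) < r -> cdiffable (fun l => h l t) w) ->
  (forall t w, `|t| <= `|x| -> nc (w - z) < r -> nc (h w t) <= M) ->
  (forall w, ccont (h w)) -> cdiffable (fun l => prim (h l) x) z.
Proof.
move=> r0 dh hM ch.
have key u v : (forall t, u <= t <= v -> `|t| <= `|x|) -> cdiffable (fun l => cint `[u, v] (h l)) z.
  move=> huv.
  have H := @hol_int _ `[u, v] (fun t l => h l t) (fun=> 1) z r M.
  have -> : (fun l => cint `[u, v] (h l)) = (fun l => cint `[u, v] (fun t => h l t * 1)).
    by apply/funext => l; congr cint; apply/funext => t; rewrite mulr1.
  apply: H => //.
  - exact/ccont_on_integrable/ccont_cst.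
  - by move=> t w /=; rewrite in_itv /= => /huv; exact: dh.
  - by move=> t w /=; rewrite in_itv /= => /huv; exact: hM.
  - by move=> w _; apply: ccont_on_meas; exact: ch.
rewrite /prim; case: (leP 0 x) => x0.
  by apply: key => t /andP[t0 tx]; rewrite !ger0_norm.
by apply: cdiffableN; apply: key => t /andP[xt t0]; rewrite !ler0_norm ?lerN2// ltW.
Qed.

Lemma picard_hol n x z : cdiffable (fun l => (picard l n).1 x) z /\ cdiffable (fun l => (picard l n).2 x) z.
Proof.
elim: n x z => [|n IH] x z /=; first by split; exact: cdiffable_cst.
have wN w : nc (w - z) < 1 -> nc w <= nc z + 1.
  by move=> h; rewrite -(subrKC z w); apply: le_trans (ncD _ _) _; rewrite lerD2l ltW.
pose N := nc z + 1.
have D0 : 0 < D N by apply: lt_le_trans (D2 _).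
pose L := K / 2 ^+ n * expR (D N * `|x|).
have L0 : 0 <= L by rewrite /L mulr_ge0 ?expR_ge0// divr_ge0 ?exprn_ge0// addr_ge0 ?nc_ge0.
have bnd t w : `|t| <= `|x| -> nc (w - z) < 1 -> nc ((picard w n).1 t) <= L /\ nc ((picard w n).2 t) <= L.
  move=> tx wz; have [h1 h2] := picard_bound n t (wN w wz).
  have le : K / 2 ^+ n * expR (D N * `|t|) <= L.
    rewrite /L ler_wpM2l//; first by rewrite divr_ge0 ?exprn_ge0// addr_ge0 ?nc_ge0.
    by rewrite ler_expR ler_wpM2l// ltW.
  by split; [exact: le_trans h1 le|exact: le_trans h2 le].
split.
  apply: (@hol_prim (fun l => (picard l n).2) x z L 1) => //.
  - by move=> t w _ _; have [] := IH t w.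
  - by move=> t w tx wz; have [] := bnd t w tx wz.
  - by move=> w; have [] := picard_cont w n.
apply: (@hol_prim (fun l t => pot l t * (picard l n).1 t) x z ((B0 + N ^+ 2) * L) 1) => //.
- move=> t w _ _; apply: cdiffableM; last by have [] := IH t w.
  by apply: cdiffableB; [exact: cdiffable_cst|apply: cdiffableX; exact: cdiffable_id].
- move=> t w tx wz; rewrite ncM; apply: ler_pM; rewrite ?nc_ge0 ?pot_bound ?wN//.
  by have [] := bnd t w tx wz.
- by move=> w; apply: ccontM; [exact: pot_cont|have [] := picard_cont w n].
Qed.

(** Each Picard iterate is a polynomial in [l] built by integration, and the
    series converges uniformly for bounded [l]. *)
Lemma sol_hol x z : cdiffable (fun l => sol0 l x) z /\ cdiffable (fun l => sol1 l x) z.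
Proof.
have wN w : nc (w - z) < 1 -> nc w <= nc z + 1.
  by move=> h; rewrite -(subrKC z w); apply: le_trans (ncD _ _) _; rewrite lerD2l ltW.
split.
  apply: (@hol_sum _ (fun n l => (picard l n).1 x) _ z 1 (K * expR (D (nc z + 1) * `|x|)) _) => //.
  - by move=> n w _; have [] := picard_hol n x w.
  - by move=> n w /wN h; have [] := picard_bound n x h; rewrite mulrAC.
  - by move=> w /wN h; have [h1 _] := sol_series x h; exact: h1.
apply: (@hol_sum _ (fun n l => (picard l n).2 x) _ z 1 (K * expR (D (nc z + 1) * `|x|)) _) => //.
- by move=> n w _; have [] := picard_hol n x w.
- by move=> n w /wN h; have [_] := picard_bound n x h; rewrite mulrAC.
- by move=> w /wN h; have [_ h1] := sol_series x h; exact: h1.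
Qed.

End Cauchy_problem.

(** * Frobenius coefficients at an end of the line *)

Section Wronskian.
Variable R : realType.
Local Notation C := R[i].
Implicit Types (q u v : R -> C) (x y : R).

Definition issol q x y u u1 := AC x y u1 u /\ AC x y (fun t => q t * u t) u1.

Lemma wronskian_const q x y u u1 v v1 : x <= y -> issol q x y u u1 -> issol q x y v v1 ->
  u y * v1 y - u1 y * v y = u x * v1 x - u1 x * v x.
Proof.
move=> xy [U1 U2] [V1 V2].
apply: (@AC_uniq0 R x y _ (fun t => u t * v1 t - u1 t * v t) xy (AC_B (AC_M xy U1 V2) (AC_M xy U2 V1))).
by move=> t _ /=; ring.
Qed.

Lemma issol_lin q x y u u1 v v1 (a b : C) : issol q x y u u1 -> issol q x y v v1 ->
  issol q x y (fun t => a * u t + b * v t) (fun t => a * u1 t + b * v1 t).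
Proof.
move=> [U1 U2] [V1 V2]; split; first by apply: AC_D; exact: AC_Z.
by apply: eq_AC (AC_D (AC_Z a U2) (AC_Z b V2)) => t _ //; ring.
Qed.

End Wronskian.

Section JostCoefficients.
Variable R : realType.
Local Notation C := R[i].
Variables (A : R) (a : nat -> C) (M rho : R).
Hypotheses (A0 : 0 < A) (rho0 : 0 < rho) (M0 : 0 <= M).
Hypothesis ha : forall n, nc (a n) <= M / rho ^+ n.
Implicit Types (l z : C).

Definition den l (k : nat) : C := (A * k%:R)%:C - 2 * 'i * l.

Fixpoint jtab l (n : nat) : nat -> C :=
  if n is m.+1 then fun k =>
    if (k <= m)%N then jtab l m k
    else (\sum_(j < m.+1) a (m.+1 - j)%N * jtab l m j) / ((A * m.+1%:R)%:C * den l m.+1)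
  else fun=> 1.

(** The coefficients of the Frobenius series at infinity, tabulated because the
    recursion uses all the previous ones. *)
Definition jcoef l k := jtab l k k.

Lemma jtabE l n k : (k <= n)%N -> jtab l n k = jcoef l k.
Proof.
move=> kn; rewrite -(subnK kn); elim: (n - k)%N => [//|m IH].
by rewrite addSn /= leq_addl.
Qed.

Lemma jcoef0 l : jcoef l 0 = 1. Proof. by []. Qed.

Lemma jcoefS l k : jcoef l k.+1 =
  (\sum_(j < k.+1) a (k.+1 - j)%N * jcoef l j) / ((A * k.+1%:R)%:C * den l k.+1).
Proof.
rewrite /jcoef /= ltnn; congr (_ / _); apply: eq_bigr => j _; congr (_ * _).
by rewrite jtabE// -ltnS.
Qed.

(** Beyond [k > m] each partial sum is at most twice the previous one; before that
    a factor [1 + m] is lost at each step. *)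
Lemma growth (B : nat -> R) (m : R) : 0 <= m -> (forall k, 0 <= B k) -> B 0%N <= 1 ->
  (forall k, B k.+1 <= m / k.+1%:R * \sum_(j < k.+1) B j) ->
  forall k, B k <= (1 + m) ^+ (Num.bound m) * 2 ^+ k.
Proof.
move=> m0 B0 B1 BS; set k0 := Num.bound m.
have mk : m < k0%:R by exact: archi_boundP.
pose S k := \sum_(j < k.+1) B j.
have S0 k : 0 <= S k by apply: sumr_ge0.
have m1 : 1 <= 1 + m by rewrite lerDl.
have SS k : S k.+1 <= (1 + m / k.+1%:R) * S k.
  by rewrite /S big_ord_recr /= mulrDl mul1r lerD2l BS.
have early k : S k <= (1 + m) ^+ k.
  elim: k => [|k IH]; first by rewrite /S big_ord1 expr0.
  apply: (le_trans (SS k)); rewrite exprS; apply: ler_pM => //.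
    by rewrite addr_ge0// divr_ge0.
  by rewrite lerD2l ler_pdivrMr ?ltr0n// ler_peMr// ler1n.
have late k : S k <= (1 + m) ^+ k0 * 2 ^+ k.
  have [kk|] := leqP k k0.
    apply: (le_trans (early k)); rewrite -[leLHS]mulr1; apply: ler_pM => //.
    - by rewrite exprn_ge0// addr_ge0.
    - exact: ler_weXn2l.
    - by rewrite exprn_ege1// ler1n.
  elim: k => [//|k IH]; rewrite ltnS leq_eqVlt => /predU1P[<-|kk].
    apply: (le_trans (SS k0)); rewrite exprS mulrCA; apply: ler_pM => //.
    - by rewrite addr_ge0// divr_ge0.
    - have -> : (2 : R) = 1 + 1 by ring.
      rewrite lerD2l ler_pdivrMr ?ltr0n// mul1r ltW// (lt_trans mk)// ltr_nat.
      by [].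
    - apply: (le_trans (early k0)); rewrite ler_peMr ?exprn_ge0 ?addr_ge0//.
      by rewrite exprn_ege1// ler1n.
  apply: (le_trans (SS k)); rewrite exprS mulrCA; apply: ler_pM => //.
  - by rewrite addr_ge0// divr_ge0.
  - have -> : (2 : R) = 1 + 1 by ring.
    rewrite lerD2l ler_pdivrMr ?ltr0n// mul1r ltW// (lt_trans mk)// ltr_nat.
    by rewrite ltnS ltnW.
  - exact: IH.
move=> k; apply: le_trans (late k); rewrite /S big_ord_recr /= lerDr.
by apply: sumr_ge0.
Qed.

Definition jpole l := exists2 k : nat, (0 < k)%N & den l k = 0.

Lemma den_lip l z k : nc (den l k - den z k) = 2 * nc (l - z).
Proof.
have -> : den l k - den z k = - (2 * 'i * (l - z)) by rewrite /den; ring.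
rewrite ncN ncM ncM nci mulr1; congr (_ * _).
exact: (@ncn R 2).
Qed.

(** The denominators grow linearly in [k] and are distinct, so near [z] all but at
    most one of them are bounded below. The index [0] encodes that none is small. *)
Lemma den_far z : exists2 d : R, 0 < d & exists p : nat, (p = 0%N \/ (0 < p)%N /\ den z p = 0) /\
  forall l k, nc (l - z) < d -> (0 < k)%N -> k != p -> d <= nc (den l k).
Proof.
have [k1 hk1] : exists k1 : nat, forall k, (k1 < k)%N -> A <= nc (den z k).
  exists (Num.bound ((nc (2 * 'i * z) + A) / A)) => k kk.
  have h : (nc (2 * 'i * z) + A) / A < k%:R.
    apply: lt_trans (archi_boundP _) _; first by rewrite divr_ge0 ?addr_ge0 ?nc_ge0// ltW.
    by rewrite ltr_nat.
  rewrite ltr_pdivrMr// in h; apply: le_trans (nc_dist _ _).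
  by rewrite ncR ger0_norm ?mulr_ge0 ?(ltW A0)//; move: h; lra.
have [e e0 he] : exists2 e : R, 0 < e & forall k, (k <= k1)%N -> den z k != 0 -> e <= nc (den z k).
  elim: (k1) => [|n [e e0 he]].
    have [d0|d0] := eqVneq (den z 0) 0.
      by exists 1 => // k; rewrite leqn0 => /eqP ->; rewrite d0 eqxx.
    by exists (nc (den z 0)); [rewrite nc_gt0|move=> k; rewrite leqn0 => /eqP ->].
  have [d0|d0] := eqVneq (den z n.+1) 0.
    exists e => // k; rewrite leq_eqVlt => /predU1P[->|]; first by rewrite d0 eqxx.
    by rewrite ltnS; exact: he.
  exists (Num.min e (nc (den z n.+1))); first by rewrite lt_min e0 nc_gt0.
  move=> k; rewrite leq_eqVlt => /predU1P[->|]; first by rewrite ge_min lexx orbT.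
  by rewrite ltnS => kn kd; rewrite ge_min he.
pose f := Num.min e A; have f0 : 0 < f by rewrite lt_min e0.
have hf k : den z k != 0 -> f <= nc (den z k).
  move=> dk; have [kk|kk] := leqP k k1; first by rewrite ge_min he.
  by rewrite ge_min hk1 ?orbT.
have uniq k p : den z k = 0 -> den z p = 0 -> k = p.
  rewrite /den => /eqP; rewrite subr_eq0 => /eqP hk /eqP; rewrite subr_eq0 -hk => /eqP hp.
  have := complexI hp; move=> /(mulfI (lt0r_neq0 A0))/eqP; rewrite eqr_nat => /eqP ->.
  by [].
have [p hp] : exists p, (p = 0%N \/ (0 < p)%N /\ den z p = 0) /\ forall k, (0 < k)%N -> k != p -> den z k != 0.
  have [[p p0 hp]|np] := pselect (jpole z).
    exists p; split; first by right.
    by move=> k k0; apply: contra => /eqP dk; apply/eqP; exact: uniq dk hp.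
  exists 0%N; split; first by left.
  by move=> k k0 _; apply/eqP => dk; apply: np; exists k.
exists (f / 3); first by rewrite divr_gt0.
exists p; split; first exact: hp.1.
move=> l k lz k0 kp; have h1 := hf k (hp.2 k k0 kp).
have h2 := den_lip l z k; have h3 := nc_dist (den z k) (den l k); rewrite ncB h2 in h3.
lra.
Qed.

(* Weight killing the possible pole near [z]. *)
Definition dpole (p : nat) l : C := if p is 0%N then 1 else den l p.

(** Multiplying by the one small denominator, and only from its index on, leaves
    a recursion with bounded coefficients to which [growth] applies. *)
Lemma jcoef_bound z (d : R) (p : nat) : 0 < d -> (p = 0%N \/ (0 < p)%N /\ den z p = 0) ->
  (forall l k, nc (l - z) < d -> (0 < k)%N -> k != p -> d <= nc (den l k)) ->
  exists2 K : R, 0 <= K & forall l k, nc (l - z) < d -> nc (dpole p l * jcoef l k) <= K * (2 / rho) ^+ k.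
Proof.
move=> d0 pz hd; pose G := 1 + 2 * d; pose m := M * G / (A * d) + M / A * G.
have G1 : 1 <= G by rewrite lerDl mulr_ge0// ltW.
have G0 : 0 <= G by exact: le_trans G1.
have m0 : 0 <= m by rewrite addr_ge0 ?mulr_ge0 ?divr_ge0 ?invr_ge0 ?mulr_ge0 ?(ltW A0) ?(ltW d0).
exists (G * (1 + m) ^+ (Num.bound m)); first by apply: mulr_ge0 => //; apply: exprn_ge0; exact: addr_ge0.
move=> l k lz.
have Dl : nc (dpole p l) <= G.
  rewrite /dpole; case: p pz hd => [|p] pz hd; first by rewrite nc1.
  case: pz => // -[_ dz]; have -> : den l p.+1 = den l p.+1 - den z p.+1 by rewrite dz subr0.
  by rewrite den_lip /G; have := ltW lz; lra.
pose B k := (if (k < p)%N then 1 else nc (dpole p l)) * (rho ^+ k * nc (jcoef l k)).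
have B0 j : 0 <= B j by rewrite /B; case: ifP => _; rewrite !mulr_ge0 ?nc_ge0 ?exprn_ge0 ?(ltW rho0).
have BE j : nc (dpole p l) * (rho ^+ j * nc (jcoef l j)) <= G * B j.
  have e0 : 0 <= rho ^+ j * nc (jcoef l j) by rewrite mulr_ge0 ?nc_ge0 ?exprn_ge0 ?(ltW rho0).
  rewrite /B; case: ifP => _; first by rewrite mul1r ler_wpM2r.
  by rewrite ler_peMl// mulr_ge0// nc_ge0.
have B1 : B 0%N <= 1.
  rewrite /B jcoef0 nc1 expr0 !mulr1 /dpole; case: p {pz hd Dl B B0 BE} => [|p].
    by rewrite nc1 ltnn.
  by rewrite ltn0Sn.
have sumE j : rho ^+ j.+1 * nc (\sum_(i < j.+1) a (j.+1 - i)%N * jcoef l i) <=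
     M * \sum_(i < j.+1) rho ^+ i * nc (jcoef l i).
  rewrite mulr_sumr; apply: (le_trans (ler_wpM2l _ (nc_sum _ _ _))); first by rewrite exprn_ge0// ltW.
  rewrite mulr_sumr; apply: ler_sum => i _.
  have ij : (i <= j.+1)%N by rewrite ltnW.
  have {1}-> : j.+1 = (j.+1 - i + i)%N by rewrite subnK.
  rewrite ncM exprD mulrACA; apply: ler_wpM2r.
    by rewrite mulr_ge0 ?nc_ge0 ?exprn_ge0 ?(ltW rho0).
  have := ha (j.+1 - i); rewrite ler_pdivlMr ?exprn_gt0//.
  by rewrite mulrC.
have T0 j : 0 <= \sum_(i < j.+1) rho ^+ i * nc (jcoef l i).
  by apply: sumr_ge0 => i _; rewrite mulr_ge0 ?nc_ge0 ?exprn_ge0 ?(ltW rho0).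
have rec j : nc (den l j.+1) * (rho ^+ j.+1 * nc (jcoef l j.+1)) <=
    M / A / j.+1%:R * \sum_(i < j.+1) rho ^+ i * nc (jcoef l i).
  rewrite jcoefS ncM ncV ncM ncR.
  have AJ : 0 < A * j.+1%:R by rewrite mulr_gt0.
  rewrite gtr0_norm// invfM.
  have [->|dn] := eqVneq (den l j.+1) 0.
    by rewrite nc0 mul0r mulr_ge0// !mulr_ge0 ?invr_ge0 ?(ltW A0).
  have ndn : nc (den l j.+1) != 0 by rewrite gt_eqF// nc_gt0.
  have := sumE j; rewrite -(ler_pM2r (_ : 0 < (A * j.+1%:R)^-1)) ?invr_gt0//.
  congr (_ <= _); last by rewrite [X in _ * X]invfM; move: (\sum_(i < _) _) => s; ring.
  move: (nc (\sum_(i < _) _)) (A * _)^-1 (rho ^+ _) => s t r.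
  by field; rewrite ndn.
have BS j : B j.+1 <= m / j.+1%:R * \sum_(i < j.+1) B i.
  have SB0 : 0 <= \sum_(i < j.+1) B i by apply: sumr_ge0.
  have le1 : \sum_(i < j.+1) rho ^+ i * nc (jcoef l i) <= \sum_(i < j.+1) B i \/ (p <= j)%N.
    have [pj|jp] := leqP p j; first by right.
    left; apply: ler_sum => i _; rewrite /B ifT ?mul1r//.
    by apply: leq_trans jp.
  have leD : nc (dpole p l) * \sum_(i < j.+1) rho ^+ i * nc (jcoef l i) <= G * \sum_(i < j.+1) B i.
    by rewrite !mulr_sumr; apply: ler_sum => i _.
  have j0 : 0 < j.+1%:R :> R by rewrite ltr0n.
  have MAG : M / A * G <= m by rewrite /m lerDr divr_ge0 ?mulr_ge0 ?(ltW A0) ?(ltW d0).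
  have MA : M / A <= m by apply: le_trans MAG; rewrite ler_peMr// divr_ge0// ltW.
  have MAd : M * G / (A * d) <= m by rewrite /m lerDl mulr_ge0// divr_ge0// ltW.
  have MAd1 : M / (A * d) <= m.
    by apply: le_trans MAd; rewrite ler_wpM2r ?invr_ge0 ?mulr_ge0 ?(ltW A0) ?(ltW d0)// ler_peMr.
  have [pj|jp] := eqVneq j.+1 p.
    have -> : B j.+1 = nc (den l j.+1) * (rho ^+ j.+1 * nc (jcoef l j.+1)).
      by rewrite /B -pj ltnn.
    apply: (le_trans (rec j)); apply: ler_pM => //.
    - by rewrite divr_ge0 ?divr_ge0 ?(ltW A0).
    - by rewrite ler_wpM2r// invr_ge0.
    - by case: le1 => //; rewrite -pj ltnn.
  have dl := hd l j.+1 lz isT jp.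
  have rec' : rho ^+ j.+1 * nc (jcoef l j.+1) <= M / (A * d) / j.+1%:R * \sum_(i < j.+1) rho ^+ i * nc (jcoef l i).
    have x0 : 0 <= rho ^+ j.+1 * nc (jcoef l j.+1) by rewrite mulr_ge0 ?nc_ge0 ?exprn_ge0 ?(ltW rho0).
    have := le_trans (ler_wpM2r x0 dl) (rec j).
    rewrite -(ler_pM2l (_ : 0 < d^-1)) ?invr_gt0// mulKf ?gt_eqF//.
    move=> /le_trans; apply; rewrite le_eqVlt; apply/orP; left; apply/eqP.
    by rewrite invfM; move: (\sum_(i < _) _) => s; ring.
  rewrite {1}/B; case: ltnP => jp'.
    rewrite mul1r; apply: (le_trans rec'); apply: ler_pM => //.
    - by rewrite !divr_ge0// mulr_ge0// ltW.
    - by rewrite ler_wpM2r// invr_ge0.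
    - by case: le1 => //; rewrite leqNgt (ltnW jp').
  apply: (le_trans (ler_wpM2l (nc_ge0 _) rec')).
  rewrite mulrCA; apply: (@le_trans _ _ (M / (A * d) / j.+1%:R * (G * \sum_(i < j.+1) B i))).
    by apply: ler_wpM2l => //; rewrite !divr_ge0// mulr_ge0// ltW.
  rewrite mulrA; apply: ler_wpM2r => //.
  rewrite mulrAC; apply: ler_wpM2r; first by rewrite invr_ge0.
  by rewrite mulrAC.
have := growth m0 B0 B1 BS k => h.
rewrite ncM; have rk : 0 < rho ^+ k by rewrite exprn_gt0.
have -> : G * (1 + m) ^+ Num.bound m * (2 / rho) ^+ k = G * ((1 + m) ^+ Num.bound m * 2 ^+ k) / rho ^+ k.
  by rewrite expr_div_n; move: (_ ^+ Num.bound m) (2 ^+ k) (rho ^+ k)^-1 => s t r; ring.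
rewrite ler_pdivlMr//; apply: le_trans (ler_wpM2l G0 h); apply: le_trans (BE k).
by rewrite -mulrA [nc (jcoef l k) * _]mulrC.
Qed.

Lemma jcoef_hol z k : ~ jpole z -> cdiffable (fun l => jcoef l k) z.
Proof.
move=> nz; elim/ltn_ind: k => -[|k] IH; first exact: cdiffable_cst.
have -> : (fun l => jcoef l k.+1) = (fun l => (\sum_(j < k.+1) a (k.+1 - j)%N * jcoef l j) *
    (((A * k.+1%:R)%:C * den l k.+1)^-1)) by apply/funext => l; rewrite jcoefS.
apply: cdiffableM.
  have : forall n, (n <= k.+1)%N -> cdiffable (fun l => \sum_(j < n) a (k.+1 - j)%N * jcoef l j) z.
    elim=> [|n IHn] nk.
      have -> : (fun l => \sum_(j < 0) a (k.+1 - j)%N * jcoef l j) = fun=> 0 by apply/funext => l; rewrite big_ord0.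
      exact: cdiffable_cst.
    have -> : (fun l => \sum_(j < n.+1) a (k.+1 - j)%N * jcoef l j) =
       fun l => \sum_(j < n) a (k.+1 - j)%N * jcoef l j + a (k.+1 - n)%N * jcoef l n.
      by apply/funext => l; rewrite big_ord_recr.
    apply: cdiffableD; first by apply: IHn; exact: ltnW.
    by apply: cdiffableM; [exact: cdiffable_cst|exact: IH].
  exact.
apply: cdiffableV.
  rewrite mulf_neq0//; last by apply/eqP => d0; apply: nz; exists k.+1.
  by apply: nc_neq0; rewrite ncR normr_gt0 mulf_neq0 ?pnatr_eq0// gt_eqF.
apply: cdiffableM; first exact: cdiffable_cst.
apply: cdiffableB; first exact: cdiffable_cst.
by apply: cdiffableM; [exact: cdiffable_cst|exact: cdiffable_id].
Qed.

Lemma jpole_isolated z : exists2 d : R, 0 < d & forall l, nc (l - z) < d -> l != z -> ~ jpole l.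
Proof.
have [d d0 [p [hp hd]]] := den_far z; exists d => // l lz lnz [k k0 dk].
have [kp|kp] := eqVneq k p; last by have := hd l k lz k0 kp; rewrite dk nc0 leNgt d0.
case: hp => [p0|[p0 dz]]; first by move: k0; rewrite kp p0.
have := den_lip l z k; rewrite dk kp dz subr0 nc0 => /eqP; rewrite eq_sym mulf_eq0 pnatr_eq0 /=.
by move=> /eqP/nc_eq0/eqP; rewrite subr_eq0 (negPf lnz).
Qed.

(** The poles are the points [- i A k / 2] with [k] positive. *)
Lemma jpole_Im l : jpole l -> cIm l < 0.
Proof.
move=> [k k0 /(congr1 (fun z : C => cRe z))]; rewrite /den ReB ReM !ReM !ImM /= => h.
have : 0 < A * k%:R by rewrite mulr_gt0// ltr0n.
by move: h; move: (A * k%:R) (cIm l) (cRe l) => p q r; lra.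
Qed.

(** The coefficient of [w^k] in the differential equation, by
    [(i l - A k)^2 + l^2 = A k (A k - 2 i l)]. *)
Lemma jcoef_rec l k : ~ jpole l ->
  ('i * l - (A * k%:R)%:C) ^+ 2 * jcoef l k =
  - l ^+ 2 * jcoef l k + \sum_(j < k) a (k - j)%N * jcoef l j.
Proof.
move=> nl.
have e : ('i * l - (A * k%:R)%:C) ^+ 2 = - l ^+ 2 + (A * k%:R)%:C * den l k.
  have i2 : 'i * 'i = -1 :> C by rewrite -expr2 sqr_i.
  rewrite /den; move: ((A * k%:R)%:C) => p.
  have -> : ('i * l - p) ^+ 2 = ('i * 'i) * l ^+ 2 - 2 * 'i * l * p + p ^+ 2 by ring.
  by rewrite i2; ring.
rewrite e mulrDl; congr (_ + _); case: k {e} => [|k].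
  by rewrite big_ord0 mulr0 /= !mul0r.
rewrite jcoefS mulrC divfK// mulf_neq0//; last by apply/eqP => d0; apply: nl; exists k.+1.
by apply: nc_neq0; rewrite ncR normr_gt0 mulf_neq0 ?pnatr_eq0// gt_eqF.
Qed.

End JostCoefficients.

(** * Jost solutions *)

Section JostSolution.
Variable R : realType.
Local Notation C := R[i].
Variables (V : R -> R) (B0 : R).
Hypotheses (cV : continuous V) (bV : forall x, `|V x| <= B0).
Implicit Types (l z : C) (x t : R).

Definition cs0 := sol0 V 1 0.
Definition cs1 := sol1 V 1 0.
Definition sn0 := sol0 V 0 1.
Definition sn1 := sol1 V 0 1.

Lemma cs_sol l x y : issol (pot V l) x y (cs0 l) (cs1 l).
Proof. exact: (sol_AC cV bV). Qed.
Lemma sn_sol l x y : issol (pot V l) x y (sn0 l) (sn1 l).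
Proof. exact: (sol_AC cV bV). Qed.

(** Abel's identity, evaluated at the origin. *)
Lemma cs_sn_wronskian l x : cs0 l x * sn1 l x - cs1 l x * sn0 l x = 1.
Proof.
have init : cs0 l 0 * sn1 l 0 - cs1 l 0 * sn0 l 0 = 1.
  have [h1 h2] := sol_init V 1 0 l; have [h3 h4] := sol_init V 0 1 l.
  by rewrite /cs0 /cs1 /sn0 /sn1 h1 h2 h3 h4 mulr1 mul0r subr0.
have [x0|/ltW x0] := leP 0 x.
  by rewrite -init; exact: wronskian_const x0 (cs_sol l 0 x) (sn_sol l 0 x).
by rewrite -init; apply/esym; exact: wronskian_const x0 (cs_sol l x 0) (sn_sol l x 0).
Qed.

Lemma sol_coord l x (u u1 : C) :
  u = (u * sn1 l x - u1 * sn0 l x) * cs0 l x + (cs0 l x * u1 - cs1 l x * u) * sn0 l x /\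
  u1 = (u * sn1 l x - u1 * sn0 l x) * cs1 l x + (cs0 l x * u1 - cs1 l x * u) * sn1 l x.
Proof.
have w := cs_sn_wronskian l x; split.
  by rewrite -{1}[u]mulr1 -w; move: (cs0 l x) (cs1 l x) (sn0 l x) (sn1 l x) => *; ring.
by rewrite -{1}[u1]mulr1 -w; move: (cs0 l x) (cs1 l x) (sn0 l x) (sn1 l x) => *; ring.
Qed.

Variables (sg A : R) (F : C -> C) (r0 rho : R) (M : R) (a : nat -> C).
Hypotheses (sg1 : sg = 1 \/ sg = -1) (A0 : 0 < A) (rho0 : 0 < rho) (M0 : 0 <= M).
Hypothesis ha : forall n, nc (a n) <= M / rho ^+ n.
Hypothesis a00 : a 0%N = 0.
Hypothesis hF : forall w, nc w <= rho / 2 -> cseries (fun n => a n * w ^+ n) (F w) (2 * M).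
Hypothesis VF : forall x, r0 < sg * x -> (V x)%:C = F (expR (- A * (sg * x)))%:C.

Let b := jcoef A a.
Let pole l := jpole A l.

(* The base point lies so far out that the series converges with ratio 1/32. *)
Let X1 : R := Num.max (r0 + 1) (- ln (rho / 64) / A).
Let x1 : R := sg * X1.
Let wx x : R := expR (- A * (sg * x)).
Let ck l k : C := sg%:C * ('i * l - (A * k%:R)%:C).
Let E l x : C := cexp (sg%:C * 'i * l * (x - x1)%:C).

Let sgsg : sg * sg = 1. Proof. by case: sg1 => ->; rewrite ?mulr1 ?mulrNN ?mulr1. Qed.
Let sgx1 : sg * x1 = X1. Proof. by rewrite /x1 mulrA sgsg mul1r. Qed.
Let nsg : nc (sg%:C : C) = 1. Proof. by rewrite ncR; case: sg1 => ->; rewrite ?normrN normr1. Qed.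

Let wx0 x : 0 < wx x. Proof. exact: expR_gt0. Qed.
Let nwx x : nc ((wx x)%:C : C) = wx x. Proof. by rewrite ncR gtr0_norm. Qed.

Let wx_le x : X1 <= sg * x -> wx x <= rho / 64.
Proof.
move=> h; have r64 : 0 < rho / 64 by rewrite divr_gt0.
rewrite /wx -[leRHS]lnK ?posrE// ler_expR mulNr lerNl.
rewrite [A * _]mulrC -ler_pdivrMr//; apply: le_trans h.
by rewrite /X1 le_max lexx orbT.
Qed.

Let far x : X1 <= sg * x -> r0 < sg * x.
Proof.
move=> h; apply: lt_le_trans h; rewrite /X1 lt_max ltrDl ltr01 //.
Qed.

Let wx_cexp x k : (wx x)%:C ^+ k = cexp ((sg * - (A * k%:R) * x)%:C) :> C.
Proof.
rewrite -cexp_real -cexpMn; congr cexp.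
have -> : (k%:R : C) = (k%:R : R)%:C by rewrite rmorph_nat.
by rewrite -rmorphM; congr (_%:C); ring.
Qed.

Let ckE l k x : cexp (ck l k * x%:C) = cexp (sg%:C * 'i * l * x%:C) * (wx x)%:C ^+ k.
Proof.
rewrite wx_cexp -cexpD; congr cexp.
have -> : (sg * - (A * k%:R) * x)%:C = sg%:C * - (A * k%:R)%:C * x%:C :> C.
  by rewrite rmorphM /= (rmorphM _ sg) /= (rmorphN _ (A * k%:R)).
by rewrite /ck; move: (sg%:C : C) ((A * k%:R)%:C : C) (x%:C : C) => s p q; ring.
Qed.

Let N l := nc l + A + 1.
Let N1 l : 1 <= N l. Proof. by rewrite /N lerDr addr_ge0 ?nc_ge0 ?ltW. Qed.

Let ck_bound l k : nc (ck l k) <= N l * 2 ^+ k.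
Proof.
rewrite /ck ncM nsg mul1r (le_trans (ncDB _ _))// ncM nci mul1r ncR ger0_norm ?mulr_ge0 ?(ltW A0)//.
have k2 : k%:R <= 2 ^+ k :> R by rewrite -natrX ler_nat ltnW// ltn_expl.
have p1 : 1 <= 2 ^+ k :> R by rewrite exprn_ege1// ler1n.
have := ler_wpM2l (ltW A0) k2; have := ler_wpM2l (nc_ge0 l) p1; rewrite /N; lra.
Qed.

Let wpow x k : X1 <= sg * x -> (2 / rho) ^+ k * nc ((wx x)%:C ^+ k : C) <= 1 / 32 ^+ k.
Proof.
move=> h; rewrite ncX nwx -exprMn.
have -> : 1 / 32 ^+ k = (1 / 32) ^+ k :> R by rewrite expr_div_n expr1n.
rewrite lerXn2r ?nnegrE ?mulr_ge0 ?invr_ge0 ?(ltW rho0) ?(ltW (wx0 _))//.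
have := wx_le h; rewrite mulrAC ler_pdivrMr//; lra.
Qed.

Let good (p : nat) l (K : R) := 0 <= K /\ forall k, nc (dpole A p l * b l k) <= K * (2 / rho) ^+ k.

Let term_bound p l K k x (D : C) (S : R) : good p l K -> X1 <= sg * x -> 1 <= S -> nc D <= S * 4 ^+ k ->
  nc (dpole A p l * (D * b l k * (wx x)%:C ^+ k)) <= K * S / 4 ^+ k.
Proof.
move=> [K0 hK] hx S1 hD; have S0 : 0 <= S by exact: le_trans S1.
have -> : dpole A p l * (D * b l k * (wx x)%:C ^+ k) = D * (dpole A p l * b l k) * (wx x)%:C ^+ k by ring.
rewrite !ncM -mulrA; apply: (@le_trans _ _ (S * 4 ^+ k * (K * (1 / 32 ^+ k)))).
  apply: ler_pM; rewrite ?nc_ge0 ?mulr_ge0 ?nc_ge0//.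
  apply: (le_trans (ler_wpM2r (nc_ge0 _) _)); first by rewrite -ncM; exact: hK.
  by rewrite -mulrA; apply: ler_wpM2l => //; exact: wpow.
have -> : S * 4 ^+ k * (K * (1 / 32 ^+ k)) = K * S * (4 ^+ k / 32 ^+ k) by ring.
apply: ler_wpM2l; first by rewrite mulr_ge0.
rewrite ler_pdivrMr ?exprn_gt0// mulrC ler_pdivlMr ?exprn_gt0// -exprMn.
by rewrite lerXn2r ?nnegrE//; lra.
Qed.

Let d4 T k : 0 <= T -> T / 4 ^+ k <= T / 2 ^+ k :> R.
Proof.
move=> T0; rewrite ler_wpM2l// lef_pV2 ?posrE ?exprn_gt0//.
rewrite lerXn2r ?nnegrE//; lra.
Qed.

Let jm l x := csum (fun k => 1 * b l k * (wx x)%:C ^+ k).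
Let jn l x := csum (fun k => ck l k * b l k * (wx x)%:C ^+ k).
Definition jost_u l x : C := E l x * jm l x.
Definition jost_v l x : C := E l x * jn l x.

Let m_bound k l : nc (1 : C) <= N l * 4 ^+ k.
Proof.
rewrite nc1 -[1]mulr1; apply: ler_pM => //; rewrite exprn_ege1//; lra.
Qed.

Let n_bound k l : nc (ck l k) <= N l * 4 ^+ k.
Proof.
apply: (le_trans (ck_bound l k)); apply: ler_wpM2l; first exact: le_trans (N1 l).
by rewrite lerXn2r ?nnegrE//; lra.
Qed.

Let n2_bound k l : nc (ck l k * ck l k) <= N l ^+ 2 * 4 ^+ k.
Proof.
rewrite ncM pow4 expr2 mulrACA; apply: ler_pM; rewrite ?nc_ge0//; exact: ck_bound.
Qed.

Let dm_bound p l K k x : good p l K -> X1 <= sg * x ->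
  nc (dpole A p l * (1 * b l k * (wx x)%:C ^+ k)) <= K * N l / 2 ^+ k /\
  nc (dpole A p l * (ck l k * b l k * (wx x)%:C ^+ k)) <= K * N l / 2 ^+ k.
Proof.
move=> g hx; have K0 := g.1; have KN : 0 <= K * N l by rewrite mulr_ge0// (le_trans _ (N1 l)).
split; apply: le_trans (d4 k KN).
  by apply: term_bound.
by apply: term_bound.
Qed.

Let good_near z : exists2 d : R, 0 < d & exists p : nat, [/\ p = 0%N \/ (0 < p)%N /\ den A z p = 0,
  (forall l, nc (l - z) < d -> p = 0%N -> ~ pole l) &
  exists K : R, forall l, nc (l - z) < d -> good p l K].
Proof.
have [d d0 [p [hp hd]]] := den_far A0 z; exists d => //; exists p; split => //.
  move=> l lz p0 [k k0 dk]; have := hd l k lz k0.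
  by rewrite p0 -lt0n dk nc0 leNgt d0 => /(_ k0).
have [K K0 hK] := jcoef_bound A0 rho0 M0 ha d0 hp hd.
by exists K => l lz; split => // k; exact: hK.
Qed.

Let good0 l : ~ pole l -> exists K, good 0 l K.
Proof.
move=> nl; have [d d0 [p [hp hd [K hK]]]] := good_near l.
exists K; have gp := hK l _; rewrite subrr nc0 in gp.
case: hp => [p0|[p0 dp]]; first by rewrite -p0; exact: gp.
by exfalso; apply: nl; exists p.
Qed.

Let b_cseries l K x : good 0 l K -> X1 <= sg * x ->
  cseries (fun k => 1 * b l k * (wx x)%:C ^+ k) (jm l x) (4 * (K * N l)) /\
  cseries (fun k => ck l k * b l k * (wx x)%:C ^+ k) (jn l x) (4 * (K * N l)).
Proof.
move=> g hx; split; apply: csumP => k.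
  by have := (dm_bound k g hx).1; rewrite [dpole _ _ _ * _]mul1r.
by have := (dm_bound k g hx).2; rewrite [dpole _ _ _ * _]mul1r.
Qed.

Let nE l x : nc (E l x) = expR (- cIm l * (sg * x - X1)).
Proof.
rewrite /E nc_cexp; congr expR.
have -> : sg%:C * 'i * l * (x - x1)%:C = 'i * l * (sg * (x - x1))%:C.
  by rewrite rmorphM /=; ring.
by rewrite mulrBr sgx1 !ReM !ImM /= !mul0r !mul1r !mulr0 add0r subr0.
Qed.

Let Econt l : ccont (E l).
Proof.
have -> : E l = fun x => cexp (- (sg%:C * 'i * l * x1%:C)) * cexp (sg%:C * 'i * l * x%:C).
  apply/funext => x; rewrite /E -cexpD; congr cexp; rewrite rmorphB /=; ring.
by apply: ccontZ; apply: AC_ccont => u v; exact: AC_cexp.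
Qed.

Let convex x y t : X1 <= sg * x -> X1 <= sg * y -> x <= t <= y -> X1 <= sg * t.
Proof.
move=> hx hy /andP[xt ty]; case: sg1 => s1; move: hx hy; rewrite s1; lra.
Qed.

Let U l k x := E l x * (1 * b l k * (wx x)%:C ^+ k).

Let UE l k x : U l k x = b l k * cexp (- (sg%:C * 'i * l * x1%:C)) * cexp (ck l k * x%:C).
Proof.
rewrite ckE /U /E rmorphB mulrBr cexpD; move: (cexp _) (cexp _) (b l k) => p q s.
by move: (_ ^+ k) => v; ring.
Qed.

Let U_AC l k x y : AC x y (fun t => ck l k * U l k t) (U l k).
Proof.
apply: eq_AC (AC_Z (b l k * cexp (- (sg%:C * 'i * l * x1%:C))) (AC_cexp (ck l k) x y)) => t _.
  by rewrite UE mulrCA.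
by rewrite UE.
Qed.

Let U_cont l k : ccont (U l k).
Proof. by apply: AC_ccont => x y; exact: U_AC. Qed.

(** Termwise differentiation of the Frobenius series; the recursion for the
    coefficients turns the second derivative into [V - l^2] times the series. *)
Lemma jost_issol l x y : ~ pole l -> x <= y -> X1 <= sg * x -> X1 <= sg * y ->
  issol (pot V l) x y (jost_u l) (jost_v l).
Proof.
move=> nl xy hx hy; have [K g] := good0 nl.
have K0 := g.1; have N0 : 0 <= N l by exact: le_trans (N1 l).
have [G G0 hG] := ccont_on_bounded xy (@Econt l x y).
have reg t : x <= t <= y -> X1 <= sg * t by exact: convex.
have ser t : x <= t <= y -> cseries (fun k => U l k t) (jost_u l t) (G * (4 * (K * N l))) /\
    cseries (fun k => ck l k * U l k t) (jost_v l t) (G * (4 * (K * N l))).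
  move=> ht; have [h1 h2] := b_cseries g (reg t ht).
  have le : nc (E l t) * (4 * (K * N l)) <= G * (4 * (K * N l)).
    by apply: ler_wpM2r; [rewrite mulr_ge0// mulr_ge0|exact: hG].
  split; first by apply: cseriesW le _; exact: cseriesZ.
  apply: cseriesW le _; apply: eq_cseries (cseriesZ (E l t) h2) => k.
  by rewrite /U; ring.
split.
  apply: (@AC_sum _ x y (fun k t => ck l k * U l k t) (fun k t => U l k t) _ _ (G * (4 * (K * N l)))) => //.
  - by move=> k; apply: ccontZ; exact: U_cont.
  - by move=> t ht; have [] := ser t ht.
  - by move=> t ht; have [] := ser t ht.
have [P0 hP] : exists P : R, forall t, x <= t <= y ->
    cseries (fun k => ck l k * (ck l k * U l k t)) (pot V l t * jost_u l t) P.
  exists (G * (4 * (K * N l ^+ 2))) => t ht.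
  have ht' := reg t ht; have [h1 _] := b_cseries g ht'.
  have hf k : nc (1 * b l k * (wx t)%:C ^+ k) <= (K * N l) / 4 ^+ k.
    have := @term_bound 0%N l K k t 1 (N l) g ht' (N1 l) (m_bound k l).
    by rewrite [dpole _ _ _ * _]mul1r.
  have w64 : wx t <= rho / 64 by exact: wx_le.
  have hg k : nc (a k * (wx t)%:C ^+ k) <= M / 4 ^+ k.
    rewrite ncM ncX nwx; apply: (@le_trans _ _ (M / rho ^+ k * (rho / 4) ^+ k)).
      apply: ler_pM; rewrite ?nc_ge0 ?exprn_ge0 ?(ltW (wx0 _))//.
      have r4 : wx t <= rho / 4 by apply: le_trans w64 _; rewrite ler_wpM2l ?(ltW rho0)// lef_pV2 ?posrE// ler_nat.
      by apply: lerXn2r => //; rewrite nnegrE ?(ltW (wx0 _))// divr_ge0// ltW.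
    by rewrite expr_div_n mulrA divfK// expf_neq0// gt_eqF.
  have KN0 : 0 <= K * N l by rewrite mulr_ge0.
  have [Q hQ] := cauchy_product KN0 M0 hf hg.
  have Fw : csum (fun k => a k * (wx t)%:C ^+ k) = (V t)%:C.
    rewrite (VF (far ht')); apply: csum_eq; apply: hF; rewrite nwx.
    by apply: le_trans w64 _; rewrite ler_wpM2l ?(ltW rho0)// lef_pV2 ?posrE// ler_nat.
  rewrite Fw in hQ.
  have hS : cseries (fun k => ck l k * ck l k * b l k * (wx t)%:C ^+ k) (pot V l t * jm l t) (nc (- l ^+ 2) * (4 * (K * N l)) + Q).
    have -> : pot V l t * jm l t = - l ^+ 2 * jm l t + jm l t * (V t)%:C by rewrite /pot; ring.
    apply: eq_cseries (cseriesD (cseriesZ (- l ^+ 2) h1) hQ) => k.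
    have c2 : ck l k * ck l k = ('i * l - (A * k%:R)%:C) ^+ 2.
      by rewrite /ck mulrACA -rmorphM sgsg mul1r.
    rewrite c2 (jcoef_rec a A0 k nl) mulrDl mul1r; congr (_ + _); first by rewrite mulrA.
    rewrite big_ord_recr /= subnn a00 !mul0r mulr0 addr0 mulr_suml.
    apply: eq_bigr => j _; rewrite mul1r.
    have -> : (wx t)%:C ^+ k = (wx t)%:C ^+ (k - j) * (wx t)%:C ^+ j :> C by rewrite -exprD subnK// ltnW.
    rewrite /b; move: (a _) (jcoef _ _ _ _) (_ ^+ (k - j)) (_ ^+ j) => p q r s; ring.
  have hS2 : cseries (fun k => ck l k * ck l k * b l k * (wx t)%:C ^+ k) (pot V l t * jm l t) (4 * (K * N l ^+ 2)).
    rewrite -(csum_eq hS); apply: csumP => k.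
    have N2 : 1 <= N l ^+ 2 by rewrite exprn_ege1.
    have := @term_bound 0%N l K k t (ck l k * ck l k) (N l ^+ 2) g ht' N2 (n2_bound k l).
    rewrite [dpole _ _ _ * _]mul1r => /le_trans; apply; apply: d4; rewrite mulr_ge0// exprn_ge0//.
  have le : nc (E l t) * (4 * (K * N l ^+ 2)) <= G * (4 * (K * N l ^+ 2)).
    by apply: ler_wpM2r; [rewrite mulr_ge0// mulr_ge0// exprn_ge0|exact: hG].
  apply: cseriesW le _; rewrite /jost_u mulrCA; apply: eq_cseries (cseriesZ (E l t) hS2) => k.
  by rewrite /U; ring.
pose L := Num.max P0 (G * (4 * (K * N l))).
apply: (@AC_sum _ x y (fun k t => ck l k * (ck l k * U l k t)) (fun k t => ck l k * U l k t) _ _ L) => //.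
- by move=> k; apply: AC_Z; exact: U_AC.
- by move=> k; apply: ccontZ; apply: ccontZ; exact: U_cont.
- by move=> t ht; apply: cseriesW (hP t ht); rewrite /L le_max lexx.
- by move=> t ht; apply: cseriesW (ser t ht).2; rewrite /L le_max lexx orbT.
Qed.

Definition jost_al l : C := jost_u l x1 * sn1 l x1 - jost_v l x1 * sn0 l x1.
Definition jost_be l : C := cs0 l x1 * jost_v l x1 - cs1 l x1 * jost_u l x1.

(** Both sides solve the same equation, and Wronskians with the basis are
    constant, so agreement at the base point propagates. *)
Lemma jost_coord l x : ~ pole l -> X1 <= sg * x ->
  jost_u l x = jost_al l * cs0 l x + jost_be l * sn0 l x /\
  jost_v l x = jost_al l * cs1 l x + jost_be l * sn1 l x.
Proof.
move=> nl hx; have hx1 : X1 <= sg * x1 by rewrite sgx1.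
have W q q1 : (forall y y2, issol (pot V l) y y2 q q1) ->
    jost_u l x * q1 x - jost_v l x * q x = jost_u l x1 * q1 x1 - jost_v l x1 * q x1.
  move=> hq; have [xx|/ltW xx] := leP x x1.
    by apply/esym; apply: (wronskian_const xx _ (hq _ _)); exact: jost_issol.
  by apply: (wronskian_const xx _ (hq _ _)); exact: jost_issol.
have al : jost_al l = jost_u l x * sn1 l x - jost_v l x * sn0 l x by rewrite /jost_al W// => *; exact: sn_sol.
have be : jost_be l = cs0 l x * jost_v l x - cs1 l x * jost_u l x.
  have w : jost_u l x * cs1 l x - jost_v l x * cs0 l x = jost_u l x1 * cs1 l x1 - jost_v l x1 * cs0 l x1.
    by apply: W => *; exact: cs_sol.
  have flip (p q r s p' q' r' s' : C) : p * q - r * s = p' * q' - r' * s' -> s' * r' - q' * p' = s * r - q * p.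
    move=> h.
    have e : s' * r' - q' * p' = - (p' * q' - r' * s') by ring.
    rewrite e -h.
    ring.
  have w2 := flip _ _ _ _ _ _ _ _ w.
  rewrite /jost_be.
  exact w2.
by rewrite al be; exact: (sol_coord l x (jost_u l x) (jost_v l x)).
Qed.

Let E1 l : E l x1 = 1. Proof. by rewrite /E subrr mulr0 cexp0. Qed.

Let base_hol z : ~ pole z -> cdiffable (fun l => jost_u l x1) z /\ cdiffable (fun l => jost_v l x1) z.
Proof.
move=> nz; have [d d0 [p [hp hd [K hK]]]] := good_near z.
have p0 : p = 0%N by case: hp => // -[p0 dp]; exfalso; apply: nz; exists p.
have hx1 : X1 <= sg * x1 by rewrite sgx1.
have w1 k w : cdiffable (fun _ : C => (wx x1)%:C ^+ k) w by exact: cdiffable_cst.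
pose d' := Num.min d 1; have d'0 : 0 < d' by rewrite lt_min d0 ltr01.
have K0 : 0 <= K by have := (hK z); rewrite subrr nc0 => /(_ d0)[].
have NN l : nc (l - z) < d' -> good 0 l K /\ K * N l <= K * (N z + 1).
  rewrite lt_min => /andP[ld l1]; split; first by rewrite -{1}p0; exact: hK.
  apply: ler_wpM2l => //; rewrite /N.
  have := ncD (l - z) z; rewrite subrK; have := ltW l1; lra.
have np l : nc (l - z) < d' -> ~ pole l by rewrite lt_min => /andP[ld _]; exact: hd.
have bh k l : nc (l - z) < d' -> cdiffable (fun l => b l k) l by move=> /np; exact: jcoef_hol.
have Kle k l : nc (l - z) < d' -> K * N l / 2 ^+ k <= K * (N z + 1) / 2 ^+ k.
  by move=> /NN[_ h]; rewrite ler_wpM2r// invr_ge0 exprn_ge0.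
have -> : (fun l => jost_u l x1) = (fun l => jm l x1) by apply/funext => l; rewrite /jost_u E1 mul1r.
have -> : (fun l => jost_v l x1) = (fun l => jn l x1) by apply/funext => l; rewrite /jost_v E1 mul1r.
split.
  apply: (@hol_sum _ (fun k l => 1 * b l k * (wx x1)%:C ^+ k) _ z d' (K * (N z + 1)) (4 * (K * (N z + 1)))) => //.
  - move=> k l ld; apply: cdiffableM => //; apply: cdiffableM; [exact: cdiffable_cst|exact: bh].
  - move=> k l ld; apply: le_trans (Kle k l ld); have [g _] := NN l ld.
    by have := (dm_bound k g hx1).1; rewrite [dpole _ _ _ * _]mul1r.
  - move=> l ld; have [g h] := NN l ld; apply: cseriesW (b_cseries g hx1).1.
    exact: ler_wpM2l.
apply: (@hol_sum _ (fun k l => ck l k * b l k * (wx x1)%:C ^+ k) _ z d' (K * (N z + 1)) (4 * (K * (N z + 1)))) => //.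
- move=> k l ld; apply: cdiffableM => //; apply: cdiffableM; last exact: bh.
  apply: cdiffableM; first exact: cdiffable_cst.
  apply: cdiffableB; last exact: cdiffable_cst.
  by apply: cdiffableM; [exact: cdiffable_cst|exact: cdiffable_id].
- move=> k l ld; apply: le_trans (Kle k l ld); have [g _] := NN l ld.
  by have := (dm_bound k g hx1).2; rewrite [dpole _ _ _ * _]mul1r.
- move=> l ld; have [g h] := NN l ld; apply: cseriesW (b_cseries g hx1).2.
  exact: ler_wpM2l.
Qed.

(** Near a pole of the coefficients the series is bounded after multiplication by
    [l - z], because only one denominator vanishes there, and to first order. *)
Let base_mero z : mero (fun l => jost_u l x1) z /\ mero (fun l => jost_v l x1) z.
Proof.
have [d d0 [p [hp hd [K hK]]]] := good_near z.
have [e e0 he] := jpole_isolated A0 z.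
have hx1 : X1 <= sg * x1 by rewrite sgx1.
have -> : (fun l => jost_u l x1) = (fun l => jm l x1) by apply/funext => l; rewrite /jost_u E1 mul1r.
have -> : (fun l => jost_v l x1) = (fun l => jn l x1) by apply/funext => l; rewrite /jost_v E1 mul1r.
have base l : ~ pole l -> cdiffable (fun l => jm l x1) l /\ cdiffable (fun l => jn l x1) l.
  move=> nl; have [h1 h2] := base_hol nl; split.
    by move: h1; congr (cdiffable _ l); apply/funext => u; rewrite /jost_u E1 mul1r.
  by move: h2; congr (cdiffable _ l); apply/funext => u; rewrite /jost_v E1 mul1r.
case: hp => [p0|[p0 dp]].
  by split; apply: (@mero_hol _ _ _ d) => // l ld; have [h1 h2] := base l (hd l ld p0).
pose f := Num.min (Num.min d e) 1.
have f0 : 0 < f by rewrite !lt_min d0 e0 ltr01.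
have K0 : 0 <= K by have := (hK z); rewrite subrr nc0 => /(_ d0)[].
have bnd l : nc (l - z) < f -> l != z ->
    nc ((l - z) ^+ 1 * jm l x1) <= 4 * (K * (N z + 1)) /\ nc ((l - z) ^+ 1 * jn l x1) <= 4 * (K * (N z + 1)).
  rewrite !lt_min => /andP[/andP[ld le] l1] lz.
  have nD : nc (dpole A p l) = 2 * nc (l - z).
    by have := den_lip A l z p; rewrite dp subr0 => <-; case: (p) p0.
  have lz0 : 0 < nc (l - z) by rewrite nc_gt0// subr_eq0.
  have NN : K * N l <= K * (N z + 1).
    apply: ler_wpM2l => //; rewrite /N.
    by have := ncD (l - z) z; rewrite subrK; have := ltW l1; lra.
  have g := hK l ld.
  have gen (h : nat -> C) : (forall k, nc (dpole A p l * h k) <= K * N l / 2 ^+ k) ->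
      nc ((l - z) ^+ 1 * csum h) <= 4 * (K * (N z + 1)).
    move=> hh; have hh' k : nc (h k) <= (K * N l / nc (dpole A p l)) / 2 ^+ k.
      rewrite mulrAC ler_pdivlMr ?nD ?mulr_gt0// -nD mulrC -ncM; exact: hh.
    rewrite expr1 ncM; have := cseries_le (csumP hh'); rewrite nD => h1.
    have := ler_wpM2l (ltW lz0) h1 => /le_trans; apply.
    have -> : nc (l - z) * (4 * (K * N l / (2 * nc (l - z)))) = 2 * (K * N l) by field; rewrite gt_eqF.
    have Nz0 : 0 <= N z by exact: le_trans (N1 z).
    apply: (@le_trans _ _ (2 * (K * (N z + 1)))); first exact: ler_wpM2l.
    by apply: ler_wpM2r; [apply: mulr_ge0 => //; exact: addr_ge0|rewrite ler_nat].
  by split; apply: gen => k; have [h1 h2] := dm_bound k g hx1.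
have nf l : nc (l - z) < f -> l != z -> ~ pole l.
  by rewrite !lt_min => /andP[/andP[_ le] _] lz; exact: he.
split; apply: (@mero_bounded _ _ _ 1 f (4 * (K * (N z + 1)))) => // l lf lz.
- by have [] := base l (nf l lf lz).
- by have [] := bnd l lf lz.
- by have [] := base l (nf l lf lz).
- by have [] := bnd l lf lz.
Qed.

Lemma jost_hol z : ~ pole z -> cdiffable jost_al z /\ cdiffable jost_be z.
Proof.
move=> nz; have [u v] := base_hol nz.
have [c0 c1] := sol_hol cV bV 1 0 x1 z; have [s0 s1] := sol_hol cV bV 0 1 x1 z.
by split; apply: cdiffableB; exact: cdiffableM.
Qed.

Lemma jost_mero z : mero jost_al z /\ mero jost_be z.
Proof.
have [u v] := base_mero z.
have ent (f : C -> C) : (forall w, cdiffable f w) -> mero f z.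
  by move=> df; apply: (@mero_hol _ _ _ 1).
have c0 : mero (fun l => cs0 l x1) z by apply: ent => w; have [] := sol_hol cV bV 1 0 x1 w.
have c1 : mero (fun l => cs1 l x1) z by apply: ent => w; have [] := sol_hol cV bV 1 0 x1 w.
have s0 : mero (fun l => sn0 l x1) z by apply: ent => w; have [] := sol_hol cV bV 0 1 x1 w.
have s1 : mero (fun l => sn1 l x1) z by apply: ent => w; have [] := sol_hol cV bV 0 1 x1 w.
have mB (f g : C -> C) : mero f z -> mero g z -> mero (fun l => f l - g l) z.
  move=> mf mg; apply: (@mero_eq _ (fun l => f l + (- 1) * g l) _ z 1) => //.
    by move=> l _ _; rewrite mulN1r.
  by apply: meroD => //; apply: meroM => //; exact: mero_cst.
by split; apply: mB; exact: meroM.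
Qed.

(** The power series in [w] is bounded, so the size is that of the exponential
    factor. *)
Lemma jost_decay l : ~ pole l -> exists K X : R, forall x, X <= sg * x ->
  nc (jost_al l * cs0 l x + jost_be l * sn0 l x) <= K * expR (- cIm l * (sg * x)) /\
  nc (jost_al l * cs1 l x + jost_be l * sn1 l x) <= K * expR (- cIm l * (sg * x)).
Proof.
move=> nl; have [K g] := good0 nl.
exists (expR (cIm l * X1) * (4 * (K * N l))), X1 => x hx.
have [<- <-] := jost_coord nl hx; have [h1 h2] := b_cseries g hx.
have e : nc (E l x) = expR (cIm l * X1) * expR (- cIm l * (sg * x)).
  by rewrite nE -expRD; congr expR; ring.
have gen (T : C) : nc T <= 4 * (K * N l) ->
    nc (E l x * T) <= expR (cIm l * X1) * (4 * (K * N l)) * expR (- cIm l * (sg * x)).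
  move=> hT; rewrite ncM e [leRHS]mulrAC; apply: ler_wpM2l => //.
by split; apply: gen; [exact: cseries_le h1|exact: cseries_le h2].
Qed.

(** Far out the series is dominated by its constant term, which is 1. *)
Lemma jost_nonzero l : ~ pole l -> jost_al l != 0 \/ jost_be l != 0.
Proof.
move=> nl; have [al0|al0] := eqVneq (jost_al l) 0; last by left.
have [be0|be0] := eqVneq (jost_be l) 0; last by right.
exfalso; have [K [K0 hK]] := good0 nl.
pose e := rho / (64 * (K + 1)); have e0 : 0 < e by rewrite divr_gt0 ?mulr_gt0// ltr_wpDl.
pose X := Num.max X1 (- ln e / A); pose x := sg * X.
have sx : sg * x = X by rewrite /x mulrA sgsg mul1r.
have hx : X1 <= sg * x by rewrite sx /X le_max lexx.
have wxe : wx x <= e.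
  rewrite /wx -[leRHS]lnK ?posrE// ler_expR mulNr lerNl sx.
  by rewrite [A * _]mulrC -ler_pdivrMr// /X le_max lexx orbT.
have [] := jost_coord nl hx; rewrite al0 be0 !mul0r addr0 => u0 _.
have jm0 : jm l x = 0.
  by move/eqP: u0; rewrite /jost_u mulf_eq0 (negPf (cexp_neq0 _)) => /eqP.
have [h1 _] := b_cseries (conj K0 hK) hx; rewrite jm0 in h1.
have h2 := cseriesS h1; rewrite /= expr0 mulr1 mul1r /b jcoef0 sub0r in h2.
have K1 : 0 <= K * (2 / rho * wx x) by rewrite mulr_ge0// mulr_ge0 ?divr_ge0 ?(ltW rho0) ?(ltW (wx0 _)).
have := cseries_bound K1 _ h2; rewrite ncN nc1 => H.
have : 1 <= 2 * (K * (2 / rho * wx x)).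
  apply: H => k; rewrite mul1r ncM ncX nwx.
  have := hK k.+1; rewrite [dpole _ _ _ * _]mul1r => hk.
  apply: (le_trans (ler_wpM2r _ hk)); first by rewrite exprn_ge0// ltW.
  have -> : K * (2 / rho) ^+ k.+1 * wx x ^+ k.+1 = K * (2 / rho * wx x) * (2 / rho * wx x) ^+ k.
    by rewrite -[RHS]mulrA -exprS [(2 / rho * wx x) ^+ k.+1]exprMn [RHS]mulrA.
  apply: ler_wpM2l => //.
  rewrite -exprVn lerXn2r ?nnegrE ?invr_ge0 ?mulr_ge0 ?invr_ge0 ?(ltW rho0) ?(ltW (wx0 _))//.
  have := rho0; have := wx_le hx; rewrite mulrAC ler_pdivrMr//; lra.
apply/negP; rewrite -ltNge.
have : K * (2 / rho * wx x) <= K * (2 / rho * e).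
  by apply: ler_wpM2l => //; apply: ler_wpM2l => //; rewrite divr_ge0// ltW.
have -> : K * (2 / rho * e) = K / (K + 1) / 32 by rewrite /e; field; rewrite !gt_eqF// ltr_wpDl.
have : K / (K + 1) <= 1 by rewrite ler_pdivrMr ?ltr_wpDl// mul1r lerDl.
lra.
Qed.

End JostSolution.

(** * Smooth functions *)

Section SmoothFunctions.
Variable R : realType.
Implicit Types (f g : R -> R) (x : R).

Lemma is_derive_epsP f x (k : R) : is_derive x 1 f k <-> forall e, 0 < e ->
  exists2 d : R, 0 < d & forall h, `|h| < d -> `|f (x + h) - f x - h * k| <= e * `|h|.
Proof.
split.
  move=> [df dk] e e0; move: df; rewrite /derivable => /cvg_ex[/= L hL].
  have Lk : L = k by rewrite -dk; apply/esym/cvg_lim => //; exact: Rhausdorff.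
  move/cvgrPdist_le : hL => /(_ e e0)/nbhs_ballP[d /= d0 hd]; exists d => // h hh.
  have [->|h0] := eqVneq h 0; first by rewrite addr0 subrr mul0r subrr normr0 mulr0.
  have := hd h; rewrite -ball_normE /= sub0r normrN => /(_ hh h0).
  rewrite Lk /GRing.scale /= mulr1 [h + x]addrC => H.
  have -> : f (x + h) - f x - h * k = - ((k - h^-1 * (f (x + h) - f x)) * h).
    by move: (f (x + h)) (f x) => p q; field.
  by rewrite normrN normrM ler_wpM2r.
move=> H; have cv : h^-1 *: (f (h *: 1 + x) - f x) @[h --> 0^'] --> k.
  apply/cvgrPdist_le => e e0; have [d d0 hd] := H e e0.
  apply/nbhs_ballP; exists d => // h; rewrite -ball_normE /= sub0r normrN => hh h0.
  have hn : 0 < `|h| by rewrite normr_gt0.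
  have := hd h hh; rewrite /GRing.scale /= mulr1 [h + x]addrC => H1.
  rewrite -(ler_pM2r hn) -normrM; apply: le_trans H1; rewrite -normrN.
  rewrite le_eqVlt; apply/orP; left; apply/eqP; congr (`|_|).
  by move: (f (x + h)) (f x) => p q; field.
split; first by apply/cvg_ex; exists k.
by apply/cvg_lim => //; exact: Rhausdorff.
Qed.

(** A class of functions closed under differentiation consists of smooth
    functions; smoothness of concrete functions is proved by exhibiting one. *)
Lemma smooth_coind (P : (R -> R) -> Prop) :
  (forall f, P f -> exists2 g, P g & forall x, is_derive x 1 f (g x)) -> forall f, P f -> smooth f.
Proof.
move=> H f Pf n; elim: n f Pf => [|n IH] f Pf x; have [g Pg hg] := H f Pf.
  by case: (hg x).
rewrite derive1Sn; have -> : f^`()%classic = g; last exact: IH.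
by apply/funext => y; rewrite derive1E; case: (hg y).
Qed.

Lemma smooth_derive f : smooth f -> smooth f^`()%classic /\ forall x, is_derive x 1 f (f^`()%classic x).
Proof.
move=> sf; split; first by move=> n x; rewrite -derive1Sn; exact: sf.
by move=> x; rewrite derive1E; apply: derivableP; exact: (sf 0%N).
Qed.

Lemma smooth_primitive f g : smooth g -> (forall x, is_derive x 1 f (g x)) -> smooth f.
Proof.
move=> sg fg [|n] x; first by case: (fg x).
rewrite derive1Sn; have -> : f^`()%classic = g; last exact: sg.
by apply/funext => y; rewrite derive1E; case: (fg y).
Qed.

Lemma smooth_cont f : smooth f -> continuous f.
Proof.
by move=> sf x; apply: differentiable_continuous; apply/derivable1_diffP; exact: (sf 0%N).
Qed.

Lemma smoothM f g : smooth f -> smooth g -> smooth (fun x => f x * g x).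
Proof.
move=> sf sg; apply: (@smooth_coind (fun F => exists2 s : seq ((R -> R) * (R -> R)),
   (forall p, List.In p s -> smooth p.1 /\ smooth p.2) & F = fun x => \sum_(p <- s) p.1 x * p.2 x)); last first.
  exists [:: (f, g)]; first by move=> p /= [<-|//].
  by apply/funext => x; rewrite big_seq1.
move=> F [s hs ->]; elim: s hs => [|p s IH] hs.
  exists (fun=> 0).
    by exists [::] => //; apply/funext => x; rewrite big_nil.
  have -> : (fun x => \sum_(p <- [::]) p.1 x * p.2 x) = cst (0 : R) by apply/funext => x; rewrite big_nil.
  by move=> x; exact: is_derive_cst.
have [G [t ht GE] hG] := IH (fun q hq => hs q (or_intror hq)).
have [s1 s2] := hs p (or_introl erefl).
have [d1 e1] := smooth_derive s1; have [d2 e2] := smooth_derive s2.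
exists (fun x => p.1^`()%classic x * p.2 x + p.1 x * p.2^`()%classic x + G x).
  exists ((p.1^`()%classic, p.2) :: (p.1, p.2^`()%classic) :: t).
    move=> q /= [<-|[<-|hq]].
    - exact: (conj d1 s2).
    - exact: (conj s1 d2).
    - exact: ht q hq.
  by apply/funext => x; rewrite !big_cons /= GE addrA.
move=> x; have -> : (fun x => \sum_(q <- p :: s) q.1 x * q.2 x) = ((p.1 * p.2) + (fun x => \sum_(q <- s) q.1 x * q.2 x)).
  by apply/funext => y; rewrite big_cons.
apply: (is_derive_eq (is_deriveD (is_deriveM (e1 x) (e2 x)) (hG x))).
by rewrite /GRing.scale /=; ring.
Qed.

Lemma smooth_affine f (a b : R) : smooth f -> smooth (fun x => f (a * x + b)).
Proof.
move=> sf; apply: (@smooth_coind (fun F => exists c g, smooth g /\ F = fun x => c * g (a * x + b))); last first.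
  by exists 1, f; split => //; apply/funext => x; rewrite mul1r.
move=> F [c [g [sg ->]]]; have [dg eg] := smooth_derive sg.
exists (fun x => c * a * g^`()%classic (a * x + b)); first by exists (c * a), g^`()%classic.
move=> x; have da : is_derive x 1 (fun y : R => a * y + b) a.
  by apply: is_derive_eq; rewrite /GRing.scale /= mulr1 addr0.
have dc := @is_derive1_comp _ g (fun y => a * y + b) x _ _ (eg (a * x + b)) da.
have := @is_deriveM _ _ (cst c) _ x 1 _ _ (is_derive_cst _ _ _) dc.
move=> h; apply: (is_derive_eq h); rewrite /GRing.scale /= mulr0 addr0; ring.
Qed.

Lemma smoothD f g : smooth f -> smooth g -> smooth (fun x => f x + g x).
Proof.
move=> sf sg; apply: (@smooth_coind (fun F => exists f g, [/\ smooth f, smooth g & F = fun x => f x + g x])); last first.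
  by exists f, g.
move=> F [f1 [g1 [s1 s2 ->]]]; have [d1 e1] := smooth_derive s1; have [d2 e2] := smooth_derive s2.
exists (fun x => f1^`()%classic x + g1^`()%classic x).
  by exists f1^`()%classic, g1^`()%classic.
by move=> x; exact: (is_deriveD (e1 x) (e2 x)).
Qed.

Lemma smooth_cst (c : R) : smooth (fun=> c).
Proof.
apply: (@smooth_coind (fun F => exists c, F = fun=> c)); last by exists c.
by move=> F [d ->]; exists (fun=> 0); [exists 0|move=> x; exact: is_derive_cst].
Qed.

Lemma smoothZ (c : R) f : smooth f -> smooth (fun x => c * f x).
Proof. by move=> sf; apply: smoothM => //; exact: smooth_cst. Qed.

(** Closed under differentiation as [p] varies. *)
Definition flat (p : {poly R}) x : R := if 0 < x then p.[x^-1] * expR (- x^-1) else 0.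

Lemma poly_le (p : {poly R}) : exists2 P : R, 0 <= P & forall y, 1 <= y -> `|p.[y]| <= P * y ^+ size p.
Proof.
exists (\sum_(i < size p) `|p`_i|); first by apply: sumr_ge0.
move=> y y1; have y0 : 0 <= y by exact: le_trans y1.
rewrite horner_coef (le_trans (ler_norm_sum _ _ _))// mulr_suml; apply: ler_sum => i _.
rewrite normrM normrX (ger0_norm y0) ler_wpM2l// ler_weXn2l//.
by rewrite ltnW.
Qed.

Lemma expR_pow_le (y : R) n : 0 < y -> expR (- y) <= (n.+1%:R / y) ^+ n.+1.
Proof.
move=> y0; have n0 : 0 < n.+1%:R :> R by rewrite ltr0n.
rewrite expRN -[leRHS]invrK -exprVn invf_div lef_pV2 ?posrE ?expR_gt0 ?exprn_gt0 ?divr_gt0//.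
have -> : expR y = expR (y / n.+1%:R) ^+ n.+1.
  by rewrite -expRM_natr divfK// gt_eqF.
apply: lerXn2r; rewrite ?nnegrE ?expR_ge0 ?divr_ge0 ?(ltW y0) ?(ltW n0)//.
by apply: le_trans (expR_ge1Dx _); rewrite lerDr.
Qed.

(** The exponential beats every power of [1/x], so that derivatives on the right
    of the origin match the zero function on the left. *)
Lemma flat_derive (p : {poly R}) x : is_derive x 1 (flat p) (flat ('X ^+ 2 * (p - p^`())) x).
Proof.
have local (f : R -> R) k (d : R) : 0 < d -> (forall y, `|y - x| < d -> flat p y = f y) -> is_derive x 1 f k ->
    is_derive x 1 (flat p) k.
  move=> d0 pf /is_derive_epsP hf; apply/is_derive_epsP => e e0; have [d1 d10 hd1] := hf e e0.
  exists (Num.min d d1); first by rewrite lt_min d0.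
  move=> h; rewrite lt_min => /andP[h1 h2].
  by rewrite !pf ?subrr ?normr0 ?hd1// addrAC subrr add0r.
case: (ltgtP x 0) => x0.
- have -> : flat ('X ^+ 2 * (p - p^`())) x = 0 by rewrite /flat ltNge ltW.
  apply: (local (cst 0) 0 (- x)); first by rewrite oppr_gt0.
  move=> y; rewrite ltr_norml => /andP[_ yx]; rewrite /flat ifF//; apply/negbTE; rewrite -leNgt.
  by rewrite ltrBlDr addNr in yx; exact: ltW.
- have xn : x != 0 by rewrite gt_eqF.
  apply: (local (fun y => p.[y^-1] * expR (- y^-1)) _ x x0).
    move=> y; rewrite ltr_norml => /andP[yx _]; rewrite /flat ifT//; lra.
  have dV : is_derive x 1 (fun y : R => y^-1) (- x ^- 2).
    have h := @is_deriveV R (fun y : R => y) x 1 1 xn (is_derive_id _ _); apply: (is_derive_eq h).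
    by rewrite /GRing.scale /= mulr1.
  have dP := @is_derive1_comp _ (horner p) (fun y => y^-1) x _ _ (is_derive_poly p x^-1) dV.
  have dN : is_derive x 1 (fun y : R => - y^-1) (x ^- 2).
    by have h := is_deriveN dV; apply: (is_derive_eq h); rewrite opprK.
  have dE := @is_derive1_comp _ expR (fun y => - y^-1) x _ _ (is_derive_expR (- x^-1)) dN.
  apply: (is_derive_eq (is_deriveM dP dE)); rewrite /GRing.scale /= /flat x0.
  rewrite hornerM hornerXn hornerD hornerN exprVn; move: (expR _) p.[_] (p^`()).[_] => a b c; ring.
- rewrite x0 /flat ltxx; apply/is_derive_epsP => e e0.
  have [P P0 hP] := poly_le p; pose m := (size p).+1.
  pose K := P * m.+1%:R ^+ m.+1; have K0 : 0 <= K by rewrite mulr_ge0// exprn_ge0.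
  exists (Num.min 1 (e / (K + 1))); first by rewrite lt_min ltr01 divr_gt0// ltr_wpDl.
  move=> h; rewrite lt_min => /andP[h1 h2]; rewrite ltxx add0r !subr0 mulr0 subr0.
  case: ifPn => h0; last by rewrite normr0 mulr_ge0// ltW.
  have y1 : 1 <= h^-1 by rewrite invf_ge1//; move: h1; rewrite gtr0_norm// => /ltW.
  have y0 : 0 < h^-1 by rewrite invr_gt0.
  rewrite normrM (ger0_norm (expR_ge0 _)) (gtr0_norm h0).
  apply: (@le_trans _ _ (P * h^-1 ^+ size p * (m.+1%:R / h^-1) ^+ m.+1)).
    by apply: ler_pM; [exact: normr_ge0|exact: expR_ge0|exact: hP|exact: expR_pow_le].
  have -> : P * h^-1 ^+ size p * (m.+1%:R / h^-1) ^+ m.+1 = K * h * h.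
    rewrite /K invrK exprMn /m !exprS exprVn; field.
    by rewrite expf_neq0// gt_eqF.
  rewrite ler_wpM2r ?(ltW h0)//; move: h2; rewrite gtr0_norm// ltr_pdivlMr ?ltr_wpDl// => h2.
  by apply: le_trans (ltW h2); rewrite mulrC ler_wpM2l ?(ltW h0)// lerDl.
Qed.

Lemma flat_smooth p : smooth (flat p).
Proof.
apply: (@smooth_coind (fun F => exists p, F = flat p)); last by exists p.
move=> F [q ->]; exists (flat ('X ^+ 2 * (q - q^`()))); first by exists ('X ^+ 2 * (q - q^`())).
by move=> x; exact: flat_derive.
Qed.

Definition bump x : R := flat 1 x * flat 1 (- 1 * x + 1).

Lemma bump_smooth : smooth bump.
Proof.
apply: smoothM; first exact: flat_smooth.
have h := @smooth_affine (flat 1) (-1) 1.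
exact: h (@flat_smooth 1).
Qed.

Lemma bump_ge0 x : 0 <= bump x.
Proof.
by rewrite /bump /flat; apply: mulr_ge0; case: ifP => _//; rewrite hornerC mul1r expR_ge0.
Qed.

Lemma bump_out x : x <= 0 \/ 1 <= x -> bump x = 0.
Proof.
rewrite /bump /flat => -[x0|x1].
  by rewrite ltNge x0 mul0r.
by rewrite [in X in _ * X]ltNge mulN1r addrC subr_le0 x1 mulr0.
Qed.

Lemma bump_gt0 x : 0 < x < 1 -> 0 < bump x.
Proof.
move=> /andP[x0 x1]; rewrite /bump /flat x0 mulN1r addrC subr_gt0 x1 !hornerC !mul1r.
by rewrite mulr_gt0 ?expR_gt0.
Qed.

End SmoothFunctions.

(** * Second differences of a primitive *)

Section DuBoisReymond.
Variable R : realType.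
Local Notation C := R[i].
Local Notation mu := (@lebesgue_measure R).
Implicit Types (x a b h e : R).

Lemma Rintegral_supp (D E : set (measurableTypeR R)) (f : R -> R) : E `<=` D -> (forall x, D x -> ~ E x -> f x = 0) ->
  (\int[mu]_(x in D) f x = \int[mu]_(x in E) f x)%R.
Proof.
move=> ED f0; rewrite [LHS]Rintegral_mkcond [RHS]Rintegral_mkcond.
apply: eq_Rintegral => x _; rewrite !patchE.
have [xE|xE] := boolP (x \in E); first by rewrite ifT// inE; apply: ED; rewrite inE in xE.
case: ifPn => // xD; rewrite f0//; first by rewrite inE in xD.
by rewrite notin_setE in xE.
Qed.

Lemma cint_supp (D E : set (measurableTypeR R)) (f : R -> C) : E `<=` D -> (forall x, D x -> ~ E x -> f x = 0) ->
  cint D f = cint E f.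
Proof.
move=> ED f0; apply: eqC; rewrite ?Re_cint ?Im_cint; apply: Rintegral_supp => // x Dx Ex; by rewrite f0.
Qed.

Lemma smooth_AC (f : R -> R) : smooth f -> forall a b, AC a b (fun x => (f^`()%classic x)%:C : C) (fun x => (f x)%:C).
Proof.
move=> sf a b; have [sf' df] := smooth_derive sf.
by apply: AC_R df; apply: continuous_subspaceT; exact: smooth_cont.
Qed.

Lemma smooth_prim (g : R -> R) : smooth g -> exists2 S, smooth S & S^`()%classic = g /\ S 0 = 0.
Proof.
move=> sg; pose G := fun x => (g x)%:C : C.
have cg : continuous g by exact: smooth_cont.
have cG : ccont G by exact: ccont_R.
have pG : forall a b, AC a b G (prim G) by apply: prim_AC => a b; exact: ccont_on_integrable.
pose S x := cRe (prim G x).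
have dS x : is_derive x 1 S (g x).
  apply/is_derive_epsP => e e0.
  have e2 : 0 < e / 2 by rewrite divr_gt0.
  have xx : x - 1 <= x <= x + 1 by apply/andP; lra.
  have [d d0 hd] := cG (x - 1) (x + 1) x xx e e0.
  exists (Num.min d 1); first by rewrite lt_min d0 ltr01.
  move=> h; rewrite lt_min => /andP[hd' h1].
  have [l u] : - 1 < h /\ h < 1 by move: h1; rewrite ltr_norml => /andP[].
  have key y z : x - 1 <= y -> y <= z -> z <= x + 1 -> (forall t, y <= t <= z -> `|t - x| < d) ->
      `|S z - S y - (z - y) * g x| <= e * (z - y).
    move=> xy yz zx near; have [i hG] := pG y z.
    have -> : S z - S y - (z - y) * g x = cRe (cint `[y, z] (fun t => G t - G x)).
      have ic := ccont_on_integrable (@ccont_cst R (G x) y z).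
      have hc : cRe (cint `[y, z] (fun=> G x)) = (z - y) * g x by rewrite Re_cint [LHS](Rintegral_cst_itv (g x) yz) mulrC.
      have e1 := @cintB R `[y, z]%classic G (fun=> G x) (measurable_itv _) i ic.
      have e3 := hG y z (lexx y) yz (lexx z).
      by rewrite e1 -e3 ReB ReB hc.
    apply: (le_trans (nc_Re _)); apply: cint_bound => //.
      by apply: cintegrableB => //; exact/ccont_on_integrable/ccont_cst.
    by move=> t ht; apply: hd; [move: ht => /andP[]; lra|exact: near].
  have [h0|h0] := leP 0 h.
    have E1 : x + h - x = h by ring.
    have := key x (x + h); rewrite E1 (ger0_norm h0) => H; apply: H; try lra.
    move=> t /andP[xt th]; apply: le_lt_trans hd'; rewrite !ger0_norm//; lra.
  have E1 : x - (x + h) = - h by ring.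
  have := key (x + h) x; rewrite E1 (ltr0_norm h0) => H.
  have -> : S (x + h) - S x - h * g x = - (S x - S (x + h) - - h * g x) by ring.
  rewrite normrN; apply: H; try lra.
  move=> t /andP[xt th]; apply: le_lt_trans hd'; rewrite ler0_norm ?subr_le0// ltr0_norm//; lra.
exists S; first exact: smooth_primitive dS.
split; last by rewrite /S prim0.
by apply/funext => x; rewrite derive1E; case: (dS x).
Qed.

(** Four-point second differences: the second derivative of the test function
    concentrates at four points, with weights 1, -1, -1, 1. *)
Lemma test_family : exists (s1 : R) (eta : R -> R), [/\ 0 < s1, continuous eta & forall x, 0 <= eta x] /\
  (forall x, x <= 0 \/ 1 <= x -> eta x = 0) /\
  (forall e a M, 0 < e -> - M <= a -> a + e <= M -> \int[mu]_(x in `[- M, M]) (e^-1 * eta ((x - a) / e)) = s1)%R /\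
  (forall e a b h, 0 < e -> 0 <= h -> exists (phi : R -> R) (M : R), [/\ smooth phi,
     (forall x, M < `|x| -> phi x = 0) &
     phi^`()%classic^`()%classic = fun x => e^-1 * eta ((x - a) / e) - e^-1 * eta ((x - (a + h)) / e)
       - (e^-1 * eta ((x - b) / e) - e^-1 * eta ((x - (b + h)) / e))]).
Proof.
have [S sS [dS S0]] := smooth_prim (@bump_smooth R).
have [T sT [dT T0]] := smooth_prim sS.
have AS a b := smooth_AC sS a b; rewrite dS in AS.
have AT a b := smooth_AC sT a b; rewrite dT in AT.
have cI := @complexI R.
have Sneg x : x <= 0 -> S x = 0.
  move=> x0; apply: cI; rewrite -(AC_uniq0 x0 (AS x 0)) ?S0// => t /andP[_ t0].
  by rewrite bump_out//; left.
have Spos x : 1 <= x -> S x = S 1.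
  move=> x1; apply: cI; rewrite (AC_uniq0 x1 (AS 1 x))// => t /andP[t1 _].
  by rewrite bump_out//; right.
have Tneg x : x <= 0 -> T x = 0.
  move=> x0; apply: cI; rewrite -(AC_uniq0 x0 (AT x 0)) ?T0// => t /andP[_ t0].
  by rewrite Sneg.
have mono x y : x <= y -> S x <= S y.
  move=> xy; rewrite -subr_ge0; have [_ h] := AS x y.
  have -> : S y - S x = cRe (cint `[x, y] (fun x => (@bump R x)%:C)) by rewrite -h// ReB.
  by rewrite Re_cint; apply: Rintegral_ge0 => t _; exact: bump_ge0.
have S1 : 0 < S 1.
  rewrite lt_neqAle; apply/andP; split; last by rewrite -S0; exact: mono.
  apply/negP => /eqP S10.
  have Sz x : 0 <= x <= 1 -> S x = 0.
    by move=> /andP[x0 x1]; apply/le_anti; rewrite [X in _ <= X]S10 mono// -S0 mono.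
  have [_ ddS] := smooth_derive sS; have /is_derive_epsP hd := ddS (1 / 2).
  have b0 : 0 < @bump R (1 / 2) by apply: bump_gt0; apply/andP; lra.
  have [d d0 hd'] := hd (bump (1 / 2) / 2) (divr_gt0 b0 (ltr0n R 2)).
  pose k := Num.min (d / 2) (1 / 4).
  have k0 : 0 < k by rewrite /k lt_min !divr_gt0.
  have kd : k <= d / 2 by rewrite /k ge_min lexx.
  have k4 : k <= 1 / 4 by rewrite /k ge_min lexx orbT.
  have := hd' k; rewrite dS gtr0_norm// => /(_ _).
  rewrite !Sz; [|apply/andP; lra|apply/andP; lra].
  rewrite subrr sub0r normrN normrM !gtr0_norm// mulrC => H.
  have : bump (1 / 2) * k <= bump (1 / 2) / 2 * k by apply: H; lra.
  rewrite ler_pM2r//; lra.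
have Tpos x : 1 <= x -> T x = T 1 + S 1 * (x - 1).
  move=> x1; have dA : AC 1 x (fun t => (S t)%:C - (S 1)%:C : C) (fun t => (T t)%:C - (S 1 * (t - 1))%:C).
    apply: AC_B (AT 1 x) _.
    have cl : {within `[1, x], continuous (fun=> 1 : R)} by apply: continuous_subspaceT; exact: cst_continuous.
    have dl (t : R) : is_derive t 1 (fun t : R => t - 1) (1 : R) by apply: is_derive_eq; rewrite ?subr0 ?addr0 ?oppr0 ?addr0.
    have H := AC_Z (S 1)%:C (AC_R cl dl).
    apply: eq_AC H => t _ /=; last by rewrite rmorphM.
    by rewrite [(1 : R)%:C]rmorph1 mulr1.
  have := AC_uniq0 x1 dA; rewrite subrr mulr0 rmorph0 subr0 => H.
  have : (T x)%:C - (S 1 * (x - 1))%:C = (T 1)%:C :> C by apply: H => t /andP[t1 _]; rewrite Spos ?subrr.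
  move=> /eqP; rewrite subr_eq -rmorphD /= => /eqP /cI ->; ring.
have aff e a x : (x - a) / e = e^-1 * x + - (a / e) by ring.
have sc (f g : R -> R) e a : e != 0 -> smooth f -> f^`()%classic = g ->
    forall x, is_derive x 1 (fun x => f ((x - a) / e)) (e^-1 * g ((x - a) / e)).
  move=> e0 sf fg x; have [_ df] := smooth_derive sf.
  have da : is_derive x 1 (fun y : R => (y - a) / e) e^-1.
    by apply: is_derive_eq; rewrite /GRing.scale /=; ring.
  have := @is_derive1_comp _ f (fun y => (y - a) / e) x _ _ (df _) da.
  by rewrite fg mulrC.
have ss (f : R -> R) e a : smooth f -> smooth (fun x => f ((x - a) / e)).
  move=> sf; have := @smooth_affine _ f e^-1 (- (a / e)) sf.
  by congr smooth; apply/funext => x; rewrite aff.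
exists (S 1), (@bump R); split; first split => //.
- by apply: smooth_cont; exact: bump_smooth.
- exact: bump_ge0.
split; first exact: bump_out.
split.
  move=> e a M e0 Ma aM; have MM : - M <= M by lra.
  have := @AC_R R (- M) M _ (fun x => e^-1 * bump ((x - a) / e)) _ (sc S (@bump R) e a (lt0r_neq0 e0) sS dS).
  case.
    apply: continuous_subspaceT; apply: smooth_cont; apply: smoothZ; apply: ss; exact: bump_smooth.
  move=> _ /(_ _ _ (lexx _) MM (lexx _))/(congr1 (fun z => cRe z)).
  rewrite ReB Re_cint /= => <-.
  have -> : S ((M - a) / e) = S 1 by apply: Spos; rewrite ler_pdivlMr// mul1r; lra.
  rewrite [S ((- M - a) / e)]Sneg ?subr0//.
  by rewrite pmulr_lle0 ?invr_gt0//; lra.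
move=> e a b h e0 h0; have en := lt0r_neq0 e0.
pose U (f : R -> R) x := f ((x - a) / e) - f ((x - (a + h)) / e) - (f ((x - b) / e) - f ((x - (b + h)) / e)).
have sU f : smooth f -> smooth (U f).
  move=> sf; have sB (p q : R -> R) : smooth p -> smooth q -> smooth (fun x => p x - q x).
    move=> sp sq; have := smoothD sp (@smoothZ _ (-1) _ sq).
    by congr smooth; apply/funext => x; rewrite mulN1r.
  by rewrite /U; apply: (sB _ _); apply: (sB _ _); exact: ss.
have dU (f g : R -> R) : smooth f -> f^`()%classic = g -> forall x, is_derive x 1 (U f) (e^-1 * U g x).
  move=> sf fg x; have D a' := sc f g e a' en sf fg x.
  have h1 := is_deriveB (is_deriveB (D a) (D (a + h))) (is_deriveB (D b) (D (b + h))).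
  by apply: (is_derive_eq h1); rewrite /U; ring.
exists (fun x => e * U T x), (`|a| + `|b| + h + e + 1); split.
- by apply: smoothZ; exact: sU.
- move=> x hx; have := ler_norm a; have := ler_norm (- a); have := ler_norm b; have := ler_norm (- b).
  rewrite !normrN => b1 b2 a1 a2.
  have [x0|x0] := leP 0 x.
    rewrite (ger0_norm x0) in hx.
    have TP c : c + e <= x -> T ((x - c) / e) = T 1 + S 1 * ((x - c) / e - 1).
      by move=> hc; apply: Tpos; rewrite ler_pdivlMr// mul1r lerBrDl.
    rewrite /U (TP a) ?(TP (a + h)) ?(TP b) ?(TP (b + h)); [|lra..].
    by move: (T 1) (S 1) => t s; field.
  rewrite (ltr0_norm x0) in hx.
  have TN c : x <= c -> T ((x - c) / e) = 0.
    by move=> hc; apply: Tneg; rewrite pmulr_lle0 ?invr_gt0// subr_le0.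
  rewrite /U (TN a) ?(TN (a + h)) ?(TN b) ?(TN (b + h)); [|lra..].
  by rewrite !subrr mulr0.
- have d1 x : is_derive x 1 (fun x => e * U T x) (U S x).
    have h1 := @is_deriveM _ _ (cst e) _ x 1 _ _ (is_derive_cst _ _ _) (dU T S sT dT x).
    apply: (is_derive_eq h1); rewrite /GRing.scale /= mulr0 addr0 /U mulrA divff ?mul1r //.
  have -> : (fun x => e * U T x)^`()%classic = U S.
    by apply/funext => x; rewrite derive1E; case: (d1 x).
  apply/funext => x; rewrite derive1E; case: (dU S (@bump R) sS dS x) => _ ->.
  by rewrite /U; ring.
Qed.

(** The distributional derivative vanishes. *)
Definition orth (D : R -> C) := forall phi : R -> R, test_function phi ->
  cint setT (fun x => D x * (phi^`()%classic x)%:C) = 0.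

Lemma derive_out (phi : R -> R) M x : (forall x, M < `|x| -> phi x = 0) -> M < `|x| -> phi^`()%classic x = 0.
Proof.
move=> h Mx; rewrite derive1E; have : is_derive x 1 phi 0.
  apply/is_derive_epsP => e e0; exists (`|x| - M); first by rewrite subr_gt0.
  move=> k hk; have xk : M < `|x + k| by have := lerB_dist x (- k); rewrite normrN opprK; lra.
  by rewrite (h x Mx) (h _ xk) !subr0 mulr0 subr0 normr0 mulr_ge0// ltW.
by case.
Qed.

(** Take four bumps of mass [s1] near the four points, with signs for which total
    mass and first moment vanish; their double primitive is then a test function.
    Integration by parts replaces [D] by its primitive, and shrinking the bumps
    evaluates this primitive at the four points. *)
Lemma orth_second_difference (D : R -> C) : (forall a b, cintegrable `[a, b] D) -> orth D ->
  forall a b h, 0 <= h -> prim D (a + h) - prim D a = prim D (b + h) - prim D b.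
Proof.
move=> iD oD a b h h0; set P := prim D.
have AP : forall a b, AC a b D P by exact: prim_AC.
have cP : ccont P by exact: AC_ccont AP.
have [s1 [eta [[s10 ceta eta0] [eout [emass fam]]]]] := test_family.
apply/esym/nc_eqP => e0 e0_0.
pose M0 := `|a| + `|b| + h + 3.
have a1 := ler_norm a; have a2 := ler_norm (- a); have b1 := ler_norm b; have b2 := ler_norm (- b).
rewrite !normrN in a2 b2.
have pts c : c \in [:: a; a + h; b; b + h] -> - M0 <= c <= M0 - 1.
  rewrite !inE => hc; have : c = a \/ c = a + h \/ c = b \/ c = b + h.
    by case/or4P: hc => /eqP; tauto.
  by move=> hc'; have na := normr_ge0 a; have nb := normr_ge0 b; apply/andP; rewrite /M0; move: hc' => [|[|[|]]] ->; lra.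
have [d d0 hd] : exists2 d, 0 < d & forall c, c \in [:: a; a + h; b; b + h] -> forall x, - M0 <= x <= M0 -> `|x - c| < d ->
    nc (P x - P c) <= e0 / 4.
  have e4 : 0 < e0 / 4 by rewrite divr_gt0.
  have M1 c : c \in [:: a; a + h; b; b + h] -> - M0 <= c <= M0 by move=> /pts/andP[]; rewrite -/M0; lra.
  have mem i : (i < 4)%N -> nth a [:: a; a + h; b; b + h] i \in [:: a; a + h; b; b + h] by move=> ?; rewrite mem_nth.
  have [da da0 ha] := cP _ _ _ (M1 _ (mem 0%N isT)) _ e4.
  have [db db0 hb] := cP _ _ _ (M1 _ (mem 1%N isT)) _ e4.
  have [dc dc0 hc] := cP _ _ _ (M1 _ (mem 2%N isT)) _ e4.
  have [dd dd0 hdd] := cP _ _ _ (M1 _ (mem 3%N isT)) _ e4.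
  exists (Num.min (Num.min da db) (Num.min dc dd)); first by rewrite !lt_min da0 db0 dc0.
  move=> c; rewrite !inE => hc0 x xM; rewrite !lt_min => /andP[/andP[x1 x2] /andP[x3 x4]].
  by case/or4P: hc0 x1 x2 x3 x4 => /eqP -> *; [exact: ha|exact: hb|exact: hc|exact: hdd].
pose e := Num.min 1 (d / 2).
have eps0 : 0 < e by rewrite lt_min ltr01 divr_gt0.
have eps1 : e <= 1 by rewrite /e ge_min lexx.
have epsd : e < d.
  by apply: (@le_lt_trans _ _ (d / 2)); [rewrite /e ge_min lexx orbT|rewrite ltr_pdivrMr// mulr_natr mulr2n ltrDl].
have [phi [M' [sphi phi0 phi2]]] := fam e a b h eps0 h0.
pose M := Num.max M0 (`|M'| + 1).
have MM0 : M0 <= M by rewrite /M le_max lexx.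
have MM' : M' < M by rewrite /M lt_max; apply/orP; right; have := ler_norm M'; lra.
have Mpos : 0 < M.
  by apply: lt_le_trans MM0; rewrite /M0; have := normr_ge0 a; have := normr_ge0 b; lra.
have MM : - M <= M by lra.
have [sphi' dphi] := smooth_derive sphi.
have [sphi'' dphi'] := smooth_derive sphi'.
have tphi : test_function phi by split => //; exists M'.
pose w c x : R := e^-1 * eta ((x - c) / e).
have cw c : ccont (fun x => (w c x)%:C : C).
  apply: ccont_R => x; apply: cvgM; first exact: cvg_cst.
  apply: (@continuous_comp _ _ _ (fun x => (x - c) / e) eta); last exact: ceta.
  by apply: cvgM; [apply: cvgB; [exact: cvg_id|exact: cvg_cst]|exact: cvg_cst].
have ABP := AC_M MM (AP (- M) M) (smooth_AC sphi' (- M) M).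
have bd x : `|x| = M -> phi^`()%classic x = 0 by move=> xM; apply: (derive_out phi0); rewrite xM.
have z0 : cint `[- M, M] (fun x => P x * (phi^`()%classic^`()%classic x)%:C) = 0.
  have [ii ee] := ABP; have := ee _ _ (lexx _) MM (lexx _).
  rewrite !bd ?normrN ?gtr0_norm// !mulr0 subrr.
  have i1 : cintegrable `[- M, M] (fun x => D x * (phi^`()%classic x)%:C).
    have := cintegrable_Mcont MM (@ccont_R _ _ (smooth_cont sphi') (- M) M) (iD (- M) M).
    by apply: eq_cintegrable => // x _; rewrite mulrC.
  have i2 : cintegrable `[- M, M] (fun x => P x * (phi^`()%classic^`()%classic x)%:C).
    by apply: ccont_on_integrable; apply: ccont_onM => //; exact: ccont_R (smooth_cont sphi'') _ _.
  rewrite cintD// => /esym/eqP; have -> : cint `[- M, M] (fun x => D x * (phi^`()%classic x)%:C) = 0.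
    rewrite -(oD phi tphi); apply/esym; apply: cint_supp => // x _ hx.
    rewrite (derive_out phi0) ?mulr0//; rewrite ltNge; apply/negP => hM; apply: hx.
    by rewrite /= in_itv /= -ler_norml (le_trans hM)// ltW.
  by rewrite add0r => /eqP.
have int1 c : c \in [:: a; a + h; b; b + h] -> nc (cint `[- M, M] (fun x => P x * (w c x)%:C) - s1%:C * P c) <= e0 / 4 * s1.
  move=> hc; have /andP[c1 c2] := pts c hc.
  have iw : cintegrable `[- M, M] (fun x => (w c x)%:C) by exact/ccont_on_integrable/cw.
  have iPw : cintegrable `[- M, M] (fun x => P x * (w c x)%:C) by apply: ccont_on_integrable; apply: ccont_onM => //; exact: cw.
  have mass : \int[mu]_(x in `[- M, M]) w c x = s1 by apply: emass => //; lra.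
  have -> : s1%:C * P c = cint `[- M, M] (fun x => P c * (w c x)%:C).
    rewrite cintZ// mulrC; congr (_ * _); apply: eqC; rewrite ?Re_cint ?Im_cint /=; first by rewrite mass.
    by rewrite /Rintegral integral0.
  rewrite -cintB//; last by apply: cintegrableZ.
  have ir : mu.-integrable `[- M, M] (EFin \o w c) by case: iw.
  rewrite -mass -RintegralZl//; apply: cint_norm_le => //.
  - by apply: cintegrableB => //; exact: cintegrableZ.
  - exact: integrableZR.
  move=> x _; rewrite -mulrBl ncM ncR.
  have w0 : 0 <= w c x by rewrite /w mulr_ge0// invr_ge0 ltW.
  rewrite ger0_norm//; have [hx|hx] := boolP (0 < (x - c) / e < 1).
    apply: ler_wpM2r => //; move: hx => /andP[x0 x1].
    rewrite pmulr_lgt0 ?invr_gt0// in x0; rewrite ltr_pdivrMr// mul1r in x1.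
    by apply: (hd c hc); [apply/andP; lra|rewrite gtr0_norm//; lra].
  have -> : w c x = 0.
    rewrite /w eout ?mulr0//; move: hx; rewrite negb_and -!leNgt => /orP[]; tauto.
  by rewrite !mulr0.
have ma : a \in [:: a; a + h; b; b + h] by rewrite !inE eqxx.
have mah : a + h \in [:: a; a + h; b; b + h] by rewrite !inE eqxx orbT.
have mb : b \in [:: a; a + h; b; b + h] by rewrite !inE eqxx !orbT.
have mbh : b + h \in [:: a; a + h; b; b + h] by rewrite !inE eqxx !orbT.
have iPw c : cintegrable `[- M, M] (fun x => P x * (w c x)%:C).
  by apply: ccont_on_integrable; apply: ccont_onM => //; exact: cw.
pose I c := cint `[- M, M] (fun x => P x * (w c x)%:C).
have zI : I a - I (a + h) - (I b - I (b + h)) = 0.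
  rewrite -z0 /I -cintB// -cintB// -cintB//; [|exact: cintegrableB..].
  apply: eq_cint => x _; rewrite phi2 -/(w a x) -/(w (a + h) x) -/(w b x) -/(w (b + h) x) !rmorphB /=; ring.
have := int1 a ma; have := int1 (a + h) mah; have := int1 b mb; have := int1 (b + h) mbh.
rewrite -!/(I _); move: (I a) (I (a + h)) (I b) (I (b + h)) (P a) (P (a + h)) (P b) (P (b + h)) zI.
move=> Ia Iah Ib Ibh pa pah pb pbh zI k4 k3 k2 k1.
have sC : nc (s1%:C : C) = s1 by rewrite ncR gtr0_norm.
have : nc (s1%:C * (pbh - pb - (pah - pa))) <= e0 * s1.
  have -> : s1%:C * (pbh - pb - (pah - pa)) = (Ia - s1%:C * pa) * -1 + (Iah - s1%:C * pah)
     + ((Ib - s1%:C * pb) - (Ibh - s1%:C * pbh)) + (Ia - Iah - (Ib - Ibh)) by ring.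
  rewrite zI addr0 (le_trans (ncD _ _))//.
  have t1 := ncD ((Ia - s1%:C * pa) * -1) (Iah - s1%:C * pah).
  have t2 := ncDB (Ib - s1%:C * pb) (Ibh - s1%:C * pbh).
  rewrite ncM ncN nc1 mulr1 in t1.
  have -> : e0 * s1 = (e0 / 4 * s1 + e0 / 4 * s1) + (e0 / 4 * s1 + e0 / 4 * s1) by field.
  by apply: lerD; [apply: le_trans t1 _|apply: le_trans t2 _]; apply: lerD.
by rewrite ncM sC mulrC ler_pM2r.
Qed.

End DuBoisReymond.

(** * Weak derivatives and absolutely continuous representatives *)

Section WeakDerivative.
Variable R : realType.
Local Notation C := R[i].
Local Notation mu := (@lebesgue_measure R).
Implicit Types (x a b h e : R).

Definition locint (f : R -> C) := forall a b, cintegrable `[a, b] f.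

Lemma bigcup_itv : \bigcup_n [set` `[- n%:R, n%:R : R]] = [set: R].
Proof.
apply/seteqP; split => // x _;
by exists (Num.bound `|x|) => //=; rewrite in_itv /= -ler_norml ltW// archi_boundP.
Qed.

Lemma locint_meas (f : R -> C) : locint f -> cmeas setT f.
Proof.
move=> lf; split; rewrite -bigcup_itv; apply/measurable_fun_bigcup => // n;
  by have [] := cintegrable_meas (lf (- n%:R) n%:R).
Qed.

(** Lebesgue's differentiation theorem, read on right-sided increments. *)
Lemma ae_derivative (f : R -> R) : measurable_fun setT f -> (forall a b, mu.-integrable `[a, b] (EFin \o f)) ->
  {ae mu, forall x, forall e, 0 < e -> exists2 d, 0 < d & forall h, 0 < h -> h < d ->
    `|(\int[mu]_(t in `[x, (x + h)%R]) f t)%R - h * f x| <= e * h}.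
Proof.
move=> mf lf; have lif : locally_integrable setT f.
  split => //; first exact: openT.
  move=> K _ cK; have [M [_ hM]] := compact_bounded cK.
  pose N := `|M| + 1; have MN : M < N by rewrite /N; have := ler_norm M; lra.
  have KN : K `<=` `[- N, N]%classic.
    by move=> x Kx /=; rewrite in_itv /= -ler_norml; exact: hM.
  have mK : measurable K by apply: closed_measurable; exact: compact_closed.
  have /integrableP[_ fin] := lf (- N) N.
  apply: le_lt_trans fin; apply: ge0_subset_integral => //.
  by apply/measurable_EFinP; apply: measurableT_comp => //; apply: measurable_funS mf.
have := lebesgue_differentiation lif; apply: filterS; first exact: (ae_filter_ringOfSetsType mu).
move=> x lx e e0; have xx : x < x + 1 by rewrite ltrDl.
have [|df f'] := FTC1_lebesgue_pt xx (lf (x - 1) (x + 1)) _ lx.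
  by rewrite lte_fin; lra.
pose F y := (\int[mu]_(t in `[(x - 1)%R, y]) f t)%R.
have iF : is_derive x 1 F (f x).
  by rewrite -f' derive1E; apply: derivableP.
have [d d0 hd] := (is_derive_epsP F x (f x)).1 iF e e0.
exists d => // h h0 hd'; have := hd h; rewrite (gtr0_norm h0) => /(_ hd').
have x1 : x - 1 <= x by lra.
have xh : x <= x + h by lra.
have -> : F (x + h) - F x = (\int[mu]_(t in `[x, (x + h)%R]) f t)%R; last by [].
by rewrite /F (Rint_split x1 xh (lf _ _)) addrAC subrr add0r.
Qed.

(** Increments of the primitive are invariant under translation, so the
    derivatives at any two Lebesgue points agree. *)
Lemma dubois_cst (D : R -> C) : locint D -> orth D -> exists c, ae_equal D (fun=> c).
Proof.
move=> lD oD; have [mr mi] := locint_meas lD.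
have h1 := ae_derivative mr (fun a b => (lD a b).1).
have h2 := ae_derivative mi (fun a b => (lD a b).2).
have tr := orth_second_difference lD oD.
have inc x h : 0 < h -> cint `[x, x + h] D = prim D (0 + h) - prim D 0.
  move=> h0; have xh : x <= x + h by lra.
  have [_ hP] := prim_AC lD x (x + h).
  by rewrite -hP// (tr x 0 h (ltW h0)).
have same (f : R -> R) (Phi : R -> R) x y : (forall z h, 0 < h -> (\int[mu]_(t in `[z, (z + h)%R]) f t)%R = Phi h) ->
  (forall e, 0 < e -> exists2 d, 0 < d & forall h, 0 < h -> h < d ->
    `|(\int[mu]_(t in `[x, (x + h)%R]) f t)%R - h * f x| <= e * h) ->
  (forall e, 0 < e -> exists2 d, 0 < d & forall h, 0 < h -> h < d ->
    `|(\int[mu]_(t in `[y, (y + h)%R]) f t)%R - h * f y| <= e * h) -> f x = f y.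
  move=> hPhi hx hy; apply/eqP; rewrite -subr_eq0 -normr_le0; apply/ler_addgt0Pl => e e0; rewrite addr0.
  have e2 : 0 < e / 2 by rewrite divr_gt0.
  have [d1 d10 hd1] := hx _ e2; have [d2 d20 hd2] := hy _ e2.
  pose h := Num.min d1 d2 / 2.
  have m0 : 0 < Num.min d1 d2 by rewrite lt_min d10.
  have hm : h < Num.min d1 d2 by rewrite /h; lra.
  have h0 : 0 < h by rewrite /h; lra.
  have [k1 k2] : h < d1 /\ h < d2 by move: hm; rewrite lt_min => /andP[].
  have := hd1 h h0 k1; have := hd2 h h0 k2; rewrite !hPhi//.
  move=> l1 l2; rewrite -(ler_pM2r h0).
  have -> : `|f x - f y| * h = `|(Phi h - h * f y) - (Phi h - h * f x)|.
    by rewrite -{1}(gtr0_norm h0) -normrM; congr `|_|; ring.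
  by apply: (le_trans (ler_normB _ _)); lra.
have muT : (0 < mu [set: R])%E.
  apply: (@lt_le_trans _ _ (mu `[0, 1]%classic)); last by apply: le_measure; rewrite ?inE.
  by rewrite lebesgue_measure_itv /= lte_fin ltr01 -EFinB subr0 lte_fin.
have pf := @ae_properfilter_algebraOfSetsType _ _ _ mu muT.
have [x0 [g1 g2]] : exists x0, (forall e, 0 < e -> exists2 d, 0 < d & forall h, 0 < h -> h < d ->
    `|(\int[mu]_(t in `[x0, (x0 + h)%R]) cRe (D t))%R - h * cRe (D x0)| <= e * h) /\
   (forall e, 0 < e -> exists2 d, 0 < d & forall h, 0 < h -> h < d ->
    `|(\int[mu]_(t in `[x0, (x0 + h)%R]) cIm (D t))%R - h * cIm (D x0)| <= e * h).
  exact: (@filter_ex _ _ pf _ (filterI h1 h2)).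
exists (D x0).
have aeF := ae_filter_ringOfSetsType mu; apply: (filterS2 _ _ h1 h2) => x k1 k2; apply: eqC.
  apply: (same (fun t => cRe (D t)) (fun h => cRe (prim D (0 + h) - prim D 0))) => // z h h0.
  by rewrite -(inc z h h0) Re_cint.
apply: (same (fun t => cIm (D t)) (fun h => cIm (prim D (0 + h) - prim D 0))) => // z h h0.
by rewrite -(inc z h h0) Im_cint.
Qed.

Lemma cintegralE (u : R -> C) : cintegral u = cint setT u.
Proof. by apply: eqC; rewrite ?Re_cint ?Im_cint. Qed.

Lemma test_out (phi : R -> R) : test_function phi -> exists2 M, 0 < M &
  (forall x, M <= `|x| -> phi x = 0 /\ phi^`()%classic x = 0).
Proof.
move=> [sp [M hM]]; exists (`|M| + 1); first by have := normr_ge0 M; lra.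
move=> x hx; have hx' : M < `|x| by have := ler_norm M; lra.
by split; [exact: hM|exact: derive_out hM hx'].
Qed.

Lemma cint_test (u : R -> C) (phi : R -> R) M : 0 < M -> (forall x, M <= `|x| -> phi x = 0) ->
  cint setT (fun x => u x * (phi x)%:C) = cint `[- M, M] (fun x => u x * (phi x)%:C).
Proof.
move=> M0 h; apply: cint_supp => // x _ hx; rewrite h ?mulr0//.
rewrite leNgt; apply/negP => xM; apply: hx.
by rewrite /= in_itv /= -ler_norml ltW.
Qed.

Lemma AC_test (g G : R -> C) (phi : R -> R) M : 0 < M -> (forall a b, AC a b g G) -> test_function phi ->
  (forall x, M <= `|x| -> phi x = 0) ->
  [/\ cintegrable `[- M, M] (fun x => g x * (phi x)%:C),
      cintegrable `[- M, M] (fun x => G x * (phi^`()%classic x)%:C) &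
  cint `[- M, M] (fun x => G x * (phi^`()%classic x)%:C) = - cint `[- M, M] (fun x => g x * (phi x)%:C)].
Proof.
move=> M0 AG [sp _] out; have MM : - M <= M by lra.
have [sp' _] := smooth_derive sp.
have [ii ee] := AC_M MM (AG (- M) M) (smooth_AC sp (- M) M).
have i1 : cintegrable `[- M, M] (fun x => g x * (phi x)%:C).
  have := cintegrable_Mcont MM (@ccont_R _ _ (smooth_cont sp) (- M) M) (AG (- M) M).1.
  by apply: eq_cintegrable => // x _; rewrite mulrC.
have i2 : cintegrable `[- M, M] (fun x => G x * (phi^`()%classic x)%:C).
  apply: ccont_on_integrable; apply: ccont_onM; first exact: (AC_ccont AG).
  exact: ccont_R (smooth_cont sp') _ _.
split => //; have := ee _ _ (lexx _) MM (lexx _).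
rewrite !out ?normrN ?gtr0_norm// !mulr0 subrr cintD//.
by move=> /esym/eqP; rewrite addr_eq0 => /eqP ->; rewrite opprK.
Qed.

Lemma AC_weak (g G : R -> C) : (forall a b, AC a b g G) -> weak_derivative G g.
Proof.
move=> AG phi tp; have [M M0 out] := test_out tp; rewrite !cintegralE.
have o1 x : M <= `|x| -> phi x = 0 by move=> /out[].
have o2 x : M <= `|x| -> derive1 phi x = 0 by move=> /out[].
have [_ _ h] := AC_test M0 AG tp o1.
by rewrite (cint_test G M0 o2) (cint_test g M0 o1).
Qed.

(** Subtracting a primitive of the weak derivative leaves a function with zero
    weak derivative, which is constant almost everywhere. *)
Lemma weak_AC (u u1 : R -> C) : locint u -> locint u1 -> weak_derivative u u1 ->
  exists G, (forall a b, AC a b u1 G) /\ ae_equal u G.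
Proof.
move=> lu lu1 wu; have AP := prim_AC lu1; set P := prim u1 in AP.
have lP : locint P by move=> a b; apply: ccont_on_integrable; exact: (AC_ccont AP).
have lD : locint (fun x => u x - P x) by move=> a b; apply: cintegrableB.
have [c hc] : exists c, ae_equal (fun x => u x - P x) (fun=> c).
  apply: dubois_cst => // phi tp; have [M M0 out] := test_out tp.
  have o1 x : M <= `|x| -> phi x = 0 by move=> /out[].
  have o2 x : M <= `|x| -> derive1 phi x = 0 by move=> /out[].
  have [_ i2 h] := AC_test M0 AP tp o1.
  have := wu phi tp; rewrite !cintegralE (cint_test u M0 o2) (cint_test u1 M0 o1) => h'.
  rewrite (cint_test _ M0 o2).
  have iu : cintegrable `[- M, M] (fun x => u x * (derive1 phi x)%:C).
    have [sp' _] := smooth_derive tp.1; have MM : - M <= M by lra.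
    have := cintegrable_Mcont MM (@ccont_R _ _ (smooth_cont sp') (- M) M) (lu (- M) M).
    by apply: eq_cintegrable => // x _; rewrite mulrC.
  have -> : cint `[- M, M] (fun x => (u x - P x) * (derive1 phi x)%:C) =
     cint `[- M, M] (fun x => u x * (derive1 phi x)%:C - P x * (derive1 phi x)%:C).
    by apply: eq_cint => x _; rewrite mulrBl.
  by rewrite cintB// h' h subrr.
exists (fun x => P x + c); split.
  move=> a b; have := AC_D (AP a b) (@AC_cst R a b c).
  by apply: eq_AC => // x _; rewrite addr0.
have aeF := ae_filter_ringOfSetsType mu; apply: (filterS _ hc) => x /eqP; by rewrite subr_eq addrC => /eqP.
Qed.

End WeakDerivative.

(** * Square integrable functions *)

Section SquareIntegrable.
Variable R : realType.
Local Notation C := R[i].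
Local Notation mu := (@lebesgue_measure R).
Implicit Types (f g u : R -> C) (D : set (measurableTypeR R)).

(** Extended-real, so that monotone and additive estimates hold before
    finiteness is known. *)
Definition en D f : \bar R := (\int[mu]_(x in D) (nc (f x) ^+ 2)%:E)%E.

Lemma nc_sq (z : C) : nc z ^+ 2 = cRe z ^+ 2 + cIm z ^+ 2.
Proof. by rewrite ncE sqr_sqrtr// addr_ge0 ?sqr_ge0. Qed.

Lemma sq0 f x : (0 <= (nc (f x) ^+ 2)%:E)%E.
Proof. by rewrite lee_fin sqr_ge0. Qed.
Hint Resolve sq0 : core.

Lemma sq_meas D f : measurable D -> cmeas D f -> measurable_fun D (fun x => (nc (f x) ^+ 2)%:E).
Proof. by move=> mD mf; apply/measurable_EFinP; apply: measurable_funX; exact: cmeas_nc. Qed.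

Lemma en_ge0 D f : (0 <= en D f)%E.
Proof. by apply: integral_ge0 => x _; exact: sq0. Qed.

Lemma le_en D f g : measurable D -> cmeas D f -> cmeas D g -> (forall x, D x -> nc (f x) <= nc (g x)) -> (en D f <= en D g)%E.
Proof.
move=> mD mf mg h; apply: ge0_le_integral => //; [exact: sq_meas|exact: sq_meas|].
by move=> x Dx; rewrite lee_fin lerXn2r ?nnegrE ?nc_ge0 ?h.
Qed.

Lemma en_sub D E f : measurable D -> measurable E -> E `<=` D -> cmeas D f -> (en E f <= en D f)%E.
Proof. by move=> mD mE ED mf; apply: ge0_subset_integral => //; exact: sq_meas. Qed.

Lemma enZ D f c : measurable D -> cmeas D f -> en D (fun x => c * f x) = ((nc c ^+ 2)%:E * en D f)%E.
Proof.
move=> mD mf; rewrite /en -ge0_integralZl//.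
- by apply: eq_integral => x _; rewrite ncM exprMn EFinM.
- exact: sq_meas.
- by rewrite lee_fin sqr_ge0.
Qed.

Lemma enD D f g : measurable D -> cmeas D f -> cmeas D g ->
  (en D (fun x => (f x + g x)%R) <= 2%:E * (en D f + en D g))%E.
Proof.
move=> mD mf mg; rewrite /en -ge0_integralD//; [|exact: sq_meas..].
rewrite -ge0_integralZl//; [|by apply: emeasurable_funD; exact: sq_meas|by move=> x _; rewrite adde_ge0].
apply: ge0_le_integral => //.
- by move=> x _; rewrite lee_fin sqr_ge0.
- by apply: (@sq_meas D (fun x => f x + g x)) => //; exact: cmeasD.
- apply: measurable_funeM; apply: emeasurable_funD; exact: sq_meas.
move=> x _; rewrite -EFinD -EFinM lee_fin.
have := ncD (f x) (g x); have := nc_ge0 (f x + g x).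
move: (nc (f x + g x)) (nc (f x)) (nc (g x)) => s a b s0 sab.
apply: (@le_trans _ _ ((a + b) ^+ 2)); first by rewrite lerXn2r ?nnegrE// (le_trans s0).
by have := sqr_ge0 (a - b); rewrite !expr2; nra.
Qed.

(** Monotone convergence along an exhaustion by bounded intervals. *)
Lemma en_trunc D f (K : \bar R) N : measurable D -> cmeas D f ->
  (forall n : nat, (N <= n)%N -> (en (D `&` `[(- n%:R)%R, n%:R%R]) f <= K)%E) -> (en D f <= K)%E.
Proof.
move=> mD mf hK; pose F (n : nat) : set (measurableTypeR R) := D `&` `[(- n%:R)%R, n%:R%R]%classic.
have mF i : measurable (F i) by apply: measurableI => //; exact: measurable_itv.
have FS m n : (m <= n)%N -> F m `<=` F n.
  by move=> mn; apply: setIS; apply: subset_itvScc; rewrite bnd_simp ?lerN2 ler_nat.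
have h n : (en (F n) f <= K)%E.
  apply: le_trans (hK (N + n)%N (leq_addr _ _)); apply: (@en_sub (F (N + n)%N) (F n)) => //; first by apply: FS; exact: leq_addl.
  by apply: cmeasS mf => // x [].
have nd : nondecreasing_seq F by move=> m n mn; apply/subsetPset; exact: FS.
have msq i : measurable_fun (F i) (fun x => (nc (f x) ^+ 2)%:E) by apply: sq_meas => //; apply: cmeasS mf => // x [].
have H := @ge0_nondecreasing_set_cvg_integral _ _ R F _ mu nd mF msq (fun i x _ => sq0 f x).
have UF : \bigcup_i F i = D.
  by rewrite /F -setI_bigcupr (_ : \bigcup_i _ = setT) ?setIT//; exact: bigcup_itv.
rewrite UF in H; rewrite /en -(cvg_lim _ H)//; apply: lime_le; first exact: cvgP H.
by near=> n; exact: h.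
Unshelve. all: by end_near.
Qed.

Lemma sq_integrable D f : measurable D -> cmeas D f -> (en D f < +oo)%E -> mu.-integrable D (EFin \o (fun x => nc (f x) ^+ 2)).
Proof.
move=> mD mf h; apply/integrableP; split; first exact: sq_meas.
by apply: le_lt_trans h; rewrite le_eqVlt; apply/orP; left; apply/eqP; apply: eq_integral => x _ /=; rewrite ger0_norm ?sqr_ge0.
Qed.

Lemma enE D f : measurable D -> cmeas D f -> (en D f < +oo)%E -> en D f = ((\int[mu]_(x in D) (nc (f x) ^+ 2))%R)%:E.
Proof.
move=> mD mf h; rewrite /Rintegral fineK//.
exact: integrable_fin_num (sq_integrable mD mf h).
Qed.

Lemma L2P f : L2 f <-> cmeas setT f /\ (en setT f < +oo)%E.
Proof.
split.
  move=> [h1 h2]; have i1 := Lfun2_integrable_sqr h1; have i2 := Lfun2_integrable_sqr h2.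
  have mf : cmeas setT f.
    by move: h1 h2; rewrite !inE => /andP[m1 _] /andP[m2 _]; split; [rewrite inE/= in m1|rewrite inE/= in m2].
  split => //; have /integrableP[_] := integrableDR measurableT i1 i2.
  apply: le_lt_trans; rewrite le_eqVlt; apply/orP; left; apply/eqP; apply: eq_integral => x _ /=.
  by rewrite ger0_norm ?addr_ge0 ?sqr_ge0// nc_sq.
move=> [mf fin].
have H (h : R -> R) : measurable_fun setT h -> (forall x, `|h x| <= nc (f x)) -> h \in Lfun mu 2%:E.
  move=> mh hle; rewrite inE; apply/andP; split; first by rewrite inE.
  rewrite inE /= /finite_norm unlock; apply: poweR_lty.
  apply: le_lt_trans fin; apply: ge0_le_integral => //.
  - by move=> x _; exact: poweR_ge0.
  - apply/measurable_EFinP; rewrite (_ : (fun x => _) = (fun x => `|h x| ^+ 2)); last first.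
      by apply/funext => x; rewrite powR_mulrn.
    by apply: measurable_funX; exact: measurableT_comp.
  - exact: sq_meas.
  - by move=> x _ /=; rewrite lee_fin powR_mulrn// lerXn2r ?nnegrE ?nc_ge0.
by split; apply: H; [exact: mf.1|move=> x; exact: nc_Re|exact: mf.2|move=> x; exact: nc_Im].
Qed.

Lemma L2normE f : L2norm f = ((en setT f) `^ 2^-1)%E.
Proof.
rewrite /L2norm unlock; congr (_ `^ _)%E; apply: eq_integral => x _ /=.
by rewrite powR_mulrn// ger0_norm ?nc_ge0.
Qed.

Lemma L2norm_le f g (c : R) : 0 <= c -> (en setT g <= (c ^+ 2)%:E * en setT f)%E -> (L2norm g <= c%:E * L2norm f)%E.
Proof.
move=> c0 h; rewrite !L2normE.
have e0 := en_ge0 setT f.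
have -> : (c%:E * en setT f `^ 2^-1 = ((c ^+ 2)%:E * en setT f) `^ 2^-1)%E.
  rewrite poweRM ?lee_fin ?sqr_ge0// poweR_EFin powR12_sqrt ?sqr_ge0//.
  by rewrite sqrtr_sqr ger0_norm.
by apply: gt0_ler_poweR => //; rewrite in_itv /= leey ?en_ge0 ?mule_ge0 ?lee_fin ?sqr_ge0.
Qed.

Lemma L2D f g : L2 f -> L2 g -> L2 (fun x => f x + g x).
Proof.
move=> /L2P[mf hf] /L2P[mg hg]; apply/L2P; split; first exact: cmeasD.
apply: le_lt_trans (enD measurableT mf mg) _.
by apply: lte_mul_pinfty => //; exact: lte_add_pinfty.
Qed.

Lemma L2_le f g (K : R) : cmeas setT g -> (forall x, nc (g x) <= K * nc (f x)) -> L2 f -> L2 g.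
Proof.
move=> mg h /L2P[mf hf]; apply/L2P; split => //.
have mKf : cmeas setT (fun x => K%:C * f x) by apply: cmeasM => //; exact: cmeas_cst.
apply: (@le_lt_trans _ _ (en setT (fun x => K%:C * f x))).
  apply: le_en => // x _; rewrite ncM ncR (le_trans (h x))// ler_wpM2r ?nc_ge0 ?ler_norm//.
by rewrite enZ// lte_mul_pinfty ?lee_fin ?sqr_ge0.
Qed.

Lemma L2Z f c : L2 f -> L2 (fun x => c * f x).
Proof.
move=> lf; have /L2P[mf _] := lf; apply: (@L2_le f _ (nc c)) => //; last by move=> x; rewrite ncM.
by apply: cmeasM => //; exact: cmeas_cst.
Qed.

Lemma L2B f g : L2 f -> L2 g -> L2 (fun x => f x - g x).
Proof.
move=> hf hg; have := L2D hf (L2Z (-1) hg).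
by congr L2; apply/funext => x; rewrite mulN1r.
Qed.

Lemma fin_locint f : cmeas setT f -> (forall a b, (en `[a, b] f < +oo)%E) -> locint f.
Proof.
move=> mf h a b; have mfi : cmeas `[a, b] f by exact: cmeasS mf.
apply: (@le_cintegrable _ _ _ (fun x => 1 + nc (f x) ^+ 2)) => //.
  by apply: integrableDR => //; [exact: integrable_cst_itv|exact: sq_integrable].
by move=> x _; have := sqr_ge0 (nc (f x) - 1); rewrite !expr2; have := nc_ge0 (f x); nra.
Qed.

Lemma L2_fin D f : measurable D -> L2 f -> (en D f < +oo)%E.
Proof. by move=> mD /L2P[mf h]; apply: le_lt_trans h; exact: en_sub. Qed.

Lemma L2_locint f : L2 f -> locint f.
Proof. by move=> lf; have /L2P[mf _] := lf; apply: fin_locint => // a b; exact: L2_fin. Qed.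

Lemma cintegrable_mul D f g : measurable D -> cmeas D f -> cmeas D g -> (en D f < +oo)%E -> (en D g < +oo)%E ->
  cintegrable D (fun x => f x * g x).
Proof.
move=> mD mf mg hf hg.
apply: (@le_cintegrable _ _ _ (fun x => nc (f x) ^+ 2 + nc (g x) ^+ 2)) => //.
- exact: cmeasM.
- by apply: integrableDR => //; exact: sq_integrable.
- move=> x _; rewrite ncM; have := sqr_ge0 (nc (f x) - nc (g x)).
  by have := nc_ge0 (f x); have := nc_ge0 (g x); rewrite !expr2; nra.
Qed.

(** Cauchy-Schwarz against the constant function: integrate
    [2 k |f| <= |f|^2 + k^2] with [k] the mean of [|f|]. *)
Lemma mean_square a b f : a < b -> cmeas `[a, b] f -> (en `[a, b] f < +oo)%E -> cintegrable `[a, b] f ->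
  (\int[mu]_(x in `[a, b]) nc (f x))%R ^+ 2 <= (b - a) * (\int[mu]_(x in `[a, b]) (nc (f x) ^+ 2))%R.
Proof.
move=> ab mf hf i_f; have ba : 0 < b - a by rewrite subr_gt0.
have isq := sq_integrable (measurable_itv _) mf hf.
have inc := cintegrable_nc (measurable_itv _) i_f.
set I := (\int[mu]_(x in _) nc (f x))%R; set E := (\int[mu]_(x in _) (_ ^+ 2))%R.
pose k := I / (b - a).
have h : 2 * k * I <= E + k ^+ 2 * (b - a).
  rewrite /I -RintegralZl// -(Rintegral_cst_itv (k ^+ 2) (ltW ab)) /E -RintegralD//; last exact: integrable_cst_itv.
  apply: le_Rintegral => //.
  - exact: integrableZR.
  - by apply: integrableDR => //; exact: integrable_cst_itv.
  - by move=> x _; have := sqr_ge0 (nc (f x) - k); rewrite !expr2; nra.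
have ba' : b - a != 0 by rewrite lt0r_neq0.
have e1 : 2 * k * I = 2 * (I ^+ 2 / (b - a)) by rewrite /k; field.
have e2 : k ^+ 2 * (b - a) = I ^+ 2 / (b - a) by rewrite /k; field.
rewrite e1 e2 in h; rewrite mulrC -ler_pdivrMr//; lra.
Qed.

End SquareIntegrable.

(** * The energy identity *)

Section Energy.
Variable R : realType.
Local Notation C := R[i].
Local Notation mu := (@lebesgue_measure R).
Implicit Types (f u v g G : R -> C) (a b x : R).

Lemma cint_conj (D : set (measurableTypeR R)) f : measurable D -> cintegrable D f ->
  cint D (fun x => conjc (f x)) = conjc (cint D f).
Proof.
move=> mD [i1 i2]; apply: eqC.
  rewrite Re_cint (_ : cRe _ = cRe (cint D f)); last by case: (cint D f).
  by rewrite Re_cint; apply: eq_Rintegral => x _; case: (f x).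
rewrite Im_cint (_ : cIm (conjc _) = - 1 * cIm (cint D f)); last by case: (cint D f) => * /=; rewrite mulN1r.
rewrite Im_cint -RintegralZl//; apply: eq_Rintegral => x _; case: (f x) => * /=; by rewrite mulN1r.
Qed.

Lemma cintegrable_conj (D : set (measurableTypeR R)) f : measurable D -> cintegrable D f ->
  cintegrable D (fun x => conjc (f x)).
Proof.
move=> mD i; apply: (@le_cintegrable _ _ _ (fun x => nc (f x))) => //.
- by apply: cmeas_conj; exact: cintegrable_meas.
- exact: cintegrable_nc.
- by move=> x _; rewrite ncJ.
Qed.

Lemma AC_conj a b g G : AC a b g G -> AC a b (fun x => conjc (g x)) (fun x => conjc (G x)).
Proof.
move=> [ig hG]; split; first exact: cintegrable_conj.
move=> x y ax xy yb; rewrite cint_conj//; last first.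
  by apply: cintegrableS ig => //; apply: subset_itvScc; rewrite bnd_simp.
by rewrite -hG// rmorphB.
Qed.

Lemma AC_all g G : (forall a b, a <= b -> AC a b g G) -> forall a b, AC a b g G.
Proof.
move=> h a b; have [ab|/ltW ba] := leP a b; first exact: h.
by apply: AC_S (h _ _ ba).
Qed.

Lemma ccont_on_conj a b f : ccont_on a b f -> ccont_on a b (fun x => conjc (f x)).
Proof.
move=> hf x xab e e0; have [d d0 hd] := hf x xab e e0; exists d => // y yab yx.
by rewrite -rmorphB ncJ; exact: hd.
Qed.

Lemma sq_ccont a b f : ccont_on a b f -> mu.-integrable `[a, b] (EFin \o (fun x => nc (f x) ^+ 2)).
Proof.
move=> hf; have [i _] := ccont_on_integrable (ccont_onM hf (ccont_on_conj hf)).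
move: i; congr (mu.-integrable _ _); apply/funext => x /=; rewrite nc_sq.
by case: (f x) => * /=; congr (_%:E); ring.
Qed.

Lemma en_ccont a b f : ccont_on a b f -> (en `[a, b] f < +oo)%E.
Proof.
move=> /sq_ccont/integrableP[_]; apply: le_lt_trans; rewrite le_eqVlt; apply/orP; left; apply/eqP.
by apply: eq_integral => x _ /=; rewrite ger0_norm ?sqr_ge0.
Qed.

Variables (V : R -> R) (l : C) (v0 : R).
Hypotheses (l0 : 0 < cIm l) (bV : forall x, `|V x| <= v0) (cV : continuous V) (hv : 2 * v0 <= cIm l ^+ 2).
Local Notation q := (pot V l).
Local Notation b := (cIm l).

(** Imaginary part of [conj l u' conj u]: its derivative is negative definite
    up to the source, because [conj l * l ^ 2 = |l| ^ 2 l]. *)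
Lemma energy_pt (v : R) (z w F : C) : `|v| <= v0 ->
  b * nc w ^+ 2 + b * nc l ^+ 2 / 4 * nc z ^+ 2 <=
  b^-1 * nc F ^+ 2 - cIm (conjc l * (((v%:C - l ^+ 2) * z - F) * conjc z + w * conjc w)).
Proof.
move=> hv0; have -> : cIm (conjc l * (((v%:C - l ^+ 2) * z - F) * conjc z + w * conjc w)) =
   - (b * v * nc z ^+ 2 + b * nc l ^+ 2 * nc z ^+ 2 + b * nc w ^+ 2 + cIm (conjc l * F * conjc z)).
  by rewrite !nc_sq; case: l => p b'; case: z => *; case: w => *; case: F => * /=; ring.
have Fz : - (nc l * nc F * nc z) <= cIm (conjc l * F * conjc z).
  rewrite lerNl; have -> : nc l * nc F * nc z = nc (conjc l * F * conjc z) by rewrite !ncM !ncJ.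
  by apply: le_trans (nc_Im _); rewrite -normrN ler_norm.
have [vl vu] : - v0 <= v /\ v <= v0 by move: hv0; rewrite ler_norml => /andP[].
have bl : b ^+ 2 <= nc l ^+ 2 by rewrite nc_sq lerDr sqr_ge0.
have z0 : 0 <= b * nc z ^+ 2 by rewrite mulr_ge0 ?sqr_ge0// ltW.
have h1 : b * nc z ^+ 2 * (- v) <= b * nc z ^+ 2 * (nc l ^+ 2 / 2).
  by apply: ler_wpM2l => //; have := hv; have := l0; lra.
have h2 : nc l * nc F * nc z <= b * nc l ^+ 2 / 4 * nc z ^+ 2 + b^-1 * nc F ^+ 2.
  rewrite -subr_ge0; have -> : b * nc l ^+ 2 / 4 * nc z ^+ 2 + b^-1 * nc F ^+ 2 - nc l * nc F * nc z =
    b^-1 * (b * nc l * nc z / 2 - nc F) ^+ 2 by field; rewrite lt0r_neq0.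
  by rewrite mulr_ge0 ?sqr_ge0// invr_ge0 ltW.
move: h1 h2 Fz; set zz := nc z ^+ 2; set ll := nc l ^+ 2; set FF := nc F ^+ 2; set ww := nc w ^+ 2.
set X := nc l * nc F * nc z; set Y := cIm _; set bi := b^-1 * FF.
have -> : b * zz * - v = - (b * v * zz) by ring.
have -> : b * zz * (ll / 2) = (b * ll * zz) / 2 by ring.
have -> : b * ll / 4 * zz = (b * ll * zz) / 4 by ring.
lra.
Qed.

(** Integrating [energy_pt]: the derivative of [conj l u' conj u] contributes only
    boundary terms. *)
Lemma energy a c f u u1 : a <= c -> (forall a b, AC a b u1 u) -> (forall a b, AC a b (fun x => q x * u x - f x) u1) ->
  cmeas setT f -> (en `[a, c] f < +oo)%E ->
  b * (\int[mu]_(x in `[a, c]) (nc (u1 x) ^+ 2))%R + b * nc l ^+ 2 / 4 * (\int[mu]_(x in `[a, c]) (nc (u x) ^+ 2))%R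
  <= b^-1 * (\int[mu]_(x in `[a, c]) (nc (f x) ^+ 2))%R + nc l * (nc (u1 a) * nc (u a) + nc (u1 c) * nc (u c)).
Proof.
move=> ac hu hu1 mf ef.
have cu := AC_ccont hu; have cu1 := AC_ccont hu1.
have AZ := AC_Z (conjc l) (AC_M ac (hu1 a c) (AC_conj (hu a c))).
have [ig hG] := AZ; have := hG a c (lexx _) ac (lexx _).
set g := fun x => _ in ig hG *; set Z := fun x => conjc l * (u1 x * conjc (u x)).
move=> hZ.
have mfi : cmeas `[a, c] f by exact: cmeasS mf.
have isq h : ccont h -> mu.-integrable `[a, c] (EFin \o (fun x => nc (h x) ^+ 2)) by move=> ch; exact: sq_ccont (ch a c).
have i1 := isq _ cu; have i2 := isq _ cu1; have i3 := sq_integrable (measurable_itv _) mfi ef.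
have mi : measurable (`[a, c]%classic : set (measurableTypeR R)) by exact: measurable_itv.
have j1 := integrableZR b mi i2; have j2 := integrableZR (b * nc l ^+ 2 / 4) mi i1.
have j3 := integrableZR b^-1 mi i3; have j4 : mu.-integrable `[a, c] (EFin \o (fun x => cIm (g x))) by exact: ig.2.
rewrite -(RintegralZl _ mi i2) -(RintegralZl _ mi i1) -(RintegralZl _ mi i3) -(RintegralD mi j1 j2).
have step : (\int[mu]_(x in `[a, c]) (b * nc (u1 x) ^+ 2 + b * nc l ^+ 2 / 4 * nc (u x) ^+ 2) <=
    \int[mu]_(x in `[a, c]) (b^-1 * nc (f x) ^+ 2 - cIm (g x)))%R.
  apply: le_Rintegral => //; [exact: integrableDR|exact: integrableBR|].
  by move=> x _; exact: energy_pt.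
apply: (le_trans step); rewrite (RintegralB mi j3 j4) lerD2l -Im_cint -hZ /Z.
have -> : nc l * (nc (u1 a) * nc (u a) + nc (u1 c) * nc (u c)) =
  nc (conjc l * (u1 a * conjc (u a))) + nc (conjc l * (u1 c * conjc (u c))) by rewrite !ncM !ncJ mulrDr.
move: (conjc l * (u1 a * conjc (u a))) (conjc l * (u1 c * conjc (u c))) => za zc.
rewrite -ImN opprB ImB; have := nc_Im za; have := nc_Im zc; rewrite !ler_norml => /andP[h1 h2] /andP[h3 h4]; lra.
Qed.

End Energy.

(** * The Green operator *)

Section GreenOperator.
Variable R : realType.
Local Notation C := R[i].
Local Notation mu := (@lebesgue_measure R).
Implicit Types (f u v : R -> C) (a b x : R).

(** Variation of parameters, the two integrals over the half lines being split
    at the origin. *)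
Definition green (W : C) (P M fp fm f : R -> C) x : C :=
  W^-1 * (P x * (cint `]-oo, 0] (fun t => fm t * f t) + prim (fun t => fm t * f t) x)
        + M x * (cint `[0, +oo[ (fun t => fp t * f t) - prim (fun t => fp t * f t) x)).

Lemma locint_M f g : ccont g -> locint f -> locint (fun x => g x * f x).
Proof.
move=> cg lf a b; have [ab|ba] := leP a b; first exact: cintegrable_Mcont.
have e : `[a, b]%classic = set0 :> set R.
  by apply/seteqP; split => // x /=; rewrite in_itv /= => /andP[h1 h2]; move: (le_lt_trans h1 (le_lt_trans h2 ba)); rewrite ltxx.
by rewrite e; split; apply/integrableP; split => //; rewrite ?integral_set0//; exact: measurable_fun_set0.
Qed.

Lemma cint_prim f x : 0 <= x -> cint `[0, x] f = prim f x.
Proof. by move=> x0; rewrite /prim x0. Qed.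

Lemma cint_primN f x : x <= 0 -> cint `[x, 0] f = - prim f x.
Proof.
rewrite le_eqVlt => /predU1P[->|x0]; first by rewrite prim0 cint_pt oppr0.
by rewrite /prim leNgt x0 /= opprK.
Qed.

Section Solution.
Variables (q fp fp1 fm fm1 : R -> C) (W : C).
Hypotheses (hp : forall a b, issol q a b fp fp1) (hm : forall a b, issol q a b fm fm1).
Hypotheses (HW : forall x, fp x * fm1 x - fp1 x * fm x = W) (W0 : W != 0).

Let cp : ccont fp. Proof. by apply: AC_ccont => a b; have [] := hp a b; eauto. Qed.
Let cm : ccont fm. Proof. by apply: AC_ccont => a b; have [] := hm a b; eauto. Qed.

(** The terms in which the integrals are differentiated cancel in the first
    derivative; in the second they leave the Wronskian times the source. *)
Lemma green_AC f : locint f -> (forall a b, AC a b (green W fp1 fm1 fp fm f) (green W fp fm fp fm f)) /\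
  (forall a b, AC a b (fun x => q x * green W fp fm fp fm f x - f x) (green W fp1 fm1 fp fm f)).
Proof.
move=> lf; have Pm := prim_AC (locint_M cm lf); have Pp := prim_AC (locint_M cp lf).
set a0 := cint `]-oo, 0] (fun t => fm t * f t); set b0 := cint `[0, +oo[ (fun t => fp t * f t).
set pm := prim _ in Pm; set pp := prim _ in Pp.
have A a b : AC a b (fun x => fm x * f x) (fun x => a0 + pm x).
  by have := AC_D (AC_cst a b a0) (Pm a b); apply: eq_AC => // x _; rewrite add0r.
have B a b : AC a b (fun x => - (fp x * f x)) (fun x => b0 - pp x).
  by have := AC_B (AC_cst a b b0) (Pp a b); apply: eq_AC => // x _; rewrite sub0r.
split; apply: AC_all => a b ab.
  have [U1 _] := hp a b; have [U2 _] := hm a b.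
  have := AC_Z W^-1 (AC_D (AC_M ab U1 (A a b)) (AC_M ab U2 (B a b))).
  apply: eq_AC => x _; rewrite /green -/a0 -/b0 -/pm -/pp //.
  by move: (a0 + pm x) (b0 - pp x) (fp x) (fp1 x) (fm x) (fm1 x) (f x) W^-1 => *; ring.
have [_ U1] := hp a b; have [_ U2] := hm a b.
have := AC_Z W^-1 (AC_D (AC_M ab U1 (A a b)) (AC_M ab U2 (B a b))).
apply: eq_AC => x _; rewrite /green -/a0 -/b0 -/pm -/pp //.
have w : W^-1 * (fp x * fm1 x - fp1 x * fm x) = 1 by rewrite HW mulVf.
rewrite -[X in _ = _ - X]mul1r -w.
by move: (a0 + pm x) (b0 - pp x) (fp x) (fp1 x) (fm x) (fm1 x) (f x) W^-1 (q x) => *; ring.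
Qed.

End Solution.
End GreenOperator.

Section Resolvent.
Variable R : realType.
Local Notation C := R[i].
Local Notation mu := (@lebesgue_measure R).
Implicit Types (f u v : R -> C) (a x : R).

Lemma expR_small (b e : R) : 0 < b -> 0 < e -> exists N : nat, forall x, N%:R <= x -> expR (- b * x) <= e.
Proof.
move=> b0 e0; exists (Num.bound (b^-1 / e)) => x hx.
have be0 : 0 <= b^-1 / e by rewrite divr_ge0// ?invr_ge0 ltW.
have k := archi_boundP be0; have kx := lt_le_trans k hx.
have h : 1 / e <= expR (b * x).
  have h0 : 1 / e <= b * x.
    have -> : 1 / e = b * (b^-1 / e) by field; rewrite !lt0r_neq0.
    by rewrite ler_pM2l// ltW.
  by apply: (le_trans h0); apply: le_trans (expR_ge1Dx _); rewrite lerDr.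
by rewrite mulNr expRN invf_ple ?posrE ?expR_gt0// -[e^-1]mul1r.
Qed.

(** Comparison with the exponential, whose square integrates to [1 / (2 d)]. *)
Lemma en_half_m (d K : R) u : 0 < d -> ccont u -> (forall x, x <= 0 -> nc (u x) <= K * expR (d * x)) -> (en `]-oo, 0%R] u < +oo)%E.
Proof.
move=> d0 cu hu; have mu' := ccont_cmeas cu.
apply: (@le_lt_trans _ _ (K ^+ 2 / (2 * d))%:E); last exact: ltry.
apply: (@en_trunc _ _ _ _ 0) => //; first exact: cmeasS mu'.
move=> n _; have n0 : - n%:R <= 0 :> R by rewrite lerNl oppr0.
have cn := cu (- n%:R) 0; have mi : measurable (`[- n%:R, 0]%classic : set (measurableTypeR R)) by exact: measurable_itv.
apply: (@le_trans _ _ (en `[(- n%:R)%R, 0%R] u)).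
  apply: en_sub => //; first by apply: measurableI; exact: measurable_itv.
    by move=> x /= [] ; rewrite !in_itv /= => h1 /andP[h2 _]; rewrite h2.
  exact: cmeasS mu'.
rewrite enE//; [|exact: cmeasS mu'|exact: en_ccont].
rewrite lee_fin; have ie := exp_integrable (2 * d) n0.
have h : (\int[mu]_(x in `[(- n%:R)%R, 0%R]) nc (u x) ^+ 2 <= \int[mu]_(x in `[(- n%:R)%R, 0%R]) (K ^+ 2 * expR (2 * d * x)))%R.
  apply: le_Rintegral => //; [exact: sq_ccont|exact: integrableZR|].
  move=> x /=; rewrite in_itv /= => /andP[_ x0].
  have := hu x x0; have := nc_ge0 (u x) => h1 h2.
  have -> : K ^+ 2 * expR (2 * d * x) = (K * expR (d * x)) ^+ 2.
    by rewrite exprMn [expR (d * x) ^+ 2]expr2 -expRD; congr (_ * expR _); ring.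
  by rewrite lerXn2r ?nnegrE// (le_trans h1 h2).
apply: (le_trans h); rewrite (RintegralZl _ mi ie) exp_integral ?lt0r_neq0 ?mulr_gt0//.
rewrite mulr0 expR0; apply: ler_wpM2l; first exact: sqr_ge0.
rewrite ler_pdivrMr ?mulr_gt0// mulVf ?lt0r_neq0 ?mulr_gt0//.
Qed.

Lemma en_half_p (d K : R) u : 0 < d -> ccont u -> (forall x, 0 <= x -> nc (u x) <= K * expR (- d * x)) -> (en `[0%R, +oo[ u < +oo)%E.
Proof.
move=> d0 cu hu; have mu' := ccont_cmeas cu.
apply: (@le_lt_trans _ _ (K ^+ 2 / (2 * d))%:E); last exact: ltry.
apply: (@en_trunc _ _ _ _ 0) => //; first exact: cmeasS mu'.
move=> n _; have n0 : 0 <= n%:R :> R by [].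
have mi : measurable (`[0, n%:R]%classic : set (measurableTypeR R)) by exact: measurable_itv.
apply: (@le_trans _ _ (en `[0%R, n%:R%R] u)).
  apply: en_sub => //; first by apply: measurableI; exact: measurable_itv.
    by move=> x /= [] ; rewrite !in_itv /= andbT => -> /andP[_ ->].
  exact: cmeasS mu'.
rewrite enE//; [|exact: cmeasS mu'|exact: en_ccont].
have n1 : - (2 * d) != 0 by rewrite oppr_eq0 lt0r_neq0// mulr_gt0.
rewrite lee_fin; have ie := exp_integrable (- (2 * d)) n0.
have h : (\int[mu]_(x in `[0%R, n%:R%R]) nc (u x) ^+ 2 <= \int[mu]_(x in `[0%R, n%:R%R]) (K ^+ 2 * expR (- (2 * d) * x)))%R.
  apply: le_Rintegral => //; [exact: sq_ccont|exact: integrableZR|].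
  move=> x /=; rewrite in_itv /= => /andP[x0 _].
  have := hu x x0; have := nc_ge0 (u x) => h1 h2.
  have -> : K ^+ 2 * expR (- (2 * d) * x) = (K * expR (- d * x)) ^+ 2.
    by rewrite exprMn [expR (- d * x) ^+ 2]expr2 -expRD; congr (_ * expR _); ring.
  by rewrite lerXn2r ?nnegrE// (le_trans h1 h2).
apply: (le_trans h); rewrite (RintegralZl _ mi ie) exp_integral//.
rewrite mulr0 expR0; apply: ler_wpM2l; first exact: sqr_ge0.
rewrite invrN mulrN -mulNr ler_pdivrMr ?mulr_gt0// mulVf ?lt0r_neq0 ?mulr_gt0//.
Qed.

End Resolvent.

(** * Truncated sources *)

Section Cutoff.
Variable R : realType.
Local Notation C := R[i].
Local Notation mu := (@lebesgue_measure R).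
Implicit Types (f u v : R -> C) (m x : R).

Lemma cutoff_in m f x : `|x| <= m -> cutoff m f x = f x.
Proof.
move=> h; rewrite /cutoff indicE mem_set /= ?mul1r//.
by rewrite in_itv /= -ler_norml.
Qed.

Lemma cutoff_out m f x : m < `|x| -> cutoff m f x = 0.
Proof.
move=> h; rewrite /cutoff indicE memNset /= ?mul0r// in_itv /= -ler_norml leNgt h.
by [].
Qed.

Lemma nc_cutoff m f x : nc (cutoff m f x) <= nc (f x).
Proof. by have [h|h] := leP `|x| m; [rewrite cutoff_in|rewrite cutoff_out// nc0 nc_ge0]. Qed.

Lemma cmeas_cutoff m f : cmeas setT f -> cmeas setT (cutoff m f).
Proof.
move=> mf; apply: cmeasM => //; apply: cmeas_R; exact: measurable_indic.
Qed.

Lemma L2_cutoff m f : L2 f -> L2 (cutoff m f).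
Proof.
move=> lf; have /L2P[mf _] := lf; apply: (@L2_le _ f _ 1) => //; first exact: cmeas_cutoff.
by move=> x; rewrite mul1r nc_cutoff.
Qed.

Lemma prim_eq f g x : (forall t, `|t| <= `|x| -> f t = g t) -> prim f x = prim g x.
Proof.
move=> h; rewrite /prim; have [x0|x0] := leP 0 x; last congr (- _); apply: eq_cint => t /=;
  rewrite in_itv /= => /andP[t0 tx]; apply: h.
  by rewrite !ger0_norm// (le_trans t0).
by rewrite (ltr0_norm x0) ler0_norm// lerN2.
Qed.

Lemma sq_mono (D E : set (measurableTypeR R)) f : measurable D -> measurable E -> D `<=` E -> cmeas E f -> (en E f < +oo)%E ->
  (\int[mu]_(x in D) (nc (f x) ^+ 2))%R <= (\int[mu]_(x in E) (nc (f x) ^+ 2))%R.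
Proof.
move=> mD mE DE mf ef; have mfD : cmeas D f by exact: cmeasS mf.
have h := en_sub mE mD DE mf; have efD := le_lt_trans h ef.
by move: h; rewrite (enE mD mfD efD) (enE mE mf ef) lee_fin.
Qed.

(** Replacing a source by its truncation changes an integral by little when the
    other factor decays faster than a square integrable weight. *)
Lemma half_close (D : set (measurableTypeR R)) f g w (m c : R) : measurable D -> 0 <= c ->
  ccont g -> ccont w -> (en D g < +oo)%E -> (en D w < +oo)%E -> L2 f ->
  (forall t, D t -> m < `|t| -> nc (g t) <= c * nc (w t)) ->
  nc (cint D (fun t => g t * f t) - cint D (fun t => g t * cutoff m f t)) <=
  c * (\int[mu]_(t in D) nc (w t * f t))%R.
Proof.
move=> mD c0 cg cw eg ew lf h.
have cmD u : cmeas setT u -> cmeas D u by apply: cmeasS.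
have mg := cmD _ (ccont_cmeas cg); have mw := cmD _ (ccont_cmeas cw).
have lc := L2_cutoff m lf.
have ig f' : L2 f' -> cintegrable D (fun t => g t * f' t).
  move=> lf'; apply: cintegrable_mul => //; last exact: L2_fin.
  by apply: cmD; have /L2P[] := lf'.
have iw : cintegrable D (fun t => w t * f t).
  apply: cintegrable_mul => //; last exact: L2_fin.
  by apply: cmD; have /L2P[] := lf.
have inw := cintegrable_nc mD iw.
rewrite -(cintB mD (ig _ lf) (ig _ lc)) -(RintegralZl _ mD inw).
apply: cint_norm_le => //; [by apply: cintegrableB => //; exact: ig|exact: integrableZR|].
move=> t Dt; rewrite -mulrBr !ncM; have [tm|tm] := leP `|t| m.
  have -> : f t - cutoff m f t = 0 by rewrite (cutoff_in f tm) subrr.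
  by rewrite (nc0 R) mulr0 !mulr_ge0 ?nc_ge0.
by rewrite (cutoff_out _ tm) subr0 mulrA ler_wpM2r ?nc_ge0// h.
Qed.

End Cutoff.

Section Resolvent.
Variable R : realType.
Local Notation C := R[i].
Local Notation mu := (@lebesgue_measure R).
Implicit Types (f u v : R -> C) (m x : R).
Variables (V : R -> R) (l : C) (v0 K : R) (fp fp1 fm fm1 : R -> C) (W : C).
Hypotheses (l0 : 0 < cIm l) (bV : forall x, `|V x| <= v0) (cV : continuous V) (hv : 2 * v0 <= cIm l ^+ 2).
Local Notation q := (pot V l).
Local Notation b := (cIm l).
Hypotheses (hp : forall a c, issol q a c fp fp1) (hm : forall a c, issol q a c fm fm1).
Hypotheses (HW : forall x, fp x * fm1 x - fp1 x * fm x = W) (W0 : W != 0) (K0 : 0 <= K).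
Hypotheses (dp : forall x, 0 <= x -> nc (fp x) <= K * expR (- b * x) /\ nc (fp1 x) <= K * expR (- b * x)).
Hypotheses (dm : forall x, x <= 0 -> nc (fm x) <= K * expR (b * x) /\ nc (fm1 x) <= K * expR (b * x)).

Let cp : ccont fp. Proof. by apply: AC_ccont => a c; have [] := hp a c; eauto. Qed.
Let cm : ccont fm. Proof. by apply: AC_ccont => a c; have [] := hm a c; eauto. Qed.
Local Notation gu := (green W fp fm fp fm).
Local Notation gu1 := (green W fp1 fm1 fp fm).

(** Beyond the support of the source one of the two integrals vanishes and the
    other is constant. *)
Lemma green_far (P M f : R -> C) m x : 0 <= m -> L2 f -> (forall t, m < `|t| -> f t = 0) ->
  (m <= x -> green W P M fp fm f x = W^-1 * (P x * (cint `]-oo, 0] (fun t => fm t * f t) + prim (fun t => fm t * f t) m))) /\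
  (x <= - m -> green W P M fp fm f x = W^-1 * (M x * (cint `[0, +oo[ (fun t => fp t * f t) - prim (fun t => fp t * f t) (- m)))).
Proof.
move=> m0 lf f0; have lp := locint_M cp (L2_locint lf); have lm := locint_M cm (L2_locint lf).
split=> hx; rewrite /green.
  have x0 := le_trans m0 hx.
  have -> : prim (fun t => fm t * f t) x = prim (fun t => fm t * f t) m.
    have [ig hG] := prim_AC lm m x; apply/eqP; rewrite -subr_eq0 hG//; apply/eqP.
    rewrite -[RHS](@cint_pt R m (fun t => fm t * f t)); apply: cint_supp.
      by move=> t /=; rewrite !in_itv /= => /andP[h1 h2]; rewrite h1 (le_trans h2 hx).
    move=> t /=; rewrite !in_itv /= => /andP[h1 h2] h3; rewrite f0 ?mulr0// ger0_norm ?(le_trans m0)//.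
    by rewrite ltNge; apply/negP => h4; apply: h3; rewrite h1.
  have -> : cint `[0, +oo[ (fun t => fp t * f t) = prim (fun t => fp t * f t) x; last by rewrite subrr mulr0 addr0.
  rewrite -cint_prim//; apply: cint_supp.
    by move=> t /=; rewrite !in_itv /= andbT => /andP[].
  move=> t /=; rewrite !in_itv /= andbT => t0 h3; rewrite f0 ?mulr0// ger0_norm//.
  by rewrite ltNge; apply/negP => h4; apply: h3; rewrite t0 (le_trans h4 hx).
have x0 : x <= 0 by rewrite (le_trans hx)// oppr_le0.
have nm0 : - m <= 0 by rewrite oppr_le0.
have -> : prim (fun t => fp t * f t) x = prim (fun t => fp t * f t) (- m).
  have [ig hG] := prim_AC lp x (- m); apply/eqP; rewrite eq_sym -subr_eq0 hG//; apply/eqP.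
  rewrite -[RHS](@cint_pt R (- m) (fun t => fp t * f t)); apply: cint_supp.
    by move=> t /=; rewrite !in_itv /= => /andP[h1 h2]; rewrite h2 (le_trans hx h1).
  move=> t /=; rewrite !in_itv /= => /andP[h1 h2] h3; rewrite f0 ?mulr0// ler0_norm ?(le_trans h2)//.
  by rewrite ltNge lerNl; apply/negP => h4; apply: h3; rewrite h2 h4.
have -> : cint `]-oo, 0] (fun t => fm t * f t) = - prim (fun t => fm t * f t) x; last by rewrite addNr mulr0 add0r.
rewrite -cint_primN//; apply: cint_supp.
  by move=> t /=; rewrite !in_itv /= => /andP[].
move=> t /=; rewrite !in_itv /= => t0 h3; rewrite f0 ?mulr0// ler0_norm//.
by rewrite ltNge lerNl; apply/negP => h4; apply: h3; rewrite t0 (le_trans hx h4).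
Qed.

(** By [green_far] the solution is a multiple of a Jost solution beyond the
    support of the source and inherits its decay. *)
Lemma green_boundary f m e : 0 <= m -> L2 f -> (forall t, m < `|t| -> f t = 0) -> 0 < e ->
  exists N : nat, forall x, N%:R <= x -> nc (gu1 f x) * nc (gu f x) <= e /\ nc (gu1 f (- x)) * nc (gu f (- x)) <= e.
Proof.
move=> m0 lf f0 e0.
set am := cint `]-oo, 0] (fun t => fm t * f t) + prim (fun t => fm t * f t) m.
set bm := cint `[0, +oo[ (fun t => fp t * f t) - prim (fun t => fp t * f t) (- m).
pose c := nc W^-1 * K * (nc am + nc bm).
have c0 : 0 <= c by rewrite !mulr_ge0 ?addr_ge0 ?nc_ge0.
have e'0 : 0 < e / (c ^+ 2 + 1) by rewrite divr_gt0// ltr_wpDl ?sqr_ge0.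
have [N hN] := expR_small l0 e'0.
exists (N + Num.bound m)%N => x; rewrite natrD => hx.
have mb := archi_boundP m0.
have Nx : N%:R <= x by apply: le_trans hx; rewrite lerDl.
have mx : m <= x by apply: le_trans hx; apply: (le_trans (ltW mb)); rewrite lerDr.
have x0 := le_trans m0 mx; have mx' : - x <= - m by rewrite lerN2.
have E := hN x Nx; have x0' : - x <= 0 by rewrite oppr_le0.
have E1 : expR (- b * x) <= 1.
  by have := @ler_expR R (- b * x) 0; rewrite expR0 => ->; rewrite mulNr oppr_le0 mulr_ge0// ltW.
have fin s t : 0 <= s -> 0 <= t -> s <= c * expR (- b * x) -> t <= c * expR (- b * x) -> s * t <= e.
  move=> s0 t0 hs ht; apply: (@le_trans _ _ (c ^+ 2 * expR (- b * x))).
    apply: (le_trans (ler_pM s0 t0 hs ht)); rewrite mulrACA -expr2 ler_wpM2l ?sqr_ge0//.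
    by rewrite -[leRHS]mulr1 ler_wpM2l ?expR_ge0.
  apply: (le_trans (ler_wpM2l (sqr_ge0 c) E)).
  by rewrite mulrCA ler_piMr ?(ltW e0)// ler_pdivrMr ?mul1r ?lerDl// ltr_wpDl ?sqr_ge0.
have bd (w z : C) (k : R) : nc w <= K * k -> 0 <= k -> nc z <= nc am + nc bm -> nc (W^-1 * (w * z)) <= c * k.
  move=> h1 k0 h2; rewrite !ncM /c -!mulrA ler_wpM2l ?nc_ge0//.
  rewrite [_ * k]mulrC mulrA; apply: ler_pM; rewrite ?nc_ge0//.
have am_le : nc am <= nc am + nc bm by rewrite lerDl nc_ge0.
have bm_le : nc bm <= nc am + nc bm by rewrite lerDr nc_ge0.
have [g1 _] := green_far fp fm x m0 lf f0; have [g2 _] := green_far fp1 fm1 x m0 lf f0.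
have [_ g3] := green_far fp fm (- x) m0 lf f0; have [_ g4] := green_far fp1 fm1 (- x) m0 lf f0.
rewrite (g1 mx) (g2 mx) (g3 mx') (g4 mx') -/am -/bm.
have [p p1] := dp x0; have [n n1] := dm x0'; rewrite mulrN -mulNr in n n1.
by split; apply: fin; rewrite ?nc_ge0//; apply: bd => //; exact: expR_ge0.
Qed.

End Resolvent.

(** * The resolvent estimate *)

Lemma sum4_ge (R : realType) (a b c d : R) : 0 <= a -> 0 <= b -> 0 <= c -> 0 <= d ->
  [/\ 0 <= a + b + c + d, a <= a + b + c + d /\ b <= a + b + c + d & c <= a + b + c + d /\ d <= a + b + c + d].
Proof. by move=> *; split; [lra|split; lra|split; lra]. Qed.

Lemma double_le (R : realType) (b L s t F N e : R) : b * s + L * t <= F ->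
  b * (2 * s + 2 * N * e) + L * (2 * t + 2 * N * e) <= 2 * F + (b + L) * (2 * N) * e.
Proof.
move=> h; have -> : b * (2 * s + 2 * N * e) + L * (2 * t + 2 * N * e) = 2 * (b * s + L * t) + (b + L) * (2 * N) * e by ring.
by rewrite lerD2r ler_wpM2l.
Qed.

Section ResolventBound.
Variable R : realType.
Local Notation C := R[i].
Local Notation mu := (@lebesgue_measure R).
Implicit Types (f u v : R -> C) (m x : R).
Variables (V : R -> R) (l : C) (v0 K : R) (fp fp1 fm fm1 : R -> C) (W : C).
Hypotheses (l0 : 0 < cIm l) (bV : forall x, `|V x| <= v0) (cV : continuous V) (hv : 2 * v0 <= cIm l ^+ 2).
Local Notation q := (pot V l).
Local Notation b := (cIm l).
Hypotheses (hp : forall a c, issol q a c fp fp1) (hm : forall a c, issol q a c fm fm1).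
Hypotheses (HW : forall x, fp x * fm1 x - fp1 x * fm x = W) (W0 : W != 0) (K0 : 0 <= K).
Hypotheses (dp : forall x, 0 <= x -> nc (fp x) <= K * expR (- b * x) /\ nc (fp1 x) <= K * expR (- b * x)).
Hypotheses (dm : forall x, x <= 0 -> nc (fm x) <= K * expR (b * x) /\ nc (fm1 x) <= K * expR (b * x)).

Let cp : ccont fp. Proof. by apply: AC_ccont => a c; have [h _] := hp a c; exact: h. Qed.
Let cm : ccont fm. Proof. by apply: AC_ccont => a c; have [h _] := hm a c; exact: h. Qed.
Let cp1 : ccont fp1. Proof. by apply: AC_ccont => a c; have [_ h] := hp a c; exact: h. Qed.
Let cm1 : ccont fm1. Proof. by apply: AC_ccont => a c; have [_ h] := hm a c; exact: h. Qed.

Let efm : (en `]-oo, 0%R] fm < +oo)%E.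
Proof. by apply: (en_half_m l0 cm) => x x0; have [h _] := dm x0; exact: h. Qed.
Let efp : (en `[0%R, +oo[ fp < +oo)%E.
Proof. by apply: (en_half_p l0 cp) => x x0; have [h _] := dp x0; exact: h. Qed.

Local Notation gu := (green W fp fm fp fm).
Local Notation gu1 := (green W fp1 fm1 fp fm).
Local Notation sq a c u := (\int[mu]_(x in `[a, c]) (nc (u x) ^+ 2))%R.

Lemma L2_sq f E (D : set (measurableTypeR R)) : measurable D -> L2 f -> (en setT f <= E%:E)%E ->
  (\int[mu]_(x in D) (nc (f x) ^+ 2))%R <= E.
Proof.
move=> mD lf fE; have /L2P[mf _] := lf; have mfD : cmeas D f by exact: cmeasS mf.
rewrite -lee_fin -(enE mD mfD (L2_fin mD lf)); apply: le_trans fE; exact: en_sub.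
Qed.

(** For a compactly supported source the boundary terms of [energy] on larger and
    larger intervals tend to zero. *)
Lemma energy_compact f E m (n : nat) : 0 <= m -> L2 f -> (forall t, m < `|t| -> f t = 0) -> (en setT f <= E%:E)%E ->
  b * sq (- n%:R) n%:R (gu1 f) + b * nc l ^+ 2 / 4 * sq (- n%:R) n%:R (gu f) <= b^-1 * E.
Proof.
move=> m0 lf f0 fE; apply/ler_addgt0Pl => e e0; rewrite [e + _]addrC.
have e'0 : 0 < e / (2 * nc l + 1) by rewrite divr_gt0// ltr_wpDl ?mulr_ge0 ?nc_ge0.
have [N hN] := green_boundary W l0 hp hm K0 dp dm m0 lf f0 e'0.
have [AU AU1] := green_AC hp hm HW W0 (L2_locint lf).
pose k : R := (n + N)%N%:R; have k0 : - k <= k by rewrite /k; have := ler0n R (n + N)%N; lra.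
have nk : n%:R <= k by rewrite /k ler_nat leq_addr.
have Nk : N%:R <= k by rewrite /k ler_nat leq_addl.
have /L2P[mf _] := lf.
have mk : measurable (`[- k, k]%classic : set (measurableTypeR R)) by exact: measurable_itv.
have mn : measurable (`[- n%:R, n%:R]%classic : set (measurableTypeR R)) by exact: measurable_itv.
have En := energy l0 bV hv k0 AU AU1 mf (L2_fin mk lf).
have [B1 B2] := hN k Nk.
have sub : `[- n%:R, n%:R]%classic `<=` `[- k, k]%classic.
  by apply: subset_itvScc; rewrite bnd_simp ?lerN2.
have mono u : ccont u -> sq (- n%:R) n%:R u <= sq (- k) k u.
  by move=> cu; apply: sq_mono => //; [exact: ccont_on_meas (cu _ _)|exact: en_ccont (cu _ _)].
have b1 := ler_wpM2l (ltW l0) (mono _ (AC_ccont AU1)).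
have L0 : 0 <= b * nc l ^+ 2 / 4 by rewrite divr_ge0// mulr_ge0 ?sqr_ge0// ltW.
have b2 := ler_wpM2l L0 (mono _ (AC_ccont AU)).
have b3 : b^-1 * sq (- k) k f <= b^-1 * E by rewrite ler_wpM2l ?invr_ge0 ?(ltW l0)//; exact: L2_sq.
have b4 : nc l * (nc (gu1 f (- k)) * nc (gu f (- k)) + nc (gu1 f k) * nc (gu f k)) <= e.
  apply: (@le_trans _ _ (nc l * (2 * (e / (2 * nc l + 1))))).
    apply: ler_wpM2l; first exact: nc_ge0.
    by rewrite mulr_natl mulr2n; exact: lerD B2 B1.
  have d0 : 0 < 2 * nc l + 1 by rewrite ltr_wpDl ?mulr_ge0 ?nc_ge0.
  have -> : nc l * (2 * (e / (2 * nc l + 1))) = e * (2 * nc l) / (2 * nc l + 1) by ring.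
  by rewrite ler_pdivrMr// ler_wpM2l ?(ltW e0)// lerDl.
apply: (le_trans (lerD b1 b2)); apply: (le_trans En); exact: lerD b3 b4.
Qed.

(** On a bounded interval truncating the source far away changes only the two
    constants of integration, by [half_close] with the square root of the
    exponential decay as weight. *)
Lemma trunc_close f n e : L2 f -> 0 < e -> exists m : nat, forall x, `|x| <= n ->
  nc (gu f x - gu (cutoff m%:R f) x) <= e /\ nc (gu1 f x - gu1 (cutoff m%:R f) x) <= e.
Proof.
move=> lf e0.
have b2 : 0 < b / 2 by rewrite divr_gt0.
pose wm t : C := (expR (b / 2 * t))%:C; pose wp t : C := (expR (- (b / 2) * t))%:C.
have cexpR (k : R) : ccont (fun t => (expR (k * t))%:C : C).
  apply: ccont_R => t; apply: (@continuous_comp _ _ _ (fun t => k * t) expR); last exact: continuous_expR.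
  by apply: cvgM; [exact: cvg_cst|exact: cvg_id].
have ewm : (en `]-oo, 0%R] wm < +oo)%E.
  by apply: (@en_half_m _ _ 1 _ b2 (cexpR _)) => t _; rewrite ncR mul1r ger0_norm ?expR_ge0.
have ewp : (en `[0%R, +oo[ wp < +oo)%E.
  by apply: (@en_half_p _ _ 1 _ b2 (cexpR _)) => t _; rewrite ncR mul1r ger0_norm ?expR_ge0.
pose Jm := (\int[mu]_(t in `]-oo, 0%R]) nc (wm t * f t))%R.
pose Jp := (\int[mu]_(t in `[0%R, +oo[) nc (wp t * f t))%R.
have Jm0 : 0 <= Jm by apply: Rintegral_ge0 => t _; exact: nc_ge0.
have Jp0 : 0 <= Jp by apply: Rintegral_ge0 => t _; exact: nc_ge0.
have bdd u : ccont u -> exists2 B, 0 <= B & forall x, `|x| <= n -> nc (u x) <= B.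
  move=> cu; have [n0|n0] := leP 0 n.
    have nn : - n <= n by lra.
    have [B B0 hB] := ccont_on_bounded nn (cu (- n) n); exists B => // x; rewrite ler_norml; exact: hB.
  by exists 0 => // x xn; move: (le_lt_trans xn n0); rewrite ltNge normr_ge0.
have [B1 B10 h1] := bdd _ cp; have [B2 B20 h2] := bdd _ cm; have [B3 B30 h3] := bdd _ cp1; have [B4 B40 h4] := bdd _ cm1.
pose c := nc W^-1 * (B1 + B2 + B3 + B4) * (K * (Jm + Jp)).
have [Bs0 [s1 s2] [s3 s4]] := sum4_ge B10 B20 B30 B40.
have c0 : 0 <= c.
  apply: mulr_ge0; first by apply: mulr_ge0; [exact: nc_ge0|exact: Bs0].
  by apply: mulr_ge0; [exact: K0|exact: (addr_ge0 Jm0 Jp0)].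
have e'0 : 0 < e / (c + 1) by rewrite divr_gt0// ltr_wpDl.
have [N hN] := expR_small b2 e'0.
pose mn := (N + Num.bound n)%N; exists mn; pose m : R := mn%:R.
have Nm : N%:R <= m by rewrite /m ler_nat leq_addr.
have E := hN m Nm; have m0 : 0 <= m by exact: ler0n.
set k := expR (- (b / 2) * m) in E; have k0 : 0 <= k by exact: expR_ge0.
have nm x : `|x| <= n -> `|x| <= m.
  move=> xn; have n0 : 0 <= n by exact: le_trans xn.
  apply: (le_trans xn); apply: (le_trans (ltW (archi_boundP n0))); rewrite /m ler_nat; exact: leq_addl.
have lc := L2_cutoff m lf.
have Kk : 0 <= K * k by rewrite mulr_ge0.
have dmm := @half_close R _ f fm wm m (K * k) (measurable_itv _) Kk cm (cexpR _) efm ewm lf.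
have dpp := @half_close R _ f fp wp m (K * k) (measurable_itv _) Kk cp (cexpR _) efp ewp lf.
have Dm : nc (cint `]-oo, 0] (fun t => fm t * f t) - cint `]-oo, 0] (fun t => fm t * cutoff m f t)) <= K * k * Jm.
  apply: dmm => t tD; have t0 : t <= 0 by move: tD; rewrite /= in_itv.
  rewrite (ler0_norm t0) => mt.
  have [h _] := dm t0; apply: (le_trans h).
  rewrite /wm ncR ger0_norm ?expR_ge0// -mulrA ler_wpM2l// -expRD ler_expR.
  have : 0 <= b / 2 * (- t - m) by rewrite mulr_ge0 ?(ltW b2)// subr_ge0 ltW.
  lra.
have Dp : nc (cint `[0, +oo[ (fun t => fp t * f t) - cint `[0, +oo[ (fun t => fp t * cutoff m f t)) <= K * k * Jp.
  apply: dpp => t tD; have t0 : 0 <= t by move: tD; rewrite /= in_itv /= andbT.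
  rewrite (ger0_norm t0) => mt.
  have [h _] := dp t0; apply: (le_trans h); rewrite /wp ncR ger0_norm ?expR_ge0// -mulrA ler_wpM2l// -expRD ler_expR.
  have : 0 <= b / 2 * (t - m) by rewrite mulr_ge0 ?(ltW b2)// subr_ge0 ltW.
  lra.
have gen (P M : R -> C) x : `|x| <= n -> nc (P x) <= B1 + B2 + B3 + B4 -> nc (M x) <= B1 + B2 + B3 + B4 ->
    nc (green W P M fp fm f x - green W P M fp fm (cutoff m f) x) <= e.
  move=> xn hP hM; rewrite /green.
  have pe g : prim (fun t => g t * f t) x = prim (fun t => g t * cutoff m f t) x.
    by apply: prim_eq => t tx; rewrite cutoff_in// (le_trans tx)// nm.
  rewrite !pe; move: Dm Dp hP hM; set a1 := cint _ _; set a2 := cint _ _; set b1 := cint _ _; set b2' := cint _ _.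
  move: (prim _ x) (prim _ x) (P x) (M x) => p1 p2 P0 M0 D1 D2 hP hM.
  have -> : W^-1 * (P0 * (a1 + p2) + M0 * (b1 - p1)) - W^-1 * (P0 * (a2 + p2) + M0 * (b2' - p1)) =
     W^-1 * (P0 * (a1 - a2) + M0 * (b1 - b2')) by ring.
  apply: (@le_trans _ _ (c * k)).
    have -> : c * k = nc W^-1 * ((B1 + B2 + B3 + B4) * (K * k * Jm) + (B1 + B2 + B3 + B4) * (K * k * Jp)) by rewrite /c; ring.
    rewrite ncM ler_wpM2l ?nc_ge0//; apply: (le_trans (ncD _ _)); rewrite !ncM.
    by apply: lerD; apply: ler_pM; [exact: nc_ge0|exact: nc_ge0|exact: hP|exact: D1|exact: nc_ge0|exact: nc_ge0|exact: hM|exact: D2].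
  apply: (le_trans (ler_wpM2l c0 E)).
  by rewrite mulrCA ler_piMr ?(ltW e0)// ler_pdivrMr ?mul1r ?lerDl// ltr_wpDl.
move=> x xn; have := h1 x xn; have := h2 x xn; have := h3 x xn; have := h4 x xn => k4 k3 k2 k1.
by split; apply: gen => //; [exact: le_trans k1 s1|exact: le_trans k2 s2|exact: le_trans k3 s3|exact: le_trans k4 s4].
Qed.

(** Approximating the source by truncations costs a factor 2, from the square of
    a sum, and an error that can be made arbitrarily small. *)
Lemma resolvent_bound f E (n : nat) : L2 f -> (en setT f <= E%:E)%E ->
  b * sq (- n%:R) n%:R (gu1 f) + b * nc l ^+ 2 / 4 * sq (- n%:R) n%:R (gu f) <= 2 * (b^-1 * E).
Proof.
move=> lf fE.
have [AU AU1] := green_AC hp hm HW W0 (L2_locint lf).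
have L0 : 0 <= b * nc l ^+ 2 / 4 by rewrite divr_ge0// mulr_ge0 ?sqr_ge0// ltW.
have b0 := ltW l0.
have nn : - n%:R <= n%:R :> R by have := ler0n R n; lra.
pose c := (b + b * nc l ^+ 2 / 4) * (2 * (n%:R - - n%:R)).
have c0 : 0 <= c by rewrite !mulr_ge0 ?addr_ge0// subr_ge0.
have key e : 0 < e -> e <= 1 ->
  b * sq (- n%:R) n%:R (gu1 f) + b * nc l ^+ 2 / 4 * sq (- n%:R) n%:R (gu f) <= 2 * (b^-1 * E) + c * e.
  move=> e0 e1; have [m hm'] := trunc_close n%:R lf e0.
  have m0 : 0 <= m%:R :> R by exact: ler0n.
  set fc := cutoff m%:R f in hm'.
  have lc : L2 fc by exact: L2_cutoff.
  have fc0 t : m%:R < `|t| -> fc t = 0 by exact: cutoff_out.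
  have fcE : (en setT fc <= E%:E)%E.
    have /L2P[mf _] := lf; have /L2P[mc _] := lc.
    by apply: le_trans fE; apply: le_en => // x _; exact: nc_cutoff.
  have En := energy_compact n m0 lc fc0 fcE.
  have [BU BU1] := green_AC hp hm HW W0 (L2_locint lc).
  have cmp u v : ccont u -> ccont v -> (forall x, `|x| <= n%:R -> nc (u x - v x) <= e) ->
      sq (- n%:R) n%:R u <= 2 * sq (- n%:R) n%:R v + 2 * (n%:R - - n%:R) * e.
    move=> cu cv huv.
    have mi : measurable (`[- n%:R, n%:R]%classic : set (measurableTypeR R)) by exact: measurable_itv.
    have iu := sq_ccont (cu (- n%:R) n%:R); have iv := sq_ccont (cv (- n%:R) n%:R).
    have ic := integrable_cst_itv (- n%:R) n%:R (2 * e).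
    have -> : 2 * (n%:R - - n%:R) * e = 2 * e * (n%:R - - n%:R) by ring.
    rewrite -(Rintegral_cst_itv (2 * e) nn) -(RintegralZl _ mi iv) -(RintegralD mi (integrableZR 2 mi iv) ic).
    apply: le_Rintegral => //; first by apply: integrableDR => //; exact: integrableZR.
    move=> x /=; rewrite in_itv /= => hx; have xn : `|x| <= n%:R by rewrite ler_norml.
    have := huv x xn; have := ncD (u x - v x) (v x); rewrite subrK.
    have := nc_ge0 (u x); have := nc_ge0 (v x); have := nc_ge0 (u x - v x).
    move: (nc (u x)) (nc (v x)) (nc (u x - v x)) => A B d' d0 B0 A0 Ad de.
    apply: (@le_trans _ _ ((d' + B) ^+ 2)); first by rewrite lerXn2r ?nnegrE// addr_ge0.
    have h1 : d' ^+ 2 <= e by rewrite expr2; nra.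
    by have := sqr_ge0 (d' - B); rewrite !expr2 in h1 *; nra.
  have k1 := cmp _ _ (AC_ccont AU1) (AC_ccont BU1) (fun x xn => (hm' x xn).2).
  have k2 := cmp _ _ (AC_ccont AU) (AC_ccont BU) (fun x xn => (hm' x xn).1).
  have j1 := ler_wpM2l b0 k1; have j2 := ler_wpM2l L0 k2.
  apply: (le_trans (lerD j1 j2)); exact: double_le En.
apply/ler_addgt0Pl => e e0; rewrite [e + _]addrC.
pose e' := Num.min 1 (e / (c + 1)).
have c1 : 0 < c + 1 by rewrite ltr_wpDl.
have e'0 : 0 < e' by rewrite lt_min ltr01 divr_gt0.
have e'1 : e' <= 1 by rewrite ge_min lexx.
apply: (le_trans (key e' e'0 e'1)); rewrite lerD2l.
have : e' <= e / (c + 1) by rewrite ge_min lexx orbT.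
by rewrite ler_pdivlMr// mulrDr mulr1 mulrC => h; apply: le_trans h; rewrite lerDl ltW.
Qed.

End ResolventBound.

(** * The resolvent in the upper half plane *)

Section Wronskians.
Variable R : realType.
Local Notation C := R[i].
Local Notation mu := (@lebesgue_measure R).
Local Notation sq a c u := (\int[mu]_(x in `[a, c]) (nc (u x) ^+ 2))%R.
Implicit Types (f g u v : R -> C) (a c x : R).

(** A constant Wronskian with a bounded solution is controlled by the mean
    square of the other one. *)
Lemma wronskian_sq a c u u1 v v1 (k : C) (B : R) : a <= c -> ccont u -> ccont u1 ->
  (forall x, a <= x <= c -> nc (v x) <= B /\ nc (v1 x) <= B) ->
  (forall x, a <= x <= c -> u x * v1 x - u1 x * v x = k) ->
  nc k ^+ 2 * (c - a) <= 2 * B ^+ 2 * (sq a c u + sq a c u1).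
Proof.
move=> ac cu cu1 hB hk.
have mi : measurable (`[a, c]%classic : set (measurableTypeR R)) by exact: measurable_itv.
have iu := sq_ccont (cu a c); have iu1 := sq_ccont (cu1 a c).
have isum := integrableDR mi iu iu1.
rewrite -(Rintegral_cst_itv _ ac) -(RintegralD mi iu iu1) -(RintegralZl _ mi isum).
apply: le_Rintegral => //; [exact: integrable_cst_itv|exact: integrableZR|].
move=> x xac; have hx : a <= x <= c by move: xac; rewrite /= in_itv.
have [b1 b2] := hB x hx; rewrite -(hk x hx).
have h1 := ncDB (u x * v1 x) (u1 x * v x); rewrite !ncM in h1.
have := nc_ge0 (u x); have := nc_ge0 (u1 x); have := nc_ge0 (v x); have := nc_ge0 (v1 x).
have := nc_ge0 (u x * v1 x - u1 x * v x).
move: h1 b1 b2; move: (nc (_ - _)) (nc (u x)) (nc (u1 x)) (nc (v x)) (nc (v1 x)) => s p p1 r r1 h b1 b2 s0 r10 r0 p10 p0.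
have B0 : 0 <= B by exact: le_trans b1.
have h2 : s <= (p + p1) * B.
  by apply: (le_trans h); rewrite mulrDl; apply: lerD; apply: ler_wpM2l.
apply: (@le_trans _ _ (((p + p1) * B) ^+ 2)); first by rewrite lerXn2r ?nnegrE// mulr_ge0// addr_ge0.
rewrite exprMn; have -> : 2 * B ^+ 2 * (p ^+ 2 + p1 ^+ 2) = 2 * (p ^+ 2 + p1 ^+ 2) * B ^+ 2 by ring.
apply: ler_wpM2r; first exact: sqr_ge0.
by have := sqr_ge0 (p - p1); rewrite !expr2; nra.
Qed.

Lemma AC_ae a c g g' G : AC a c g G -> cintegrable `[a, c] g' -> ae_equal g g' -> AC a c g' G.
Proof.
move=> [ig hG] ig' ae; split => // x y ax xy yc; rewrite hG//.
have sub : `[x, y] `<=` `[a, c] by apply: subset_itvScc; rewrite bnd_simp.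
have i1 : cintegrable `[x, y] g by exact: cintegrableS ig.
have i2 : cintegrable `[x, y] g' by exact: cintegrableS ig'.
have [m1 m2] := cintegrable_meas i1; have [m3 m4] := cintegrable_meas i2.
have aeF := ae_filter_ringOfSetsType mu.
apply: eqC; rewrite ?Re_cint ?Im_cint; congr fine; apply: ae_eq_integral => //; try exact/measurable_EFinP.
  by apply: (filterS _ ae) => t -> .
by apply: (filterS _ ae) => t -> .
Qed.

Lemma en_ae f g : cmeas setT f -> cmeas setT g -> ae_equal f g -> en setT f = en setT g.
Proof.
move=> mf mg ae; have aeF := ae_filter_ringOfSetsType mu.
apply: ae_eq_integral; [exact: measurableT|exact: sq_meas|exact: sq_meas|].
by apply: (filterS _ ae) => t ->.
Qed.

End Wronskians.

Section ResolventAxioms.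
Variable R : realType.
Local Notation C := R[i].
Local Notation mu := (@lebesgue_measure R).
Implicit Types (f u v : R -> C) (m x : R).
Variables (V : R -> R) (l : C) (v0 K : R) (fp fp1 fm fm1 : R -> C).
Hypotheses (l0 : 0 < cIm l) (bV : forall x, `|V x| <= v0) (cV : continuous V) (hv : 2 * v0 <= cIm l ^+ 2).
Local Notation q := (pot V l).
Local Notation b := (cIm l).
Hypotheses (hp : forall a c, issol q a c fp fp1) (hm : forall a c, issol q a c fm fm1).
Hypothesis (K0 : 0 <= K).
Hypotheses (dp : forall x, 0 <= x -> nc (fp x) <= K * expR (- b * x) /\ nc (fp1 x) <= K * expR (- b * x)).
Hypotheses (dm : forall x, x <= 0 -> nc (fm x) <= K * expR (b * x) /\ nc (fm1 x) <= K * expR (b * x)).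

Let cp : ccont fp. Proof. by apply: AC_ccont => a c; have [h _] := hp a c; exact: h. Qed.
Let cp1 : ccont fp1. Proof. by apply: AC_ccont => a c; have [_ h] := hp a c; exact: h. Qed.
Local Notation sq a c u := (\int[mu]_(x in `[a, c]) (nc (u x) ^+ 2))%R.

Let expb x : 0 <= x -> expR (- b * x) <= 1.
Proof. by move=> x0; have := @ler_expR R (- b * x) 0; rewrite expR0 => ->; rewrite mulNr oppr_le0 mulr_ge0// ltW. Qed.

(** A solution that decays at both ends is an eigenfunction at a non-real
    spectral parameter; the energy estimate without source rules it out. *)
Lemma no_eigenfunction (k : C) v v1 x : k != 0 -> (forall x, fm x = k * fp x) -> (forall x, fm1 x = k * fp1 x) ->
  (forall a c, issol q a c v v1) -> fp x * v1 x - fp1 x * v x = 0.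
Proof.
move=> k0 km km1 hvv; set kap := fp x * v1 x - fp1 x * v x.
have cv : ccont v by apply: AC_ccont => a c; have [h _] := hvv a c; exact: h.
have cv1 : ccont v1 by apply: AC_ccont => a c; have [_ h] := hvv a c; exact: h.
have const y : fp y * v1 y - fp1 y * v y = kap.
  have [xy|/ltW yx] := leP x y; first exact: wronskian_const xy (hp _ _) (hvv _ _).
  by apply/esym; exact: wronskian_const yx (hp _ _) (hvv _ _).
have [B1 B10 hB1] := ccont_on_bounded (@ler01 R) (cv 0 1); have [B2 B20 hB2] := ccont_on_bounded (@ler01 R) (cv1 0 1).
have L0 : 0 < nc l.
  by apply: lt_le_trans l0 _; apply: le_trans (nc_Im l); exact: ler_norm.
pose c1 := b * nc l ^+ 2 / 4.
have c10 : 0 < c1 by rewrite divr_gt0// mulr_gt0// exprn_gt0.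
pose D := K + nc k^-1 * K.
have D0 : 0 <= D by rewrite addr_ge0// mulr_ge0// nc_ge0.
have decay s y : 0 <= y -> (s = 1 \/ s = -1) -> nc (fp (s * y)) <= D * expR (- b * y) /\ nc (fp1 (s * y)) <= D * expR (- b * y).
  move=> y0 [->|->].
    rewrite mul1r; have [h1 h2] := dp y0; have e := expR_ge0 (- b * y).
    by split; [apply: (le_trans h1)|apply: (le_trans h2)]; rewrite ler_wpM2r// /D lerDl mulr_ge0// nc_ge0.
  have y0' : - y <= 0 by rewrite oppr_le0.
  have [h1 h2] := dm y0'; rewrite mulrN -mulNr in h1 h2; have e := expR_ge0 (- b * y).
  have E z : fp z = k^-1 * fm z by rewrite km mulKf.
  have E1 z : fp1 z = k^-1 * fm1 z by rewrite km1 mulKf.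
  have kk : nc k^-1 * (K * expR (- b * y)) <= D * expR (- b * y) by rewrite mulrA ler_wpM2r// /D lerDr.
  by rewrite mulN1r E E1 !ncM; split; apply: le_trans kk; apply: ler_wpM2l; rewrite ?nc_ge0.
have small e : 0 < e -> b * sq 0 1 fp1 + c1 * sq 0 1 fp <= e.
  move=> e0; pose e' := e / (2 * nc l * D ^+ 2 + 1).
  have d0 : 0 < 2 * nc l * D ^+ 2 + 1 by rewrite ltr_wpDl ?mulr_ge0 ?sqr_ge0 ?(ltW L0).
  have e'0 : 0 < e' by rewrite divr_gt0.
  have [N hN] := expR_small l0 e'0; pose n : R := (N + 1)%:R.
  have n1 : 1 <= n by rewrite /n natrD lerDr.
  have Nn : N%:R <= n by rewrite /n natrD lerDl.
  have n0 : 0 <= n by lra.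
  have nn : - n <= n by lra.
  have E := hN n Nn.
  have hp1 a c := (hp a c).1.
  have hp2 a c : AC a c (fun x => q x * fp x - 0) fp1.
    by have [_ h] := hp a c; apply: eq_AC h => // t _; rewrite subr0.
  have m0 : cmeas setT (fun _ : R => 0 : C) by exact: cmeas_cst.
  have e00 : (en `[(- n)%R, n] (fun _ : R => (0 : C)%R) < +oo)%E by apply: en_ccont; exact: ccont_cst.
  have En := energy l0 bV hv nn hp1 hp2 m0 e00.
  have s0 : sq (- n) n (fun _ : R => 0 : C) = 0.
    by rewrite (_ : (fun _ => _) = (fun=> 0)) ?Rintegral_cst_itv ?mul0r//; apply/funext => t; rewrite nc0 expr0n.
  rewrite s0 mulr0 add0r in En.
  have mn : measurable (`[- n, n]%classic : set (measurableTypeR R)) by exact: measurable_itv.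
  have m01 : measurable (`[0, 1]%classic : set (measurableTypeR R)) by exact: measurable_itv.
  have sub : `[0, 1]%classic `<=` `[- n, n]%classic by apply: subset_itvScc; rewrite bnd_simp; lra.
  have mono u : ccont u -> sq 0 1 u <= sq (- n) n u.
    by move=> cu; apply: sq_mono => //; [exact: ccont_on_meas (cu _ _)|exact: en_ccont (cu _ _)].
  have b1 := ler_wpM2l (ltW l0) (mono _ cp1); have b2 := ler_wpM2l (ltW c10) (mono _ cp).
  apply: (le_trans (lerD b1 b2)); apply: (le_trans En).
  have [p1 p2] := decay 1 n n0 (or_introl erefl); have [p3 p4] := decay (-1) n n0 (or_intror erefl).
  rewrite mul1r in p1 p2; rewrite mulN1r in p3 p4.
  have eb := expb n0; have ee := expR_ge0 (- b * n).
  have pr s t : 0 <= s -> 0 <= t -> s <= D * expR (- b * n) -> t <= D * expR (- b * n) -> s * t <= D ^+ 2 * e'.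
    move=> s0' t0 hs ht; apply: (le_trans (ler_pM s0' t0 hs ht)); rewrite mulrACA -expr2 ler_wpM2l ?sqr_ge0//.
    by apply: le_trans E; rewrite -[leRHS]mulr1 ler_wpM2l.
  have q1 := pr _ _ (nc_ge0 _) (nc_ge0 _) p4 p3; have q2 := pr _ _ (nc_ge0 _) (nc_ge0 _) p2 p1.
  apply: (le_trans (ler_wpM2l (nc_ge0 l) (lerD q1 q2))).
  have -> : nc l * (D ^+ 2 * e' + D ^+ 2 * e') = e * (2 * nc l * D ^+ 2) / (2 * nc l * D ^+ 2 + 1) by rewrite /e'; ring.
  by rewrite ler_pdivrMr// ler_wpM2l ?(ltW e0)// lerDl.
have sq0' u : 0 <= sq 0 1 u by apply: Rintegral_ge0 => t _; exact: sqr_ge0.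
have z : b * sq 0 1 fp1 + c1 * sq 0 1 fp <= 0.
  by apply/ler_addgt0Pl => e e0; rewrite addr0; exact: small.
have [z1 z2] : sq 0 1 fp1 = 0 /\ sq 0 1 fp = 0.
  have z1 : 0 <= b * sq 0 1 fp1 by rewrite mulr_ge0// ltW.
  have z2 : 0 <= c1 * sq 0 1 fp by rewrite mulr_ge0// ltW.
  split; apply/le_anti; rewrite sq0' andbT.
    by rewrite -(ler_pM2l l0) mulr0; apply: le_trans z; rewrite lerDl.
  by rewrite -(ler_pM2l c10) mulr0; apply: le_trans z; rewrite lerDr.
have bd t : 0 <= t <= 1 -> nc (v t) <= B1 + B2 /\ nc (v1 t) <= B1 + B2.
  by move=> ht; split; [apply: (le_trans (hB1 t ht)); rewrite lerDl|apply: (le_trans (hB2 t ht)); rewrite lerDr].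
have := wronskian_sq (@ler01 R) cp cp1 bd (fun t _ => const t).
rewrite z1 z2 addr0 mulr0 subr0 mulr1 => h.
by apply: nc_le0; rewrite -(@ler_pXn2r _ 2) ?nnegrE ?nc_ge0// expr0n.
Qed.

Variable W : C.
Hypotheses (HW : forall x, fp x * fm1 x - fp1 x * fm x = W) (W0 : W != 0).

(** The Jost solutions are bounded at their ends, so by [wronskian_sq] the squared
    Wronskian times the length of any interval there is bounded by the mean
    squares, and vanishes. A function whose Wronskians with two independent
    solutions vanish is zero. *)
Lemma L2_solution_eq0 v v1 : (forall a c, issol q a c v v1) -> L2 v -> L2 v1 -> forall x, v x = 0.
Proof.
move=> hvv lv lv1 x.
have cv : ccont v by apply: AC_ccont => a c; have [h _] := hvv a c; exact: h.
have cv1 : ccont v1 by apply: AC_ccont => a c; have [_ h] := hvv a c; exact: h.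
have /L2P[_ fv] := lv; have /L2P[_ fv1] := lv1.
pose Ev := fine (en setT v); pose Ev1 := fine (en setT v1).
have hEv : (en setT v <= Ev%:E)%E by rewrite /Ev fineK// ge0_fin_numE ?en_ge0.
have hEv1 : (en setT v1 <= Ev1%:E)%E by rewrite /Ev1 fineK// ge0_fin_numE ?en_ge0.
have kill u u1 s : s = 0 \/ s = 1 -> (forall a c, issol q a c u u1) ->
    (forall n : nat, forall y, (- (s * n%:R)) <= y <= (1 - s) * n%:R -> nc (u y) <= K /\ nc (u1 y) <= K) ->
    v x * u1 x - v1 x * u x = 0.
  move=> hs hu bu; set kap := _ - _.
  have const y : v y * u1 y - v1 y * u y = kap.
    have [xy|/ltW yx] := leP x y; first exact: wronskian_const xy (hvv _ _) (hu _ _).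
    by apply/esym; exact: wronskian_const yx (hvv _ _) (hu _ _).
  have main (n : nat) : nc kap ^+ 2 * n%:R <= 2 * K ^+ 2 * (Ev + Ev1).
    have n0 := ler0n R n.
    have len : (1 - s) * n%:R - - (s * n%:R) = n%:R by ring.
    have ac : - (s * n%:R) <= (1 - s) * n%:R by rewrite -subr_ge0 len.
    have mi : measurable (`[- (s * n%:R), (1 - s) * n%:R]%classic : set (measurableTypeR R)) by exact: measurable_itv.
    have := wronskian_sq ac cv cv1 (bu n) (fun t _ => const t); rewrite len => h.
    apply: (le_trans h); apply: ler_wpM2l; first by rewrite mulr_ge0 ?sqr_ge0.
    by apply: lerD; exact: L2_sq.
  apply/eqP; apply/negPn/negP => kn; have k0 : 0 < nc kap ^+ 2 by rewrite exprn_gt0// nc_gt0.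
  pose M := 2 * K ^+ 2 * (Ev + Ev1) / nc kap ^+ 2.
  have := main (Num.bound M); rewrite mulrC -ler_pdivlMr// -/M => h.
  have := archi_boundP (le_trans (ler0n R _) h); rewrite ltNge h.
  by [].
have Kexp y : 0 <= y -> K * expR (- b * y) <= K by move=> y0; rewrite -[leRHS]mulr1 ler_wpM2l// expb.
have kp : v x * fp1 x - v1 x * fp x = 0.
  apply: (kill fp fp1 0) => //; first by left.
  move=> n y; rewrite mul0r oppr0 => /andP[y0 _]; have [h1 h2] := dp y0.
  by split; [apply: (le_trans h1)|apply: (le_trans h2)]; exact: Kexp.
have km : v x * fm1 x - v1 x * fm x = 0.
  apply: (kill fm fm1 1) => //; first by right.
  move=> n y; rewrite subrr mul0r => /andP[_ y0]; have [h1 h2] := dm y0.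
  have y0' : 0 <= - y by rewrite oppr_ge0.
  have := Kexp _ y0'; rewrite mulrNN => ke.
  by split; [apply: (le_trans h1)|apply: (le_trans h2)].
have : v x * W = 0.
  rewrite -(HW x); have -> : v x * (fp x * fm1 x - fp1 x * fm x) = fp x * (v x * fm1 x - v1 x * fm x) - fm x * (v x * fp1 x - v1 x * fp x) by ring.
  by rewrite kp km !mulr0 subr0.
by move=> /eqP; rewrite mulf_eq0 (negbTE W0) orbF => /eqP.
Qed.

Local Notation gu := (green W fp fm fp fm).
Local Notation gu1 := (green W fp1 fm1 fp fm).

Lemma green_L2 f : L2 f -> [/\ L2 (gu f), L2 (gu1 f) &
  (en setT (gu f) <= (8 / (b ^+ 2 * nc l ^+ 2))%:E * en setT f)%E].
Proof.
move=> lf; have /L2P[mf ff] := lf.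
pose E := fine (en setT f).
have hE : en setT f = E%:E by rewrite /E fineK// ge0_fin_numE ?en_ge0.
have fE : (en setT f <= E%:E)%E by rewrite hE.
have [AU AU1] := green_AC hp hm HW W0 (L2_locint lf).
have L0 : 0 < nc l.
  by apply: lt_le_trans l0 _; apply: le_trans (nc_Im l); exact: ler_norm.
pose c1 := b * nc l ^+ 2 / 4.
have c10 : 0 < c1 by rewrite divr_gt0// mulr_gt0// exprn_gt0.
have bnd n := resolvent_bound l0 bV hv hp hm HW W0 K0 dp dm n lf fE.
have sq0' u n : 0 <= sq (- n) n u by apply: Rintegral_ge0 => t _; exact: sqr_ge0.
have glob u B : ccont u -> (forall n : nat, sq (- n%:R) n%:R u <= B) -> (en setT u <= B%:E)%E.
  move=> cu h; apply: (@en_trunc _ _ _ _ 0) => //; first exact: ccont_cmeas.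
  move=> n _; rewrite setTI enE//; [by rewrite lee_fin|exact: ccont_on_meas (cu _ _)|exact: en_ccont (cu _ _)].
have cu := AC_ccont AU; have cu1 := AC_ccont AU1.
have Eu : (en setT (gu f) <= (8 / (b ^+ 2 * nc l ^+ 2) * E)%:E)%E.
  apply: glob => // n; have h := bnd n; have z1 := mulr_ge0 (ltW l0) (sq0' (gu1 f) n%:R).
  have h' : c1 * sq (- n%:R) n%:R (gu f) <= 2 * (b^-1 * E).
    by apply: le_trans h; rewrite lerDr.
  rewrite -(ler_pM2l c10); apply: (le_trans h').
  rewrite le_eqVlt; apply/orP; left; apply/eqP; rewrite /c1; field.
  by rewrite !lt0r_neq0.
have Eu1 : (en setT (gu1 f) <= (b^-1 * (2 * (b^-1 * E)))%:E)%E.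
  apply: glob => // n; have h := bnd n; have z1 := mulr_ge0 (ltW c10) (sq0' (gu f) n%:R).
  have h' : b * sq (- n%:R) n%:R (gu1 f) <= 2 * (b^-1 * E).
    by apply: le_trans h; rewrite lerDl.
  by rewrite -(ler_pM2l l0) mulVKf ?lt0r_neq0.
split; last by rewrite hE -EFinM.
  by apply/L2P; split; [exact: ccont_cmeas|apply: le_lt_trans Eu _; exact: ltry].
by apply/L2P; split; [exact: ccont_cmeas|apply: le_lt_trans Eu1 _; exact: ltry].
Qed.

Lemma L2_pot u : L2 u -> ccont u -> L2 (fun x => q x * u x).
Proof.
move=> lu cu; apply: (@L2_le _ u _ (v0 + nc l ^+ 2)) => //.
  apply: ccont_cmeas; apply: ccontM => //; exact: pot_cont cV l.
move=> x; rewrite ncM ler_wpM2r ?nc_ge0// (pot_bound bV)//.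
Qed.

(** Existence and boundedness come from [green_AC] and [green_L2]. For uniqueness,
    replace an element of the graph by absolutely continuous representatives and
    subtract the Green solution with the same source. *)
Theorem green_resolvent : is_resolvent V l gu.
Proof.
split.
- move=> f lf; have [lu lu1 _] := green_L2 lf.
  have [AU AU1] := green_AC hp hm HW W0 (L2_locint lf).
  have cu := AC_ccont AU.
  split; first by apply: L2D => //; exact: L2Z.
  exists (gu1 f), (fun x => q x * gu f x - f x); split.
    by split => //; apply: L2B => //; exact: L2_pot.
  split; [exact: AC_weak|exact: AC_weak|].
  have aeF := ae_filter_ringOfSetsType mu.
  by apply: aeW => x /=; rewrite /pot; move: (V x)%:C (gu f x) (f x) => *; ring.
- move=> u w [lw [u1 [u2 [[lu lu1 lu2] [wu wu1 hw]]]]].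
  set f := fun x => w x - l ^+ 2 * u x.
  have lf : L2 f by apply: L2B => //; exact: L2Z.
  have [G [AG uG]] := weak_AC (L2_locint lu) (L2_locint lu1) wu.
  have [G1 [AG1 uG1]] := weak_AC (L2_locint lu1) (L2_locint lu2) wu1.
  have cG := AC_ccont AG; have cG1 := AC_ccont AG1.
  have aeF := ae_filter_ringOfSetsType mu.
  have AG' a c : AC a c G1 G by apply: AC_ae (AG a c) _ uG1; exact: ccont_on_integrable (cG1 a c).
  have cq : ccont q by exact: pot_cont cV l.
  have AG1' a c : AC a c (fun x => q x * G x - f x) G1.
    apply: AC_ae (AG1 a c) _ _.
      have cqG : ccont (fun x => q x * G x) by exact: ccontM.
      exact: (cintegrableB (measurable_itv _) (ccont_on_integrable (cqG a c)) (L2_locint lf a c)).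
    apply: (filterS2 _ _ uG hw) => x uGx wx; rewrite /f /pot wx -uGx.
    by move: (V x)%:C (u x) (u2 x) => *; ring.
  have [AU AU1] := green_AC hp hm HW W0 (L2_locint lf).
  have [lg lg1 _] := green_L2 lf.
  have L2ae (h h' : R -> C) : ae_equal h h' -> ccont h' -> L2 h -> L2 h'.
    move=> ae ch' /L2P[mh fh]; apply/L2P; split; first exact: ccont_cmeas.
    by rewrite -(en_ae mh (ccont_cmeas ch') ae).
  have lG := L2ae _ _ uG cG lu; have lG1 := L2ae _ _ uG1 cG1 lu1.
  have z := @L2_solution_eq0 (fun x => G x - gu f x) (fun x => G1 x - gu1 f x) _ (L2B lG lg) (L2B lG1 lg1).
  apply: (filterS _ uG) => x ->; apply/esym/eqP; rewrite -subr_eq0; apply/eqP; apply: z.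
  move=> a c; split; first exact: AC_B (AG' a c) (AU a c).
  by apply: eq_AC (AC_B (AG1' a c) (AU1 a c)) => // t _; rewrite /f; move: (q t) (G t) (gu _ t) (w t) (l ^+ 2 * u t) => *; ring.
- exists (Num.sqrt (8 / (b ^+ 2 * nc l ^+ 2))) => f lf; have [_ _ h] := green_L2 lf.
  apply: L2norm_le; first exact: sqrtr_ge0.
  by rewrite sqr_sqrtr// divr_ge0// mulr_ge0 ?sqr_ge0.
Qed.

End ResolventAxioms.

(** * Compactly supported sources *)

Section CompactSources.
Variable R : realType.
Local Notation C := R[i].
Local Notation mu := (@lebesgue_measure R).
Implicit Types (f g u v h : R -> C) (a c x M N : R) (D : set (measurableTypeR R)).

Lemma en_cutoff M u : en setT (cutoff M u) = en `[- M, M] u.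
Proof.
rewrite /en [RHS]integral_mkcond; apply: eq_integral => x _; rewrite patchE.
case: ifPn => [|]; rewrite ?inE ?notin_setE /= in_itv /= -ler_norml.
  by move=> h; rewrite (cutoff_in u h).
by move=> /negP; rewrite -ltNge => h; rewrite (cutoff_out u h) nc0 expr0n.
Qed.

Lemma L2_cutoff_cont M u : ccont u -> L2 (cutoff M u).
Proof.
move=> cu; apply/L2P; split; first by apply: cmeas_cutoff; exact: ccont_cmeas.
by rewrite en_cutoff; apply: en_ccont; exact: cu.
Qed.

Lemma green_cont (W : C) P Q fp fm f : ccont P -> ccont Q -> ccont fp -> ccont fm -> locint f ->
  ccont (green W P Q fp fm f).
Proof.
move=> cP cQ cp cm lf.
have c1 := AC_ccont (prim_AC (locint_M cm lf)); have c2 := AC_ccont (prim_AC (locint_M cp lf)).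
apply: ccontZ; apply: ccontD; apply: ccontM => //.
  by apply: ccontD => //; exact: ccont_cst.
by apply: ccontB => //; exact: ccont_cst.
Qed.

Lemma cint_ae D f g : measurable D -> cmeas D f -> cmeas D g -> ae_equal f g -> cint D f = cint D g.
Proof.
move=> mD [m1 m2] [m3 m4] ae; have aeF := ae_filter_ringOfSetsType mu.
apply: eqC; rewrite ?Re_cint ?Im_cint; congr fine; apply: ae_eq_integral => //; try exact/measurable_EFinP.
  by apply: (filterS _ ae) => t -> .
by apply: (filterS _ ae) => t -> .
Qed.

Lemma supported_cutoff M f : supported_in M f -> ae_equal f (cutoff M f).
Proof.
move=> ae; have aeF := ae_filter_ringOfSetsType mu; apply: (filterS _ ae) => x h.
by have [xM|xM] := leP `|x| M; [rewrite cutoff_in|rewrite cutoff_out// h].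
Qed.

Lemma supported_le M N f : M <= N -> supported_in M f -> supported_in N f.
Proof.
move=> MN ae; have aeF := ae_filter_ringOfSetsType mu; apply: (filterS _ ae) => x h xN.
by apply: h; exact: le_lt_trans MN xN.
Qed.

(** Support conditions hold almost everywhere only; from here on they are used in
    this form. *)
Lemma cint_supported D M f h : measurable D -> ccont h -> L2 f -> supported_in M f ->
  cint D (fun t => h t * f t) = cint (D `&` `[- M, M]) (fun t => h t * f t).
Proof.
move=> mD ch lf sf; have /L2P[mf _] := lf; have mh := ccont_cmeas ch.
have mc := cmeas_cutoff M mf.
have mS u : cmeas setT u -> cmeas D u by apply: cmeasS.
have mI : measurable (D `&` `[- M, M]) by apply: measurableI => //; exact: measurable_itv.
have aeF := ae_filter_ringOfSetsType mu.
have ae : ae_equal (fun t => h t * f t) (fun t => h t * cutoff M f t).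
  by apply: (filterS _ (supported_cutoff sf)) => t {1}->.
rewrite (cint_ae mD _ _ ae); [|by apply: mS; exact: cmeasM|by apply: mS; exact: cmeasM].
transitivity (cint (D `&` `[- M, M]) (fun t => h t * cutoff M f t)).
  apply: cint_supp => [t []//|t Dt nt]; rewrite cutoff_out ?mulr0//.
  by rewrite ltNge; apply/negP => tM; apply: nt; split => //=; rewrite in_itv /= -ler_norml.
by apply: eq_cint => t [_ /=]; rewrite in_itv /= -ler_norml => tM; rewrite cutoff_in.
Qed.

Lemma cintegrable_supported D M f h : measurable D -> ccont h -> L2 f -> supported_in M f ->
  cintegrable D (fun t => h t * f t).
Proof.
move=> mD ch lf sf; have /L2P[mf _] := lf; have mh := ccont_cmeas ch.
have mS u : cmeas setT u -> cmeas D u by apply: cmeasS.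
have lc := L2_cutoff_cont M ch; have /L2P[mc _] := lc.
have i1 : cintegrable D (fun t => cutoff M h t * f t).
  by apply: cintegrable_mul; [|exact: mS|exact: mS|exact: L2_fin|exact: L2_fin].
have aeF := ae_filter_ringOfSetsType mu.
have ae : ae_equal (fun t => cutoff M h t * f t) (fun t => h t * f t).
  apply: (filterS _ sf) => t ft; have [tM|tM] := leP `|t| M; first by rewrite cutoff_in.
  by rewrite ft// !mulr0.
have m2 : cmeas D (fun t => h t * f t) by apply: mS; exact: cmeasM.
apply: (@le_cintegrable _ _ _ (fun t => nc (h t * f t))) => //.
have /integrableP[_ fin] := cintegrable_nc mD i1.
apply/integrableP; split; first by apply/measurable_EFinP; exact: cmeas_nc.
apply: le_lt_trans fin; rewrite le_eqVlt; apply/orP; left; apply/eqP.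
have m1 := cintegrable_meas i1.
apply: ae_eq_integral => //.
- by apply/measurable_EFinP; apply: measurableT_comp => //; exact: cmeas_nc.
- by apply/measurable_EFinP; apply: measurableT_comp => //; exact: cmeas_nc.
- by apply: (filterS _ ae) => t /= ->.
Qed.

Lemma supp_bound D M f h B : measurable D -> ccont h -> L2 f -> supported_in M f -> 0 <= B ->
  (forall x, `|x| <= M -> nc (h x) <= B) ->
  nc (cint D (fun t => h t * f t)) <= B * (\int[mu]_(t in `[- M, M]) nc (f t))%R.
Proof.
move=> mD ch lf sf B0 hB; rewrite (cint_supported mD ch lf sf).
have mM : measurable (`[- M, M]%classic : set (measurableTypeR R)) by exact: measurable_itv.
have mI : measurable (D `&` `[- M, M]) by exact: measurableI.
have i1 := cintegrable_supported mI ch lf sf.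
have iM := cintegrable_nc mM (L2_locint lf (- M) M).
have iI : mu.-integrable (D `&` `[- M, M]) (EFin \o (fun t => nc (f t))) by apply: integrableS iM.
apply: (@le_trans _ _ (\int[mu]_(t in D `&` `[- M, M]) (B * nc (f t)))%R).
  apply: cint_norm_le => //; first exact: integrableZR.
  move=> t [_ /=]; rewrite in_itv /= -ler_norml => tM.
  by rewrite ncM ler_wpM2r ?nc_ge0 ?hB.
rewrite (RintegralZl _ mI iI); apply: ler_wpM2l => //.
rewrite /Rintegral fine_le ?(integrable_fin_num mI iI) ?(integrable_fin_num mM iM)//.
apply: ge0_subset_integral => //.
  by apply/measurable_EFinP; apply: cmeas_nc => //; exact: cintegrable_meas (L2_locint lf _ _).
by move=> t _; rewrite lee_fin nc_ge0.
Qed.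

Lemma prim_cint g x : exists s : C, nc s = 1 /\ exists D, measurable D /\ prim g x = s * cint D g.
Proof.
rewrite /prim; case: ifP => _.
  by exists 1; split; [exact: nc1|exists `[0, x]%classic; split; [exact: measurable_itv|rewrite mul1r]].
by exists (-1); split; [rewrite ncN nc1|exists `[x, 0]%classic; split; [exact: measurable_itv|rewrite mulN1r]].
Qed.

(** Only values of the two solutions on bounded intervals enter. *)
Lemma green_bounded (W : C) fp fm M N : ccont fp -> ccont fm -> exists2 K, 0 <= K & forall f, L2 f -> supported_in M f ->
  forall x, `|x| <= N -> nc (green W fp fm fp fm f x) <= K * (\int[mu]_(t in `[- M, M]) nc (f t))%R.
Proof.
move=> cp cm.
have bdd u n : ccont u -> exists2 B, 0 <= B & forall x, `|x| <= n -> nc (u x) <= B.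
  move=> cu; have [n0|n0] := leP 0 n.
    have nn : - n <= n by lra.
    have [B B0 hB] := ccont_on_bounded nn (cu (- n) n); exists B => // x; rewrite ler_norml; exact: hB.
  by exists 0 => // x xn; move: (le_lt_trans xn n0); rewrite ltNge normr_ge0.
have [B1 B10 h1] := bdd _ N cp; have [B2 B20 h2] := bdd _ N cm.
have [B3 B30 h3] := bdd _ M cp; have [B4 B40 h4] := bdd _ M cm.
exists (nc W^-1 * (B1 * (B4 + B4) + B2 * (B3 + B3))).
  by apply: mulr_ge0; [exact: nc_ge0|apply: addr_ge0; apply: mulr_ge0 => //; exact: addr_ge0].
move=> f lf sf x xN; set I := (\int[mu]_(t in _) _)%R.
have pb h B : ccont h -> 0 <= B -> (forall x, `|x| <= M -> nc (h x) <= B) -> nc (prim (fun t => h t * f t) x) <= B * I.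
  move=> ch B0 hB; have [s [s1 [D [mD ->]]]] := prim_cint (fun t => h t * f t) x.
  by rewrite ncM s1 mul1r; exact: supp_bound.
have b1 := supp_bound (measurable_itv `]-oo, 0]) cm lf sf B40 h4; have b2 := pb _ _ cm B40 h4.
have b3 := supp_bound (measurable_itv `[0, +oo[) cp lf sf B30 h3; have b4 := pb _ _ cp B30 h3.
rewrite /green -mulrA ncM; apply: ler_wpM2l; first exact: nc_ge0.
apply: (le_trans (ncD _ _)); rewrite mulrDl !ncM; apply: lerD; rewrite -mulrA mulrDl; apply: ler_pM; rewrite ?nc_ge0 ?h1 ?h2//.
  by apply: (le_trans (ncD _ _)); exact: lerD.
by apply: (le_trans (ncDB _ _)); exact: lerD.
Qed.

Lemma green_bounded_L2 (W : C) fp fm : ccont fp -> ccont fm -> bounded_L2c_L2loc (green W fp fm fp fm).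
Proof.
move=> cp cm; have aeF := ae_filter_ringOfSetsType mu; split.
- move=> f [lf _] M; apply: L2_cutoff_cont; apply: green_cont => //; exact: L2_locint.
- move=> a f g [lf [M1 sf]] [lg [M2 sg]]; apply: aeW => x.
  have lin D h : measurable D -> ccont h -> cint D (fun t => h t * (a * f t + g t)) = a * cint D (fun t => h t * f t) + cint D (fun t => h t * g t).
    move=> mD ch; have i1 := cintegrable_supported mD ch lf sf; have i2 := cintegrable_supported mD ch lg sg.
    rewrite -(cintZ a mD i1) -(cintD mD (cintegrableZ a mD i1) i2).
    by apply: eq_cint => t _; move: (h t) (f t) (g t) => *; ring.
  have plin h : ccont h -> prim (fun t => h t * (a * f t + g t)) x = a * prim (fun t => h t * f t) x + prim (fun t => h t * g t) x.
    move=> ch; rewrite /prim; case: ifP => _; rewrite (lin _ _ (measurable_itv _) ch)//.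
    by move: (cint _ _) (cint _ _) => *; ring.
  rewrite /green (lin _ _ (measurable_itv _) cp) (lin _ _ (measurable_itv _) cm) (plin _ cp) (plin _ cm).
  move: (prim (fun t => fp t * f t) x) (prim (fun t => fp t * g t) x) (prim (fun t => fm t * f t) x) (prim (fun t => fm t * g t) x).
  move: (cint `]-oo, 0] (fun t => fm t * f t)) (cint `]-oo, 0] (fun t => fm t * g t)).
  move: (cint `[0, +oo[ (fun t => fp t * f t)) (cint `[0, +oo[ (fun t => fp t * g t)) (fp x) (fm x) W^-1 => *; ring.
- move=> M N; pose M' := `|M| + 1; pose N' := `|N| + 1.
  have MM : M <= M' by rewrite /M'; have := ler_norm M; lra.
  have NN : N <= N' by rewrite /N'; have := ler_norm N; lra.
  have M0 : 0 < M' by rewrite /M'; have := normr_ge0 M; lra.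
  have N0 : 0 < N' by rewrite /N'; have := normr_ge0 N; lra.
  have [K K0 hK] := green_bounded W M' N' cp cm.
  pose c := K ^+ 2 * (N' - - N') * (M' - - M').
  have Mp : 0 < M' - - M' by lra.
  have Np : 0 < N' - - N' by lra.
  have NN' : - N' <= N' by lra.
  have c0 : 0 <= c by rewrite /c mulr_ge0 ?(ltW Mp)// mulr_ge0 ?sqr_ge0// ltW.
  exists (Num.sqrt c) => f lf sf; apply: L2norm_le; first exact: sqrtr_ge0.
  have /L2P[mf ff] := lf; have sf' := supported_le MM sf.
  have cg : ccont (green W fp fm fp fm f) by apply: green_cont => //; exact: L2_locint.
  set I := (\int[mu]_(t in `[(- M')%R, M']) nc (f t))%R.
  have mMi : measurable (`[- M', M']%classic : set (measurableTypeR R)) by exact: measurable_itv.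
  have mNi : measurable (`[- N', N']%classic : set (measurableTypeR R)) by exact: measurable_itv.
  have MMlt : - M' < M' by lra.
  have mfM : cmeas `[- M', M'] f by exact: cmeasS mf.
  have I2 := mean_square MMlt mfM (L2_fin mMi lf) (L2_locint lf _ _).
  pose E := fine (en setT f).
  have hE : en setT f = E%:E by rewrite /E fineK// ge0_fin_numE ?en_ge0.
  have E2 : (\int[mu]_(t in `[(- M')%R, M']) (nc (f t) ^+ 2))%R <= E by apply: L2_sq => //; rewrite hE.
  rewrite sqr_sqrtr// en_cutoff hE -EFinM.
  apply: (@le_trans _ _ (en `[(- N')%R, N'] (green W fp fm fp fm f))).
    apply: en_sub => //; first by apply: subset_itvScc; rewrite bnd_simp ?lerN2.
    exact: ccont_on_meas (cg _ _).
  rewrite enE//; [|exact: ccont_on_meas (cg _ _)|exact: en_ccont (cg _ _)].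
  rewrite lee_fin; apply: (@le_trans _ _ ((K * I) ^+ 2 * (N' - - N'))).
    rewrite -(Rintegral_cst_itv ((K * I) ^+ 2) NN'); apply: le_Rintegral => //.
    - exact: sq_ccont (cg _ _).
    - exact: integrable_cst_itv.
    move=> x /=; rewrite in_itv /= -ler_norml => xN.
    by rewrite lerXn2r ?nnegrE ?nc_ge0 ?hK// mulr_ge0// Rintegral_ge0// => t _; exact: nc_ge0.
  have -> : (K * I) ^+ 2 * (N' - - N') = K ^+ 2 * (N' - - N') * I ^+ 2 by ring.
  have -> : c * E = K ^+ 2 * (N' - - N') * ((M' - - M') * E) by rewrite /c; ring.
  apply: ler_wpM2l; first by rewrite mulr_ge0 ?sqr_ge0// ltW.
  by apply: (le_trans I2); apply: ler_wpM2l; [exact: ltW|].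
Qed.

End CompactSources.

(** * The pairing as a function of the spectral parameter *)

Section Continuation.
Variable R : realType.
Local Notation C := R[i].
Local Notation mu := (@lebesgue_measure R).
Implicit Types (f g u v h : R -> C) (x M : R) (D : set (measurableTypeR R)) (l z w : C).
Variables (V : R -> R) (B0 : R).
Hypotheses (cV : continuous V) (bV : forall x, `|V x| <= B0).

Lemma sol0_cont (a b l : C) : ccont (sol0 V a b l).
Proof. by have [h _] := sol_cont cV bV a b l. Qed.

Lemma sol0_bounded (a b z : C) M : exists2 B, 0 <= B & forall l x, nc (l - z) < 1 -> `|x| <= M -> nc (sol0 V a b l x) <= B.
Proof.
have H l x (lz : nc (l - z) < 1) (xM : `|x| <= M) := sol_bound cV bV a b (l := l) (N := nc z + 1) (X := M) (x := x).
eexists; last first.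
  move=> l x lz xM; have [||h _] := H l x lz xM; last exact: h; last exact: xM.
  by rewrite -(subrK z l); apply: (le_trans (ncD _ _)); rewrite addrC lerD2l ltW.
by rewrite mulr_ge0// mulr_ge0 ?expR_ge0// addr_ge0 ?nc_ge0.
Qed.

Lemma entire_cint (a b : C) D M f z : measurable D -> D `<=` `[- M, M] -> cintegrable D f ->
  cdiffable (fun l => cint D (fun x => sol0 V a b l x * f x)) z.
Proof.
move=> mD DM i_f; have [B Bp hB] := sol0_bounded a b z M.
apply: (@hol_int R D (fun x l => sol0 V a b l x) f z 1 B) => //.
- by move=> x w _ _; have [h _] := sol_hol cV bV a b x w.
- by move=> x w /DM /=; rewrite in_itv /= -ler_norml => xM wz; exact: hB.
- by move=> w _; apply: cmeasS (ccont_cmeas (sol0_cont a b w)).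
Qed.

Lemma entire_prim (a b : C) f x z : locint f -> cdiffable (fun l => prim (fun t => sol0 V a b l t * f t) x) z.
Proof.
move=> lf; rewrite /prim; case: (leP 0 x) => x0; last apply: cdiffableN.
  apply: (@entire_cint _ _ _ `|x|) => //; first by apply: subset_itvScc; rewrite bnd_simp ?oppr_le0 ?normr_ge0 ?ler_norm.
apply: (@entire_cint _ _ _ `|x|) => //; apply: subset_itvScc; rewrite bnd_simp ?normr_ge0//.
by rewrite lerNl ltr0_norm.
Qed.

(** The solution operator with zero data at the origin; it is entire in [l]. *)
Definition gkernel l f x : C :=
  cs0 V l x * prim (fun t => sn0 V l t * f t) x - sn0 V l x * prim (fun t => cs0 V l t * f t) x.

Lemma gkernel_cont l f : locint f -> ccont (gkernel l f).
Proof.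
move=> lf; have c1 : ccont (cs0 V l) := sol0_cont 1 0 l; have c2 : ccont (sn0 V l) := sol0_cont 0 1 l.
have p1 := AC_ccont (prim_AC (locint_M c1 lf)); have p2 := AC_ccont (prim_AC (locint_M c2 lf)).
exact: (ccontB (ccontM c1 p2) (ccontM c2 p1)).
Qed.

Lemma entire_gkernel M f g z : 0 <= M -> locint f -> cintegrable `[- M, M] g ->
  cdiffable (fun l => cint `[- M, M] (fun x => gkernel l f x * g x)) z.
Proof.
move=> M0 lf ig; have [B1 B10 h1] := sol0_bounded 1 0 z M; have [B2 B20 h2] := sol0_bounded 0 1 z M.
have iM := cintegrable_nc (measurable_itv _) (lf (- M) M).
set I := (\int[mu]_(t in `[- M, M]) nc (f t))%R.
have mM : measurable (`[- M, M]%classic : set (measurableTypeR R)) by exact: measurable_itv.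
have pb (a b : C) B w x : 0 <= B -> (forall l x, nc (l - z) < 1 -> `|x| <= M -> nc (sol0 V a b l x) <= B) ->
    nc (w - z) < 1 -> `|x| <= M -> nc (prim (fun t => sol0 V a b w t * f t) x) <= B * I.
  move=> B0' hB wz xM.
  have gen c d : - M <= c -> d <= M -> nc (cint `[c, d] (fun t => sol0 V a b w t * f t)) <= B * I.
    move=> c1 d1; have sub : `[c, d]%classic `<=` `[- M, M]%classic by apply: subset_itvScc; rewrite bnd_simp.
    have md : measurable (`[c, d]%classic : set (measurableTypeR R)) by exact: measurable_itv.
    have iI : mu.-integrable `[c, d] (EFin \o (fun t => nc (f t))) by apply: integrableS iM.
    apply: (@le_trans _ _ (\int[mu]_(t in `[c, d]) (B * nc (f t)))%R).
      apply: cint_norm_le => //; [exact: locint_M (sol0_cont a b w) lf c d|exact: integrableZR|].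
      by move=> t /sub /=; rewrite in_itv /= -ler_norml => tM; rewrite ncM ler_wpM2r ?nc_ge0 ?hB.
    rewrite (RintegralZl _ md iI); apply: ler_wpM2l => //.
    rewrite /I /Rintegral fine_le ?(integrable_fin_num md iI) ?(integrable_fin_num mM iM)//.
    apply: ge0_subset_integral => //.
      by apply/measurable_EFinP; apply: cmeas_nc => //; exact: cintegrable_meas (lf _ _).
    by move=> t _; rewrite lee_fin nc_ge0.
  move: xM; rewrite ler_norml => /andP[x1 x2].
  by rewrite /prim; case: ifP => _; rewrite ?ncN; apply: gen; rewrite ?oppr_le0.
have I0 : 0 <= I by apply: Rintegral_ge0 => t _; exact: nc_ge0.
apply: (@hol_int R _ (fun x l => gkernel l f x) g z 1 (B1 * (B2 * I) + B2 * (B1 * I))) => //.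
- move=> x w _ _; have [d1 _] := sol_hol cV bV 1 0 x w; have [d2 _] := sol_hol cV bV 0 1 x w.
  by apply: cdiffableB; apply: cdiffableM => //; exact: entire_prim.
- move=> x w /=; rewrite in_itv /= -ler_norml => xM wz; apply: (le_trans (ncDB _ _)); rewrite !ncM.
  by apply: lerD; apply: ler_pM; rewrite ?nc_ge0//; [exact: h1|exact: pb|exact: h2|exact: pb].
- by move=> w _; apply: cmeasS (ccont_cmeas (gkernel_cont w lf)).
Qed.

Variables ap bp am bm : C -> C.
Definition wr l := ap l * bm l - bp l * am l.
Definition jp l x := ap l * cs0 V l x + bp l * sn0 V l x.
Definition jm l x := am l * cs0 V l x + bm l * sn0 V l x.
Definition cont_resolvent l f := green (wr l) (jp l) (jm l) (jp l) (jm l) f.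

Lemma jp_cont l : ccont (jp l).
Proof. exact: (ccontD (ccontZ (ap l) (sol0_cont 1 0 l)) (ccontZ (bp l) (sol0_cont 0 1 l))). Qed.
Lemma jm_cont l : ccont (jm l).
Proof. exact: (ccontD (ccontZ (am l) (sol0_cont 1 0 l)) (ccontZ (bm l) (sol0_cont 0 1 l))). Qed.

Definition ctr (c : C -> R -> C) (D : set (measurableTypeR R)) f l : C := cint D (fun t => c l t * f t).

(** The pairing after expanding the Jost solutions in the basis [cs0], [sn0]. The
    Wronskian cancels in front of the last term. *)
Definition pair_formula (Dm Dp Dg : set (measurableTypeR R)) f g l : C :=
  (wr l)^-1 * (ap l * (am l * ctr (cs0 V) Dm f l + bm l * ctr (sn0 V) Dm f l)
             + am l * (ap l * ctr (cs0 V) Dp f l + bp l * ctr (sn0 V) Dp f l)) * ctr (cs0 V) Dg g l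
+ (wr l)^-1 * (bp l * (am l * ctr (cs0 V) Dm f l + bm l * ctr (sn0 V) Dm f l)
             + bm l * (ap l * ctr (cs0 V) Dp f l + bp l * ctr (sn0 V) Dp f l)) * ctr (sn0 V) Dg g l
+ cint Dg (fun x => gkernel l f x * g x).

(** Expand both Jost solutions in the basis. The part of the integrals starting at
    the origin collects to [W] times [gkernel]; the rest is a product of a
    function of [x] and constants depending on [f]. *)
Lemma pairingE f g M l : 0 <= M -> L2 f -> L2 g -> supported_in M f -> supported_in M g -> wr l != 0 ->
  pairing (cont_resolvent l f) g =
  pair_formula (`]-oo, 0] `&` `[- M, M]) (`[0, +oo[ `&` `[- M, M]) `[- M, M] f (fun x => conjc (g x)) l.
Proof.
move=> M0 lf lg sf sg w0; have aeF := ae_filter_ringOfSetsType mu.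
set cg := fun x => conjc (g x).
have lcg : L2 cg.
  by apply: (@L2_le _ g _ 1) => //; [apply: cmeas_conj; have /L2P[] := lg|move=> x; rewrite mul1r ncJ].
have scg : supported_in M cg by apply: (filterS _ sg) => x gx xM; rewrite /cg gx// conjc0.
have lo := L2_locint lf; have lgo := L2_locint lcg.
have cT : ccont (cont_resolvent l f) by apply: green_cont => //; [exact: jp_cont|exact: jm_cont|exact: jp_cont|exact: jm_cont].
rewrite /pairing cintegralE (cint_supported measurableT cT lcg scg) setTI.
have c1 : ccont (cs0 V l) := sol0_cont 1 0 l; have c2 : ccont (sn0 V l) := sol0_cont 0 1 l.
have lin D (p q : C) : measurable D -> cint D (fun t => (p * cs0 V l t + q * sn0 V l t) * f t) =
    p * ctr (cs0 V) (D `&` `[- M, M]) f l + q * ctr (sn0 V) (D `&` `[- M, M]) f l.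
  move=> mD; have ch : ccont (fun t => p * cs0 V l t + q * sn0 V l t) by exact: (ccontD (ccontZ p c1) (ccontZ q c2)).
  rewrite (cint_supported mD ch lf sf) /ctr.
  have mI : measurable (D `&` `[- M, M]) by apply: measurableI => //; exact: measurable_itv.
  have i1 := cintegrable_supported mI c1 lf sf; have i2 := cintegrable_supported mI c2 lf sf.
  rewrite -(cintZ p mI i1) -(cintZ q mI i2) -(cintD mI (cintegrableZ p mI i1) (cintegrableZ q mI i2)).
  by apply: eq_cint => t _; rewrite mulrDl !mulrA.
have plin (p q : C) x : prim (fun t => (p * cs0 V l t + q * sn0 V l t) * f t) x =
    p * prim (fun t => cs0 V l t * f t) x + q * prim (fun t => sn0 V l t * f t) x.
  have gen c d : cint `[c, d] (fun t => (p * cs0 V l t + q * sn0 V l t) * f t) =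
      p * cint `[c, d] (fun t => cs0 V l t * f t) + q * cint `[c, d] (fun t => sn0 V l t * f t).
    have mI : measurable (`[c, d]%classic : set (measurableTypeR R)) by exact: measurable_itv.
    have i1 := locint_M c1 lo c d; have i2 := locint_M c2 lo c d.
    rewrite -(cintZ p mI i1) -(cintZ q mI i2) -(cintD mI (cintegrableZ p mI i1) (cintegrableZ q mI i2)).
    by apply: eq_cint => t _; rewrite mulrDl !mulrA.
  rewrite /prim; case: ifP => _; rewrite gen//.
  by move: (cint _ _) (cint _ _) => *; ring.
set Dm := `]-oo, 0] `&` _; set Dp := `[0, +oo[ `&` _.
pose Ac := (wr l)^-1 * (ap l * (am l * ctr (cs0 V) Dm f l + bm l * ctr (sn0 V) Dm f l)
             + am l * (ap l * ctr (cs0 V) Dp f l + bp l * ctr (sn0 V) Dp f l)).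
pose Bc := (wr l)^-1 * (bp l * (am l * ctr (cs0 V) Dm f l + bm l * ctr (sn0 V) Dm f l)
             + bm l * (ap l * ctr (cs0 V) Dp f l + bp l * ctr (sn0 V) Dp f l)).
have TE x : cont_resolvent l f x = Ac * cs0 V l x + Bc * sn0 V l x + gkernel l f x.
  rewrite /cont_resolvent /green /jp /jm (lin _ _ _ (measurable_itv _)) (lin _ _ _ (measurable_itv _)) !plin -/Dm -/Dp /Ac /Bc /gkernel.
  have ww : (wr l)^-1 * (ap l * bm l - bp l * am l) = 1 by rewrite -/(wr l) mulVf.
  rewrite -[X in _ = _ + X]mul1r -ww.
  move: (ctr _ _ _ _) (ctr _ _ _ _) (ctr _ _ _ _) (ctr _ _ _ _) (prim _ x) (prim _ x) (cs0 V l x) (sn0 V l x).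
  by move: (wr l)^-1 (ap l) (bp l) (am l) (bm l) => *; ring.
have mM : measurable (`[- M, M]%classic : set (measurableTypeR R)) by exact: measurable_itv.
have i1 := locint_M c1 lgo (- M) M; have i2 := locint_M c2 lgo (- M) M.
have i3 := locint_M (gkernel_cont l lo) lgo (- M) M.
rewrite /pair_formula -/Ac -/Bc /ctr -(cintZ Ac mM i1) -(cintZ Bc mM i2).
rewrite -(cintD mM (cintegrableZ Ac mM i1) (cintegrableZ Bc mM i2)).
rewrite -(cintD mM (cintegrableD mM (cintegrableZ Ac mM i1) (cintegrableZ Bc mM i2)) i3).
by apply: eq_cint => x _; rewrite TE !mulrDl !mulrA.
Qed.

(** The same closure argument serves twice: for differentiability at a point and
    for meromorphy at a point. *)
Lemma pair_formula_closed (Q : (C -> C) -> Prop) M f g : 0 <= M -> L2 f -> L2 g ->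
  (forall p q, Q p -> Q q -> Q (fun l => p l + q l)) -> (forall p q, Q p -> Q q -> Q (fun l => p l * q l)) ->
  (forall p, (forall z, cdiffable p z) -> Q p) ->
  Q ap -> Q bp -> Q am -> Q bm -> Q (fun l => (wr l)^-1) ->
  Q (pair_formula (`]-oo, 0] `&` `[- M, M]) (`[0, +oo[ `&` `[- M, M]) `[- M, M] f g).
Proof.
move=> M0 lf lg QD QM QE qap qbp qam qbm qw.
have mM : measurable (`[- M, M]%classic : set (measurableTypeR R)) by exact: measurable_itv.
have ent (a b : C) D h : measurable D -> L2 h -> Q (fun l => cint (D `&` `[- M, M]) (fun t => sol0 V a b l t * h t)).
  move=> mD lh; apply: QE => z; have mI : measurable (D `&` `[- M, M]) by exact: measurableI.
  by apply: (@entire_cint _ _ _ M) => //; apply: cintegrableS (L2_locint lh (- M) M).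
have e1 := ent 1 0 _ f (measurable_itv `]-oo, 0]) lf; have e2 := ent 0 1 _ f (measurable_itv `]-oo, 0]) lf.
have e3 := ent 1 0 _ f (measurable_itv `[0, +oo[) lf; have e4 := ent 0 1 _ f (measurable_itv `[0, +oo[) lf.
have e5 := ent 1 0 _ g measurableT lg; have e6 := ent 0 1 _ g measurableT lg; rewrite setTI in e5 e6.
have e7 : Q (fun l => cint `[- M, M] (fun x => gkernel l f x * g x)).
  by apply: QE => z; apply: entire_gkernel => //; exact: L2_locint.
have q1 := QD _ _ (QM _ _ qam e1) (QM _ _ qbm e2).
have q2 := QD _ _ (QM _ _ qap e3) (QM _ _ qbp e4).
have A := QM _ _ (QM _ _ qw (QD _ _ (QM _ _ qap q1) (QM _ _ qam q2))) e5.
have B := QM _ _ (QM _ _ qw (QD _ _ (QM _ _ qbp q1) (QM _ _ qbm q2))) e6.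
exact: (QD _ _ (QD _ _ A B) e7).
Qed.

End Continuation.

(** * The resonances and the meromorphic continuation *)

Section Assembly.
Variable R : realType.
Local Notation C := R[i].
Local Notation mu := (@lebesgue_measure R).
Implicit Types (f g u v h : R -> C) (x M : R) (l z w : C).

(** The hypothesis on the potential, as a power series with explicit bounds. *)
Lemma taylor_at0 (U : set R[i]^o) (F : R[i]^o -> R[i]^o) : U 0 -> holomorphic_on U F -> F 0 = 0 ->
  exists (rho M : R) (a : nat -> C), [/\ 0 < rho, 0 <= M & forall n, nc (a n) <= M / rho ^+ n] /\ a 0%N = 0 /\
    forall w, nc w <= rho / 2 -> cseries (fun n => a n * w ^+ n) (F w) (2 * M).
Proof.
move=> U0 [oU hF] F0; have /nbhsCP[d d0 hd] : nbhs (0 : R[i]^o) U by exact: open_nbhs_nbhs.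
have dF w : nc w < d -> cdiffable F w by move=> wd; apply/derivableCP; apply: hF; apply: hd; rewrite subr0.
have dF0 : cdiffable F 0 by apply: dF; rewrite nc0.
have [d1 d10 [M M0 hM]] := local_bound dF0.
pose rho' := Num.min d d1; have r'0 : 0 < rho' by rewrite lt_min d0.
have rr : rho' / 2 < rho' by lra.
have r0 : 0 < rho' / 2 by rewrite divr_gt0.
have c1 z : nc z < rho' -> cdiffable F z by rewrite lt_min => /andP[h _]; exact: dF.
have c2 z : nc z = rho' / 2 -> nc (F z) <= M.
  by move=> hz; apply: hM; rewrite subr0 hz; apply: lt_le_trans rr _; rewrite ge_min lexx orbT.
have [a [ha hs]] := taylor r0 rr c1 c2.
exists (rho' / 2), M, a; split; first by split.
split => //; have h0 : nc (0 : C) <= rho' / 2 / 2 by rewrite nc0 divr_ge0// ltW.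
by have := hs 0 h0; rewrite F0 => /cseries_pow0 ->.
Qed.

Lemma decay_global (b s : R) u u1 : 0 < b -> s = 1 \/ s = -1 -> ccont u -> ccont u1 ->
  (exists K X : R, forall x, X <= s * x -> nc (u x) <= K * expR (- b * (s * x)) /\ nc (u1 x) <= K * expR (- b * (s * x))) ->
  exists2 K, 0 <= K & forall x, 0 <= s * x -> nc (u x) <= K * expR (- b * (s * x)) /\ nc (u1 x) <= K * expR (- b * (s * x)).
Proof.
move=> b0 hs cu cu1 [K [X hX]]; pose Y := `|X|.
have Y0 : 0 <= Y by exact: normr_ge0.
have YY : - Y <= Y by lra.
have [B1 B10 h1] := ccont_on_bounded YY (cu (- Y) Y); have [B2 B20 h2] := ccont_on_bounded YY (cu1 (- Y) Y).
pose e := expR (b * Y); have e0 : 0 <= e by exact: expR_ge0.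
have K0 := normr_ge0 K.
exists (`|K| + (B1 + B2) * e); first by rewrite addr_ge0// mulr_ge0// addr_ge0.
move=> x sx; set k := expR (- b * (s * x)); have k0 : 0 <= k by exact: expR_ge0.
have [hx|hx] := leP X (s * x).
  have [g1 g2] := hX x hx.
  have Kk : K * k <= (`|K| + (B1 + B2) * e) * k.
    by apply: ler_wpM2r => //; apply: (le_trans (ler_norm K)); rewrite lerDl mulr_ge0// addr_ge0.
  by split; [exact: le_trans g1 Kk|exact: le_trans g2 Kk].
have xY : - Y <= x <= Y.
  have : s * x <= Y by apply: (le_trans (ltW hx)); exact: ler_norm.
  by move: sx; case: hs => ->; rewrite ?mul1r ?mulN1r => *; apply/andP; lra.
have ek : 1 <= e * k.
  rewrite /e /k -expRD -expR0 ler_expR; have -> : b * Y + - b * (s * x) = b * (Y - s * x) by ring.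
  rewrite mulr_ge0 ?(ltW b0)// subr_ge0; apply: (le_trans (ltW hx)); exact: ler_norm.
have gen B : 0 <= B -> B <= B1 + B2 -> B <= (`|K| + (B1 + B2) * e) * k.
  move=> B0 BB; rewrite mulrDl -mulrA; apply: (@le_trans _ _ ((B1 + B2) * (e * k))).
    by apply: (le_trans BB); rewrite -[leLHS]mulr1 ler_wpM2l// addr_ge0.
  by rewrite lerDr mulr_ge0.
split; [apply: (le_trans (h1 x xY))|apply: (le_trans (h2 x xY))]; apply: gen => //.
  by rewrite lerDl.
by rewrite lerDr.
Qed.

(** One end of the line: the data of the family of solutions decaying there, in
    terms of its coordinates in the basis of solutions normalized at the origin. *)
Definition jost_family (V : R -> R) (s : R) (al be : C -> C) (P : C -> Prop) :=
  [/\ (forall z, exists2 d : R, 0 < d & forall l, nc (l - z) < d -> l != z -> ~ P l),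
      (forall l, P l -> cIm l < 0),
      (forall z, ~ P z -> cdiffable al z /\ cdiffable be z) &
      (forall z, mero al z /\ mero be z)] /\
  forall l, ~ P l -> (al l != 0 \/ be l != 0) /\
    exists K X : R, forall x, X <= s * x ->
      nc (al l * cs0 V l x + be l * sn0 V l x) <= K * expR (- cIm l * (s * x)) /\
      nc (al l * cs1 V l x + be l * sn1 V l x) <= K * expR (- cIm l * (s * x)).

Lemma jost_family_exists (V : R -> R) (s A r B0 : R) (U : set R[i]^o) (F : R[i]^o -> R[i]^o) :
  continuous V -> (forall x, `|V x| <= B0) -> s = 1 \/ s = -1 -> 0 < A ->
  U 0 -> holomorphic_on U F -> F 0 = 0 ->
  (forall x, r < s * x -> (V x)%:C = F (expR (- A * (s * x)))%:C) ->
  exists al be P, jost_family V s al be P.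
Proof.
move=> cV bV hs A0 U0 hU F0 VF; have [rho [M [a [[rho0 M0 ha] [a0 hF]]]]] := taylor_at0 U0 hU F0.
exists (jost_al V s A r rho a), (jost_be V s A r rho a), (jpole A); split; first split.
- exact: (jpole_isolated A0).
- by move=> l; exact: (jpole_Im A0).
- by move=> z; exact: (jost_hol cV bV r hs A0 rho0 M0 ha).
- by move=> z; exact: (jost_mero cV bV r hs A0 rho0 M0 ha).
move=> l nl; split; first exact: (jost_nonzero cV bV hs A0 rho0 M0 ha a0 hF VF nl).
exact: (jost_decay cV bV hs A0 rho0 M0 ha a0 hF VF nl).
Qed.

Lemma bounded_end (V : R -> R) (s A r : R) (U : set R[i]^o) (F : R[i]^o -> R[i]^o) : 0 < A ->
  U 0 -> holomorphic_on U F -> F 0 = 0 ->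
  (forall x, r < s * x -> (V x)%:C = F (expR (- A * (s * x)))%:C) ->
  exists B X : R, forall x, X <= s * x -> `|V x| <= B.
Proof.
move=> A0 U0 hU F0 VF; have [rho [M [a [[rho0 M0 ha] [a0 hF]]]]] := taylor_at0 U0 hU F0.
have r2 : 0 < rho / 2 by rewrite divr_gt0.
have [N hN] := expR_small A0 r2.
exists (2 * M), (Num.max N%:R (r + 1)) => x; rewrite ge_max => /andP[x1 x2].
have rx : r < s * x by lra.
rewrite -(ncR (V x)) (VF x rx); apply: cseries_le (hF _ _).
by rewrite ncR ger0_norm ?expR_ge0//; exact: hN.
Qed.

Lemma bounded_potential (V : R -> R) : continuous V -> exponential_expansion V -> exists B0 : R, forall x, `|V x| <= B0.
Proof.
move=> cV [Ap [Am [r [Up [Um [Fp [Fm [[Ap0 Am0 r0] [[Up0 hUp Fp0 _ Vp] [Um0 hUm Fm0 _ Vm]]]]]]]]]].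
have Vp' x : r < 1 * x -> (V x)%:C = Fp (expR (- Ap * (1 * x)))%:C.
  by rewrite mul1r => /Vp[].
have Vm' x : r < -1 * x -> (V x)%:C = Fm (expR (- Am * (-1 * x)))%:C.
  by rewrite mulN1r mulrNN => h; have [] := Vm x _; first by lra.
have [B1 [X1 h1]] := bounded_end Ap0 Up0 hUp Fp0 Vp'; have [B2 [X2 h2]] := bounded_end Am0 Um0 hUm Fm0 Vm'.
pose Y := `|X1| + `|X2|; have y1 := normr_ge0 X1; have y2 := normr_ge0 X2.
have YY : - Y <= Y by rewrite /Y; lra.
have [B3 B30 h3] := ccont_on_bounded YY (ccont_R cV (a := - Y) (b := Y)).
exists (`|B1| + `|B2| + B3) => x.
have b1 := normr_ge0 B1; have b2 := normr_ge0 B2; have b1' := ler_norm B1; have b2' := ler_norm B2.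
have x1 := ler_norm X1; have x2 := ler_norm X2.
have [hx1|hx1] := leP X1 x.
  by have := h1 x; rewrite mul1r => /(_ hx1); lra.
have [hx2|hx2] := leP X2 (- x).
  by have := h2 x; rewrite mulN1r => /(_ hx2); lra.
have xY : - Y <= x <= Y by apply/andP; rewrite /Y; lra.
by have := h3 x xY; rewrite ncR; lra.
Qed.

Section Wronskian.
Variables (V : R -> R) (B0 : R) (ap bp am bm : C -> C) (Pp Pm : C -> Prop).
Hypotheses (cV : continuous V) (bV : forall x, `|V x| <= B0).
Hypotheses (Jp : jost_family V 1 ap bp Pp) (Jm : jost_family V (-1) am bm Pm).
Local Notation W := (wr ap bp am bm).
Local Notation T := (cont_resolvent V ap bp am bm).

(** If [W l] were zero the two Jost solutions would be proportional, and
    [no_eigenfunction] would make their coordinates vanish. *)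
Lemma upper_resolvent l : 2 * B0 + 1 < cIm l -> W l != 0 /\ is_resolvent V l (T l).
Proof.
move=> hl; have B00 : 0 <= B0 by apply: le_trans (bV 0); exact: normr_ge0.
have l0 : 0 < cIm l by lra.
have hv : 2 * B0 <= cIm l ^+ 2 by rewrite expr2; nra.
have [[_ imp _ _] /(_ l) jp'] := Jp; have [[_ imm _ _] /(_ l) jm'] := Jm.
have [np [K1 [X1 dp']]] : (ap l != 0 \/ bp l != 0) /\ exists K X : R, forall x, X <= 1 * x ->
      nc (ap l * cs0 V l x + bp l * sn0 V l x) <= K * expR (- cIm l * (1 * x)) /\
      nc (ap l * cs1 V l x + bp l * sn1 V l x) <= K * expR (- cIm l * (1 * x)).
  by apply: jp' => /imp; lra.
have [nm [K2 [X2 dm']]] : (am l != 0 \/ bm l != 0) /\ exists K X : R, forall x, X <= -1 * x ->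
      nc (am l * cs0 V l x + bm l * sn0 V l x) <= K * expR (- cIm l * (-1 * x)) /\
      nc (am l * cs1 V l x + bm l * sn1 V l x) <= K * expR (- cIm l * (-1 * x)).
  by apply: jm' => /imm; lra.
have c00 := sol0_cont cV bV 1 0 l; have s00 := sol0_cont cV bV 0 1 l.
have [_ c11] := sol_cont cV bV 1 0 l; have [_ s11] := sol_cont cV bV 0 1 l.
set fp := jp V ap bp l; set fm := jm V am bm l.
pose fp1 x := ap l * cs1 V l x + bp l * sn1 V l x; pose fm1 x := am l * cs1 V l x + bm l * sn1 V l x.
have [L1 L10 dp1] := decay_global l0 (or_introl erefl) (ccontD (ccontZ (ap l) c00) (ccontZ (bp l) s00))
  (ccontD (ccontZ (ap l) c11) (ccontZ (bp l) s11)) (ex_intro _ K1 (ex_intro _ X1 dp')).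
have [L2 L20 dm1] := decay_global l0 (or_intror erefl) (ccontD (ccontZ (am l) c00) (ccontZ (bm l) s00))
  (ccontD (ccontZ (am l) c11) (ccontZ (bm l) s11)) (ex_intro _ K2 (ex_intro _ X2 dm')).
pose K := L1 + L2; have K0 : 0 <= K by rewrite addr_ge0.
have dp x : 0 <= x -> nc (fp x) <= K * expR (- cIm l * x) /\ nc (fp1 x) <= K * expR (- cIm l * x).
  move=> x0; have := dp1 x; rewrite mul1r => /(_ x0) [h1 h2].
  have le : L1 * expR (- cIm l * x) <= K * expR (- cIm l * x) by rewrite ler_wpM2r ?expR_ge0// /K lerDl.
  by split; [exact: le_trans h1 le|exact: le_trans h2 le].
have dm x : x <= 0 -> nc (fm x) <= K * expR (cIm l * x) /\ nc (fm1 x) <= K * expR (cIm l * x).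
  move=> x0; have := dm1 x; rewrite mulN1r oppr_ge0 mulrNN => /(_ x0) [h1 h2].
  have le : L2 * expR (cIm l * x) <= K * expR (cIm l * x) by rewrite ler_wpM2r ?expR_ge0// /K lerDr.
  by split; [exact: le_trans h1 le|exact: le_trans h2 le].
have cs := cs_sol cV bV l; have sn := sn_sol cV bV l.
have hp a c : issol (pot V l) a c fp fp1 by exact: issol_lin.
have hm a c : issol (pot V l) a c fm fm1 by exact: issol_lin.
have w1 := cs_sn_wronskian cV bV l.
have HW x : fp x * fm1 x - fp1 x * fm x = W l.
  rewrite -[RHS]mulr1 -(w1 x) /fp /fm /jp /jm /fp1 /fm1 /wr.
  by move: (cs0 V l x) (cs1 V l x) (sn0 V l x) (sn1 V l x) (ap l) (bp l) (am l) (bm l) => *; ring.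
suff W0 : W l != 0 by split => //; have GR := green_resolvent l0 bV cV hv hp hm K0 dp dm HW W0; exact: GR.
apply/negP => /eqP W0.
have [k [k0 [ka kb]]] : exists k, k != 0 /\ am l = k * ap l /\ bm l = k * bp l.
  have WW : ap l * bm l = bp l * am l by apply/eqP; rewrite -subr_eq0 -/(wr ap bp am bm l) W0.
  have [a0|a0] := eqVneq (ap l) 0.
    have b0 : bp l != 0 by case: np; rewrite ?a0 ?eqxx.
    have am0 : am l = 0 by apply/eqP; move: WW; rewrite a0 mul0r => /esym/eqP; rewrite mulf_eq0 (negbTE b0).
    have bm0 : bm l != 0 by case: nm; rewrite ?am0 ?eqxx.
    by exists (bm l / bp l); rewrite a0 mulr0 divfK// mulf_neq0// invr_neq0.
  exists (am l / ap l); rewrite divfK//.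
  have E : bm l = am l / ap l * bp l by rewrite mulrAC [am l * _]mulrC -WW mulrAC divff// mul1r.
  split => //; apply: mulf_neq0; last by rewrite invr_neq0.
  by apply/eqP => z; case: nm; rewrite ?E z ?mul0r ?eqxx.
have e0 x : fm x = k * fp x by rewrite /fm /fp /jm /jp ka kb mulrDr !mulrA.
have e1 x : fm1 x = k * fp1 x by rewrite /fm1 /fp1 ka kb mulrDr !mulrA.
have zz := no_eigenfunction l0 bV hv hp K0 dp dm 0 k0 e0 e1.
have z1 := zz _ _ sn; have z2 := zz _ _ cs.
have a0 : ap l = 0.
  rewrite -[LHS]mulr1 -(w1 0) -z1 /fp /fp1 /jp.
  by move: (cs0 V l 0) (cs1 V l 0) (sn0 V l 0) (sn1 V l 0) (ap l) (bp l) => *; ring.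
have b0 : bp l = 0.
  apply/eqP; rewrite -oppr_eq0 -[- _]mulr1 -(w1 0); apply/eqP; rewrite -[RHS]z2 /fp /fp1 /jp.
  by move: (cs0 V l 0) (cs1 V l 0) (sn0 V l 0) (sn1 V l 0) (ap l) (bp l) => *; ring.
by case: np; rewrite ?a0 ?b0 eqxx.
Qed.

(** The singularities of the Jost coefficients and of [W^-1], from which the
    pairings are built. *)
Definition resonances : set R[i]^o := [set l : R[i]^o | Pp l \/ Pm l \/ W l = 0].

Lemma wr_mero z : mero W z.
Proof.
have [[_ _ _ /(_ z)[m1 m2]] _] := Jp; have [[_ _ _ /(_ z)[m3 m4]] _] := Jm.
have mN : mero (fun l => -1 * (bp l * am l)) z by apply: meroM; [exact: mero_cst|exact: meroM].
apply: (@mero_eq _ (fun l => ap l * bm l + -1 * (bp l * am l)) _ _ 1) => //; last exact: meroD (meroM m1 m4) mN.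
by move=> u _ _; rewrite mulN1r.
Qed.

(** If [W] vanished near [z] it would vanish near a point high in the upper half
    plane, contrary to [upper_resolvent]. *)
Lemma wr_inv z : (exists2 d : R, 0 < d & forall l, nc (l - z) < d -> l != z -> W l != 0) /\ mero (fun l => (W l)^-1) z.
Proof.
case: (mero_inv (wr_mero z)) => // vz; exfalso.
pose w0 : C := (2 * B0 + 3)%:C * 'i.
have [d d0 hd] := mero_identity w0 wr_mero vz.
have d'0 : 0 < Num.min d 1 by rewrite lt_min d0 ltr01.
have [u [ud uw]] := near_pick w0 d'0.
move: ud; rewrite lt_min => /andP[ud u1].
have := hd u ud uw; apply/eqP; apply: (upper_resolvent _).1.
have := nc_Im (u - w0); rewrite ImB ler_norml => /andP[h _].
have iw : cIm w0 = 2 * B0 + 3 by rewrite /w0 ImM /=; ring.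
by rewrite iw in h; lra.
Qed.

Lemma resonances_isolated z : exists2 d : R, 0 < d & forall l, nc (l - z) < d -> l != z -> ~ resonances l.
Proof.
have [[/(_ z)[d1 d10 h1] _ _ _] _] := Jp; have [[/(_ z)[d2 d20 h2] _ _ _] _] := Jm.
have [[d3 d30 h3] _] := wr_inv z.
exists (Num.min d1 (Num.min d2 d3)); first by rewrite !lt_min d10 d20.
move=> l; rewrite !lt_min => /and3P[l1 l2 l3] lz [|[|]]; [exact: h1|exact: h2|].
by move=> W0; have := h3 l l3 lz; rewrite W0 eqxx.
Qed.

Lemma resonances_discrete : limit_point resonances = set0.
Proof.
apply/seteqP; split => // z /= hz; have [d d0 hd] := resonances_isolated z.
have nz : nbhs z [set w : R[i]^o | nc (w - z) < d] by apply/nbhsCP; exists d.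
by have [y [yz Sy dy]] := hz _ nz; exact: (hd y dy yz Sy).
Qed.

Lemma resonances_closed z : ~ resonances z -> exists2 d : R, 0 < d & forall l, nc (l - z) < d -> ~ resonances l.
Proof.
move=> nz; have [d d0 hd] := resonances_isolated z; exists d => // l ld.
by have [->|lz] := eqVneq l z; [|exact: hd].
Qed.

(** Off the resonances the pairing equals a formula built by sums and products from
    functions that are holomorphic there and meromorphic everywhere. *)
Lemma pairing_meromorphic f g : L2c f -> L2c g -> meromorphic_with_poles_in resonances (fun l => pairing (T l f) g).
Proof.
move=> [lf [M1 sf]] [lg [M2 sg]]; pose M := `|M1| + `|M2|.
have M0 : 0 <= M by rewrite addr_ge0.
have sf' : supported_in M f by apply: supported_le sf; apply: (le_trans (ler_norm _)); rewrite lerDl.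
have sg' : supported_in M g by apply: supported_le sg; apply: (le_trans (ler_norm _)); rewrite lerDr.
have lcg : L2 (fun x => conjc (g x)).
  by apply: (@L2_le _ g _ 1) => //; [apply: cmeas_conj; have /L2P[] := lg|move=> x; rewrite mul1r ncJ].
pose F := pair_formula V ap bp am bm (`]-oo, 0] `&` `[- M, M]) (`[0, +oo[ `&` `[- M, M]) `[- M, M] f (fun x => conjc (g x)).
have EF l : ~ resonances l -> F l = pairing (T l f) g.
  move=> nl; apply/esym; apply: pairingE => //.
  by apply/eqP => W0; apply: nl; right; right.
split.
  split.
    rewrite openE => z /= nz; have [d d0 hd] := resonances_closed nz.
    by apply/nbhsCP; exists d.
  move=> z nz; apply/derivableCP; have [d d0 hd] := resonances_closed nz.
  apply: (cdiffable_near d0 (fun w wd => EF w (hd w wd))).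
  have [[_ _ h1 _] _] := Jp; have [[_ _ h2 _] _] := Jm.
  have [a1 b1] : cdiffable ap z /\ cdiffable bp z by apply: h1 => h; apply: nz; left.
  have [a2 b2] : cdiffable am z /\ cdiffable bm z by apply: h2 => h; apply: nz; right; left.
  apply: (@pair_formula_closed R V B0 cV bV ap bp am bm (fun p => cdiffable p z)) => //.
  - by move=> p q; exact: cdiffableD.
  - by move=> p q; exact: cdiffableM.
  - apply: cdiffableV; first by apply/eqP => W0; apply: nz; right; right.
    by apply: cdiffableB; exact: cdiffableM.
move=> z Sz; have [d d0 hd] := resonances_isolated z.
have [[_ _ _ /(_ z)[a1 b1]] _] := Jp; have [[_ _ _ /(_ z)[a2 b2]] _] := Jm.
have [n [h [e [e0 dh fh]]]] : mero (fun l => pairing (T l f) g) z.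
  apply: (@mero_eq _ F _ _ d) => //; first by move=> u ud uz; apply: EF; exact: hd.
  apply: (@pair_formula_closed R V B0 cV bV ap bp am bm (fun p => mero p z)) => //.
  - by move=> p q; exact: meroD.
  - by move=> p q; exact: meroM.
  - by move=> p hp; apply: (@mero_hol _ _ _ 1).
  - exact: (wr_inv z).2.
exists n, [set w : R[i]^o | nc (w - z) < e], h; split.
- by rewrite /= subrr nc0.
- split; last by move=> w we; apply/derivableCP; exact: dh.
  rewrite openE => w /= we; apply/nbhsCP; exists (e - nc (w - z)); first by rewrite subr_gt0.
  move=> u uw /=; have -> : u - z = (u - w) + (w - z) by ring.
  by apply: (le_lt_trans (ncD _ _)); lra.
- by move=> w we wz; exact: fh.
Qed.

End Wronskian.

End Assembly.

Theorem proposition1p1 (R : realType) (V : R -> R)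
    (V_smooth : smooth V) (V_exp : exponential_expansion V) :
  exists C : R,
    (forall l : R[i], C < complex.Im l -> exists T, is_resolvent V l T) /\
    (forall RV : R[i] -> (R -> R[i]) -> (R -> R[i]),
      (forall l : R[i], C < complex.Im l -> is_resolvent V l (RV l)) ->
      exists (S : set R[i]^o) (RM : R[i] -> (R -> R[i]) -> (R -> R[i])),
        limit_point S = set0 /\
        (forall l : R[i], C < complex.Im l ->
          ~ S l /\ forall f, L2c f -> ae_equal (RM l f) (RV l f)) /\
        (forall l : R[i], ~ S l -> bounded_L2c_L2loc (RM l)) /\
        (forall f g : R -> R[i], L2c f -> L2c g ->
          meromorphic_with_poles_in S (fun l => pairing (RM l f) g))).
Proof.
have cV := smooth_cont V_smooth; have [B0 bV] := bounded_potential cV V_exp.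
have B00 : 0 <= B0 by apply: le_trans (bV 0); exact: normr_ge0.
have [Ap [Am [r [Up [Um [Fp [Fm [[Ap0 Am0 r0] [[Up0 hUp Fp0 _ Vp] [Um0 hUm Fm0 _ Vm]]]]]]]]]] := V_exp.
have [ap [bp [Pp Jp]]] : exists al be P, jost_family V 1 al be P.
  apply: (@jost_family_exists R V 1 Ap r B0 Up Fp) => //; first by left.
  by move=> x; rewrite mul1r => /Vp[].
have [am [bm [Pm Jm]]] : exists al be P, jost_family V (-1) al be P.
  apply: (@jost_family_exists R V (-1) Am r B0 Um Fm) => //; first by right.
  by move=> x; rewrite mulN1r mulrNN => h; have [] := Vm x _; first by lra.
exists (2 * B0 + 1); split.
  by move=> l hl; exists (cont_resolvent V ap bp am bm l); exact: (upper_resolvent cV bV Jp Jm hl).2.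
move=> RV hRV; exists (resonances ap bp am bm Pp Pm), (cont_resolvent V ap bp am bm).
split; first exact: (resonances_discrete cV bV Jp Jm).
split; last split.
- move=> l hl; have [W0 [_ T2 _]] := upper_resolvent cV bV Jp Jm hl; split.
    have [[_ imp _ _] _] := Jp; have [[_ imm _ _] _] := Jm.
    by move=> [/imp|[/imm|/eqP]]; [lra|lra|rewrite (negbTE W0)].
  move=> f [lf _]; have [R1 _ _] := hRV l hl; have := T2 _ _ (R1 f lf).
  by congr (ae_equal (cont_resolvent _ _ _ _ _ _ _) _); apply/funext => x; rewrite addrK.
- move=> l _; apply: green_bounded_L2; [exact: (jp_cont cV bV)|exact: (jm_cont cV bV)].
- by move=> f g lf lg; exact: (pairing_meromorphic cV bV Jp Jm).
Qed.
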